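(* Let $n\ge 1$, $\beta\in(0,2]$, $\alpha\in(0,n)$, $p>n/(n-\alpha)$, $q\geq1$, and let $u_0\in L^s(\mathbb{R}^n)\cap L^\infty(\mathbb{R}^n)$ with $n/(n-\alpha)<s<n(p-1)/\alpha$. Consider the Cauchy problem $$u_t+(-\Delta)^{\frac{\beta}{2}}u=I_\alpha(|u|^p)|u|^q\quad (x\in\mathbb{R}^n,\ t>0),\qquad u(x,0)=u_0(x)\quad (x\in\mathbb{R}^n).\qquad (P)$$ Then there exists a time $T=T(u_0)>0$ such that problem (P) possesses a unique mild solution $$u\in C([0,T],L^s(\mathbb{R}^n))\cap L^\infty((0,T),L^\infty(\mathbb{R}^n)).$$ Moreover, the following properties hold: (i) Problem (P) possesses a maximal mild solution $$u\in C([0,T_{\max}),L^s(\mathbb{R}^n))\cap L^\infty((0,T_{\max}),L^\infty(\mathbb{R}^n))$$ with $u(0)=u_0$, where $T_{\max}=T_{\max}(u_0)\leq\infty$. Furthermore, either $T_{\max}=\infty$, or else $T_{\max}<\infty$ and $$\lim_{t\to T_{\max}^-}\left(\|u(t)\|_{L^\infty(\mathbb{R}^n)}+\|u(t)\|_{L^s(\mathbb{R}^n)}\right)=+\infty.$$ (ii) If $u_0\geq0$, then the mild solution remains nonnegative, $u(t)\geq0$, for all $t\in[0,T]$.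
   Context: Fractional Laplacian: $(-\Delta)^{\beta/2}$ is the operator with Fourier symbol $|\xi|^\beta$ (for $\beta=2$ it is $-\Delta$). Riesz potential: $I_\alpha(v)(x)=A_\alpha\int_{\mathbb{R}^n}\frac{v(y)}{|x-y|^{n-\alpha}}\,dy$, with $A_\alpha=\dfrac{\Gamma(\frac{n-\alpha}{2})}{\Gamma(\frac\alpha2)\,\pi^{n/2}\,2^\alpha}$, acting in the space variable. Semigroup: $S_\beta(t)v=S_\beta(\cdot,t)\ast v$, where $S_\beta(x,t)=\frac{1}{(2\pi)^{n}}\int_{\mathbb{R}^n}e^{ix\cdot\xi-t|\xi|^\beta}\,d\xi$ is the fundamental solution of $u_t+(-\Delta)^{\beta/2}u=0$ (so $S_\beta\ge 0$ and $\int_{\mathbb{R}^n}S_\beta(x,t)\,dx=1$ for all $t>0$). Mild solution: a function $u\in L^\infty((0,T),X)$, here with $X=L^s(\mathbb{R}^n)\cap L^\infty(\mathbb{R}^n)$, is a mild solution of (P) if it has initial data $u_0$ and satisfies $$u(t)=S_\beta(t)u_0+\int_0^tS_\beta(t-\tau)\,\big[I_\alpha(|u|^p)|u|^q\big](\tau)\,d\tau .$$ Maximality: $T_{\max}$ is the supremum of all $T>0$ for which there is a mild solution of (P) in $C([0,T],L^s(\mathbb{R}^n))\cap L^\infty((0,T),L^\infty(\mathbb{R}^n))$, and the maximal mild solution is the mild solution on $[0,T_{\max})$.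
   Formalization: In (i), u ∈ L^∞((0,T_max),L^∞) is read locally in time: u ∈ L^∞((0,T),L^∞) for every T<T_max. The bound on all of (0,T_max) fails for solutions that blow up in finite time (e.g. q=1, large radially decreasing bounded data). *)

(* Defs.v *)
From HB Require Import structures.
From mathcomp Require Import all_boot all_order all_algebra.
From mathcomp Require Import all_classical all_reals all_analysis.
From mathcomp Require Import complex.

Set Implicit Arguments.
Unset Strict Implicit.
Unset Printing Implicit Defensive.

Import Order.TTheory GRing.Theory Num.Theory.
Import numFieldNormedType.Exports.

Local Open Scope classical_set_scope.
Local Open Scope ring_scope.

Notation Rn R n := (n.-tuple (measurableTypeR R)).

(* The Lebesgue measure of R^n.+1 is the image of the product of the Lebesgue
   measures of R and R^n; [leb_box] gives its value on boxes. *)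
Section lebesgue_Rn.
Context {R : realType}.

Definition cons_pt n (z : measurableTypeR R * Rn R n) : Rn R n.+1 :=
  [tuple of z.1 :: z.2].

Lemma measurable_cons_pt n : measurable_fun setT (@cons_pt n).
Proof. exact: measurable_cons measurable_fst measurable_snd. Qed.

Section step.
Variables (n : nat) (m : {sigma_finite_measure set (Rn R n) -> \bar R}).

Definition leb_step : set (Rn R n.+1) -> \bar R :=
  pushforward (lebesgue_measure \x m)%E (@cons_pt n).

Let leb_step0 : leb_step set0 = 0%E.
Proof. by rewrite /leb_step measure0//; exact: measurable_cons_pt. Qed.

Let leb_step_ge0 A : (0 <= leb_step A)%E.
Proof. by rewrite /leb_step measure_ge0//; exact: measurable_cons_pt. Qed.

Let leb_step_sigma_additive : semi_sigma_additive leb_step.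
Proof.
by apply: measure_semi_sigma_additive; exact: measurable_cons_pt.
Qed.

HB.instance Definition _ := isMeasure.Build _ _ _ leb_step
  leb_step0 leb_step_ge0 leb_step_sigma_additive.

Lemma leb_stepX (A : set (measurableTypeR R)) (B : set (Rn R n)) :
  measurable A -> measurable B ->
  leb_step [set x | A (thead x) /\ B [tuple of behead x]] =
  (lebesgue_measure A * m B)%E.
Proof.
move=> mA mB; rewrite -product_measure1E// /leb_step /pushforward.
have consK (z : measurableTypeR R * Rn R n) :
    [tuple of behead (cons_pt z)] = z.2 by exact/val_inj.
by congr (_ _); apply/seteqP; split=> z /=; rewrite theadE consK.
Qed.

Lemma measurable_box_step (A : set (measurableTypeR R)) (B : set (Rn R n)) :
  measurable A -> measurable B ->
  measurable [set x : Rn R n.+1 | A (thead x) /\ B [tuple of behead x]].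
Proof.
move=> mA mB; apply: measurableI.
  rewrite -[X in measurable X]setTI.
  exact: (@measurable_tnth _ (measurableTypeR R) n.+1 ord0).
rewrite -[X in measurable X]setTI.
exact: (@measurable_behead _ (measurableTypeR R) n).
Qed.

Let leb_step_sigma_finite : sigma_finite setT leb_step.
Proof.
have /sigma_finiteP[F [FT Fnd Ffin]] :=
  sigma_finiteT (@lebesgue_measure R : {sigma_finite_measure set _ -> \bar R}).
have /sigma_finiteP[G [GT Gnd Gfin]] := sigma_finiteT m.
exists (fun i => [set x | F i (thead x) /\ G i [tuple of behead x]]).
  apply/seteqP; split=> // x _.
  have [i _ Fi] : (\bigcup_i F i) (thead x) by rewrite -FT.
  have [j _ Gj] : (\bigcup_i G i) [tuple of behead x] by rewrite -GT.
  exists (maxn i j) => //; split.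
    by have /subsetPset := Fnd _ _ (leq_maxl i j); apply.
  by have /subsetPset := Gnd _ _ (leq_maxr i j); apply.
move=> i; have [mF Foo] := Ffin i; have [mG Goo] := Gfin i; split.
  exact: measurable_box_step.
by rewrite leb_stepX// lte_mul_pinfty// ge0_fin_numE.
Qed.

HB.instance Definition _ :=
  @Measure_isSigmaFinite.Build _ _ _ leb_step leb_step_sigma_finite.

End step.

Fixpoint leb n : {sigma_finite_measure set (Rn R n) -> \bar R} :=
  match n with
  | 0%N => @dirac _ (Rn R 0) [tuple] R
  | k.+1 => leb_step (leb k)
  end.

Let boxS n (A : 'I_n.+1 -> set (measurableTypeR R)) :
  [set x : Rn R n.+1 | forall i, A i (tnth x i)] =
  [set x | A ord0 (thead x) /\
     [set y : Rn R n | forall i, A (lift ord0 i) (tnth y i)]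
       [tuple of behead x]].
Proof.
apply/seteqP; split=> x /=.
  move=> Ax; split=> [|i]; first exact: Ax.
  by have := Ax (lift ord0 i); rewrite {1}(tuple_eta x) tnthS.
move=> [A0 AS] i; have [j ->|->//] := unliftP ord0 i.
by rewrite (tuple_eta x) tnthS; exact: AS.
Qed.

Let measurable_box n (A : 'I_n -> set (measurableTypeR R)) :
  (forall i, measurable (A i)) ->
  measurable [set x : Rn R n | forall i, A i (tnth x i)].
Proof.
elim: n A => [|n ih] A mA.
  rewrite [X in measurable X](_ : _ = setT)//.
  by apply/seteqP; split=> // x _ [].
rewrite boxS; apply: measurable_box_step => //.
exact: (ih (fun i : 'I_n => A (lift ord0 i))).
Qed.

Lemma leb_box n (A : 'I_n -> set (measurableTypeR R)) :
  (forall i, measurable (A i)) ->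
  leb n [set x | forall i, A i (tnth x i)] =
  (\prod_(i < n) lebesgue_measure (A i))%E.
Proof.
elim: n A => [|n ih] A mA.
  rewrite big_ord0 [X in leb 0 X](_ : _ = setT); first exact: probability_setT.
  by apply/seteqP; split=> // x _ [].
have mB := @measurable_box n (fun i => A (lift ord0 i)) (fun i => mA _).
rewrite boxS big_ord_recl -(ih (fun i : 'I_n => A (lift ord0 i)))//.
exact: leb_stepX (leb n) _ _ (mA ord0) mB.
Qed.

End lebesgue_Rn.
Arguments leb : clear implicits.

Section Euclidean.
Context {R : realType} {n : nat}.
Implicit Types x y : Rn R n.

Definition subp x y : Rn R n :=
  [tuple (tnth x i : R) - (tnth y i : R) | i < n].
Definition dotp x y : R := \sum_(i < n) (tnth x i : R) * (tnth y i : R).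
Definition enorm x : R := Num.sqrt (dotp x x).

Definition lnorm (r : \bar R) (v : Rn R n -> R) : \bar R :=
  'N[leb R n]_r[EFin \o v]%E.

End Euclidean.

Definition cexp (R : realType) (z : R[i]) : R[i] :=
  ((expR (complex.Re z) * cos (complex.Im z)) +i*
   (expR (complex.Re z) * sin (complex.Im z)))%C.

Definition Cintegral (R : realType) n (f : Rn R n -> R[i]) : R[i] :=
  ((\int[leb R n]_x complex.Re (f x)) +i*
   (\int[leb R n]_x complex.Im (f x)))%C.

Definition Gamma (R : realType) (z : R) : R :=
  \int[@lebesgue_measure R]_(x in `]0, +oo[) (x `^ (z - 1) * expR (- x)).

Section operators.
Context {R : realType} {n : nat}.
Implicit Types (x y xi : Rn R n) (v : Rn R n -> R).

(* The integral is real, since the imaginary part of the integrand is odd in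
   [xi]; [complex.Re] is only there to obtain an element of [R]. *)
Definition stable_kernel (beta : R) x (t : R) : R :=
  complex.Re (((2 * pi) ^- n)%:C *
    Cintegral (fun xi => cexp ((- (t * enorm xi `^ beta)) +i* dotp x xi)))%C.

Definition semigroup (beta t : R) v x : R :=
  \int[leb R n]_y (stable_kernel beta (subp x y) t * v y).

Definition riesz_const (alpha : R) : R :=
  Gamma ((n%:R - alpha) / 2) /
  (Gamma (alpha / 2) * pi `^ (n%:R / 2) * 2 `^ alpha).

Definition riesz (alpha : R) v x : R :=
  riesz_const alpha *
  \int[leb R n]_y (v y / enorm (subp x y) `^ (n%:R - alpha)).

End operators.

(* Function spaces in time. A map [u : R -> Rn R n -> R] is read as
   t |-> u(t); its values are functions up to equality almost everywhere. *)
Section spaces.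
Context {R : realType} {n : nat}.
Local Notation fct := (Rn R n -> R).
Implicit Types (N : fct -> \bar R) (u : R -> fct) (D : set R).

Definition C_Lr D (r : \bar R) u : Prop :=
  (forall t, D t -> u t \in Lfun (leb R n) r) /\
  (forall t0, D t0 ->
     lnorm r (u t \- u t0) @[t --> within D (nbhs t0)] --> 0%E).

(* The Banach space with norm [N] is made of the (classes of) measurable
   functions [v] such that [N v < +oo]. *)
Definition in_space N (v : fct) : Prop :=
  measurable_fun setT v /\ (N v < +oo)%E.

Definition simple_map N (phi : R -> fct) : Prop :=
  exists m (A : 'I_m -> set (measurableTypeR R)) (g : 'I_m -> fct),
    [/\ forall i, measurable (A i), forall i, in_space N (g i) &
        forall t x, phi t x = \sum_(i < m) \1_(A i) t * g i x].

Definition strongly_measurable D N u : Prop :=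
  exists2 phi : nat -> R -> fct, forall k, simple_map N (phi k) &
    {ae @lebesgue_measure R, forall t, D t ->
      N (phi k t \- u t) @[k --> \oo] --> 0%E}.

(* L^oo(D, X), in the sense of Bochner, for X the Banach space normed by N *)
Definition Linfty D N u : Prop :=
  [/\ {ae @lebesgue_measure R, forall t, D t -> in_space N (u t)},
      strongly_measurable D N u &
      exists M : R,
        {ae @lebesgue_measure R, forall t, D t -> (N (u t) <= M%:E)%E}].

Definition norm_Linfty : fct -> \bar R := lnorm +oo%E.

Definition norm_X (s : R) : fct -> \bar R :=
  fun v => (lnorm s%:E v + lnorm +oo v)%E.

End spaces.

Section problem.
Context {R : realType} {n : nat}.
Variables (beta alpha p q s : R) (u0 : Rn R n -> R).
Implicit Types (T : R) (u : R -> Rn R n -> R).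

Definition nonlinearity (v : Rn R n -> R) (x : Rn R n) : R :=
  riesz alpha (fun y => `|v y| `^ p) x * `|v x| `^ q.

Definition duhamel_integrand u t x (tau : R) : R :=
  semigroup beta (t - tau) (nonlinearity (u tau)) x.

(* The kernel S_beta(., t) is only defined for t > 0, whence the separate
   initial condition. The integrability clause says that the time integral is
   defined, since [Rintegral] has a junk value otherwise. *)
Definition mild_solution T u : Prop :=
  [/\ Linfty `]0, T[ (norm_X s) u,
      u 0 = u0 %[ae leb R n] &
      forall t, 0 < t <= T ->
        {ae leb R n, forall x,
          (@lebesgue_measure R).-integrable `]0, t[
            (EFin \o duhamel_integrand u t x) /\
          u t x = semigroup beta t u0 x +
            \int[@lebesgue_measure R]_(tau in `]0, t[)
              duhamel_integrand u t x tau}].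

(* mild solutions in C([0,T], L^s) /\ L^oo((0,T), L^oo) *)
Definition mild_solution_CL T u : Prop :=
  [/\ mild_solution T u, C_Lr `[0, T] s%:E u & Linfty `]0, T[ norm_Linfty u].

Definition Tmax : \bar R :=
  ereal_sup [set T%:E | T in [set T | 0 < T /\ exists u, mild_solution_CL T u]].

(* C([0,Tmax), L^s) /\ L^oo((0,Tmax), L^oo), with boundedness in L^oo on every
   (0,T) with T < Tmax: this is what is compatible with blow-up at Tmax. *)
Definition maximal_mild_solution u : Prop :=
  forall T, 0 < T -> (T%:E < Tmax)%E -> mild_solution_CL T u.

End problem.

(* Main.v *)
Require Import Defs.
From HB Require Import structures.
From mathcomp Require Import all_boot all_order all_algebra.
From mathcomp Require Import all_classical all_reals all_analysis.
From mathcomp Require Import measurable_realfun ess_sup_inf.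
From mathcomp Require Import ring lra.

(** The Fourier transform of the symbol [exp (- t |xi|^beta)] is nonnegative
    because [l^(beta/2)] is, up to a constant, the integral of
    [(1 - exp (- l a)) a^(-1 - beta/2)] over [a > 0]: the symbol is a limit of
    positive combinations of Gaussians. Gaussian summability then shows that
    the kernel has mass one, forms a convolution semigroup, is continuous in
    [t] for the L^1 norm, and concentrates at the origin as [t] tends to 0.

    Write [X] for L^s /\ L^oo. Splitting the Riesz kernel at [|z| = 1] bounds
    [I_alpha (|v|^p)] uniformly: near the origin [v] is bounded, and far from
    it Young's inequality applies with an exponent [r] such that
    [|z|^(- (n - alpha) r)] is integrable at infinity while [|v|^(p r')] is
    controlled by [|v|^s]; such an [r] exists because [s < n p / alpha]. Hence
    the nonlinearity is locally Lipschitz on [X], and Picard iteration solves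
    the integral equation on a time interval whose length depends only on the
    norm of the initial value in [X]. Solutions can be restarted at any time by
    the semigroup law, so they are continuous in [X] for [t > 0], and in L^s at
    [t = 0] by the strong continuity of the semigroup; they are unique by
    iterating the Lipschitz bound with weights [exp (l t)], nonnegative because
    the nonlinearity is, and can be extended as long as the norm in [X] stays
    bounded along a sequence of times, which is the blow-up alternative.

    An arbitrary mild solution is only strongly measurable with values in [X];
    it has a jointly measurable version, and its Duhamel integral is then a
    solution in the pointwise sense which agrees with it almost everywhere. *)

Set Implicit Arguments.
Unset Strict Implicit.
Unset Printing Implicit Defensive.

Import Order.TTheory GRing.Theory Num.Theory.
Import numFieldNormedType.Exports.

Local Open Scope classical_set_scope.
Local Open Scope ring_scope.

(** * Dominated convergence and Fubini for real-valued integrals *)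

Section Rintegral_facts.
Context d (T : measurableType d) (R : realType).
Variable mu : {measure set T -> \bar R}.

(** A mild solution is an almost everywhere class at each time, and joint measurability in time and
    space, which Fubini needs at every step, is not part of its definition. What helps is that
    [S(t) v] depends only on the class of [v] and yet is defined at every point, so the right-hand
    side of the integral equation is a genuine function of [(t, x)]. Solutions are therefore built,
    compared and glued as jointly measurable functions that satisfy the equation everywhere, and
    classes reappear only when passing to and from mild solutions.

    Real-valued integrals take a junk value when they diverge. Sizes are therefore recorded as
    membership in the balls [Lle M] and [Xle M], which are stable under sums, domination, pointwise
    limits and weighted integrals. The evolution argument sees the kernel and the nonlinearity only
    through the records [heat_kernel] and [lip_nonlinearity].

    For the kernel, nonnegativity has to precede integrability; its Fourier integrals are thus
    tested against Gaussians, which are removed by monotone convergence. *)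

Lemma le_Rintegrable (f g : T -> R) : measurable_fun setT f ->
  (forall x, `|f x| <= g x) -> mu.-integrable setT (EFin \o g) ->
  mu.-integrable setT (EFin \o f).
Proof.
move=> mf fg; apply: le_integrable => //; first exact/measurable_EFinP.
by move=> x _ /=; rewrite lee_fin (le_trans (fg x))// ler_norm.
Qed.

Lemma RintegralK (f : T -> R) : mu.-integrable setT (EFin \o f) ->
  (\int[mu]_x f x)%:E = (\int[mu]_x (f x)%:E)%E.
Proof. by move=> h; rewrite /Rintegral fineK//; exact: integrable_fin_num. Qed.

Lemma ge0_integrable_lty (f : T -> R) : measurable_fun setT f ->
  (forall x, 0 <= f x) ->
  (\int[mu]_x (f x)%:E < +oo)%E -> mu.-integrable setT (EFin \o f).
Proof.
move=> mf f0 foo; apply/integrableP; split; first exact/measurable_EFinP.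
by under eq_integral do rewrite /= ger0_norm//.
Qed.

Lemma dominated_Rintegral (f_ : nat -> T -> R) (f g : T -> R) :
  (forall k, measurable_fun setT (f_ k)) ->
  (forall x, f_ k x @[k --> \oo] --> f x) ->
  mu.-integrable setT (EFin \o g) ->
  (forall k x, `|f_ k x| <= g x) ->
  mu.-integrable setT (EFin \o f) /\
  \int[mu]_x f_ k x @[k --> \oo] --> \int[mu]_x f x.
Proof.
move=> mf cf ig fg.
have mf' : measurable_fun setT f.
  by apply: (measurable_fun_cvg mf) => x _; exact: cf.
have [] := @dominated_convergence _ T R mu setT measurableT
  (fun k => EFin \o f_ k) (EFin \o f) (EFin \o g).
- by move=> k; exact/measurable_EFinP.
- exact/measurable_EFinP.
- by apply: aeW => x _; apply: cvg_EFin; [exact: nearW|exact: cf].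
- exact: ig.
- by apply: aeW => x k _; rewrite /= lee_fin.
move=> i_f _ cI; split => //.
by apply: fine_cvg; rewrite RintegralK.
Qed.

(** Reduction to sequences: if the limit failed, points [u k] of [D] within [1/(k+1)] of [t0] would
    keep the integrals at distance [e] from the expected limit, against [dominated_Rintegral] along
    [u]. *)
Lemma dominated_Rintegral_at (f : R -> T -> R) (g : T -> R) (D : set R) t0 :
  (forall t, D t -> measurable_fun setT (f t)) -> D t0 ->
  (forall x, f t x @[t --> within D (nbhs t0)] --> f t0 x) ->
  mu.-integrable setT (EFin \o g) ->
  (forall t x, D t -> `|f t x| <= g x) ->
  \int[mu]_x f t x @[t --> within D (nbhs t0)] --> \int[mu]_x f t0 x.
Proof.
move=> mf D0 cf ig fg.
apply/cvgrPdist_lt => e e0; apply/not_notP => nh.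
have H (k : nat) : exists t, [/\ D t, `|t - t0| < k.+1%:R^-1 &
    e <= `|\int[mu]_x f t0 x - \int[mu]_x f t x|].
  apply/not_existsP => h; apply: nh; rewrite /within /=.
  exists k.+1%:R^-1 => /=; first by rewrite invr_gt0 ltr0n.
  move=> t /= tt0 Dt; rewrite ltNge; apply/negP => et; apply: (h t); split => //.
  by rewrite distrC.
have [u Hu] := choice H.
have ut0 : u k @[k --> \oo] --> t0.
  apply/cvgrPdist_lt => r r0.
  near=> k; have [_ /lt_trans + _] := Hu k; rewrite distrC; apply.
  near: k; exact: near_infty_natSinv_lt (PosNum r0).
have [] := @dominated_Rintegral (fun k => f (u k)) (f t0) g.
- by move=> k; have [? _ _] := Hu k; exact: mf.
- move=> x; apply: (cvg_comp _ _ _ (cf x)) => A [r /= r0 rA].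
  have /cvgrPdist_lt/(_ r r0)[N _ NA] := ut0.
  by exists N => // k Nk /=; apply: rA => /=; [exact: NA|case: (Hu k)].
- exact: ig.
- by move=> k x; apply: fg; case: (Hu k).
move=> _ /cvgrPdist_lt/(_ _ e0)[N _ /(_ N (leqnn N))].
by case: (Hu N) => _ _ /[swap]; rewrite /= ltNge => /negP.
Unshelve. all: by end_near. Qed.

End Rintegral_facts.

Section product_facts.
Context d1 d2 (T1 : measurableType d1) (T2 : measurableType d2) (R : realType).
Variables (m1 : {sigma_finite_measure set T1 -> \bar R})
  (m2 : {sigma_finite_measure set T2 -> \bar R}).

Lemma measurable_section1 d3 (T3 : measurableType d3) (f : T1 -> T2 -> T3) x :
  measurable_fun setT (fun z : T1 * T2 => f z.1 z.2) -> measurable_fun setT (f x).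
Proof. by move=> mf; exact: (measurableT_comp mf (measurable_pair1 x)). Qed.

Lemma measurable_section2 d3 (T3 : measurableType d3) (f : T1 -> T2 -> T3) y :
  measurable_fun setT (fun z : T1 * T2 => f z.1 z.2) ->
  measurable_fun setT (f ^~ y).
Proof. by move=> mf; exact: (measurableT_comp mf (measurable_pair2 y)). Qed.

(** No integrability is assumed: the positive and negative parts are measurable by Tonelli, and so
    is [fine], so the junk value taken where the integral is not finite does no harm. *)
Lemma measurable_fine_integral (f : T1 -> T2 -> R) :
  measurable_fun setT (fun z : T1 * T2 => f z.1 z.2) ->
  measurable_fun setT (fun x => \int[m2]_y f x y).
Proof.
move=> mf.
have mf' : measurable_fun setT (fun z : T1 * T2 => (f z.1 z.2)%:E).
  exact/measurable_EFinP.
rewrite /Rintegral; apply: (measurableT_comp (@fine_measurable R setT _)) => //.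
rewrite (_ : (fun x => _) = fun x =>
  ((fubini_F m2 (fun z : T1 * T2 => (f z.1 z.2)%:E)^\+ x) -
   (fubini_F m2 (fun z : T1 * T2 => (f z.1 z.2)%:E)^\- x)))%E; last first.
  apply/funext => x; rewrite integralE; congr (_ - _)%E;
    by rewrite /fubini_F; apply: eq_integral => y _; rewrite ?funeposE ?funenegE.
apply: (emeasurable_funB (measurable_fun_fubini_tonelli_F _ _ _)
  (measurable_fun_fubini_tonelli_F _ _ _)) => //.
- exact: measurable_funepos.
- exact: measurable_funeneg.
Qed.

Lemma measurable_ge0_integral (f : T1 -> T2 -> R) :
  measurable_fun setT (fun z : T1 * T2 => f z.1 z.2) ->
  (forall x y, 0 <= f x y) ->
  measurable_fun setT (fun x => \int[m2]_y (f x y)%:E)%E.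
Proof.
move=> mf f0; apply: (measurable_fun_fubini_tonelli_F
  (fun z : T1 * T2 => (f z.1 z.2)%:E)).
- exact/measurable_EFinP.
- by move=> x; rewrite lee_fin.
Qed.

Lemma tonelli (f : T1 -> T2 -> R) :
  measurable_fun setT (fun z : T1 * T2 => f z.1 z.2) ->
  (forall x y, 0 <= f x y) ->
  (\int[m1]_x \int[m2]_y (f x y)%:E = \int[m2]_y \int[m1]_x (f x y)%:E)%E.
Proof.
move=> mf f0.
apply: (fubini_tonelli (fun z : T1 * T2 => (f z.1 z.2)%:E)).
- exact/measurable_EFinP.
- by move=> x; rewrite lee_fin.
Qed.

(** The majorant [g] serves to bound the double integral of [|f|]. Integrability of every section,
    and not just of almost every one, identifies the inner real-valued integrals with the extended
    ones at all points. *)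
Lemma RFubini (f : T1 -> T2 -> R) (g : T1 -> T2 -> R) (C : R) :
  measurable_fun setT (fun z : T1 * T2 => f z.1 z.2) ->
  measurable_fun setT (fun z : T1 * T2 => g z.1 z.2) ->
  (forall x y, `|f x y| <= g x y) ->
  (\int[m1]_x \int[m2]_y (g x y)%:E <= C%:E)%E ->
  (forall x, m2.-integrable setT (EFin \o f x)) ->
  (forall y, m1.-integrable setT (EFin \o f ^~ y)) ->
  \int[m1]_x \int[m2]_y f x y = \int[m2]_y \int[m1]_x f x y.
Proof.
move=> mf mg fg gC i2 i1.
rewrite /Rintegral; congr fine.
under eq_integral do rewrite -/(Rintegral _ _ _) RintegralK//.
under [RHS]eq_integral do rewrite -/(Rintegral _ _ _) RintegralK//.
apply: (@Fubini _ _ _ _ _ m1 m2 (fun z : T1 * T2 => (f z.1 z.2)%:E)).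
apply/integrable12ltyP; first exact/measurable_EFinP.
apply: (@le_lt_trans _ _ (\int[m1]_x \int[m2]_y (g x y)%:E)%E); last first.
  exact: le_lt_trans (ltry C).
have g0 x y : 0 <= g x y by exact: le_trans (fg x y).
apply: ge0_le_integral => //.
- by move=> x _; apply: integral_ge0.
- apply: (@measurable_ge0_integral (fun x y => `|f x y|)) => //.
  exact: measurableT_comp.
- exact: measurable_ge0_integral.
- move=> x _; apply: ge0_le_integral => //.
  + apply/measurable_EFinP; apply: measurableT_comp => //.
    exact: measurable_section1.
  + by apply/measurable_EFinP; exact: measurable_section1.
  + by move=> y _; rewrite lee_fin.
Qed.

End product_facts.

(** * Euclidean structure and Lebesgue measure on [Rn R n] *)

Section euclidean_facts.
Context {R : realType}.
Implicit Types n : nat.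

Lemma tnth_cons_pt n (a : R) (x : Rn R n) :
  (tnth (cons_pt (a, x)) ord0 = a) *
  (forall i, tnth (cons_pt (a, x)) (lift ord0 i) = tnth x i).
Proof.
by split=> [|i]; [rewrite (tnth_nth 0) | rewrite /cons_pt tnthS].
Qed.

Lemma dotp_cons n (a b : R) (x y : Rn R n) :
  dotp (cons_pt (a, x)) (cons_pt (b, y)) = a * b + dotp x y.
Proof.
rewrite /dotp big_ord_recl !tnth_cons_pt; congr (_ + _).
by apply: eq_bigr => i _; rewrite !tnth_cons_pt.
Qed.

Lemma subp_cons n (a b : R) (x y : Rn R n) :
  subp (cons_pt (a, x)) (cons_pt (b, y)) = cons_pt (a - b, subp x y).
Proof.
apply: eq_from_tnth => i; rewrite tnth_mktuple.
by have [j ->|->] := unliftP ord0 i; rewrite !tnth_cons_pt ?tnth_mktuple.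
Qed.

Lemma dotpC n (x y : Rn R n) : dotp x y = dotp y x.
Proof. by apply: eq_bigr => i _; rewrite mulrC. Qed.

Lemma dotp_subpl n (x y z : Rn R n) : dotp (subp x y) z = dotp x z - dotp y z.
Proof.
rewrite /dotp -sumrB; apply: eq_bigr => i _.
by rewrite tnth_mktuple mulrBl.
Qed.

Lemma dotp_ge0 n (x : Rn R n) : 0 <= dotp x x.
Proof. by apply: sumr_ge0 => i _; rewrite -expr2 sqr_ge0. Qed.

Lemma enorm_ge0 n (x : Rn R n) : 0 <= enorm x.
Proof. exact: sqrtr_ge0. Qed.

Lemma enorm_sqr n (x : Rn R n) : enorm x ^+ 2 = dotp x x.
Proof. by rewrite sqr_sqrtr ?dotp_ge0. Qed.

Definition origin n : Rn R n := [tuple (0 : R) | i < n].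

Lemma dotp0 n (x : Rn R n) : dotp (origin n) x = 0.
Proof. by rewrite /dotp big1// => i _; rewrite tnth_mktuple mul0r. Qed.

Lemma subp_self n (x : Rn R n) : subp x x = origin n.
Proof. by apply: eq_from_tnth => i; rewrite !tnth_mktuple subrr. Qed.

Lemma subpK n (x y : Rn R n) : subp x (subp x y) = y.
Proof. by apply: eq_from_tnth => i; rewrite !tnth_mktuple; lra. Qed.

Lemma dotp_subp_sym n (x y : Rn R n) :
  dotp (subp x y) (subp x y) = dotp (subp y x) (subp y x).
Proof. by apply: eq_bigr => i _; rewrite !tnth_mktuple; lra. Qed.

Lemma tnth_le_enorm n (x : Rn R n) i : `|tnth x i : R| <= enorm x.
Proof.
rewrite -sqrtr_sqr ler_sqrt ?dotp_ge0// /dotp (bigD1 i)//= -expr2 lerDl.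
by apply: sumr_ge0 => j _; rewrite -expr2 sqr_ge0.
Qed.

End euclidean_facts.

Section leb_facts.
Context {R : realType}.
Local Notation mu1 := (@lebesgue_measure R).

Lemma measurable_subp n :
  measurable_fun setT (fun z : Rn R n * Rn R n => subp z.1 z.2).
Proof.
apply/measurable_fun_tnthP => i.
rewrite (_ : _ \o _ = (fun z : Rn R n * Rn R n => tnth z.1 i - tnth z.2 i : R)); last first.
  by apply/funext => z /=; rewrite tnth_mktuple.
apply: measurable_funB.
- exact: (measurableT_comp (measurable_tnth i)).
- exact: (measurableT_comp (measurable_tnth i)).
Qed.

Lemma measurable_subpr n (x : Rn R n) : measurable_fun setT (subp x).
Proof. exact: (measurableT_comp (@measurable_subp n) (pair1_measurable x)). Qed.

Lemma measurable_dotp n :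
  measurable_fun setT (fun z : Rn R n * Rn R n => dotp z.1 z.2).
Proof.
apply: measurable_sum => i; apply: measurable_funM.
- exact: (measurableT_comp (measurable_tnth i)).
- exact: (measurableT_comp (measurable_tnth i)).
Qed.

Lemma measurable_enorm n : measurable_fun setT (@enorm R n).
Proof.
apply: (@measurableT_comp _ _ _ _ _ _ (@Num.sqrt R)).
  by apply: continuous_measurable_fun; exact: sqrt_continuous.
rewrite /dotp; apply: measurable_sum => i; apply: measurable_funM; exact: measurable_tnth.
Qed.

Lemma leb0_integral (f : Rn R 0 -> \bar R) : (\int[leb R 0]_x f x = f [tuple])%E.
Proof.
rewrite /= integral_dirac ?diracT ?mul1e//.
move=> _ A mA; rewrite setTI.
have [f0|f0] := pselect (A (f [tuple])).
  rewrite (_ : _ @^-1` _ = setT)//; apply/seteqP; split=> // x _ /=.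
  by rewrite (tuple0 x).
rewrite (_ : _ @^-1` _ = set0)//; apply/seteqP; split=> // x /=.
by rewrite (tuple0 x).
Qed.

Lemma lebS_integral n (f : Rn R n.+1 -> \bar R) : measurable_fun setT f ->
  (forall x, 0 <= f x)%E ->
  (\int[leb R n.+1]_x f x =
   \int[mu1]_a \int[leb R n]_x f (cons_pt (a, x)))%E.
Proof.
move=> mf f0; have mc := @measurable_cons_pt R n.
transitivity (\int[(mu1 \x leb R n)%E]_z (f \o @cons_pt R n) z)%E.
  have := @ge0_integral_pushforward _ _ _ _ R (@cons_pt R n) mc
    (mu1 \x leb R n)%E setT f measurableT mf.
  by rewrite preimage_setT; apply.
by apply: fubini_tonelli1; [exact: (measurableT_comp mf mc)|move=> z; exact: f0].
Qed.

(** The image of Lebesgue measure under [y |-> x - y] gives intervals their length, hence is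
    Lebesgue measure. Reflections are taken as basic because convolutions involve [subp x y]; two of
    them make a translation. *)
Lemma leb1_reflect (f : measurableTypeR R -> \bar R) (x : R) : measurable_fun setT f ->
  (forall y, 0 <= f y)%E ->
  (\int[mu1]_y f (x - y)%R = \int[mu1]_y f y)%E.
Proof.
move=> mf f0.
have mphi : measurable_fun setT (fun y : measurableTypeR R => x - y : measurableTypeR R).
  exact: measurable_funB.
rewrite (eq_measure_integral (pushforward mu1 (fun y : measurableTypeR R => x - y : measurableTypeR R))).
  rewrite ge0_integral_pushforward//=; last exact: (measurableT_comp mf mphi).
  by rewrite preimage_setT; apply: eq_integral => y _; congr f; lra.
pose phi : {mfun measurableTypeR R >-> measurableTypeR R} :=
  HB.pack (fun y : measurableTypeR R => x - y : measurableTypeR R)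
    (isMeasurableFun.Build _ _ _ _ _ mphi).
move=> A mA _; apply: (@lebesgue_measure_unique _ (pushforward mu1 phi)) => //.
move=> _ [[a b]] _ <-.
(* The preimage of []a, b]] is closed on the left instead of the right; its length is the same. *)
transitivity (mu1 `[x - b, x - a[%classic); last first.
  congr (mu1 _); apply/seteqP; split=> y /=; rewrite !in_itv/=.
    by move=> /andP[h1 h2]; apply/andP; split; lra.
  by move=> /andP[h1 h2]; apply/andP; split; lra.
rewrite !lebesgue_measure_itv/= !lte_fin.
have -> : (x - b < x - a) = (a < b) by apply/idP/idP; lra.
by case: ifP => // _; rewrite -!EFinB; congr EFin; lra.
Qed.

Lemma leb_subp n (f : Rn R n -> \bar R) (x : Rn R n) : measurable_fun setT f ->
  (forall y, 0 <= f y)%E ->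
  (\int[leb R n]_y f (subp x y) = \int[leb R n]_y f y)%E.
Proof.
elim: n f x => [|n ih] f x mf f0.
  by rewrite !leb0_integral; congr f; exact/tuple0.
have mfc : measurable_fun setT (fun z : measurableTypeR R * Rn R n => f (cons_pt z)).
  by apply: (measurableT_comp mf); exact: measurable_cons_pt.
have mfs : measurable_fun setT (fun y => f (subp x y)).
  by apply: (measurableT_comp mf); exact: measurable_subpr.
rewrite !lebS_integral// (tuple_eta x) -/(cons_pt (thead x, [tuple of behead x])).
under eq_integral => a _.
  under eq_integral do rewrite subp_cons.
  rewrite (ih (fun y => f (cons_pt (thead x - a, y))))//; last first.
    exact: (measurableT_comp mfc (pair1_measurable _)).
  over.
apply: (@leb1_reflect (fun a => \int[leb R n]_y f (cons_pt (a, y)))%E (thead x)).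
- by apply: (measurable_fun_fubini_tonelli_F (fun z => f (cons_pt z))).
- by move=> a; exact: integral_ge0.
Qed.

Lemma leb_prod n (g : 'I_n -> R -> R) (C : 'I_n -> R) :
  (forall i, measurable_fun setT (g i)) -> (forall i y, 0 <= g i y) ->
  (forall i, \int[mu1]_y (g i y)%:E = (C i)%:E)%E ->
  (\int[leb R n]_x (\prod_i g i (tnth x i))%:E = (\prod_i C i)%:E)%E.
Proof.
elim: n g C => [|n ih] g C mg g0 gC; first by rewrite leb0_integral !big_ord0.
have mprod m (h : 'I_m -> R -> R) : (forall i, measurable_fun setT (h i)) ->
    measurable_fun setT (fun x : Rn R m => \prod_i h i (tnth x i)).
  move=> mh; apply: measurable_prod => i _.
  exact: (measurableT_comp (mh i) (measurable_tnth i)).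
rewrite lebS_integral; last 2 first.
- by apply/measurable_EFinP; exact: mprod.
- by move=> x; rewrite lee_fin prodr_ge0.
under eq_integral => a _.
  under eq_integral => x _.
    rewrite big_ord_recl tnth_cons_pt.
    under eq_bigr do rewrite tnth_cons_pt.
    rewrite EFinM.
    over.
  rewrite ge0_integralZl//; last 3 first.
  - by apply/measurable_EFinP; apply: (mprod n (fun i => g (lift ord0 i))).
  - by move=> x _; rewrite lee_fin prodr_ge0.
  - by rewrite lee_fin.
  rewrite (ih (fun i => g (lift ord0 i)) (fun i => C (lift ord0 i)))// muleC.
  over.
have C0 i : 0 <= C i.
  by rewrite -lee_fin -gC; apply: integral_ge0 => y _; rewrite lee_fin.
rewrite ge0_integralZl//; last 3 first.
- by apply/measurable_EFinP; exact: mg.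
- by move=> x _; rewrite lee_fin.
- by rewrite lee_fin prodr_ge0.
by rewrite gC big_ord_recl -EFinM mulrC.
Qed.

Lemma leb_setT n : (0 < n)%N -> leb R n setT = +oo%E.
Proof.
case: n => // n _.
have := @leb_box R n.+1 (fun=> setT) (fun=> measurableT).
rewrite (_ : [set x | _] = setT); last by apply/seteqP; split.
move=> ->; rewrite big_ord_recl.
have mT : mu1 setT = +oo%E.
  by have := lebesgue_measure_itv (Interval -oo%O +oo%O : interval R); rewrite set_itvE.
rewrite mT gt0_mulye//; elim: n => [|n ih]; first by rewrite big_ord0.
by rewrite big_ord_recl gt0_mulye.
Qed.

End leb_facts.

(** * Integrals of powers, on the line and on [Rn R n] *)

Section real_line.
Context {R : realType}.
Local Notation mu1 := (@lebesgue_measure R).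

Lemma leb1_scale (f : measurableTypeR R -> \bar R) (c : R) : 0 < c ->
  measurable_fun setT f -> (forall y, 0 <= f y)%E ->
  (\int[mu1]_y f (c * y)%R = c^-1%:E * \int[mu1]_y f y)%E.
Proof.
move=> c0 mf f0.
have mphi : measurable_fun setT (fun y : measurableTypeR R => c * y : measurableTypeR R).
  exact: measurable_funM.
pose phi : {mfun measurableTypeR R >-> measurableTypeR R} :=
  HB.pack (fun y : measurableTypeR R => c * y : measurableTypeR R)
    (isMeasurableFun.Build _ _ _ _ _ mphi).
have c0' : 0 <= c by exact: ltW.
have -> : (\int[mu1]_y f y = c%:E * \int[pushforward mu1 phi]_y f y)%E.
  rewrite -(@ge0_integral_mscale _ _ R (pushforward mu1 phi) setT measurableT (NngNum c0'))//.
  apply: eq_measure_integral => A mA _.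
  apply: (@lebesgue_measure_unique _ (mscale (NngNum c0') (pushforward mu1 phi))) => //.
  move=> _ [[a b]] _ <-.
  transitivity (c%:E * mu1 `](a / c)%R, (b / c)%R]%classic)%E; last first.
    congr (_ * mu1 _)%E; apply/seteqP; split=> y /=; rewrite !in_itv/=.
      by rewrite ltr_pdivrMr// ler_pdivlMr// ![y * c]mulrC.
    by rewrite ltr_pdivrMr// ler_pdivlMr// ![y * c]mulrC.
  rewrite !lebesgue_measure_itv/= !lte_fin ltr_pM2r ?invr_gt0//.
  case: ifP => _; last by rewrite mule0.
  rewrite -!EFinB -EFinM; congr EFin; field; lra.
rewrite muleA -EFinM mulVf ?gt_eqF// mul1e ge0_integral_pushforward//=.
Qed.

(** In the applications [h] vanishes on the negative half line: an even function is controlled by a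
    bound on positive arguments and its mirror image. *)
Lemma integral_dom_even (f h : R -> R) : measurable_fun setT f ->
  measurable_fun setT h -> (forall x, 0 <= f x) -> (forall x, 0 <= h x) ->
  (forall x, f x <= h x + h (- x)) -> (\int[mu1]_x (h x)%:E < +oo)%E ->
  (\int[mu1]_x (f x)%:E < +oo)%E.
Proof.
move=> mf mh f0 h0 fh hoo.
have mhN : measurable_fun setT (fun x : R => h (- x)) by apply: (measurableT_comp mh).
apply: (@le_lt_trans _ _ (\int[mu1]_x ((h x)%:E + (h (- x))%:E))%E).
  apply: ge0_le_integral => //.
  - by move=> x _; rewrite lee_fin.
  - by apply/measurable_EFinP; exact: mf.
  - by apply/measurable_EFinP; apply: measurable_funD; [exact: mh|exact: mhN].
  - by move=> x _; rewrite -EFinD lee_fin.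
rewrite ge0_integralD//; last 4 first.
- by move=> x _; rewrite lee_fin.
- by apply/measurable_EFinP; exact: mh.
- by move=> x _; rewrite lee_fin.
- by apply/measurable_EFinP; exact: mhN.
rewrite lte_add_pinfty//.
rewrite (_ : (\int[_]_x _)%E = \int[mu1]_x (h (0 - x))%:E)%E; last first.
  by apply: eq_integral => x _; rewrite sub0r.
rewrite (@leb1_reflect R (fun x => (h x)%:E) 0)//.
by apply/measurable_EFinP; exact: mh.
Qed.

Lemma FTC2_itv (f F : R -> R) (a b : R) : a < b ->
  (forall x, a <= x <= b -> is_derive x 1 F (f x)) ->
  (forall x, a <= x <= b -> {for x, continuous f}) ->
  (\int[mu1]_(x in `[a, b]) (f x)%:E = (F b - F a)%:E)%E.
Proof.
move=> ab dF cf.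
have cF x : a <= x <= b -> {for x, continuous F}.
  move=> xab; apply: differentiable_continuous.
  by apply/derivable1_diffP; have [] := dF x xab.
rewrite (@continuous_FTC2 _ f F)//.
- apply: continuous_in_subspaceT => x; rewrite inE/= in_itv/=; exact: cf.
- split.
  + by move=> x; rewrite in_itv/= => /andP[/ltW ax /ltW xb]; have [] := dF x; rewrite ?ax.
  + by apply: cvg_at_right_filter; apply: cF; rewrite lexx ltW.
  + by apply: cvg_at_left_filter; apply: cF; rewrite lexx ltW.
- move=> x; rewrite in_itv/= => /andP[/ltW ax /ltW xb].
  by have := dF x; rewrite ax xb derive1E => /(_ isT)[_ ->].
Qed.

Lemma continuous_powR_gt0 (e x : R) : 0 < x -> {for x, continuous (@powR R ^~ e)}.
Proof.
move=> x0; apply: differentiable_continuous; apply/derivable1_diffP.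
by have [] := @is_derive1_powR R e x x0.
Qed.

Lemma integral_powR (e a b : R) : 0 < a -> a < b -> e + 1 != 0 ->
  (\int[mu1]_(x in `[a, b]) (x `^ e)%:E =
   ((b `^ (e + 1) - a `^ (e + 1)) / (e + 1))%:E)%E.
Proof.
move=> a0 ab e1.
have := @FTC2_itv (fun x => x `^ e) (fun x => (e + 1)^-1 * x `^ (e + 1)) a b ab.
rewrite -mulrBr mulrC; apply.
- move=> x /andP[ax _]; have x0 : 0 < x by exact: lt_le_trans ax.
  apply: (is_derive_eq (is_deriveZ (e + 1)^-1 (is_derive1_powR (e + 1) x0))).
  by rewrite /GRing.scale/= mulrA mulVf// mul1r addrK.
- by move=> x /andP[ax _]; apply: continuous_powR_gt0; exact: lt_le_trans ax.
Qed.

Lemma integral_powR_1y (c : R) : 1 < c ->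
  (\int[mu1]_(x in `[1%R, +oo[) (x `^ (- c))%:E < +oo)%E.
Proof.
move=> c1.
apply: (@le_lt_trans _ _ ((c - 1)^-1)%:E); last exact: ltry.
(* With [k + 2] the intervals are nondegenerate from [k = 0] on, as [integral_powR] requires. *)
have -> : [set` `[1%R, +oo[] = \bigcup_k `[1%R, (k%:R + 2 : R)]%classic.
  apply/seteqP; split=> x /=.
    rewrite in_itv/= andbT => x1.
    exists (Num.truncn x) => //=; rewrite in_itv/= x1/=.
    have /andP[_ +] := truncn_itv (le_trans ler01 x1).
    by rewrite -natr1 => /ltW /le_trans; apply; rewrite lerD2l; lra.
  by move=> [k _] /=; rewrite !in_itv/= andbT => /andP[].
have := @ge0_nondecreasing_set_cvg_integral _ (measurableTypeR R) R
  (fun k => `[1%R, (k%:R + 2 : R)]%classic) (fun x => (x `^ (- c))%:E) (@lebesgue_measure R).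
move=> h; have {h} := h _ _ _ _.
move=> /(_ _ _ _ _)/cvg_lim <-//.
- apply: lime_le.
    apply: ereal_nondecreasing_is_cvgn => i j ij; apply: ge0_subset_integral => //.
    + by apply/measurable_EFinP; apply: measurable_funTS; exact: measurable_powR.
    + by move=> x _; rewrite lee_fin powR_ge0.
    + by apply: subset_itvl; rewrite bnd_simp lerD2r ler_nat.
  apply: nearW => k.
  have k2 : (1 : R) < k%:R + 2 by have := ler0n R k; lra.
  rewrite integral_powR//; last by lra.
  rewrite lee_fin powR1.
  have -> : (((k%:R + 2) `^ (- c + 1) - 1) / (- c + 1)) = (1 - (k%:R + 2) `^ (- c + 1)) / (c - 1).
    by field; lra.
  by rewrite ler_piMl ?invr_ge0 ?gerBl ?powR_ge0//; lra.
- move=> i j ij; apply/subsetPset; apply: subset_itvl.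
  by rewrite bnd_simp lerD2r ler_nat.
- by move=> i; apply/measurable_EFinP; apply: measurable_funTS; exact: measurable_powR.
- by move=> i x _; rewrite lee_fin powR_ge0.
Qed.

Lemma integral_powR_01 (a : R) : 0 < a < 1 ->
  (\int[mu1]_(x in `]0%R, 1%R]) (x `^ (- a))%:E < +oo)%E.
Proof.
move=> /andP[a0 a1].
apply: (@le_lt_trans _ _ ((1 - a)^-1)%:E); last exact: ltry.
have -> : [set` `]0%R, 1%R]] = \bigcup_k `[((k%:R + 2)^-1 : R), 1%R]%classic.
  apply/seteqP; split=> x /=.
    rewrite in_itv/= => /andP[x0 x1].
    exists (Num.truncn x^-1) => //=; rewrite in_itv/= x1 andbT.
    have x'0 : 0 <= x^-1 by rewrite invr_ge0 ltW.
    have /andP[_ +] := truncn_itv x'0.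
    rewrite -natr1 => h.
    rewrite -[leRHS]invrK lef_pV2 ?posrE ?invr_gt0 ?ltr_wpDl//.
    by rewrite (le_trans (ltW h))// lerD2l; lra.
  move=> [k _] /=; rewrite !in_itv/= => /andP[kx ->]; rewrite andbT.
  by rewrite (lt_le_trans _ kx)// invr_gt0 ltr_wpDl.
have := @ge0_nondecreasing_set_cvg_integral _ (measurableTypeR R) R
  (fun k => `[((k%:R + 2)^-1 : R), 1%R]%classic) (fun x => (x `^ (- a))%:E) (@lebesgue_measure R).
move=> h; have {h} := h _ _ _ _.
move=> /(_ _ _ _ _)/cvg_lim <-//.
- apply: lime_le.
    apply: ereal_nondecreasing_is_cvgn => i j ij; apply: ge0_subset_integral => //.
    + by apply/measurable_EFinP; apply: measurable_funTS; exact: measurable_powR.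
    + by move=> x _; rewrite lee_fin powR_ge0.
    + by apply: subset_itvr; rewrite bnd_simp lef_pV2 ?posrE ?ltr_wpDl// lerD2r ler_nat.
  apply: nearW => k.
  have k0 : (0 : R) < (k%:R + 2)^-1 by rewrite invr_gt0 ltr_wpDl.
  have k2 : ((k%:R + 2)^-1 : R) < 1.
    by rewrite invf_lt1; have := ler0n R k; lra.
  rewrite integral_powR//; last by lra.
  rewrite lee_fin powR1 (addrC (- a) 1).
  by rewrite ler_piMl ?invr_ge0 ?gerBl ?powR_ge0//; lra.
- move=> i j ij; apply/subsetPset; apply: subset_itvr.
  by rewrite bnd_simp lef_pV2 ?posrE ?ltr_wpDl// lerD2r ler_nat.
- by move=> i; apply/measurable_EFinP; apply: measurable_funTS; exact: measurable_powR.
- by move=> i x _; rewrite lee_fin powR_ge0.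
Qed.

End real_line.

Section ae_facts.
Context d (T : measurableType d) (R : realType) (mu : {measure set T -> \bar R}).
Implicit Types P Q S : T -> Prop.

Lemma aeS P Q : (forall x, P x -> Q x) ->
  {ae mu, forall x, P x} -> {ae mu, forall x, Q x}.
Proof. by move=> PQ; apply: filterS. Qed.

Lemma aeS2 P Q S : (forall x, P x -> Q x -> S x) ->
  {ae mu, forall x, P x} -> {ae mu, forall x, Q x} -> {ae mu, forall x, S x}.
Proof. by move=> PQ; apply: filterS2. Qed.

Lemma ae_seq (P : nat -> T -> Prop) : (forall k, {ae mu, forall x, P k x}) ->
  {ae mu, forall x, forall k, P k x}.
Proof. by move=> h; exact/ae_foralln. Qed.

End ae_facts.

Section power_integrals.
Context {R : realType}.
Local Notation mu1 := (@lebesgue_measure R).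

Lemma integral_mkcond_indic d (T : measurableType d) (mu : {measure set T -> \bar R})
    (D : set T) (f : T -> R) : measurable D ->
  (\int[mu]_(x in D) (f x)%:E = \int[mu]_x (\1_D x * f x)%:E)%E.
Proof.
move=> mD; rewrite integral_mkcond; apply: eq_integral => x _.
rewrite /restrict /patch indicE; case: ifP => _; rewrite ?mul1r ?mul0r//.
Qed.

Lemma integral_powR_1D (c : R) : 1 < c ->
  (\int[mu1]_x ((1 + `|x|) `^ (- c))%:E < +oo)%E.
Proof.
move=> c1.
pose h (x : R) := \1_(`[0, 1]%classic : set R) x + \1_(`[1, +oo[%classic : set R) x * x `^ (- c).
have mpow (e : R) : measurable_fun setT (fun x : R => (1 + `|x|) `^ e).
  by apply: (measurableT_comp (measurable_powR e)); apply: measurable_funD => //; exact: normr_measurable.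
have h0 x : 0 <= h x by rewrite addr_ge0 ?mulr_ge0 ?powR_ge0.
have m1 : measurable_fun setT (\1_(`[0, 1]%classic : set R) : R -> R) by exact: measurable_indic.
have m2 : measurable_fun setT (fun x : R => \1_(`[1, +oo[%classic : set R) x * x `^ (- c)).
  by apply: measurable_funM; [exact: measurable_indic|exact: measurable_powR].
have hpos (x : R) : 0 <= x -> (1 + `|x|) `^ (- c) <= h x.
  move=> x0; rewrite ger0_norm// /h !indicE !mem_setE !in_itv/= x0 andbT/=.
  have [x1|x1] := leP x 1; have [x2|x2] := leP 1 x; rewrite ?mul1r ?mul0r ?add0r ?addr0/=; last 1 first.
  - lra.
  - rewrite (@le_trans _ _ 1) ?lerDl ?powR_ge0//.
    by rewrite powRN invf_le1 ?powR_gt0 ?ltr_wpDr// -[leLHS](powRr0 (1 + x)) ler_powR ?lerDl//; lra.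
  - by rewrite powRN invf_le1 ?powR_gt0 ?ltr_wpDr// -[leLHS](powRr0 (1 + x)) ler_powR ?lerDl//; lra.
  - rewrite !powRN lef_pV2 ?posrE ?powR_gt0 ?ltr_wpDr//; last lra.
    by rewrite ge0_ler_powR ?nnegrE; lra.
apply: (@integral_dom_even _ _ h) => //.
- exact: measurable_funD.
- move=> x; have [x0|x0] := leP 0 x.
    by rewrite (le_trans (hpos x x0))// lerDl.
  rewrite -normrN (le_trans (hpos (- x) _)) ?lerDr//; lra.
under eq_integral do rewrite EFinD.
rewrite ge0_integralD//; last 3 first.
- by apply/measurable_EFinP; exact: m1.
- by move=> x _; rewrite lee_fin mulr_ge0 ?powR_ge0.
- by apply/measurable_EFinP; exact: m2.
rewrite lte_add_pinfty//.
  rewrite integral_indic// setIT.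
  have := lebesgue_measure_itv (`[0, 1] : interval R).
  by rewrite /= lte01 -EFinB => ->; rewrite ltry.
by rewrite -integral_mkcond_indic//; exact: integral_powR_1y.
Qed.

Lemma integral_powR_0D (a : R) : 0 < a < 1 ->
  (\int[mu1]_x (\1_(`[-1, 1]%classic : set R) x * `|x| `^ (- a))%:E < +oo)%E.
Proof.
move=> a01.
pose h (x : R) := \1_(`]0, 1]%classic : set R) x * x `^ (- a).
have mh : measurable_fun setT h.
  by apply: measurable_funM; [exact: measurable_indic|exact: measurable_powR].
have h0 x : 0 <= h x by rewrite mulr_ge0 ?powR_ge0.
apply: (@integral_dom_even _ _ h) => //.
- apply: measurable_funM; first exact: measurable_indic.
  by apply: (measurableT_comp (measurable_powR _)); exact: normr_measurable.
- move=> x; have [->|x0] := eqVneq x 0.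
    by rewrite normr0 powR0 ?oppr_eq0 ?mulr0 ?addr_ge0//; case/andP: a01; lra.
  rewrite {1}indicE mem_setE in_itv/=.
  have [x1|] := boolP (-1 <= x <= 1); last by rewrite mul0r addr_ge0.
  rewrite mul1r /h !indicE !mem_setE !in_itv/=.
  have [xp|xn] := ltP 0 x.
    case/andP: x1 => _ ->; rewrite mul1r gtr0_norm// lerDl.
    by rewrite mulr_ge0 ?powR_ge0.
  have xn' : x < 0 by rewrite lt_neqAle x0.
  case/andP: x1 => x1 _; rewrite oppr_gt0 xn' lerNl x1/= mul0r add0r mul1r.
  by rewrite ltr0_norm.
by rewrite -integral_mkcond_indic//; exact: integral_powR_01.
Qed.

Lemma integrable_lty_ex d (T : measurableType d) (mu : {measure set T -> \bar R})
    (f : T -> R) : (forall x, 0 <= f x) -> (\int[mu]_x (f x)%:E < +oo)%E ->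
  exists C : R, (\int[mu]_x (f x)%:E = C%:E)%E.
Proof.
move=> f0 foo; exists (fine (\int[mu]_x (f x)%:E)%E); rewrite fineK//.
by rewrite ge0_fin_numE//; apply: integral_ge0 => x _; rewrite lee_fin.
Qed.

(** Shares a power equally among the coordinates; together with [|x_i| <= |x|] this replaces polar
    coordinates in the next two lemmas. *)
Lemma powR_prod_const n (b : R) (e : R) : 0 <= b -> (0 < n)%N ->
  b `^ e = \prod_(i < n) (b `^ (e / n%:R)).
Proof.
move=> b0 n0; rewrite prodr_const card_ord -powR_mulrn ?powR_ge0// -powRrM.
by rewrite mulfVK// pnatr_eq0 -lt0n.
Qed.

(** The weight is at most the product over [i] of [(1 + |x_i|)^(-c/n)], and each factor is
    integrable on the line because [c / n > 1]. *)
Lemma enorm_far_lty n (c : R) : (0 < n)%N -> n%:R < c ->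
  (\int[leb R n]_x ((1 + enorm x) `^ (- c))%:E < +oo)%E.
Proof.
move=> n0 nc; have n0' : (0 : R) < n%:R by rewrite ltr0n.
have c1 : 1 < c / n%:R by rewrite ltr_pdivlMr// mul1r.
have [C HC] := integrable_lty_ex (fun x => powR_ge0 _ _) (integral_powR_1D c1).
have mg : measurable_fun setT (fun y : R => (1 + `|y|) `^ (- (c / n%:R))).
  by apply: (measurableT_comp (measurable_powR _)); apply: measurable_funD => //; exact: normr_measurable.
have := @leb_prod R n (fun _ y => (1 + `|y|) `^ (- (c / n%:R))) (fun=> C)
  (fun=> mg) (fun _ _ => powR_ge0 _ _) (fun=> HC).
move=> E; apply: (@le_lt_trans _ _ (\prod_(i < n) C)%:E); last exact: ltry.
rewrite -E; apply: ge0_le_integral => //.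
- by move=> x _; rewrite lee_fin powR_ge0.
- apply/measurable_EFinP; apply: (measurableT_comp (measurable_powR _)).
  by apply: measurable_funD => //; exact: measurable_enorm.
- apply/measurable_EFinP; apply: measurable_prod => i _.
  exact: (measurableT_comp mg (measurable_tnth i)).
move=> x _; rewrite lee_fin powRN (@powR_prod_const n)// ?addr_ge0 ?enorm_ge0//.
rewrite -prodfV; apply: ler_prod => i _.
rewrite invr_ge0 powR_ge0/= powRN lef_pV2 ?posrE ?powR_gt0 ?ltr_wpDr ?enorm_ge0//.
by rewrite ge0_ler_powR ?nnegrE ?addr_ge0 ?enorm_ge0 ?lerD2l ?tnth_le_enorm//; lra.
Qed.

(** The unit ball lies in the cube of half side 1, where [|x|^(-a)] is at most the product of the
    [|x_i|^(-a/n)], integrable near 0 because [a / n < 1]. *)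
Lemma enorm_near_lty n (a : R) : (0 < n)%N -> 0 < a < n%:R ->
  (\int[leb R n]_x (if enorm x <= 1 then (enorm x `^ a)^-1 else 0)%:E < +oo)%E.
Proof.
move=> n0 /andP[a0 an]; have n0' : (0 : R) < n%:R by rewrite ltr0n.
have a1 : 0 < a / n%:R < 1 by rewrite divr_gt0// ltr_pdivrMr// mul1r.
pose g (x : R) := \1_(`[-1, 1]%classic : set R) x * `|x| `^ (- (a / n%:R)).
have g0 x : 0 <= g x by rewrite mulr_ge0 ?powR_ge0.
have goo : (\int[mu1]_x (g x)%:E < +oo)%E := integral_powR_0D a1.
have [C HC] := @integrable_lty_ex _ _ (@lebesgue_measure R) g g0 goo.
have mg : measurable_fun setT g.
  apply: measurable_funM; first exact: measurable_indic.
  by apply: (measurableT_comp (measurable_powR _)); exact: normr_measurable.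
have := @leb_prod R n (fun=> g) (fun=> C) (fun=> mg) (fun=> g0) (fun=> HC).
move=> E; apply: (@le_lt_trans _ _ (\prod_(i < n) C)%:E); last exact: ltry.
rewrite -E; apply: ae_ge0_le_integral => //.
- by move=> x _; rewrite lee_fin; case: ifP => // _; rewrite invr_ge0 powR_ge0.
- apply/measurable_EFinP; apply: measurable_fun_ifT => //.
    by apply: measurable_fun_ler => //; exact: measurable_enorm.
  under eq_fun do rewrite -powRN.
  by apply: (measurableT_comp (measurable_powR _)); exact: measurable_enorm.
- by move=> x _; rewrite lee_fin prodr_ge0.
- apply/measurable_EFinP; apply: measurable_prod => i _.
  exact: (measurableT_comp mg (measurable_tnth i)).
(* [powR] sends 0 to 0 for a nonzero exponent, so the product bound fails where a coordinate
   vanishes; these hyperplanes are null sets. *)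
have Hi (i : 'I_n) : {ae leb R n, forall x, (tnth x i : R) != 0}.
  pose A (j : 'I_n) : set (measurableTypeR R) := if j == i then [set 0] else setT.
  have mA j : measurable (A j) by rewrite /A; case: ifP => _ //; exact: measurable_set1.
  exists [set x : Rn R n | forall j, A j (tnth x j)].
  split.
  - rewrite (_ : [set x | _] = (fun x : Rn R n => tnth x i : measurableTypeR R) @^-1` [set 0]).
      by rewrite -[X in measurable X]setTI; exact: (measurable_tnth i).
    apply/seteqP; split=> x /=; first by move=> /(_ i); rewrite /A eqxx.
    by move=> xi j; rewrite /A; case: ifPn => // /eqP ->.
  - by rewrite leb_box// (bigD1 i)//= {1}/A eqxx lebesgue_measure_set1 mul0e.
  - move=> x /= /negP; rewrite negbK => /eqP xi j.
    by rewrite /A; case: ifPn => // /eqP ->.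
have : {ae leb R n, forall x (i : 'I_n), (tnth x i : R) != 0} by exact: filter_forall.
apply: aeS => x xi _; rewrite lee_fin; case: ifPn => x1; last by rewrite prodr_ge0.
rewrite (@powR_prod_const n) ?enorm_ge0// -prodfV; apply: ler_prod => i _.
rewrite invr_ge0 powR_ge0/= /g indicE mem_setE in_itv/=.
have xi1 : `|tnth x i : R| <= 1 by exact: le_trans (tnth_le_enorm _ _) x1.
rewrite -ler_norml xi1 mul1r powRN lef_pV2 ?posrE ?powR_gt0 ?normr_gt0//; last first.
  by rewrite (lt_le_trans _ (tnth_le_enorm x i))// normr_gt0.
by rewrite ge0_ler_powR ?nnegrE ?enorm_ge0 ?tnth_le_enorm//; lra.
Qed.

End power_integrals.

Section integrable_facts.
Context d (T : measurableType d) (R : realType) (mu : {measure set T -> \bar R}).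
Implicit Types f g : T -> R.

Lemma RintegrableZl (c : R) f : mu.-integrable setT (EFin \o f) ->
  mu.-integrable setT (EFin \o (fun x => c * f x)).
Proof.
by move=> h; rewrite /comp; under eq_fun do rewrite EFinM; exact: integrableZl.
Qed.

Lemma RintegrableD f g : mu.-integrable setT (EFin \o f) ->
  mu.-integrable setT (EFin \o g) ->
  mu.-integrable setT (EFin \o (fun x => f x + g x)).
Proof.
by move=> hf hg; rewrite /comp; under eq_fun do rewrite EFinD; exact: integrableD.
Qed.

Lemma RintegrableB f g : mu.-integrable setT (EFin \o f) ->
  mu.-integrable setT (EFin \o g) ->
  mu.-integrable setT (EFin \o (fun x => f x - g x)).
Proof.
by move=> hf hg; rewrite /comp; under eq_fun do rewrite EFinB; exact: integrableB.
Qed.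

End integrable_facts.

Section leb_Rintegral.
Context {R : realType}.
Local Notation mu1 := (@lebesgue_measure R).

Lemma leb_subpR n (f : Rn R n -> R) (x : Rn R n) : measurable_fun setT f ->
  \int[leb R n]_y f (subp x y) = \int[leb R n]_y f y.
Proof.
move=> mf; rewrite /Rintegral; congr fine.
have mf' : measurable_fun setT (EFin \o f) by exact/measurable_EFinP.
rewrite [LHS]integralE [RHS]integralE; congr (_ - _)%E.
  rewrite -(leb_subp x (measurable_funepos mf'))//.
  by apply: eq_integral => y _; rewrite /= !funeposE.
rewrite -(leb_subp x (measurable_funeneg mf'))//.
by apply: eq_integral => y _; rewrite /= !funenegE.
Qed.

Lemma integrable_subp n (f : Rn R n -> R) (x : Rn R n) :
  (leb R n).-integrable setT (EFin \o f) ->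
  (leb R n).-integrable setT (fun y => (f (subp x y))%:E).
Proof.
move=> /integrableP[/measurable_EFinP mf foo]; apply/integrableP; split.
  by apply/measurable_EFinP; apply: (measurableT_comp mf); exact: measurable_subpr.
rewrite (leb_subp x (f := fun y => `|(f y)%:E|%E))//.
by apply: measurableT_comp => //; exact/measurable_EFinP.
Qed.

Lemma lebS_Rintegral n (f : Rn R n.+1 -> R) :
  (leb R n.+1).-integrable setT (EFin \o f) ->
  (forall a, (leb R n).-integrable setT (EFin \o (fun x => f (cons_pt (a, x))))) ->
  \int[leb R n.+1]_x f x =
  \int[mu1]_a \int[leb R n]_x f (cons_pt (a, x)).
Proof.
move=> intf intfa.
have mf : measurable_fun setT (EFin \o f) by case/integrableP: intf.
have mc := @measurable_cons_pt R n.
have ic : ((mu1 \x leb R n)%E).-integrable setT (EFin \o f \o @cons_pt R n).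
  apply/integrableP; split; first exact: measurableT_comp.
  case/integrableP: intf => _.
  have -> : (\int[leb R n.+1]_x `|(EFin \o f) x| =
      \int[(mu1 \x leb R n)%E]_z `|(EFin \o f \o @cons_pt R n) z|)%E => //.
  have := @ge0_integral_pushforward _ _ _ _ R (@cons_pt R n) mc
    (mu1 \x leb R n)%E setT (fun x => `|(EFin \o f) x|)%E measurableT.
  rewrite preimage_setT; apply => //; exact: measurableT_comp.
have E : (\int[leb R n.+1]_x (f x)%:E =
    \int[(mu1 \x leb R n)%E]_z (EFin \o f \o @cons_pt R n) z)%E.
  have := @integral_pushforward _ _ _ _ R (@cons_pt R n) mc
    (mu1 \x leb R n)%E setT (EFin \o f) mf.
  by rewrite preimage_setT; apply.
rewrite /Rintegral E; congr fine.
rewrite -(integral12_prod_meas1 ic); apply: eq_integral => a _.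
by rewrite -/(Rintegral _ _ _) RintegralK//; exact: intfa.
Qed.

End leb_Rintegral.

(** * Fourier transform of Gaussians *)

Section gaussian.
Context {R : realType}.
Local Notation mu1 := (@lebesgue_measure R).
Implicit Types a x y : R.

Definition gauss a x := expR (- (a * x ^+ 2)).

Lemma measurable_gauss a : measurable_fun setT (gauss a).
Proof.
apply: measurableT_comp => //; apply: measurableT_comp => //.
by apply: measurable_funM => //; exact: exprn_measurable.
Qed.

Lemma gauss_ge0 a x : 0 <= gauss a x. Proof. exact: expR_ge0. Qed.

Lemma integral_gauss a : 0 < a ->
  (\int[mu1]_x (gauss a x)%:E = (Num.sqrt (pi / a))%:E)%E.
Proof.
move=> a0; have sa0 : 0 < Num.sqrt a by rewrite sqrtr_gt0.
have := @leb1_scale R (fun x => (gauss_fun x)%:E) (Num.sqrt a) sa0.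
rewrite integralT_gauss => h.
transitivity (\int[mu1]_y (gauss_fun (Num.sqrt a * y))%:E)%E.
  apply: eq_integral => y _; rewrite /gauss /gauss_fun exprMn sqr_sqrtr// ltW//.
rewrite h.
- by rewrite -EFinM mulrC sqrtrM ?pi_ge0// sqrtrV// ltW.
- by apply/measurable_EFinP; exact: measurable_gauss_fun.
- by move=> y; rewrite lee_fin gauss_fun_ge0.
Qed.

Lemma integrable_gauss a : 0 < a -> mu1.-integrable setT (EFin \o gauss a).
Proof.
move=> a0; apply: ge0_integrable_lty.
- exact: measurable_gauss.
- exact: gauss_ge0.
- by rewrite integral_gauss// ltry.
Qed.

(** Half of the exponent pays for the factor [|x|]: [|x| <= (1 + 1/a) exp (a x^2 / 2)], from
    [exp y >= 1 + y] and [2 |x| <= 1 + x^2]. *)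
Lemma moment_gauss a x : 0 < a ->
  `|x| * gauss a x <= (1 + a^-1) * gauss (a / 2) x.
Proof.
move=> a0.
have -> : gauss a x = gauss (a / 2) x * gauss (a / 2) x.
  by rewrite /gauss -expRD; congr expR; field.
rewrite mulrA ler_wpM2r ?gauss_ge0//.
have H : `|x| <= (1 + a^-1) * expR (a / 2 * x ^+ 2).
  apply: (@le_trans _ _ ((1 + a^-1) * (1 + a / 2 * x ^+ 2))); last first.
    by rewrite ler_wpM2l ?expR_ge1Dx// addr_ge0// invr_ge0 ltW.
  have -> : (1 + a^-1) * (1 + a / 2 * x ^+ 2) =
    1 + a^-1 + a / 2 * x ^+ 2 + x ^+ 2 / 2 by field; rewrite gt_eqF.
  have := sqr_ge0 (`|x| - 1); have := sqr_ge0 x.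
  rewrite -(real_normK (num_real x)) => h1 h2.
  have h3 : 0 < a^-1 by rewrite invr_gt0.
  have h4 : 0 <= a / 2 * `|x| ^+ 2 by rewrite mulr_ge0// divr_ge0// ltW.
  nra.
rewrite -ler_pdivlMr ?expR_gt0// /gauss -expRN opprK; exact: H.
Qed.

Lemma integrable_gaussM a (f : R -> R) : 0 < a -> measurable_fun setT f ->
  (forall y, `|f y| <= 1) -> mu1.-integrable setT (fun y => (gauss a y * f y)%:E).
Proof.
move=> a0 mf f1; apply: (@le_Rintegrable _ (measurableTypeR R) R mu1 _ (gauss a)).
- by apply: measurable_funM => //; exact: measurable_gauss.
- by move=> y; rewrite normrM (ger0_norm (gauss_ge0 _ _)) ler_piMr ?gauss_ge0.
- exact: integrable_gauss.
Qed.

Lemma integrable_xgaussM a (f : R -> R) : 0 < a -> measurable_fun setT f ->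
  (forall y, `|f y| <= 1) ->
  mu1.-integrable setT (fun y => (y * gauss a y * f y)%:E).
Proof.
move=> a0 mf f1.
apply: (@le_Rintegrable _ (measurableTypeR R) R mu1 _ (fun y => (1 + a^-1) * gauss (a / 2) y)).
- by apply: measurable_funM => //; apply: measurable_funM => //; exact: measurable_gauss.
- move=> y; rewrite !normrM (ger0_norm (gauss_ge0 _ _)).
  rewrite (le_trans _ (moment_gauss y a0))// ler_piMr ?mulr_ge0 ?gauss_ge0//.
- by apply: RintegrableZl; apply: integrable_gauss; rewrite divr_gt0.
Qed.

Lemma measurable_cosM x : measurable_fun setT (fun y => cos (x * y)).
Proof.
apply: (measurableT_comp (continuous_measurable_fun (@continuous_cos R))).
exact: measurable_funM.
Qed.

Lemma measurable_sinM x : measurable_fun setT (fun y => sin (x * y)).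
Proof.
apply: (measurableT_comp (continuous_measurable_fun (@continuous_sin R))).
exact: measurable_funM.
Qed.

Lemma is_derive_gauss_sin a x y :
  is_derive y 1 (fun y => gauss a y * sin (x * y))
    (x * (gauss a y * cos (x * y)) - 2 * a * (y * gauss a y * sin (x * y))).
Proof.
rewrite /gauss; apply: trigger_derive; rewrite /GRing.scale/=.
by rewrite ?expr1; ring.
Qed.

(** The difference of the two integrands is the derivative of [gauss a y * sin (x * y)], which
    vanishes at infinity. This is the differential equation of the cosine transform in disguise. *)
Lemma gauss_by_parts a x : 0 < a ->
  x * \int[mu1]_y (gauss a y * cos (x * y)) =
  2 * a * \int[mu1]_y (y * gauss a y * sin (x * y)).
Proof.
move=> a0.
pose h y := x * (gauss a y * cos (x * y)) - 2 * a * (y * gauss a y * sin (x * y)).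
have i1 : mu1.-integrable setT (fun y => (gauss a y * cos (x * y))%:E).
  by apply: integrable_gaussM => //; [exact: measurable_cosM|move=> y; exact: cos_max].
have i2 : mu1.-integrable setT (fun y => (y * gauss a y * sin (x * y))%:E).
  by apply: integrable_xgaussM => //; [exact: measurable_sinM|move=> y; exact: sin_max].
have ih : mu1.-integrable setT (EFin \o h).
  by apply: RintegrableB; apply: RintegrableZl.
have mh : measurable_fun setT h by case/integrableP: ih => /measurable_EFinP.
suff : \int[mu1]_y h y = 0.
  rewrite RintegralB//; last 2 first.
  - exact: RintegrableZl.
  - exact: RintegrableZl.
  by rewrite !RintegralZl// => /eqP; rewrite subr_eq0 => /eqP.
pose D (k : nat) : set R := `[(- k.+1%:R : R), k.+1%:R]%classic.
have [] := @dominated_Rintegral _ (measurableTypeR R) R mu1 (fun k y => \1_(D k) y * h y) h (fun y => `|h y|).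
- move=> k; apply: (@measurable_funM _ (measurableTypeR R) R); last exact: mh.
  by apply: measurable_indic; exact: measurable_itv.
- move=> y; apply: cvg_near_cst; exists (Num.truncn `|y|) => // k /= yk.
  rewrite indicE mem_set ?mul1r// /D /= in_itv/= -ler_norml.
  have /andP[_ /ltW /le_trans] := truncn_itv (normr_ge0 y); apply.
  by rewrite ler_nat.
- exact: (integrable_norm ih).
- move=> k y; rewrite normrM ler_piMl// indicE; case: (_ \in _); rewrite ?normr1 ?normr0//.
move=> _ c1.
(* The primitive is odd, so both end points contribute the same amount. *)
have E k : \int[mu1]_y (\1_(D k) y * h y) = 2 * (gauss a k.+1%:R * sin (x * k.+1%:R)).
  have kk : (- k.+1%:R : R) < k.+1%:R by have := ltr0Sn R k; lra.
  have ch (y : R) : - k.+1%:R <= y <= k.+1%:R -> {for y, continuous h}.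
    move=> _.
    apply: differentiable_continuous; apply/derivable1_diffP.
    by rewrite /h /gauss; apply: ex_derive.
  have := @FTC2_itv R h _ _ _ kk (fun y _ => is_derive_gauss_sin a x y) ch.
  rewrite integral_mkcond_indic// /Rintegral => ->.
  by rewrite /= /gauss sqrrN mulrN sinN; ring.
have c2 : \int[mu1]_y (\1_(D k) y * h y) @[k --> \oo] --> 0.
  under eq_fun do rewrite E.
  apply/cvgr0Pnorm_le => e e0.
  have c3 : (2 * a^-1) * (k.+1%:R^-1 : R) @[k --> \oo] --> 0.
    rewrite -[X in _ --> X](mulr0 (2 * a^-1)).
    by apply: cvgMr; exact: cvg_harmonic.
  move/cvgr0Pnorm_le : c3 => /(_ _ e0); apply: filterS => k.
  apply: le_trans; rewrite !normrM -!mulrA ler_wpM2l//.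
  have ai : 0 <= a^-1 by rewrite invr_ge0 ltW.
  have ki : 0 <= k.+1%:R^-1 :> R by rewrite invr_ge0.
  rewrite (ger0_norm (gauss_ge0 _ _)) (ger0_norm ai) (ger0_norm ki).
  apply: (@le_trans _ _ (gauss a k.+1%:R)).
    by rewrite ler_piMr ?gauss_ge0// sin_max.
  rewrite /gauss expRN -invfM lef_pV2 ?posrE ?expR_gt0 ?mulr_gt0//.
  apply: le_trans (expR_ge1Dx _); rewrite ler_wpDl// ler_wpM2l ?(ltW a0)//.
  by rewrite -natrX ler_nat; rewrite leq_pmulr.
exact: (cvg_unique _ c1 c2).
Qed.

(** Differentiation under the integral and [gauss_by_parts] give [F' = - x F / (2 a)], so
    [F x * exp (x^2 / (4 a))] is constant; at [x = 0] it is the Gaussian integral. *)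
Lemma gauss_cos a x : 0 < a ->
  \int[mu1]_y (gauss a y * cos (x * y)) =
  Num.sqrt (pi / a) * expR (- (x ^+ 2 / (4 * a))).
Proof.
move=> a0.
pose F x := \int[mu1]_y (gauss a y * cos (x * y)).
have dF (z : R) : is_derive z 1 F (- \int[mu1]_y (y * gauss a y * sin (z * y))).
  pose f (z y : R) := gauss a y * cos (z * y).
  have fd (w y : R) : is_derive w 1 (f ^~ y) (- (y * gauss a y * sin (w * y))).
    rewrite /f; apply: trigger_derive; rewrite /GRing.scale/=; ring.
  have fd1 (w y : R) : partial1of2 f w y = - (y * gauss a y * sin (w * y)).
    by rewrite partial1of2E; have [_ ->] := fd w y.
  have Iz : [set` `]z - 1, z + 1[] z by rewrite /= in_itv/=; apply/andP; split; lra.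
  have h1 (w : R) : [set` `]z - 1, z + 1[] w -> mu1.-integrable setT (EFin \o f w).
    by move=> _; apply: integrable_gaussM => //; [exact: measurable_cosM|move=> y; exact: cos_max].
  have h2 (w y : R) : [set` `]z - 1, z + 1[] w -> [set: R] y -> derivable (f ^~ y) w 1.
    by move=> _ _; have [] := fd w y.
  have h3 (y : R) : 0 <= `|y * gauss a y| by [].
  have h4 : mu1.-integrable setT (fun y => (`|y * gauss a y|)%:E).
    have := @integrable_xgaussM a (cst 1) a0 (measurable_cst _).
    move=> /(_ _)/integrable_abse h; apply: eq_integrable (h _) => //.
      by move=> y _ /=; rewrite mulr1.
    by move=> y; rewrite normr1.
  have h5 (w y : R) : [set` `]z - 1, z + 1[] w -> [set: R] y ->
      `|partial1of2 f w y| <= `|y * gauss a y|.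
    by move=> _ _; rewrite fd1 normrN normrM ler_piMr ?sin_max.
  have E := @differentiation_under_integral R _ _ mu1 f setT measurableT z _ _ Iz h1 h2 _ h3 h4 h5.
  have D := @derivable_under_integral R _ _ mu1 f setT measurableT z _ _ Iz h1 h2 _ h3 h4 h5.
  apply: DeriveDef; first exact: D.
  rewrite -derive1E E; under eq_Rintegral do rewrite fd1.
  rewrite -[RHS]mulN1r -RintegralZl//.
    by apply: eq_Rintegral => y _; rewrite mulN1r.
  by apply: integrable_xgaussM => //; [exact: measurable_sinM|move=> y; exact: sin_max].
pose G x := F x * expR (x ^+ 2 / (4 * a)).
have dG (z : R) : is_derive z 1 G 0.
  have De : is_derive z 1 (fun x : R => expR (x ^+ 2 / (4 * a)))
      (expR (z ^+ 2 / (4 * a)) * (z / (2 * a))).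
    by apply: trigger_derive; rewrite /GRing.scale/=; field; lra.
  apply: (is_derive_eq (is_deriveM (dF z) De)); rewrite /GRing.scale/=.
  have := gauss_by_parts z a0; rewrite -/(F z) => E.
  have -> : \int[mu1]_y (y * gauss a y * sin (z * y)) = z * F z / (2 * a).
    by rewrite E; field; lra.
  by field; lra.
have := @is_derive_0_is_cst R G x 0 dG.
rewrite /G expr0n/= mul0r expR0 mulr1 => H.
have -> : Num.sqrt (pi / a) = F 0.
  rewrite /F /Rintegral; under eq_integral do rewrite mul0r cos0 mulr1.
  by rewrite integral_gauss.
by rewrite -H -mulrA -expRD addrN expR0 mulr1.
Qed.

Lemma gauss_sin a x : 0 < a -> \int[mu1]_y (gauss a y * sin (x * y)) = 0.
Proof.
move=> a0.
have mg : measurable_fun setT (fun y => gauss a y * sin (x * y)).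
  by apply: measurable_funM; [exact: measurable_gauss|exact: measurable_sinM].
have ig : mu1.-integrable setT (fun y => (gauss a y * sin (x * y))%:E).
  by apply: integrable_gaussM => //; [exact: measurable_sinM|move=> y; exact: sin_max].
suff : \int[mu1]_y (gauss a y * sin (x * y)) = - \int[mu1]_y (gauss a y * sin (x * y)) by lra.
rewrite -[RHS]mulN1r -RintegralZl//.
have := ig; rewrite -/(comp EFin (fun y => gauss a y * sin (x * y))) => /integrableP[m _].
rewrite /Rintegral; congr fine.
rewrite [LHS]integralE [RHS]integralE; congr (_ - _)%E.
- rewrite -(leb1_reflect 0 (measurable_funepos m))//.
  apply: eq_integral => y _; rewrite !funeposE; congr maxe.
  by rewrite /= /gauss sub0r sqrrN mulrN sinN; congr EFin; ring.
- rewrite -(leb1_reflect 0 (measurable_funeneg m))//.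
  apply: eq_integral => y _; rewrite !funenegE; congr maxe.
  by rewrite /= /gauss sub0r sqrrN mulrN sinN; congr EFin; ring.
Qed.

End gaussian.

Section gaussian_n.
Context {R : realType}.
Local Notation mu1 := (@lebesgue_measure R).
Implicit Types a : R.

Definition gaussn n a (x : Rn R n) : R := expR (- (a * dotp x x)).

Lemma gaussn_ge0 n a (x : Rn R n) : 0 <= gaussn a x. Proof. exact: expR_ge0. Qed.

Lemma gaussn_le1 n a (x : Rn R n) : 0 <= a -> gaussn a x <= 1.
Proof. by move=> a0; rewrite -expR0 ler_expR oppr_le0 mulr_ge0 ?dotp_ge0. Qed.

Lemma gaussn_cons n a y (x : Rn R n) :
  gaussn a (cons_pt (y, x)) = gauss a y * gaussn a x.
Proof. by rewrite /gaussn /gauss dotp_cons -expRD; congr expR; rewrite expr2; ring. Qed.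

Lemma gaussn_prod n a (x : Rn R n) : gaussn a x = \prod_i gauss a (tnth x i).
Proof.
rewrite /gaussn /gauss -expR_sum; congr expR.
by rewrite sumrN /dotp mulr_sumr.
Qed.

Lemma measurable_sqnorm n : measurable_fun setT (fun x : Rn R n => dotp x x).
Proof.
rewrite /dotp; apply: measurable_sum => i.
by apply: measurable_funM; exact: measurable_tnth.
Qed.

Lemma measurable_gaussn n a : measurable_fun setT (@gaussn n a).
Proof.
apply: measurableT_comp => //; apply: measurableT_comp => //.
by apply: measurable_funM => //; exact: measurable_sqnorm.
Qed.

Lemma measurable_dotpr n (x : Rn R n) : measurable_fun setT (dotp x).
Proof. exact: (measurableT_comp (@measurable_dotp R n) (pair1_measurable x)). Qed.

Lemma measurable_cos_dotp n (x : Rn R n) : measurable_fun setT (fun y => cos (dotp x y)).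
Proof.
apply: (measurableT_comp (continuous_measurable_fun (@continuous_cos R))).
exact: measurable_dotpr.
Qed.

Lemma measurable_sin_dotp n (x : Rn R n) : measurable_fun setT (fun y => sin (dotp x y)).
Proof.
apply: (measurableT_comp (continuous_measurable_fun (@continuous_sin R))).
exact: measurable_dotpr.
Qed.

Lemma integral_gaussn n a : 0 < a ->
  (\int[leb R n]_x (gaussn a x)%:E = (Num.sqrt (pi / a) ^+ n)%:E)%E.
Proof.
move=> a0; under eq_integral do rewrite gaussn_prod.
rewrite (@leb_prod R n (fun=> gauss a) (fun=> Num.sqrt (pi / a)))//.
- by rewrite prodr_const card_ord.
- by move=> i; exact: measurable_gauss.
- by move=> i y; exact: gauss_ge0.
- by move=> i; exact: integral_gauss.
Qed.

Lemma integrable_gaussn n a : 0 < a -> (leb R n).-integrable setT (EFin \o @gaussn n a).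
Proof.
move=> a0; apply: ge0_integrable_lty.
- exact: measurable_gaussn.
- exact: gaussn_ge0.
- by rewrite integral_gaussn// ltry.
Qed.

Lemma integrable_gaussnM n a (f : Rn R n -> R) : 0 < a -> measurable_fun setT f ->
  (forall y, `|f y| <= 1) ->
  (leb R n).-integrable setT (EFin \o (fun y => gaussn a y * f y)).
Proof.
move=> a0 mf f1; apply: (@le_Rintegrable _ _ _ _ _ (gaussn a)).
- by apply: measurable_funM => //; exact: measurable_gaussn.
- by move=> y; rewrite normrM (ger0_norm (gaussn_ge0 _ _)) ler_piMr ?gaussn_ge0.
- exact: integrable_gaussn.
Qed.

(** The cosine and sine transforms go through the induction together, because the addition formulas
    mix them when a coordinate is split off. *)
Lemma gaussn_fourier n a (x : Rn R n) : 0 < a ->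
  (\int[leb R n]_y (gaussn a y * cos (dotp x y)) =
    Num.sqrt (pi / a) ^+ n * gaussn (4 * a)^-1 x) /\
  (\int[leb R n]_y (gaussn a y * sin (dotp x y)) = 0).
Proof.
move=> a0; elim: n x => [|n ih] x.
  rewrite /Rintegral !leb0_integral /gaussn /dotp !big_ord0 cos0 sin0 !mulr0 oppr0.
  by rewrite expR0 expr0 !mulr1.
have [x0 [x' ->]] : exists x0 x', x = cons_pt (x0, x').
  by exists (thead x), [tuple of behead x]; rewrite {1}(tuple_eta x).
have [ihc ihs] := ih x'.
have ic := integrable_gaussnM a0 (measurable_cos_dotp x') (fun=> cos_max _).
have is_ := integrable_gaussnM a0 (measurable_sin_dotp x') (fun=> sin_max _).
have ic1 := integrable_gaussM a0 (measurable_cosM x0) (fun=> cos_max _).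
have is1 := integrable_gaussM a0 (measurable_sinM x0) (fun=> sin_max _).
have Ec b : (fun y : Rn R n => gaussn a (cons_pt (b, y)) *
      cos (dotp (cons_pt (x0, x')) (cons_pt (b, y)))) =
    (fun y => gauss a b * cos (x0 * b) * (gaussn a y * cos (dotp x' y)) -
      gauss a b * sin (x0 * b) * (gaussn a y * sin (dotp x' y))).
  by apply/funext => y; rewrite gaussn_cons dotp_cons cosD; ring.
have Es b : (fun y : Rn R n => gaussn a (cons_pt (b, y)) *
      sin (dotp (cons_pt (x0, x')) (cons_pt (b, y)))) =
    (fun y => gauss a b * sin (x0 * b) * (gaussn a y * cos (dotp x' y)) +
      gauss a b * cos (x0 * b) * (gaussn a y * sin (dotp x' y))).
  by apply/funext => y; rewrite gaussn_cons dotp_cons sinD; ring.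
split.
- rewrite lebS_Rintegral; last 2 first.
  + by apply: integrable_gaussnM => //; [exact: measurable_cos_dotp|move=> ?; exact: cos_max].
  + move=> b; rewrite (Ec b).
    by apply: RintegrableB; exact: RintegrableZl.
  under eq_Rintegral => b _.
    rewrite (Ec b) RintegralB//; last 2 first.
    + exact: RintegrableZl.
    + exact: RintegrableZl.
    rewrite !RintegralZl// ihc ihs mulr0 subr0.
    over.
  rewrite RintegralZr// gauss_cos// [in RHS]exprS gaussn_cons /gauss.
  by rewrite [_ / (4 * a)]mulrC; ring.
- rewrite lebS_Rintegral; last 2 first.
  + by apply: integrable_gaussnM => //; [exact: measurable_sin_dotp|move=> ?; exact: sin_max].
  + move=> b; rewrite (Es b).
    by apply: RintegrableD; exact: RintegrableZl.
  under eq_Rintegral => b _.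
    rewrite (Es b) RintegralD//; last 2 first.
    + exact: RintegrableZl.
    + exact: RintegrableZl.
    rewrite !RintegralZl// ihc ihs mulr0 addr0.
    over.
  by rewrite RintegralZr// gauss_sin// mul0r.
Qed.

End gaussian_n.

(** * Powers as integrals of Levy-Khintchine type *)

Section levy.
Context {R : realType}.
Local Notation mu1 := (@lebesgue_measure R).
Implicit Types g l a : R.

(** Up to a constant factor, the Levy density of the stable subordinator of index [g]. *)
Definition levy g a : R := if 0 < a then a `^ (- (1 + g)) else 0.

Lemma levy_ge0 g a : 0 <= levy g a.
Proof. by rewrite /levy; case: ifP => // _; exact: powR_ge0. Qed.

Lemma measurable_levy g : measurable_fun setT (levy g).
Proof.
by apply: measurable_fun_ifT => //; exact: measurable_fun_ltr.
Qed.

(** The integrand, in [a], of the representation of the Bernstein function [l |-> l^g], up to a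
    constant factor. *)
Definition levyd g l a : R := (1 - expR (- (l * a))) * levy g a.

Lemma levyd_ge0 g l a : 0 <= l -> 0 <= levyd g l a.
Proof.
move=> l0; rewrite /levyd /levy; case: ifPn => a0; last by rewrite mulr0.
by rewrite mulr_ge0 ?powR_ge0// subr_ge0 -expR0 ler_expR oppr_le0 mulr_ge0// ltW.
Qed.

Lemma measurable_levyd g l : measurable_fun setT (levyd g l).
Proof.
apply: measurable_funM; last exact: measurable_levy.
apply: measurable_funB => //; apply: measurableT_comp => //.
by apply: measurableT_comp => //; exact: measurable_funM.
Qed.

Lemma levyd_scale g l a : 0 < l -> levyd g l a = l `^ (1 + g) * levyd g 1 (l * a).
Proof.
move=> l0; rewrite /levyd /levy mul1r pmulr_rgt0//.
case: ifPn => a0; last by rewrite !mulr0.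
rewrite powRM ?(ltW l0) ?(ltW a0)// !powRN.
by field; rewrite !(gt_eqF (powR_gt0 _ _)).
Qed.

(** The integrand is at most [a^(-g)] on []0, 1]], since [1 - exp (-a) <= a], and at most [a^(-1-g)]
    beyond 1. *)
Lemma integral_levyd1_lty g : 0 < g < 1 ->
  (\int[mu1]_a (levyd g 1 a)%:E < +oo)%E.
Proof.
move=> /andP[g0 g1].
pose h1 (x : R) := \1_(`]0, 1]%classic : set R) x * x `^ (- g).
pose h2 (x : R) := \1_(`[1, +oo[%classic : set R) x * x `^ (- (1 + g)).
have mh1 : measurable_fun setT h1.
  by apply: measurable_funM; [exact: measurable_indic|exact: measurable_powR].
have mh2 : measurable_fun setT h2.
  by apply: measurable_funM; [exact: measurable_indic|exact: measurable_powR].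
have h10 x : 0 <= h1 x by rewrite mulr_ge0 ?powR_ge0.
have h20 x : 0 <= h2 x by rewrite mulr_ge0 ?powR_ge0.
apply: (@le_lt_trans _ _ (\int[mu1]_a ((h1 a)%:E + (h2 a)%:E))%E).
  apply: ge0_le_integral => //.
  - by move=> a _; rewrite lee_fin levyd_ge0.
  - by apply/measurable_EFinP; exact: measurable_levyd.
  - by apply/measurable_EFinP; apply: measurable_funD; [exact: mh1|exact: mh2].
  move=> a _; rewrite -EFinD lee_fin /levyd /levy mul1r.
  case: ifPn => a0; last by rewrite mulr0 addr_ge0.
  have [a1|a1] := leP a 1.
    apply: ler_wpDr => //; rewrite /h1 indicE mem_setE in_itv/= a0 a1/= mul1r.
    have -> : a `^ (- (1 + g)) = a^-1 * a `^ (- g).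
      by rewrite !powRN (@powRD _ a 1 g) ?(gt_eqF a0) ?implybT// powRr1 ?(ltW a0)// invfM.
    rewrite mulrA ler_piMl ?powR_ge0// ler_pdivrMr// mul1r.
    by have := expR_ge1Dx (- a); lra.
  apply: ler_wpDl => //; rewrite /h2 indicE mem_setE in_itv/= (ltW a1)/= mul1r.
  by rewrite ler_piMl ?powR_ge0// gerBl expR_ge0.
rewrite ge0_integralD//; last 4 first.
- by move=> x _; rewrite lee_fin.
- by apply/measurable_EFinP; exact: mh1.
- by move=> x _; rewrite lee_fin.
- by apply/measurable_EFinP; exact: mh2.
rewrite lte_add_pinfty// -integral_mkcond_indic//.
  by apply: integral_powR_01; rewrite g0.
by apply: integral_powR_1y; lra.
Qed.

(** By [levyd_scale], a change of variable factors [l^g] out of the integral, and [C] is its value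
    at [l = 1]. Positivity of [C] allows division by it later. *)
Lemma integral_levyd g : 0 < g < 1 -> exists2 C, 0 < C &
  forall l, 0 <= l -> (\int[mu1]_a (levyd g l a)%:E = (C * l `^ g)%:E)%E.
Proof.
move=> g01; have /andP[g0 g1] := g01.
have [C HC] := @integrable_lty_ex _ _ _ (@lebesgue_measure R) (levyd g 1)
  (fun a => levyd_ge0 g a ler01) (integral_levyd1_lty g01).
have C0 : 0 <= C.
  by rewrite -lee_fin -HC; apply: integral_ge0 => a _; rewrite lee_fin levyd_ge0.
exists C.
  rewrite lt_neqAle C0 andbT; apply/eqP => C00.
  (* A lower bound of [levyd g 1] on [[1, 2]]. *)
  pose c := (1 - expR (- 1)) * 2 `^ (- (1 + g)) : R.
  have e1 : expR (- 1) < 1 :> R by rewrite -[ltRHS]expR0 ltr_expR; lra.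
  have c0 : 0 < c by rewrite mulr_gt0 ?powR_gt0// subr_gt0.
  have : (\int[mu1]_a (\1_(`[1, 2]%classic : set R) a * c)%:E <= 0)%E.
    rewrite -[leRHS]/(0%:E) C00 -HC; apply: ge0_le_integral => //.
    - by move=> a _; rewrite lee_fin mulr_ge0// ltW.
    - apply/measurable_EFinP; apply: (@measurable_funM _ (measurableTypeR R)) => //.
    - by apply/measurable_EFinP; exact: measurable_levyd.
    move=> a _; rewrite lee_fin indicE mem_setE in_itv/=.
    case: (boolP (1 <= a <= 2)) => [/andP[a1 a2]|_]; last by rewrite mul0r levyd_ge0.
    have a0 : 0 < a by lra.
    rewrite mul1r /c /levyd /levy mul1r a0 ler_pM ?powR_ge0 ?subr_ge0 ?(ltW e1)//.
      by rewrite lerD2l lerN2 ler_expR lerN2.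
    rewrite !powRN lef_pV2 ?posrE ?powR_gt0//.
    by rewrite ge0_ler_powR ?nnegrE//; lra.
  have m12 : measurable (`[1, 2]%classic : set (measurableTypeR R)) by exact: measurable_itv.
  rewrite -(@integral_mkcond_indic _ _ _ (@lebesgue_measure R) _ (fun=> c) m12).
  rewrite integral_cst//.
  have := lebesgue_measure_itv (`[1, 2] : interval R).
  rewrite /= lte_fin (_ : (1 < 2) = true); last by apply/idP; lra.
  move=> ->; rewrite -EFinB -EFinM lee_fin; lra.
move=> l; rewrite le_eqVlt => /predU1P[<-|l0].
  rewrite powR0 ?gt_eqF// mulr0 integral0_eq// => a _.
  by rewrite /levyd mul0r oppr0 expR0 subrr mul0r.
under eq_integral do rewrite levyd_scale// EFinM.
have lev0 : measurable_fun setT (fun a : measurableTypeR R => (levyd g 1 a)%:E).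
  by apply/measurable_EFinP; exact: measurable_levyd.
rewrite ge0_integralZl//; last 3 first.
- apply/measurable_EFinP; apply: (measurableT_comp (measurable_levyd _ _)).
  exact: measurable_funM.
- by move=> a _; rewrite lee_fin levyd_ge0.
- by rewrite lee_fin powR_ge0.
rewrite (@leb1_scale _ (fun a => (levyd g 1 a)%:E))//; last first.
  by move=> a; rewrite lee_fin levyd_ge0.
rewrite HC -!EFinM; congr EFin.
rewrite (@powRD _ l 1 g) ?(gt_eqF l0) ?implybT// powRr1 ?(ltW l0)//.
by field; rewrite gt_eqF.
Qed.

End levy.

(** * The symbol and the kernel it defines *)

Section kernel.
Context {R : realType} (n : nat) (beta : R).
Local Notation V := (Rn R n).
Local Notation mu := (leb R n).

Definition symb (t : R) (xi : V) : R := expR (- (t * enorm xi `^ beta)).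

Lemma symb_ge0 t xi : 0 <= symb t xi. Proof. exact: expR_ge0. Qed.

Lemma symb_norm t xi : `|symb t xi| = symb t xi.
Proof. by rewrite ger0_norm ?symb_ge0. Qed.

Lemma symb_le1 t xi : 0 <= t -> symb t xi <= 1.
Proof. by move=> t0; rewrite -expR0 ler_expR oppr_le0 mulr_ge0 ?powR_ge0. Qed.

Lemma symb_anti t1 t2 xi : t1 <= t2 -> symb t2 xi <= symb t1 xi.
Proof. by move=> t12; rewrite ler_expR lerN2 ler_wpM2r ?powR_ge0. Qed.

Lemma symbD t1 t2 xi : symb (t1 + t2) xi = symb t1 xi * symb t2 xi.
Proof. by rewrite /symb -expRD mulrDl opprD. Qed.

Lemma measurable_symb2 : measurable_fun setT (fun z : R * V => symb z.1 z.2).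
Proof.
apply: measurableT_comp => //; apply: measurableT_comp => //.
apply: measurable_funM => //.
apply: (measurableT_comp (measurable_powR _)).
exact: (measurableT_comp (@measurable_enorm R n)).
Qed.

Lemma measurable_symb t : measurable_fun setT (symb t).
Proof. exact: (measurableT_comp measurable_symb2 (pair1_measurable t)). Qed.

Lemma continuous_symb xi : continuous (symb ^~ xi).
Proof.
move=> t; apply: differentiable_continuous; apply/derivable1_diffP.
by rewrite /symb; apply: ex_derive.
Qed.

(** From [exp (- y) <= (k+1)! / y^(k+1)] with [y = t |xi|^beta]. The index [k] satisfies
    [(k+1) beta >= n + 1], so the symbol decays like [|xi|^(-(n+1))], which is integrable at
    infinity. *)
Lemma integrable_symb t : (0 < n)%N -> 0 < beta -> 0 < t ->
  mu.-integrable setT (EFin \o symb t).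
Proof.
move=> n0 beta0 t0; pose m := n.+1; pose k := Num.truncn (m%:R / beta).
have kb : m%:R <= k.+1%:R * beta.
  rewrite -ler_pdivrMr//; apply: ltW.
  by have /andP[_] := truncn_itv (divr_ge0 (ler0n R m) (ltW beta0)).
pose D := k.+1`!%:R / t ^+ k.+1.
have D0 : 0 <= D by rewrite divr_ge0// exprn_ge0// ltW.
have H xi : symb t xi <= 2 ^+ m * (1 + D) * (1 + enorm xi) `^ (- m%:R).
  have r0 := enorm_ge0 xi; rewrite /symb; set r := enorm xi in r0 *.
  have r1 : 0 < 1 + r by lra.
  rewrite powRN powR_mulrn ?(ltW r1)// ler_pdivlMr ?exprn_gt0//.
  have [r_1|r_1] := leP r 1.
    apply: (@le_trans _ _ (2 ^+ m)); last by rewrite ler_peMr ?exprn_ge0// lerDl.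
    rewrite -[leRHS]mul1r ler_pM ?expR_ge0 ?exprn_ge0 ?(ltW r1)//.
      by rewrite -expR0 ler_expR oppr_le0 mulr_ge0 ?powR_ge0// ltW.
    by rewrite lerXn2r ?nnegrE ?(ltW r1)//; lra.
  apply: (@le_trans _ _ (2 ^+ m * D)); last first.
    by rewrite ler_wpM2l ?exprn_ge0// lerDr.
  set y := t * r `^ beta.
  have y0 : 0 < y by rewrite mulr_gt0// powR_gt0; lra.
  have rm : r ^+ m <= y ^+ k.+1 / t ^+ k.+1.
    rewrite -expr_div_n /y mulrAC divff ?gt_eqF// mul1r -powR_mulrn ?powR_ge0//.
    rewrite -(powR_mulrn k.+1 (powR_ge0 r beta)) -powRrM.
    by rewrite ler_powR ?(ltW r_1)// mulrC.
  have rm2 : (1 + r) ^+ m <= 2 ^+ m * r ^+ m.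
    by rewrite -exprMn lerXn2r ?nnegrE; lra.
  have ey : expR (- y) * y ^+ k.+1 <= k.+1`!%:R.
    rewrite expRN mulrC ler_pdivrMr ?expR_gt0//.
    have := expR_ge1Dxn k (ltW y0) => h.
    have f0 : (0 : R) < k.+1`!%:R by rewrite ltr0n fact_gt0.
    rewrite mulrC -ler_pdivrMr//; lra.
  apply: (@le_trans _ _ (expR (- y) * (2 ^+ m * (y ^+ k.+1 / t ^+ k.+1)))).
    rewrite ler_wpM2l ?expR_ge0// (le_trans rm2)// ler_wpM2l ?exprn_ge0//.
  rewrite mulrCA ler_wpM2l ?exprn_ge0// mulrA /D ler_wpM2r//.
  by rewrite invr_ge0 exprn_ge0// ltW.
apply: (@le_Rintegrable _ _ _ _ _ (fun xi => 2 ^+ m * (1 + D) * (1 + enorm xi) `^ (- m%:R))).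
- exact: measurable_symb.
- by move=> x; rewrite symb_norm; exact: H.
- apply: RintegrableZl; apply: ge0_integrable_lty.
  + apply: (measurableT_comp (measurable_powR _)).
    by apply: measurable_funD => //; exact: measurable_enorm.
  + by move=> x; exact: powR_ge0.
  + by apply: enorm_far_lty => //; rewrite ltr_nat.
Qed.

Lemma integrable_symbM t (f : V -> R) : (0 < n)%N -> 0 < beta -> 0 < t ->
  measurable_fun setT f -> (forall y, `|f y| <= 1) ->
  mu.-integrable setT (EFin \o (fun y => symb t y * f y)).
Proof.
move=> n0 beta0 t0 mf f1; apply: (@le_Rintegrable _ _ _ _ _ (symb t)).
- by apply: measurable_funM => //; exact: measurable_symb.
- by move=> y; rewrite normrM symb_norm ler_piMr ?symb_ge0.
- exact: integrable_symb.
Qed.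

Lemma stable_kernelE (x : V) t : stable_kernel beta x t =
  (2 * pi) ^- n * \int[mu]_xi (symb t xi * cos (dotp x xi)).
Proof.
by rewrite /stable_kernel /Cintegral /cexp /= mul0r subr0.
Qed.

Lemma measurable_kernel2 :
  measurable_fun setT (fun z : V * R => stable_kernel beta z.1 z.2).
Proof.
under eq_fun do rewrite stable_kernelE.
apply: measurable_funM => //.
apply: (@measurable_fine_integral _ _ (V * R)%type V R mu
  (fun z xi => symb z.2 xi * cos (dotp z.1 xi))).
have m1 : measurable_fun setT (fun z : V * R * V => z.1.1) by apply: measurableT_comp.
have m2 : measurable_fun setT (fun z : V * R * V => z.1.2) by apply: measurableT_comp.
apply: measurable_funM.
- exact: (measurableT_comp measurable_symb2 (measurable_fun_pair m2 measurable_snd)).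
- apply: (measurableT_comp (continuous_measurable_fun (@continuous_cos R))).
  exact: (measurableT_comp (@measurable_dotp R n) (measurable_fun_pair m1 measurable_snd)).
Qed.

Lemma measurable_kernel t : measurable_fun setT (fun x : V => stable_kernel beta x t).
Proof. exact: (measurableT_comp measurable_kernel2 (pair2_measurable t)). Qed.

Lemma dotp_subpC (x y z : V) : dotp (subp x y) z = - dotp (subp y x) z.
Proof. by rewrite !dotp_subpl opprB. Qed.

Lemma kernel_subpC (x y : V) t :
  stable_kernel beta (subp x y) t = stable_kernel beta (subp y x) t.
Proof.
rewrite !stable_kernelE; congr (_ * _); apply: eq_Rintegral => xi _.
by rewrite dotp_subpC cosN.
Qed.

Lemma kernel_cvg_time (x : V) (t0 : R) : (0 < n)%N -> 0 < beta -> 0 < t0 ->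
  stable_kernel beta x t @[t --> within [set t | 0 < t] (nbhs t0)] -->
  stable_kernel beta x t0.
Proof.
move=> n0 beta0 t00; have t02 : 0 < t0 / 2 by rewrite divr_gt0.
under eq_fun do rewrite stable_kernelE.
rewrite stable_kernelE; apply: cvgMr.
(* Near [t0] only times above [t0 / 2] matter, and for these the symbol at [t0 / 2] is a
   majorant. *)
have -> : within [set t | 0 < t] (nbhs t0) = within [set t | t0 / 2 < t] (nbhs t0).
  apply/seteqP; split => A; rewrite /within /= => H.
    by apply: filterS H => t H1 /= H2; apply: H1 => /=; lra.
  have h : \forall t \near t0, t0 / 2 < t by apply: lt_nbhsr; lra.
  by apply: filterS2 H h => t H1 H2 _; exact: H1.
apply: (@dominated_Rintegral_at _ _ _ _ (fun t xi => symb t xi * cos (dotp x xi)) (symb (t0 / 2))).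
- move=> t _; apply: measurable_funM; first exact: measurable_symb.
  exact: measurable_cos_dotp.
- by rewrite /=; lra.
- move=> xi; apply: cvg_within_filter; apply: cvgMl; exact: continuous_symb.
- exact: integrable_symb.
- move=> t xi /ltW t0t; rewrite normrM symb_norm.
  rewrite (le_trans _ (symb_anti xi t0t))// ler_piMr ?symb_ge0// cos_max//.
Unshelve. all: by end_near. Qed.

Lemma kernel_bound (x : V) t : (0 < n)%N -> 0 < beta -> 0 < t ->
  `|stable_kernel beta x t| <= (2 * pi) ^- n * \int[mu]_xi symb t xi.
Proof.
move=> n0 beta0 t0; rewrite stable_kernelE normrM ger0_norm; last first.
  by rewrite invr_ge0 exprn_ge0// mulr_ge0// pi_ge0.
rewrite ler_wpM2l ?invr_ge0 ?exprn_ge0 ?mulr_ge0 ?pi_ge0//.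
have isym := integrable_symbM n0 beta0 t0 (measurable_cos_dotp x) (fun=> cos_max _).
rewrite (le_trans (le_normr_Rintegral _ _))//.
apply: le_Rintegral => //.
- exact: (integrable_norm isym).
- exact: integrable_symb.
- by move=> xi _; rewrite /= normrM symb_norm ler_piMr ?symb_ge0 ?cos_max.
Qed.

End kernel.

Lemma cvgn_le_bound (R : realType) (u : nat -> R) (l A : R) :
  u k @[k --> \oo] --> l -> (forall k, u k <= A) -> l <= A.
Proof.
move=> ul uA; rewrite -(cvg_lim _ ul)//; apply: limr_le; last exact: nearW.
by apply/cvg_ex; exists l.
Qed.

Lemma cvgn_ge_bound (R : realType) (u : nat -> R) (l A : R) :
  u k @[k --> \oo] --> l -> (forall k, A <= u k) -> A <= l.
Proof.
move=> ul uA; rewrite -(cvg_lim _ ul)//; apply: limr_ge; last exact: nearW.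
by apply/cvg_ex; exists l.
Qed.

(** * Nonnegativity of the kernel *)

Section positive_definite.
Context {R : realType} (n : nat).
Local Notation V := (Rn R n).
Local Notation mu := (leb R n).
Local Notation mu1 := (@lebesgue_measure R).
Implicit Types (f : R -> R) (w : R -> R).

(* [f (|xi|^2)] is of positive type, as tested against Gaussians. The functions
   [l |-> expR (- (t * l `^ g))] are reached from 1 by sums, limits and
   multiplication by Laplace transforms. *)
Definition postype (f : R -> R) := [/\ measurable_fun setT (fun xi : V => f (dotp xi xi)),
  exists A, forall l, 0 <= l -> `|f l| <= A &
  forall d (x : V), 0 < d ->
    0 <= \int[mu]_xi (gaussn d xi * (f (dotp xi xi) * cos (dotp x xi)))].

Lemma integrable_gaussnf f d (x : V) (A : R) : 0 < d ->
  measurable_fun setT (fun xi : V => f (dotp xi xi)) ->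
  (forall l, 0 <= l -> `|f l| <= A) ->
  mu.-integrable setT (EFin \o (fun xi => gaussn d xi * (f (dotp xi xi) * cos (dotp x xi)))).
Proof.
move=> d0 mf fA.
apply: (@le_Rintegrable _ _ _ _ _ (fun xi => A * gaussn d xi)).
- apply: measurable_funM; first exact: measurable_gaussn.
  by apply: measurable_funM => //; exact: measurable_cos_dotp.
- move=> xi; rewrite !normrM (ger0_norm (gaussn_ge0 _ _)) mulrC ler_wpM2r ?gaussn_ge0//.
  rewrite -[leRHS]mulr1 ler_pM// ?cos_max//; exact: fA (dotp_ge0 _).
- by apply: RintegrableZl; exact: integrable_gaussn.
Qed.

Lemma postype1 : postype (fun=> 1).
Proof.
split.
- exact: measurable_cst.
- by exists 1 => l _; rewrite normr1.
move=> d x d0; under eq_Rintegral do rewrite mul1r.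
by have [-> _] := gaussn_fourier x d0; rewrite mulr_ge0 ?exprn_ge0 ?gaussn_ge0.
Qed.

Lemma postypeD f g : postype f -> postype g -> postype (fun l => f l + g l).
Proof.
move=> [mf [A fA] pf] [mg [B gB] pg]; split.
- exact: measurable_funD.
- by exists (A + B) => l l0; rewrite (le_trans (ler_normD _ _))// lerD ?fA ?gB.
move=> d x d0; under eq_Rintegral do rewrite mulrDl mulrDr.
rewrite RintegralD//; [|exact: integrable_gaussnf d0 mf fA|exact: integrable_gaussnf d0 mg gB].
by rewrite addr_ge0 ?pf ?pg.
Qed.

Lemma postypeZ c f : 0 <= c -> postype f -> postype (fun l => c * f l).
Proof.
move=> c0 [mf [A fA] pf]; split.
- exact: measurable_funM.
- by exists (c * A) => l l0; rewrite normrM ger0_norm// ler_wpM2l ?fA.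
move=> d x d0; under eq_Rintegral do rewrite -mulrA mulrCA.
by rewrite RintegralZl ?mulr_ge0 ?pf//; exact: integrable_gaussnf d0 mf fA.
Qed.

Lemma postype_lim (f_ : nat -> R -> R) f (A : R) : (forall k, postype (f_ k)) ->
  (forall k l, 0 <= l -> `|f_ k l| <= A) ->
  (forall l, 0 <= l -> f_ k l @[k --> \oo] --> f l) -> postype f.
Proof.
move=> pf fA cf.
have mf : measurable_fun setT (fun xi : V => f (dotp xi xi)).
  apply: (measurable_fun_cvg (h := fun k (xi : V) => f_ k (dotp xi xi))).
    by move=> k; case: (pf k).
  by move=> xi _; apply: cf; exact: dotp_ge0.
split => //.
- by exists A => l l0; apply: (cvgn_le_bound (cvg_norm (cf l l0))) => k; exact: fA.
move=> d x d0.
have [] := @dominated_Rintegral _ _ _ mu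
  (fun k xi => gaussn d xi * (f_ k (dotp xi xi) * cos (dotp x xi)))
  (fun xi => gaussn d xi * (f (dotp xi xi) * cos (dotp x xi)))
  (fun xi => A * gaussn d xi).
- move=> k; apply: measurable_funM; first exact: measurable_gaussn.
  by apply: measurable_funM; [case: (pf k)|exact: measurable_cos_dotp].
- by move=> xi; apply: cvgMr; apply: cvgMl; apply: cf; exact: dotp_ge0.
- by apply: RintegrableZl; exact: integrable_gaussn.
- move=> k xi; rewrite !normrM (ger0_norm (gaussn_ge0 _ _)) mulrC ler_wpM2r ?gaussn_ge0//.
  rewrite -[leRHS]mulr1 ler_pM// ?cos_max//; exact: fA (dotp_ge0 _).
move=> _ cI; apply: (cvgn_ge_bound cI) => k.
by have [_ _ /(_ d x d0)] := pf k.
Qed.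

Definition laplace w (l : R) : R := \int[mu1]_a (expR (- (l * a)) * w a).

(** Densities of finite measures on [a > 0]; their Laplace transforms, taken at [|xi|^2], are
    mixtures of Gaussians. *)
Definition weight w := [/\ measurable_fun setT w, forall a, 0 <= w a,
  forall a, a <= 0 -> w a = 0 & mu1.-integrable setT (EFin \o w)].

Lemma weight_exp w l a : weight w -> 0 <= l ->
  0 <= expR (- (l * a)) * w a <= w a.
Proof.
move=> [mw w0 wneg iw] l0; rewrite mulr_ge0 ?expR_ge0//=.
have [a0|a0] := leP a 0; first by rewrite wneg// mulr0.
by rewrite ler_piMl// -expR0 ler_expR oppr_le0 mulr_ge0// ltW.
Qed.

Lemma measurable_weight_exp w : measurable_fun setT w ->
  measurable_fun setT (fun z : V * measurableTypeR R =>
    expR (- (dotp z.1 z.1 * z.2)) * w z.2).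
Proof.
move=> mw; apply: measurable_funM; last exact: (measurableT_comp mw measurable_snd).
apply: measurableT_comp => //; apply: measurableT_comp => //.
apply: measurable_funM; last exact: measurable_snd.
exact: (measurableT_comp (@measurable_sqnorm R n) measurable_fst).
Qed.

Lemma integrable_laplace w l : weight w -> 0 <= l ->
  mu1.-integrable setT (EFin \o (fun a => expR (- (l * a)) * w a)).
Proof.
move=> hw l0; have [mw w0 wneg iw] := hw.
apply: (@le_Rintegrable _ (measurableTypeR R) R mu1 _ w) => //.
- apply: measurable_funM => //; apply: measurableT_comp => //.
  by apply: measurableT_comp => //; exact: measurable_funM.
- by move=> a; have /andP[h1 h2] := weight_exp a hw l0; rewrite ger0_norm.
Qed.

Lemma laplace_itv w l : weight w -> 0 <= l ->
  0 <= laplace w l <= \int[mu1]_a w a.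
Proof.
move=> hw l0; have [mw w0 wneg iw] := hw.
rewrite /laplace Rintegral_ge0; last first.
  by move=> a _; rewrite mulr_ge0 ?expR_ge0.
apply: le_Rintegral => //; first exact: integrable_laplace.
by move=> a _; have /andP[] := weight_exp a hw l0.
Qed.

Lemma measurable_laplace w : measurable_fun setT w ->
  measurable_fun setT (fun xi : V => laplace w (dotp xi xi)).
Proof.
move=> mw; apply: (@measurable_fine_integral _ _ V (measurableTypeR R) R mu1
  (fun xi a => expR (- (dotp xi xi * a)) * w a)).
exact: measurable_weight_exp.
Qed.

(** After Fubini, for each [a] the factor [exp (- a |xi|^2)] merges with the test Gaussian, whose
    parameter [d] becomes [d + a]; positivity of [f] applies and is integrated against [w]. *)
Lemma postype_laplace w f : weight w -> postype f -> postype (fun l => f l * laplace w l).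
Proof.
move=> hw [mf [A fA] pf]; have [mw w0 wneg iw] := hw.
have A0 : 0 <= A by rewrite (le_trans _ (fA 0 (lexx _))).
split.
- by apply: measurable_funM => //; exact: measurable_laplace.
- exists (A * \int[mu1]_a w a) => l l0.
  have /andP[h1 h2] := laplace_itv hw l0.
  by rewrite normrM (ger0_norm h1) ler_pM ?fA.
move=> d x d0.
pose F (xi : V) (a : measurableTypeR R) :=
  gaussn d xi * (f (dotp xi xi) * cos (dotp x xi)) * (expR (- (dotp xi xi * a)) * w a).
pose G (xi : V) (a : measurableTypeR R) := A * gaussn d xi * w a.
have FG xi a : `|F xi a| <= G xi a.
  rewrite /F /G normrM; apply: ler_pM => //.
    rewrite !normrM (ger0_norm (gaussn_ge0 _ _)) mulrC ler_wpM2r ?gaussn_ge0//.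
    rewrite -[leRHS]mulr1 ler_pM// ?cos_max//; exact: fA (dotp_ge0 _).
  by have /andP[h1 h2] := weight_exp a hw (dotp_ge0 xi); rewrite ger0_norm.
have mF : measurable_fun setT (fun z : V * measurableTypeR R => F z.1 z.2).
  apply: measurable_funM; last exact: measurable_weight_exp.
  have m1 : measurable_fun setT (fun xi : V => gaussn d xi * (f (dotp xi xi) * cos (dotp x xi))).
    apply: measurable_funM; first exact: measurable_gaussn.
    by apply: measurable_funM => //; exact: measurable_cos_dotp.
  exact: (measurableT_comp m1 measurable_fst).
have mG : measurable_fun setT (fun z : V * measurableTypeR R => G z.1 z.2).
  apply: measurable_funM; last exact: (measurableT_comp mw measurable_snd).
  apply: measurable_funM => //.
  exact: (measurableT_comp (@measurable_gaussn R n d) measurable_fst).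
have E : \int[mu]_xi (gaussn d xi * (f (dotp xi xi) * laplace w (dotp xi xi) * cos (dotp x xi))) =
    \int[mu]_xi \int[mu1]_a F xi a.
  apply: eq_Rintegral => xi _; rewrite /F RintegralZl//; last first.
    by apply: integrable_laplace => //; exact: dotp_ge0.
  by rewrite -/(laplace _ _); ring.
have iG1 xi : mu1.-integrable setT (EFin \o G xi) by exact: RintegrableZl.
have iG2 a : mu.-integrable setT (EFin \o G^~ a).
  rewrite /G (_ : (fun _ => _) = (fun xi => (A * w a) * gaussn d xi)); last first.
    by apply/funext => xi; ring.
  by apply: RintegrableZl; exact: integrable_gaussn.
rewrite E (@RFubini _ _ _ _ _ mu (@lebesgue_measure R) F G
  (A * (\int[mu1]_a w a) * Num.sqrt (pi / d) ^+ n))//; last 3 first.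
- under eq_integral => xi _.
    rewrite -(RintegralK (iG1 xi)) /G RintegralZl// mulrAC EFinM.
    over.
  rewrite ge0_integralZl//; last 3 first.
  + by apply/measurable_EFinP; exact: measurable_gaussn.
  + by move=> xi _; rewrite lee_fin gaussn_ge0.
  + by rewrite lee_fin mulr_ge0// Rintegral_ge0.
  by rewrite integral_gaussn// -EFinM.
- move=> xi; apply: (le_Rintegrable _ (FG xi)) => //.
  exact: (measurable_section1 xi mF).
- move=> a; apply: (le_Rintegrable _ (FG^~ a)) => //.
  exact: (measurable_section2 a mF).
apply: Rintegral_ge0 => a _.
have [a0|a0] := leP a 0.
  by apply: Rintegral_ge0 => xi _; rewrite /F wneg// !mulr0.
have E2 xi : F xi a = w a * (gaussn (d + a) xi * (f (dotp xi xi) * cos (dotp x xi))).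
  rewrite /F /gaussn mulrDl opprD expRD [a * _]mulrC; ring.
under eq_Rintegral do rewrite E2.
have da : 0 < d + a by rewrite addr_gt0.
by rewrite RintegralZl ?mulr_ge0 ?pf//; exact: integrable_gaussnf da mf fA.
Qed.

Lemma postype_expX w (k : nat) : weight w -> postype (fun l => laplace w l ^+ k).
Proof.
move=> hw; elim: k => [|k ih].
  by rewrite (_ : (fun _ => _) = fun=> 1); [exact: postype1|apply/funext => l; rewrite expr0].
rewrite (_ : (fun _ => _) = fun l => laplace w l ^+ k * laplace w l); last first.
  by apply/funext => l; rewrite exprSr.
exact: postype_laplace.
Qed.

(** The partial sums of the exponential series combine powers of [laplace w] with nonnegative
    coefficients, and on [l >= 0] they are bounded by the exponential of [t] times the mass of
    [w]. *)
Lemma postype_exp_laplace w t : weight w -> 0 <= t ->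
  postype (fun l => expR (t * laplace w l)).
Proof.
move=> hw t0.
pose S N (l : R) := series (exp_coeff (t * laplace w l)) N.
apply: (@postype_lim S _ (expR (t * \int[mu1]_a w a))).
- elim => [|N ih].
    rewrite (_ : S 0%N = fun l => 0 * 1); first exact: postypeZ (lexx _) postype1.
    by apply/funext => l; rewrite mul0r /S /series/= big_geq.
  rewrite (_ : S N.+1 = fun l => S N l + t ^+ N / N`!%:R * laplace w l ^+ N).
    apply: postypeD => //; apply: postypeZ; last exact: postype_expX.
    by rewrite divr_ge0 ?exprn_ge0.
  apply/funext => l; rewrite /S /series/= big_nat_recr//=; congr (_ + _).
  by rewrite /exp_coeff/= exprMn mulrAC.
- move=> N l l0; have /andP[h1 h2] := laplace_itv hw l0.
  have tl0 : 0 <= t * laplace w l by rewrite mulr_ge0.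
  rewrite ger0_norm; last by rewrite /S sumr_ge0// => i _; rewrite divr_ge0 ?exprn_ge0.
  apply: (@le_trans _ _ (expR (t * laplace w l))); last first.
    by rewrite ler_expR ler_wpM2l.
  apply: (nondecreasing_cvgn_le _ (is_cvg_series_exp_coeff _)).
  by apply/nondecreasing_seqP => i; rewrite /series/= big_nat_recr//= lerDl divr_ge0 ?exprn_ge0.
- by move=> l l0; exact: is_cvg_series_exp_coeff.
Qed.

(** Compound Poisson approximation: cutting the Levy density below [1/(k+1)] leaves a finite weight
    [w k], and subtracting its mass from its Laplace transform gives an exponent that tends to a
    multiple of [- l^g]. *)
Lemma postype_exp_pow g t : 0 < g < 1 -> 0 <= t ->
  postype (fun l => expR (- (t * l `^ g))).
Proof.
move=> g01 t0; have [C C0 HC] := integral_levyd g01.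
pose w (k : nat) (a : R) : R := if k.+1%:R^-1 < a then levy g a else 0.
have mw k : measurable_fun setT (w k).
  by apply: measurable_fun_ifT => //; [exact: measurable_fun_ltr|exact: measurable_levy].
have w0 k a : 0 <= w k a by rewrite /w; case: ifP => // _; exact: levy_ge0.
have ild l : 0 <= l -> mu1.-integrable setT (EFin \o levyd g l).
  move=> l0; apply: (@ge0_integrable_lty _ (measurableTypeR R)).
  - exact: measurable_levyd.
  - by move=> a; exact: levyd_ge0.
  - by rewrite HC// ltry.
have hw k : weight (w k).
  split => //.
  - move=> a a0; rewrite /w ifF//; apply/negbTE; rewrite -leNgt (le_trans a0)//.
  - have e1 : expR (- k.+1%:R^-1) < 1 :> R by rewrite -[ltRHS]expR0 ltr_expR oppr_lt0 invr_gt0.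
    have e2 : 0 < 1 - expR (- k.+1%:R^-1) :> R by rewrite subr_gt0.
    (* On [a > 1/(k+1)] the factor [1 - exp (- a)] of [levyd g 1] is bounded below, so [levyd g 1]
       controls the truncated density. *)
    apply: (@le_Rintegrable _ (measurableTypeR R) R mu1 _
      (fun a => (1 - expR (- k.+1%:R^-1))^-1 * levyd g 1 a)).
    + exact: mw.
    + move=> a; rewrite ger0_norm// /w; case: ifPn => ka; last first.
        by rewrite mulr_ge0 ?levyd_ge0// invr_ge0 ltW.
      rewrite mulrC ler_pdivlMr// mulrC /levyd mul1r ler_wpM2r ?levy_ge0//.
      by rewrite lerD2l lerN2 ler_expR lerN2 ltW.
    + by apply: RintegrableZl; exact: ild.
have E k l : 0 <= l -> \int[mu1]_a w k a - laplace (w k) l =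
    \int[mu1]_a (if k.+1%:R^-1 < a then levyd g l a else 0).
  move=> l0; rewrite /laplace -RintegralB//; last 2 first.
  - by case: (hw k).
  - exact: integrable_laplace.
  apply: eq_Rintegral => a _; rewrite /w /levyd; case: ifP => _; ring.
(* Cancels the constant of [integral_levyd]. *)
pose t' := t / C.
have t'0 : 0 <= t' by rewrite divr_ge0// ltW.
apply: (@postype_lim (fun k l => expR (- (t' * \int[mu1]_a w k a)) * expR (t' * laplace (w k) l)) _ 1).
- by move=> k; apply: postypeZ (expR_ge0 _) _; exact: postype_exp_laplace.
- move=> k l l0; rewrite -expRD ger0_norm ?expR_ge0// -expR0 ler_expR.
  have /andP[_ h] := laplace_itv (hw k) l0.
  by rewrite addrC subr_le0 ler_wpM2l.
move=> l l0.
have -> : (fun k => expR (- (t' * \int[mu1]_a w k a)) * expR (t' * laplace (w k) l)) =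
    (fun k => expR (- (t' * \int[mu1]_a (if k.+1%:R^-1 < a then levyd g l a else 0)))).
  by apply/funext => k; rewrite -expRD -E//; congr expR; ring.
have -> : t * l `^ g = t' * (C * l `^ g) by rewrite /t'; field; rewrite gt_eqF.
apply: continuous_cvg; first exact: continuous_expR.
apply: cvgN; apply: cvgMr.
have [] := @dominated_Rintegral _ (measurableTypeR R) R mu1
  (fun k a => if k.+1%:R^-1 < a then levyd g l a else 0) (levyd g l) (levyd g l).
- move=> k; apply: measurable_fun_ifT => //; first exact: measurable_fun_ltr.
  exact: measurable_levyd.
- move=> a; have [a0|a0] := leP a 0.
    rewrite /levyd /levy ltNge a0/= mulr0.
    by under eq_fun do rewrite if_same; exact: cvg_cst.
  apply: cvg_near_cst; near=> k; rewrite ifT//.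
  near: k; exact: (near_infty_natSinv_lt (PosNum a0)).
- exact: ild.
- by move=> k a; case: ifP => _; rewrite ?normr0 ?ger0_norm// levyd_ge0.
move=> _; rewrite [X in _ --> X -> _](_ : _ = C * l `^ g)//.
by rewrite /Rintegral HC.
Unshelve. all: by end_near. Qed.

End positive_definite.

(** For [beta = 2] the symbol is itself a Gaussian. For [beta < 2], [postype_exp_pow] applies with
    [g = beta / 2], and the test Gaussians of parameter [1/(k+1)] are removed by dominated
    convergence. *)
Lemma kernel_ge0 (R : realType) (n : nat) (beta : R) (x : Rn R n) (t : R) :
  (0 < n)%N -> 0 < beta <= 2 -> 0 < t -> 0 <= stable_kernel beta x t.
Proof.
move=> n0 /andP[b0 b2] t0; rewrite stable_kernelE.
rewrite mulr_ge0 ?invr_ge0 ?exprn_ge0 ?mulr_ge0 ?pi_ge0//.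
have eb (xi : Rn R n) : enorm xi `^ beta = dotp xi xi `^ (beta / 2).
  by rewrite /enorm -powR12_sqrt ?dotp_ge0// -powRrM mulrC.
move: b2; rewrite le_eqVlt => /predU1P[b2|b2].
  have E (xi : Rn R n) : symb beta t xi = gaussn t xi.
    by rewrite /symb eb b2 divff// powRr1 ?dotp_ge0.
  under eq_Rintegral do rewrite E.
  by have [-> _] := gaussn_fourier x t0; rewrite mulr_ge0 ?exprn_ge0 ?gaussn_ge0.
have g01 : 0 < beta / 2 < 1 by apply/andP; split; lra.
have [_ _ pos] := @postype_exp_pow R n _ t g01 (ltW t0).
have [] := @dominated_Rintegral _ _ _ (leb R n)
  (fun k xi => gaussn k.+1%:R^-1 xi * (symb beta t xi * cos (dotp x xi)))
  (fun xi => symb beta t xi * cos (dotp x xi)) (symb beta t).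
- move=> k; apply: measurable_funM; first exact: measurable_gaussn.
  by apply: measurable_funM; [exact: measurable_symb|exact: measurable_cos_dotp].
- move=> xi; rewrite -[X in _ --> X]mul1r; apply: cvgMl.
  rewrite -[X in _ --> X]expR0; apply: continuous_cvg; first exact: continuous_expR.
  rewrite -[X in _ --> X]oppr0; apply: cvgN; rewrite -[X in _ --> X](mul0r (dotp xi xi)).
  by apply: cvgMl; exact: cvg_harmonic.
- exact: integrable_symb.
- move=> k xi; have k0 : 0 <= k.+1%:R^-1 :> R by rewrite invr_ge0.
  move: (gaussn_ge0 k.+1%:R^-1 xi) (gaussn_le1 xi k0) (symb_ge0 beta t xi) (cos_max (dotp x xi)).
  move: (gaussn _ _) (symb _ _ _) (cos _) => G S c G0 G1 S0 c1.
  rewrite !normrM (ger0_norm G0) (ger0_norm S0) mulrCA -[leRHS]mulr1 ler_wpM2l//.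
  by rewrite -[leRHS]mulr1 ler_pM.
move=> _ cI; apply: (cvgn_ge_bound cI) => k.
have k0 : 0 < k.+1%:R^-1 :> R by rewrite invr_gt0.
apply: le_trans (pos _ x k0) _; rewrite le_eqVlt; apply/orP; left; apply/eqP.
by apply: eq_Rintegral => xi _; rewrite {1}/symb eb.
Qed.

(** * Fourier inversion against Gaussians *)

Section symb_continuity.
Context {R : realType}.

Lemma continuous_norm_powR (b : R) : 0 < b -> continuous (fun r : R => `|r| `^ b).
Proof.
move=> b0 r; have [->|r0] := eqVneq r 0.
  apply/cvgrPdist_lt => e e0.
  exists (e `^ b^-1) => /=; first by rewrite powR_gt0.
  move=> s /=; rewrite sub0r normrN => se.
  rewrite normr0 powR0 ?gt_eqF// sub0r normrN ger0_norm ?powR_ge0//.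
  have -> : e = (e `^ b^-1) `^ b by rewrite -powRrM mulVf ?gt_eqF// powRr1 ?ltW.
  by rewrite gt0_ltr_powR ?nnegrE ?powR_ge0.
apply: (@continuous_comp _ _ _ (@Num.norm R R) (fun x => x `^ b)).
  exact: norm_continuous.
by apply: continuous_powR_gt0; rewrite normr_gt0.
Qed.

(** The symbol is a continuous function of [|xi|^2] alone, and [|xi|^2 - |eta|^2 = |z|^2 + 2 z.eta]
    for [z = xi - eta]. Closeness is measured by the squared distance because Gaussians depend on
    it. *)
Lemma symb_cont n (b t e : R) (eta : Rn R n) : 0 < b -> 0 < e ->
  exists2 r : R, 0 < r & forall xi : Rn R n,
    dotp (subp xi eta) (subp xi eta) < r ^+ 2 ->
    `|symb b t xi - symb b t eta| <= e.
Proof.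
move=> b0 e0.
pose psi (l : R) := expR (- (t * `|Num.sqrt l| `^ b)).
have psiE (xi : Rn R n) : symb b t xi = psi (dotp xi xi).
  by rewrite /symb /psi /enorm ger0_norm ?sqrtr_ge0.
have cpsi : continuous psi.
  move=> l; apply: continuous_comp; last exact: continuous_expR.
  apply: continuousN; apply: cvgMr.
  apply: (@continuous_comp _ _ _ (@Num.sqrt R) (fun x => `|x| `^ b)).
    exact: sqrt_continuous.
  exact: continuous_norm_powR.
have /cvgrPdist_le/(_ _ e0)[d /= d0 Hd] := cpsi (dotp eta eta).
pose L := \sum_(i < n) `|tnth eta i : R|.
have L0 : 0 <= L by exact: sumr_ge0.
(* For [|z| <= r] the scalar product [z.eta] is at most [r L] in absolute value; since [r <= 1],
   this choice gives [r^2 + 2 r L <= r (1 + 2 L) < d]. *)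
pose r := Num.min 1 (d / (2 * (1 + 2 * L))).
have q0 : 0 < d / (2 * (1 + 2 * L)) by rewrite divr_gt0// mulr_gt0//; lra.
have r0 : 0 < r by rewrite lt_min ltr01.
have r1 : r <= 1 by rewrite ge_min lexx.
have r2 : r * (2 * (1 + 2 * L)) <= d.
  by rewrite -ler_pdivlMr ?ge_min ?lexx ?orbT//; lra.
exists r => // xi xir; rewrite !psiE distrC; apply: Hd => /=.
set z := subp xi eta.
have zr : enorm z <= r.
  by rewrite -(ler_pXn2r (isT : (0 < 2)%N)) ?nnegrE ?enorm_ge0 ?(ltW r0)// enorm_sqr ltW.
have E : dotp xi xi = dotp eta eta + dotp z z + 2 * dotp z eta.
  rewrite /dotp -!big_split/= mulr_sumr -big_split/=; apply: eq_bigr => i _.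
  by rewrite !tnth_mktuple; ring.
have zL : `|dotp z eta| <= r * L.
  rewrite /L mulr_sumr (le_trans (ler_norm_sum _ _ _))// ler_sum// => i _.
  by rewrite normrM ler_wpM2r// (le_trans (tnth_le_enorm z i)).
have z2 : dotp z z < r ^+ 2 by exact: xir.
have z0 := dotp_ge0 z.
rewrite E distrC (_ : _ - _ = dotp z z + 2 * dotp z eta); last by ring.
apply: (@le_lt_trans _ _ (dotp z z + 2 * (r * L))).
  rewrite (le_trans (ler_normD _ _))// (ger0_norm z0) lerD2l normrM ger0_norm//.
  by rewrite ler_wpM2l.
have r3 : r ^+ 2 <= r by rewrite expr2 ler_piMl// ltW.
have rL : 0 <= r * L by rewrite mulr_ge0// ltW.
nra.
Qed.

Lemma symb_dist_le2 n (b t : R) (xi eta : Rn R n) : 0 <= t ->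
  `|symb b t xi - symb b t eta| <= 2.
Proof.
move=> t0.
move: (symb_le1 b xi t0) (symb_le1 b eta t0) (symb_ge0 b t xi) (symb_ge0 b t eta).
move: (symb _ _ _) (symb _ _ _) => u v *.
by rewrite ler_norml; apply/andP; split; lra.
Qed.

End symb_continuity.

Section heat.
Context {R : realType} (n : nat).
Local Notation V := (Rn R n).
Local Notation mu := (leb R n).

(** The Fourier transform of [gaussn d]; it is the Gaussian heat kernel at time [d], normalised to
    mass [(2 pi)^n]. *)
Definition heat (d : R) (z : V) : R := Num.sqrt (pi / d) ^+ n * gaussn (4 * d)^-1 z.

Lemma heat_ge0 d z : 0 <= heat d z.
Proof. by rewrite mulr_ge0 ?exprn_ge0 ?gaussn_ge0. Qed.

Lemma measurable_heat d : measurable_fun setT (heat d).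
Proof. by apply: measurable_funM => //; exact: measurable_gaussn. Qed.

(** The case [c = 4] is [heat]; [c = 8] is the wider Gaussian that controls its tails in
    [symb_heat_cvg]. In both cases the mass does not depend on [d]. *)
Lemma integral_scaled_gaussn (c d : R) : 0 < d -> 0 < c ->
  (\int[mu]_z (Num.sqrt (pi / d) ^+ n * gaussn (c * d)^-1 z)%:E =
   ((Num.sqrt c * pi) ^+ n)%:E)%E.
Proof.
move=> d0 c0; have cd0 : 0 < (c * d)^-1 by rewrite invr_gt0 mulr_gt0.
under eq_integral do rewrite EFinM.
rewrite ge0_integralZl//; last 2 first.
- by apply/measurable_EFinP; exact: measurable_gaussn.
- by move=> z _; rewrite lee_fin gaussn_ge0.
rewrite integral_gaussn// -EFinM -exprMn; congr (_ ^+ _)%:E.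
rewrite -sqrtrM ?divr_ge0 ?pi_ge0 ?(ltW d0)//.
have -> : pi / d * (pi / (c * d)^-1) = c * pi ^+ 2 by field; rewrite !gt_eqF.
by rewrite sqrtrM ?(ltW c0)// sqrtr_sqr ger0_norm ?pi_ge0.
Qed.

Lemma integral_heat d : 0 < d -> (\int[mu]_z (heat d z)%:E = ((2 * pi) ^+ n)%:E)%E.
Proof.
move=> d0; rewrite integral_scaled_gaussn// (_ : Num.sqrt 4 = 2)//.
by rewrite (_ : 4 = 2 ^+ 2) ?sqrtr_sqr ?ger0_norm// -natrX.
Qed.

Lemma integrable_scaled_gaussn (c d : R) : 0 < d -> 0 < c ->
  mu.-integrable setT (EFin \o (fun z => Num.sqrt (pi / d) ^+ n * gaussn (c * d)^-1 z)).
Proof.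
by move=> d0 c0; apply: RintegrableZl; apply: integrable_gaussn; rewrite invr_gt0 mulr_gt0.
Qed.

Lemma integrable_heat d : 0 < d -> mu.-integrable setT (EFin \o heat d).
Proof. by move=> d0; exact: integrable_scaled_gaussn. Qed.

Lemma gaussn_subpC (a : R) (x y : V) : gaussn a (subp x y) = gaussn a (subp y x).
Proof. by rewrite /gaussn dotp_subp_sym. Qed.

Lemma integrable_subpl (f : V -> R) (eta : V) :
  (forall x y : V, f (subp x y) = f (subp y x)) ->
  mu.-integrable setT (EFin \o f) ->
  mu.-integrable setT (EFin \o (fun xi => f (subp xi eta))).
Proof.
move=> fC /(integrable_subp eta); apply: eq_integrable => // xi _ /=.
by rewrite fC.
Qed.

Lemma heat_subpC d (x y : V) : heat d (subp x y) = heat d (subp y x).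
Proof. by rewrite /heat gaussn_subpC. Qed.

End heat.

Section inversion.
Context {R : realType} (n : nat) (beta : R).
Hypotheses (n0 : (0 < n)%N) (beta02 : 0 < beta <= 2).
Local Notation V := (Rn R n).
Local Notation mu := (leb R n).
Local Notation K := (@stable_kernel R n beta).
Local Notation sy := (@symb R n beta).
Let beta0 : 0 < beta. Proof. by case/andP: beta02. Qed.

Lemma integrable_symb_heat (t d : R) (eta : V) : 0 < t -> 0 < d ->
  mu.-integrable setT (EFin \o (fun xi => sy t xi * heat d (subp xi eta))).
Proof.
move=> t0 d0; apply: (@le_Rintegrable _ _ _ _ _ (fun xi => heat d (subp xi eta))).
- apply: measurable_funM; first exact: measurable_symb.
  exact: (measurableT_comp (@measurable_heat R n d)
    (measurableT_comp (@measurable_subp R n) (pair2_measurable eta))).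
- move=> xi; rewrite normrM symb_norm ger0_norm ?heat_ge0// ler_piMl ?heat_ge0//.
  by rewrite symb_le1// ltW.
- by apply: integrable_subpl; [exact: heat_subpC|exact: integrable_heat].
Qed.

(** By Fubini the Gaussian integral is done for fixed [xi]: [cos (x.xi) cos (eta.x)] is half the sum
    of the cosines of [(xi - eta).x] and [(xi + eta).x], and [gaussn_fourier] applies to both. The
    point [- eta] is written [subp (origin n) eta]. *)
Lemma kernel_gaussn (t d : R) (eta : V) : 0 < t -> 0 < d ->
  \int[mu]_x (K x t * (gaussn d x * cos (dotp eta x))) =
  (2 * pi) ^- n * (2^-1 * (\int[mu]_xi (sy t xi * heat d (subp xi eta)) +
    \int[mu]_xi (sy t xi * heat d (subp xi (subp (origin n) eta))))).
Proof.
move=> t0 d0.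
pose F (x xi : V) := sy t xi * cos (dotp x xi) * (gaussn d x * cos (dotp eta x)).
pose G (x xi : V) := sy t xi * gaussn d x.
have mxi (f : V -> R) : measurable_fun setT f -> measurable_fun setT (fun z : V * V => f z.2).
  by move=> mf; exact: (measurableT_comp mf measurable_snd).
have mx (f : V -> R) : measurable_fun setT f -> measurable_fun setT (fun z : V * V => f z.1).
  by move=> mf; exact: (measurableT_comp mf measurable_fst).
have mF : measurable_fun setT (fun z : V * V => F z.1 z.2).
  apply: measurable_funM; apply: measurable_funM.
  - by apply: mxi; exact: measurable_symb.
  - exact: (measurableT_comp (continuous_measurable_fun (@continuous_cos R)) (@measurable_dotp R n)).
  - by apply: mx; exact: measurable_gaussn.
  - by apply: (mx (fun y => cos (dotp eta y))); exact: measurable_cos_dotp.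
have mG : measurable_fun setT (fun z : V * V => G z.1 z.2).
  by apply: measurable_funM; [apply: mxi; exact: measurable_symb|apply: mx; exact: measurable_gaussn].
have FG x xi : `|F x xi| <= G x xi.
  rewrite /F /G.
  move: (symb_ge0 beta t xi) (gaussn_ge0 d x) (cos_max (dotp x xi)) (cos_max (dotp eta x)).
  move: (symb _ _ _) (gaussn _ _) (cos _) (cos _) => S g a b S0 g0 a1 b1.
  rewrite !normrM (ger0_norm S0) (ger0_norm g0).
  by apply: ler_pM; rewrite ?mulr_ge0// ler_piMr.
have iS := @integrable_symb R n beta t n0 beta0 t0.
have iG1 x : mu.-integrable setT (EFin \o G x).
  rewrite /G (_ : (fun _ => _) = (fun xi => gaussn d x * sy t xi)).
    exact: RintegrableZl.
  by apply/funext => xi; rewrite mulrC.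
have iG2 xi : mu.-integrable setT (EFin \o G^~ xi).
  by apply: RintegrableZl; exact: integrable_gaussn.
transitivity ((2 * pi) ^- n * \int[mu]_x \int[mu]_xi F x xi).
  rewrite -RintegralZl//; last first.
    apply: (@le_Rintegrable _ _ _ _ _ (fun x => gaussn d x * \int[mu]_xi sy t xi)).
    - exact: (@measurable_fine_integral _ _ V V R mu F).
    - move=> x; rewrite (le_trans (le_normr_Rintegral _ _))//.
        by apply: (le_Rintegrable _ (FG x)) => //; exact: (measurable_section1 x mF).
      rewrite -RintegralZl//; apply: le_Rintegral => //.
      + apply: integrable_norm; apply: (le_Rintegrable _ (FG x)) => //.
        exact: (measurable_section1 x mF).
      + exact: RintegrableZl.
      + by move=> xi _; rewrite mulrC; exact: FG.
    - rewrite (_ : (fun _ => _) = (fun x => (\int[mu]_xi sy t xi) * gaussn d x)).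
        by apply: RintegrableZl; exact: integrable_gaussn.
      by apply/funext => x; rewrite mulrC.
  apply: eq_Rintegral => x _; rewrite stable_kernelE -mulrA; congr (_ * _).
  rewrite /F RintegralZr//.
  exact: (integrable_symbM n0 beta0 t0 (measurable_cos_dotp x) (fun=> cos_max _)).
congr (_ * _).
rewrite (@RFubini _ _ _ _ _ mu mu F G
  ((\int[mu]_xi sy t xi) * Num.sqrt (pi / d) ^+ n))//; last 3 first.
- under eq_integral => x _.
    rewrite -(RintegralK (iG1 x)) /G RintegralZr// EFinM.
    over.
  rewrite ge0_integralZl//; last 3 first.
  + by apply/measurable_EFinP; exact: measurable_gaussn.
  + by move=> x _; rewrite lee_fin gaussn_ge0.
  + by rewrite lee_fin Rintegral_ge0// => x _; exact: symb_ge0.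
  by rewrite integral_gaussn// -EFinM.
- move=> x; apply: (le_Rintegrable _ (FG x)) => //.
  exact: (measurable_section1 x mF).
- move=> xi; apply: (le_Rintegrable _ (FG^~ xi)) => //.
  exact: (measurable_section2 xi mF).
have E xi : \int[mu]_x F x xi = 2^-1 * (sy t xi * heat d (subp xi eta) +
    sy t xi * heat d (subp xi (subp (origin n) eta))).
  have i1 (z : V) := integrable_gaussnM d0 (measurable_cos_dotp z) (fun=> cos_max _).
  transitivity (\int[mu]_x (2^-1 * sy t xi *
      (gaussn d x * cos (dotp (subp xi eta) x) +
       gaussn d x * cos (dotp (subp xi (subp (origin n) eta)) x)))).
    apply: eq_Rintegral => x _; rewrite /F !dotp_subpl dotp0 sub0r opprK !cosD cosN sinN.
    by rewrite (dotpC x xi); field.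
  rewrite RintegralZl//; last exact: RintegrableD.
  rewrite RintegralD//.
  have [-> _] := gaussn_fourier (subp xi eta) d0.
  have [-> _] := gaussn_fourier (subp xi (subp (origin n) eta)) d0.
  by rewrite /heat; ring.
under eq_Rintegral do rewrite E.
rewrite RintegralZl//; last by apply: RintegrableD; exact: integrable_symb_heat.
by rewrite RintegralD//; exact: integrable_symb_heat.
Qed.

(** [heat d] is an approximate identity as [d] tends to 0: near [eta] the symbol varies little, and
    elsewhere it varies by at most 2 while little mass is left. *)
Lemma symb_heat_cvg (t : R) (eta : V) : 0 < t ->
  \int[mu]_xi (sy t xi * heat k.+1%:R^-1 (subp xi eta)) @[k --> \oo] -->
  (2 * pi) ^+ n * sy t eta.
Proof.
move=> t0.
have ih (d : R) : 0 < d -> mu.-integrable setT (EFin \o (fun xi => heat d (subp xi eta))).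
  by move=> d0; apply: integrable_subpl; [exact: heat_subpC|exact: integrable_heat].
have hI (d : R) : 0 < d -> \int[mu]_xi heat d (subp xi eta) = (2 * pi) ^+ n.
  move=> d0; under eq_Rintegral do rewrite heat_subpC.
  by rewrite leb_subpR ?/Rintegral ?integral_heat//; exact: measurable_heat.
pose M := (Num.sqrt 8 * pi) ^+ n : R.
have M0 : 0 <= M by rewrite exprn_ge0// mulr_ge0 ?pi_ge0.
have p0 : 0 < (2 * pi) ^+ n :> R by rewrite exprn_gt0// mulr_gt0 ?pi_gt0.
apply/cvgrPdist_le => e e0.
have e'0 : 0 < e / 2 / (2 * pi) ^+ n by rewrite !divr_gt0.
have [r r0 Hr] := @symb_cont R n beta t _ eta beta0 e'0.
(* [heat d] is [h8 d] times [exp (- |z|^2 / (8 d))]. At distance at least [r] the second factor is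
   at most [exp (- r^2 / (8 d))], while the mass [M] of [h8 d] does not depend on [d]. *)
pose h8 (d : R) (z : V) := Num.sqrt (pi / d) ^+ n * gaussn (8 * d)^-1 z.
have h8I (d : R) : 0 < d -> \int[mu]_xi h8 d (subp xi eta) = M.
  move=> d0; transitivity (\int[mu]_xi h8 d (subp eta xi)).
    by apply: eq_Rintegral => xi _; rewrite /h8 gaussn_subpC.
  rewrite leb_subpR ?/Rintegral ?integral_scaled_gaussn//.
  by apply: measurable_funM => //; exact: measurable_gaussn.
have ih8 (d : R) : 0 < d -> mu.-integrable setT (EFin \o (fun xi => h8 d (subp xi eta))).
  move=> d0; apply: integrable_subpl; last exact: integrable_scaled_gaussn.
  by move=> x y; rewrite /h8 gaussn_subpC.
have bound (d : R) : 0 < d ->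
    `|(2 * pi) ^+ n * sy t eta - \int[mu]_xi (sy t xi * heat d (subp xi eta))| <=
    e / 2 + 2 * expR (- (r ^+ 2 / (8 * d))) * M.
  move=> d0; rewrite -(hI d d0) -RintegralZr//; last exact: ih.
  rewrite -RintegralB//; last 2 first.
  - rewrite (_ : (fun _ => _) = (fun xi => sy t eta * heat d (subp xi eta))).
      by apply: RintegrableZl; exact: ih.
    by apply/funext => xi; rewrite mulrC.
  - exact: integrable_symb_heat.
  have ii : mu.-integrable setT (EFin \o (fun xi : V =>
      heat d (subp xi eta) * sy t eta - sy t xi * heat d (subp xi eta))).
    apply: RintegrableB; last exact: integrable_symb_heat.
    rewrite (_ : (fun _ => _) = (fun xi => sy t eta * heat d (subp xi eta))).
      by apply: RintegrableZl; exact: ih.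
    by apply/funext => xi; rewrite mulrC.
  rewrite (le_trans (le_normr_Rintegral _ _))//.
  have -> : e / 2 + 2 * expR (- (r ^+ 2 / (8 * d))) * M =
      \int[mu]_xi (e / 2 / (2 * pi) ^+ n * heat d (subp xi eta) +
        2 * expR (- (r ^+ 2 / (8 * d))) * h8 d (subp xi eta)).
    rewrite RintegralD//; last 2 first.
    - by apply: RintegrableZl; exact: ih.
    - by apply: RintegrableZl; exact: ih8.
    rewrite (RintegralZl _ measurableT (ih d d0)) (RintegralZl _ measurableT (ih8 d d0)).
    by rewrite (hI d d0) (h8I d d0) divfK// gt_eqF.
  apply: le_Rintegral => //.
  - exact: (integrable_norm ii).
  - by apply: RintegrableD; apply: RintegrableZl; [exact: ih|exact: ih8].
  move=> xi _; rewrite [X in X - _]mulrC -mulrBl normrM distrC.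
  rewrite (ger0_norm (heat_ge0 d _)).
  have h80 : 0 <= h8 d (subp xi eta) by rewrite mulr_ge0 ?exprn_ge0 ?gaussn_ge0.
  have [xr|xr] := ltP (dotp (subp xi eta) (subp xi eta)) (r ^+ 2).
    apply: ler_wpDr; first by rewrite !mulr_ge0 ?expR_ge0.
    by rewrite ler_wpM2r ?heat_ge0 ?Hr.
  apply: ler_wpDl; first by rewrite mulr_ge0 ?heat_ge0// ltW.
  rewrite -mulrA; apply: ler_pM => //; first exact: heat_ge0.
    by apply: symb_dist_le2; exact: ltW.
  rewrite /heat /h8 mulrCA ler_wpM2l ?exprn_ge0// /gaussn -expRD ler_expR.
  rewrite (_ : (4 * d)^-1 = (8 * d)^-1 + (8 * d)^-1); last by field; rewrite gt_eqF.
  rewrite mulrDl opprD lerD2r lerN2 mulrC ler_wpM2l//.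
  by rewrite invr_ge0 mulr_ge0// ltW.
have c0 : (2 * M * 8 / r ^+ 2) * k.+1%:R^-1 @[k --> \oo] --> (0 : R).
  by rewrite -[X in _ --> X](mulr0 (2 * M * 8 / r ^+ 2)); apply: cvgMr; exact: cvg_harmonic.
have e20 : 0 < e / 2 by rewrite divr_gt0.
move/cvgr0Pnorm_le : c0 => /(_ _ e20); apply: filterS => k hk.
have k0 : 0 < k.+1%:R^-1 :> R by rewrite invr_gt0.
rewrite (le_trans (bound _ k0))// [leRHS](splitr e) lerD2l.
rewrite (le_trans _ hk)// (le_trans _ (ler_norm _))//.
have r20 : 0 < r ^+ 2 by rewrite exprn_gt0.
have q0 : 0 < r ^+ 2 / (8 * k.+1%:R^-1) by rewrite divr_gt0// mulr_gt0.
have : expR (- (r ^+ 2 / (8 * k.+1%:R^-1))) <= (r ^+ 2 / (8 * k.+1%:R^-1))^-1.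
  rewrite expRN lef_pV2 ?posrE ?expR_gt0//.
  by rewrite (le_trans _ (expR_ge1Dx _))// lerDr.
move=> h; rewrite mulrAC (le_trans (ler_wpM2l _ h)) ?mulr_ge0//.
rewrite le_eqVlt; apply/orP; left; apply/eqP; rewrite invf_div.
by field; rewrite !gt_eqF// ltr0n.
Qed.

End inversion.

(** * Mass, semigroup law and time continuity of the kernel *)

Section scheffe.
Context d (T : measurableType d) (R : realType) (mu : {measure set T -> \bar R}).

Lemma norm_min_le (a b : R) : 0 <= a -> 0 <= b -> `|Num.min a b| <= b.
Proof. by move=> a0 b0; rewrite ger0_norm ?le_min ?a0// ge_min lexx orbT. Qed.

Lemma cvg_minr {I : Type} (F : set_system I) {FF : Filter F} (f : I -> R) (a b : R) :
  f t @[t --> F] --> a -> Num.min (f t) b @[t --> F] --> Num.min a b.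
Proof.
move=> fa; rewrite minr_absE; under eq_fun do rewrite minr_absE.
apply: cvgMl; apply: cvgB; first by apply: cvgD; [exact: fa|exact: cvg_cst].
by apply: cvg_norm; apply: cvgB; [exact: fa|exact: cvg_cst].
Qed.

(** Pointwise, [|f - g| = f + g - 2 min (f, g)]. For functions of equal mass, pointwise convergence
    to [g] therefore implies convergence in L^1, as [min (f, g)] is dominated by [g] (Scheffe). *)
Lemma Rintegral_norm_sub (f g : T -> R) : measurable_fun setT f -> measurable_fun setT g ->
  (forall x, 0 <= f x) -> (forall x, 0 <= g x) ->
  mu.-integrable setT (EFin \o f) -> mu.-integrable setT (EFin \o g) ->
  \int[mu]_x `|f x - g x| =
  \int[mu]_x f x + \int[mu]_x g x - 2 * \int[mu]_x Num.min (f x) (g x).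
Proof.
move=> mf mg f0 g0 jf jg.
have im : mu.-integrable setT (EFin \o (fun x => Num.min (f x) (g x))).
  apply: (le_Rintegrable _ _ jg); first exact: measurable_minr.
  by move=> x; exact: norm_min_le.
transitivity (\int[mu]_x (f x + g x - 2 * Num.min (f x) (g x))).
  apply: eq_Rintegral => x _; move: (f x) (g x) => u v.
  have [uv|uv] := leP u v.
    by rewrite distrC ger0_norm ?subr_ge0//; ring.
  by rewrite ger0_norm ?subr_ge0 ?(ltW uv)//; ring.
rewrite (RintegralB _ (RintegrableD jf jg) (RintegrableZl 2 im))//.
by rewrite (RintegralD _ jf jg)// (RintegralZl _ _ im).
Qed.

End scheffe.

Section kernel_mass.
Context {R : realType} (n : nat) (beta : R).
Hypotheses (n0 : (0 < n)%N) (beta02 : 0 < beta <= 2).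
Local Notation V := (Rn R n).
Local Notation mu := (leb R n).
Local Notation K := (@stable_kernel R n beta).
Local Notation sy := (@symb R n beta).
Let beta0 : 0 < beta. Proof. by case/andP: beta02. Qed.

Lemma kernel_gaussn_cvg (t : R) (eta : V) : 0 < t ->
  \int[mu]_x (K x t * (gaussn k.+1%:R^-1 x * cos (dotp eta x))) @[k --> \oo] --> sy t eta.
Proof.
move=> t0.
have p0 : (2 * pi) ^+ n != 0 :> R by rewrite expf_neq0// mulf_neq0 ?gt_eqF ?pi_gt0.
have E k := @kernel_gaussn R n beta n0 beta02 t k.+1%:R^-1 eta t0.
have k0 k : 0 < k.+1%:R^-1 :> R by rewrite invr_gt0.
under eq_fun do rewrite (E _ (k0 _)).
have oe : sy t (subp (origin n) eta) = sy t eta.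
  by rewrite /symb /enorm !dotp_subpl !dotp0 !sub0r dotpC dotp_subpl dotp0 sub0r opprK.
have -> : sy t eta = (2 * pi) ^- n * (2^-1 * ((2 * pi) ^+ n * sy t eta +
    (2 * pi) ^+ n * sy t (subp (origin n) eta))).
  by rewrite oe; move: (sy t eta) => s; field.
by do 2 apply: cvgMr; apply: cvgD; exact: symb_heat_cvg.
Qed.

Lemma integral_kernel (t : R) : 0 < t -> (\int[mu]_x (K x t)%:E = 1%:E)%E.
Proof.
move=> t0.
have K0 x : 0 <= K x t by exact: kernel_ge0.
have g1 k x : 0 <= K x t * gaussn k.+1%:R^-1 x by rewrite mulr_ge0 ?gaussn_ge0.
have mK : measurable_fun setT (fun x : V => K x t) by exact: measurable_kernel.
have c1 : (\int[mu]_x (K x t * gaussn k.+1%:R^-1 x)%:E @[k --> \oo] -->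
    \int[mu]_x (K x t)%:E)%E.
  rewrite [X in _ --> X](_ : _ =
      \int[mu]_x limn (fun k => (K x t * gaussn k.+1%:R^-1 x)%:E))%E; last first.
    apply: eq_integral => x _; apply/esym/cvg_lim => //.
    apply: cvg_EFin; first exact: nearW.
    rewrite -[X in _ --> X]mulr1; apply: cvgMr.
    rewrite -[X in _ --> X]expR0; apply: continuous_cvg; first exact: continuous_expR.
    rewrite -[X in _ --> X]oppr0; apply: cvgN; rewrite -[X in _ --> X](mul0r (dotp x x)).
    by apply: cvgMl; exact: cvg_harmonic.
  apply: cvg_monotone_convergence => //.
  - move=> k; apply/measurable_EFinP; apply: measurable_funM => //.
    exact: measurable_gaussn.
  - by move=> k x _; rewrite lee_fin.
  - move=> x _ i j ij; rewrite lee_fin ler_wpM2l// ler_expR lerN2.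
    by rewrite ler_wpM2r ?dotp_ge0// lef_pV2 ?posrE// ler_nat.
have ig k : mu.-integrable setT (EFin \o (fun x => K x t * gaussn k.+1%:R^-1 x)).
  apply: (@le_Rintegrable _ _ _ _ _ (fun x => ((2 * pi) ^- n * \int[mu]_xi sy t xi) * gaussn k.+1%:R^-1 x)).
  - by apply: measurable_funM => //; exact: measurable_gaussn.
  - move=> x; rewrite normrM (ger0_norm (gaussn_ge0 k.+1%:R^-1 x)).
    by rewrite ler_wpM2r ?gaussn_ge0// kernel_bound.
  - by apply: RintegrableZl; apply: integrable_gaussn; rewrite invr_gt0.
have c2 : (\int[mu]_x (K x t * gaussn k.+1%:R^-1 x)%:E @[k --> \oo] --> 1%:E)%E.
  have := @kernel_gaussn_cvg t (origin n) t0.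
  have -> : sy t (origin n) = 1.
    by rewrite /symb /enorm dotp0 sqrtr0 powR0 ?gt_eqF// mulr0 oppr0 expR0.
  move=> h; have -> : (fun k => \int[mu]_x (K x t * gaussn k.+1%:R^-1 x)%:E)%E =
      (fun k => (\int[mu]_x (K x t * (gaussn k.+1%:R^-1 x * cos (dotp (origin n) x))))%:E).
    apply/funext => k; rewrite -(RintegralK (ig k)); congr EFin.
    by apply: eq_Rintegral => x _; rewrite dotp0 cos0 mulr1.
  by apply: cvg_EFin => //; exact: nearW.
exact: (cvg_unique _ c1 c2).
Qed.

Lemma integrable_kernel (t : R) : 0 < t -> mu.-integrable setT (EFin \o (fun x => K x t)).
Proof.
move=> t0; apply: ge0_integrable_lty.
- exact: measurable_kernel.
- by move=> x; exact: kernel_ge0.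
- by rewrite integral_kernel// ltry.
Qed.

Lemma integrable_kernelM (t : R) (f : V -> R) : 0 < t -> measurable_fun setT f ->
  (forall y, `|f y| <= 1) -> mu.-integrable setT (EFin \o (fun x => K x t * f x)).
Proof.
move=> t0 mf f1; apply: (@le_Rintegrable _ _ _ _ _ (fun x => K x t)).
- by apply: measurable_funM => //; exact: measurable_kernel.
- move=> x; have K0 := @kernel_ge0 R n beta x t n0 beta02 t0.
  by rewrite normrM (ger0_norm K0) ler_piMr.
- exact: integrable_kernel.
Qed.

(** Once the kernel is integrable, dominated convergence removes the Gaussians of
    [kernel_gaussn_cvg] at every frequency. *)
Lemma kernel_fourier (t : R) (eta : V) : 0 < t ->
  \int[mu]_x (K x t * cos (dotp eta x)) = sy t eta.
Proof.
move=> t0.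
have [] := @dominated_Rintegral _ _ _ mu
  (fun k x => K x t * (gaussn k.+1%:R^-1 x * cos (dotp eta x)))
  (fun x => K x t * cos (dotp eta x)) (fun x => K x t).
- move=> k; apply: measurable_funM; first exact: measurable_kernel.
  by apply: measurable_funM; [exact: measurable_gaussn|exact: measurable_cos_dotp].
- move=> x; apply: cvgMr; rewrite -[X in _ --> X]mul1r; apply: cvgMl.
  rewrite -[X in _ --> X]expR0; apply: continuous_cvg; first exact: continuous_expR.
  rewrite -[X in _ --> X]oppr0; apply: cvgN; rewrite -[X in _ --> X](mul0r (dotp x x)).
  by apply: cvgMl; exact: cvg_harmonic.
- exact: integrable_kernel.
- move=> k x; have k0 : 0 <= k.+1%:R^-1 :> R by rewrite invr_ge0.
  move: (gaussn_ge0 k.+1%:R^-1 x) (gaussn_le1 x k0)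
    (@kernel_ge0 R n beta x t n0 beta02 t0) (cos_max (dotp eta x)).
  move: (gaussn _ _) (stable_kernel _ _ _) (cos _) => G S c G0 G1 S0 c1.
  rewrite !normrM (ger0_norm G0) (ger0_norm S0) -[leRHS]mulr1 ler_wpM2l//.
  by rewrite -[leRHS]mulr1 ler_pM.
by move=> _ cI; rewrite -(cvg_lim _ cI)// (cvg_lim _ (@kernel_gaussn_cvg t eta t0)).
Qed.

Lemma kernel_fourier_sin (t : R) (eta : V) : 0 < t ->
  \int[mu]_x (K x t * sin (dotp eta x)) = 0.
Proof.
move=> t0.
have mf : measurable_fun setT (fun x : V => K x t * sin (dotp eta x)).
  by apply: measurable_funM; [exact: measurable_kernel|exact: measurable_sin_dotp].
have i1 := integrable_kernelM t0 (measurable_sin_dotp eta) (fun=> sin_max _).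
suff : \int[mu]_x (K x t * sin (dotp eta x)) = - \int[mu]_x (K x t * sin (dotp eta x)).
  by move: (\int[_]_x _) => I; lra.
rewrite -[LHS](leb_subpR (origin n) mf) -[RHS]mulN1r -RintegralZl//.
apply: eq_Rintegral => x _.
rewrite dotpC dotp_subpl dotp0 sub0r dotpC sinN mulN1r mulrN; congr (- (_ * _)).
have -> : x = subp x (origin n).
  by apply: eq_from_tnth => i; rewrite !tnth_mktuple subr0.
rewrite kernel_subpC; congr (K _ t).
by apply: eq_from_tnth => i; rewrite !tnth_mktuple subr0.
Qed.

(** Only [K (subp x y) t] is written as a Fourier integral. After Fubini, the integral in [y] is a
    cosine and a sine transform of the kernel at time [r], equal to [symb r] and to 0, and
    [symb t * symb r = symb (t + r)]. *)
Lemma kernel_semigroup (t r : R) (x : V) : 0 < t -> 0 < r ->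
  \int[mu]_y (K (subp x y) t * K y r) = K x (t + r).
Proof.
move=> t0 r0.
pose F (y xi : V) := sy t xi * cos (dotp (subp x y) xi) * K y r.
pose G (y xi : V) := sy t xi * K y r.
have K0 y : 0 <= K y r by exact: kernel_ge0.
have mK : measurable_fun setT (fun x : V => K x r) by exact: measurable_kernel.
have mF : measurable_fun setT (fun z : V * V => F z.1 z.2).
  apply: measurable_funM; last exact: (measurableT_comp mK measurable_fst).
  apply: measurable_funM.
    exact: (measurableT_comp (@measurable_symb R n beta t) measurable_snd).
  apply: (measurableT_comp (continuous_measurable_fun (@continuous_cos R))).
  apply: (measurableT_comp (@measurable_dotp R n)
    (measurable_fun_pair (measurableT_comp (@measurable_subpr R n x) measurable_fst) measurable_snd)).
have mG : measurable_fun setT (fun z : V * V => G z.1 z.2).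
  apply: measurable_funM; last exact: (measurableT_comp mK measurable_fst).
  exact: (measurableT_comp (@measurable_symb R n beta t) measurable_snd).
have FG y xi : `|F y xi| <= G y xi.
  rewrite /F /G.
  move: (symb_ge0 beta t xi) (K0 y) (cos_max (dotp (subp x y) xi)).
  move: (symb _ _ _) (stable_kernel _ _ _) (cos _) => S g a S0 g0 a1.
  by rewrite !normrM (ger0_norm S0) (ger0_norm g0) ler_wpM2r// ler_piMr.
have iS := @integrable_symb R n beta t n0 beta0 t0.
have iK := integrable_kernel r0.
have iG1 y : mu.-integrable setT (EFin \o G y).
  rewrite /G (_ : (fun _ => _) = (fun xi => K y r * sy t xi)).
    exact: RintegrableZl.
  by apply/funext => xi; rewrite mulrC.
have iG2 xi : mu.-integrable setT (EFin \o G^~ xi) by exact: RintegrableZl.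
transitivity (\int[mu]_y ((2 * pi) ^- n * \int[mu]_xi F y xi)).
  apply: eq_Rintegral => y _; rewrite stable_kernelE -mulrA; congr (_ * _).
  rewrite /F RintegralZr//.
  exact: (integrable_symbM n0 beta0 t0 (measurable_cos_dotp _) (fun=> cos_max _)).
rewrite RintegralZl//; last first.
  apply: (@le_Rintegrable _ _ _ _ _ (fun y => (\int[mu]_xi sy t xi) * K y r)).
  - exact: (@measurable_fine_integral _ _ V V R mu F).
  - move=> y; rewrite (le_trans (le_normr_Rintegral _ _))//.
      by apply: (le_Rintegrable _ (FG y)) => //; exact: (measurable_section1 y mF).
    rewrite -RintegralZr//; apply: le_Rintegral => //.
    + apply: integrable_norm; apply: (le_Rintegrable _ (FG y)) => //.
      exact: (measurable_section1 y mF).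
    + exact: iG1.
  - exact: RintegrableZl.
rewrite stable_kernelE; congr (_ * _).
rewrite (@RFubini _ _ _ _ _ mu mu F G (\int[mu]_xi sy t xi))//; last 3 first.
- under eq_integral => y _.
    rewrite -(RintegralK (iG1 y)) /G RintegralZr// EFinM.
    over.
  rewrite ge0_integralZl//; last 3 first.
  + exact/measurable_EFinP.
  + by move=> y _; rewrite lee_fin.
  + by rewrite lee_fin Rintegral_ge0// => xi _; exact: symb_ge0.
  by rewrite integral_kernel// mule1.
- move=> y; apply: (le_Rintegrable _ (FG y)) => //.
  exact: (measurable_section1 y mF).
- move=> xi; apply: (le_Rintegrable _ (FG^~ xi)) => //.
  exact: (measurable_section2 xi mF).
apply: eq_Rintegral => xi _.
have ic := integrable_kernelM r0 (measurable_cos_dotp xi) (fun=> cos_max _).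
have is_ := integrable_kernelM r0 (measurable_sin_dotp xi) (fun=> sin_max _).
transitivity (\int[mu]_y ((sy t xi * cos (dotp x xi)) * (K y r * cos (dotp xi y)) +
    (sy t xi * sin (dotp x xi)) * (K y r * sin (dotp xi y)))).
  apply: eq_Rintegral => y _.
  by rewrite /F dotp_subpl cosB (dotpC y xi); move: (sy t xi) => S; ring.
rewrite RintegralD//; last 2 first.
- exact: RintegrableZl.
- exact: RintegrableZl.
rewrite !RintegralZl// kernel_fourier// kernel_fourier_sin// mulr0 addr0 symbD.
by move: (sy t xi) (sy r xi) => S1 S2; ring.
Qed.

Lemma integral_kernelR (t : R) : 0 < t -> \int[mu]_x K x t = 1.
Proof. by move=> t0; rewrite /Rintegral integral_kernel. Qed.

(** [Rintegral_norm_sub] with both masses equal to 1 leaves only the integral of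
    [min (K x t) (K x t0)], which is dominated by [K x t0]. *)
Lemma kernel_L1_cvg (t0 : R) : 0 < t0 ->
  \int[mu]_x `|K x t - K x t0| @[t --> within [set t | 0 < t] (nbhs t0)] --> (0 : R).
Proof.
move=> t00.
have mK t : measurable_fun setT (fun x : V => K x t) by exact: measurable_kernel.
have mm t : measurable_fun setT (fun x : V => Num.min (K x t) (K x t0)).
  exact: measurable_minr.
have cm : \int[mu]_x Num.min (K x t) (K x t0) @[t --> within [set t | 0 < t] (nbhs t0)] -->
    \int[mu]_x Num.min (K x t0) (K x t0).
  apply: (@dominated_Rintegral_at _ _ _ _ (fun t x => Num.min (K x t) (K x t0)) (fun x => K x t0)) => //.
  - by move=> x; apply: cvg_minr; exact: kernel_cvg_time.
  - exact: integrable_kernel.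
  - by move=> t x tp; apply: norm_min_le; exact: kernel_ge0.
rewrite [X in _ --> X](_ : 0 = 2 - 2 * \int[mu]_x Num.min (K x t0) (K x t0)); last first.
  under eq_Rintegral do rewrite minxx.
  by rewrite integral_kernelR// mulr1 subrr.
have E t : 0 < t -> \int[mu]_x `|K x t - K x t0| = 2 - 2 * \int[mu]_x Num.min (K x t) (K x t0).
  move=> tp; rewrite (Rintegral_norm_sub (mK t) (mK t0) _ _ (integrable_kernel tp)
    (integrable_kernel t00)); last 2 first.
  - by move=> x; exact: kernel_ge0.
  - by move=> x; exact: kernel_ge0.
  by rewrite (integral_kernelR tp) (integral_kernelR t00).
have c2 : 2 - 2 * \int[mu]_x Num.min (K x t) (K x t0)
    @[t --> within [set t | 0 < t] (nbhs t0)] -->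
    2 - 2 * \int[mu]_x Num.min (K x t0) (K x t0).
  by apply: cvgB; [exact: cvg_cst|apply: cvgMr; exact: cm].
apply: cvg_trans c2; apply: near_eq_cvg.
by rewrite near_withinE; apply: nearW => t tp; rewrite E.
Qed.

(** At frequency 0, [kernel_gaussn] turns the integral into 1 minus [(2 pi)^(-n)] times the integral
    of [symb t] against [heat d]; as [t] tends to 0 the symbol tends to 1 and [heat d] has mass
    [(2 pi)^n]. *)
Lemma kernel_concentration (d : R) : 0 < d ->
  \int[mu]_x (K x t * (1 - gaussn d x)) @[t --> within [set t | 0 < t] (nbhs (0 : R))] --> (0 : R).
Proof.
move=> d0.
have ih := integrable_heat n d0.
have p0 : (2 * pi) ^+ n != 0 :> R by rewrite expf_neq0// mulf_neq0 ?gt_eqF ?pi_gt0.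
have hI : \int[mu]_xi heat d xi = (2 * pi) ^+ n by rewrite /Rintegral integral_heat.
have E t : 0 < t -> \int[mu]_x (K x t * (1 - gaussn d x)) =
    1 - (2 * pi) ^- n * \int[mu]_xi (sy t xi * heat d xi).
  move=> t0.
  have := kernel_gaussn n0 beta02 (origin n) t0 d0.
  have so (xi : V) : subp xi (origin n) = xi.
    by apply: eq_from_tnth => i; rewrite !tnth_mktuple subr0.
  rewrite subp_self; under [X in _ = _ * (_ * (X + _))]eq_Rintegral do rewrite so.
  under [X in _ = _ * (_ * (_ + X))]eq_Rintegral do rewrite so.
  under eq_Rintegral do rewrite dotp0 cos0 mulr1.
  move=> e; transitivity (\int[mu]_x (K x t - K x t * gaussn d x)).
    by apply: eq_Rintegral => x _; rewrite mulrBr mulr1.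
  rewrite RintegralB//; last 2 first.
  - exact: integrable_kernel.
  - apply: integrable_kernelM => //; first exact: measurable_gaussn.
    by move=> y; rewrite ger0_norm ?gaussn_ge0// gaussn_le1// ltW.
  rewrite integral_kernelR// e; congr (_ - _ * _).
  by move: (\int[_]_x _) => I; field.
(* [dominated_Rintegral_at] is stated for a set containing the limit point, hence [0 <= t] here; the
   restriction to [0 < t] comes afterwards. *)
have cm : \int[mu]_xi (sy t xi * heat d xi) @[t --> within [set t | 0 <= t] (nbhs (0 : R))] -->
    \int[mu]_xi (sy 0 xi * heat d xi).
  apply: (@dominated_Rintegral_at _ _ _ _ (fun t xi => sy t xi * heat d xi) (heat d)) => //.
  - move=> t _; apply: measurable_funM; [exact: measurable_symb|exact: measurable_heat].
  - by rewrite /=.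
  - by move=> xi; apply: cvg_within_filter; apply: cvgMl; exact: continuous_symb.
  - move=> t xi tp.
    move: (symb_ge0 beta t xi) (symb_le1 beta xi tp) (heat_ge0 d xi).
    move: (symb _ _ _) (heat _ _) => S h S0 S1 h0.
    by rewrite ger0_norm ?mulr_ge0// ler_piMl.
rewrite [X in _ --> X](_ : 0 = 1 - (2 * pi) ^- n * \int[mu]_xi (sy 0 xi * heat d xi)); last first.
  under eq_Rintegral do rewrite /symb mul0r oppr0 expR0 mul1r.
  by rewrite hI mulVf// subrr.
have c2 : 1 - (2 * pi) ^- n * \int[mu]_xi (sy t xi * heat d xi)
    @[t --> within [set t | 0 < t] (nbhs (0 : R))] -->
    1 - (2 * pi) ^- n * \int[mu]_xi (sy 0 xi * heat d xi).
  apply: cvgB; first exact: cvg_cst.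
  apply: cvgMr; apply/cvgrPdist_le => e e0; move/cvgrPdist_le : cm => /(_ _ e0).
  by rewrite !near_withinE; apply: filterS => t H t0; apply: H; exact: ltW.
apply: cvg_trans c2; apply: near_eq_cvg.
by rewrite near_withinE; apply: nearW => t tp; rewrite E.
Qed.

End kernel_mass.

Lemma integralZl_ge0 (R : realType) d (T : measurableType d)
    (mu : {measure set T -> \bar R}) (k : R) (f : T -> R) :
  measurable_fun setT f -> (forall x, 0 <= f x) -> 0 <= k ->
  (\int[mu]_x (k * f x)%:E = k%:E * \int[mu]_x (f x)%:E)%E.
Proof.
move=> mf f0 k0; under eq_integral do rewrite EFinM.
apply: ge0_integralZl => //.
- exact/measurable_EFinP.
- by move=> x _; rewrite lee_fin.
Qed.

(** * Balls of L^s and of L^s /\ L^oo, and Minkowski's integral inequality *)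

Section jensen.
Context {R : realType} (s : R).
Hypothesis s1 : 1 < s.
Let s0 : 0 < s. Proof. exact: lt_trans s1. Qed.

Lemma cvg_powR_ge0 (u : nat -> R) (l : R) : (forall k, 0 <= u k) ->
  u k @[k --> \oo] --> l -> u k `^ s @[k --> \oo] --> l `^ s.
Proof.
move=> u0 ul; have l0 : 0 <= l by exact: (cvgn_ge_bound ul u0).
have [l_gt0|] := ltP 0 l.
  apply: (@cvg_comp _ _ _ u (fun y => y `^ s) _ (nbhs l) _ ul).
  exact: continuous_powR_gt0.
move=> /(conj l0)/andP/le_anti lE; rewrite -lE in ul *; rewrite powR0 ?gt_eqF//.
apply: (@squeeze_cvgr _ _ _ _ (fun=> 0) u) => //; last exact: cvg_cst.
have u1 : \forall k \near \oo, u k < 1 by apply: (cvgr_lt 0).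
near=> k; rewrite powR_ge0/=.
have [->|uk] := eqVneq (u k) 0; first by rewrite powR0 ?gt_eqF.
rewrite -[leRHS]powRr1// ger_powR ?(ltW s1)//.
by rewrite lt_neqAle eq_sym uk u0/= ltW//; near: k.
Unshelve. all: by end_near.
Qed.

Lemma le_poweR (x y : \bar R) : (0 <= x)%E -> (x <= y)%E -> (x `^ s <= y `^ s)%E.
Proof.
move=> x0 xy; apply: gt0_ler_poweR => //; rewrite ?in_itv/= ?leey ?andbT//.
- exact: ltW.
- exact: le_trans xy.
Qed.

(** Hoelder's inequality for [g^(1/s) f] and [g^(1/q)] with [q] conjugate to [s]; the mass of [g]
    enters through the second factor. With extended integrals, the case of infinite values is
    included. *)
Lemma jensen_poweR d (T : measurableType d) (mu : {measure set T -> \bar R})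
    (g f : T -> R) (A : R) : measurable_fun setT g -> measurable_fun setT f ->
  (forall x, 0 <= g x) -> (forall x, 0 <= f x) -> 0 <= A ->
  (\int[mu]_x (g x)%:E <= A%:E)%E ->
  ((\int[mu]_x (g x * f x)%:E) `^ s <=
    (A `^ (s - 1))%:E * \int[mu]_x (g x * f x `^ s)%:E)%E.
Proof.
move=> mg mf g0 f0 A0 gA.
have s10 : 0 < 1 - s^-1 by rewrite subr_gt0 invf_lt1.
pose q := (1 - s^-1)^-1.
have q0 : 0 < q by rewrite invr_gt0.
have sq : s^-1 + q^-1 = 1 by rewrite /q invrK; lra.
have m1 : measurable_fun setT (fun x => g x `^ s^-1 * f x).
  by apply: measurable_funM => //; exact: (measurableT_comp (measurable_powR _)).
have m2 : measurable_fun setT (fun x => g x `^ q^-1).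
  exact: (measurableT_comp (measurable_powR _)).
have := hoelder mu m1 m2 s0 q0 sq.
rewrite Lnorm1 => H.
have -> : (\int[mu]_x (g x * f x)%:E =
    \int[mu]_x `|(EFin \o ((fun x => g x `^ s^-1 * f x) \* (fun x => g x `^ q^-1))%R) x|)%E.
  apply: eq_integral => x _ /=; congr EFin.
  rewrite ger0_norm ?mulr_ge0 ?powR_ge0// mulrAC.
  have [->|gx] := eqVneq (g x) 0; first by rewrite mul0r powR0 ?mul0r// invr_eq0 gt_eqF.
  by rewrite -powRD ?gx ?implybT// sq powRr1.
apply: (le_trans (le_poweR _ H)); first by apply: integral_ge0 => x _; exact: abse_ge0.
rewrite poweRM ?Lnorm_ge0// muleC powR_Lnorm ?gt_eqF//.
apply: lee_pmul.
- exact: poweR_ge0.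
- by apply: integral_ge0 => x _; exact: poweR_ge0.
- have -> : ('N[mu]_q%:E[EFin \o (fun x => (g x `^ q^-1)%R)] `^ s = (\int[mu]_x (g x)%:E) `^ (s - 1))%E.
    rewrite unlock -poweRrM; have -> : q^-1 * s = s - 1.
      by rewrite /q invrK; field; rewrite gt_eqF.
    congr (_ `^ _)%E; apply: eq_integral => x _ /=.
    rewrite ger0_norm ?powR_ge0// -powRrM mulVf ?gt_eqF// powRr1//.
  rewrite -poweR_EFin; apply: gt0_ler_poweR => //.
  + by rewrite subr_ge0 ltW.
  + by rewrite in_itv/= leey andbT; apply: integral_ge0 => x _; rewrite lee_fin.
  + by rewrite in_itv/= leey andbT lee_fin.
- rewrite le_eqVlt; apply/orP; left; apply/eqP; apply: eq_integral => x _ /=.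
  rewrite ger0_norm ?mulr_ge0 ?powR_ge0// powRM ?powR_ge0// -powRrM.
  by rewrite mulVf ?gt_eqF// powRr1.
Qed.

End jensen.

Section Ls_balls.
Context {R : realType} (s : R).
Hypothesis s1 : 1 < s.
Let s0 : 0 < s. Proof. exact: lt_trans s1. Qed.

Section measure_space.
Context d (T : measurableType d) (mu : {measure set T -> \bar R}).
Implicit Types v w : T -> R.

(* The ball of radius M in L^s; Xle is the ball of L^s /\ L^oo. *)
Definition Lle (M : R) v : Prop :=
  (\int[mu]_x (`|v x| `^ s)%:E <= (M `^ s)%:E)%E.

Definition Xle (M : R) v : Prop :=
  [/\ measurable_fun setT v, {ae mu, forall x, `|v x| <= M} & Lle M v].

Lemma measurable_absX v : measurable_fun setT v ->
  measurable_fun setT (fun x => `|v x| `^ s).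
Proof.
move=> mv; apply: (measurableT_comp (measurable_powR _)).
by apply: measurableT_comp => //; exact: normr_measurable.
Qed.

Lemma Lle_norm (M : R) v : 0 <= M -> Lle M v <-> ('N[mu]_s%:E[EFin \o v] <= M%:E)%E.
Proof.
move=> M0; rewrite /Lle.
have E : (\int[mu]_x (`|v x| `^ s)%:E = 'N[mu]_s%:E[EFin \o v] `^ s)%E.
  by rewrite powR_Lnorm ?gt_eqF.
rewrite E -poweR_EFin; split; last exact: le_poweR (Lnorm_ge0 _ _ _).
move=> h; have : (('N[mu]_s%:E[EFin \o v] `^ s) `^ s^-1 <= (M%:E `^ s) `^ s^-1)%E.
  apply: gt0_ler_poweR => //; rewrite ?in_itv/= ?leey ?andbT ?poweR_ge0 ?lee_fin ?powR_ge0//.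
  by rewrite invr_ge0 ltW.
by rewrite -!poweRrM divff ?gt_eqF// !poweRe1 ?Lnorm_ge0.
Qed.

Lemma Lle_ae (M : R) v w : measurable_fun setT v -> measurable_fun setT w ->
  {ae mu, forall x, `|v x| <= `|w x|} -> Lle M w -> Lle M v.
Proof.
move=> mv mw vw; apply: le_trans; apply: ae_ge0_le_integral => //.
- by apply/measurable_EFinP; exact: measurable_absX.
- by apply/measurable_EFinP; exact: measurable_absX.
by apply: aeS vw => x vw _; rewrite lee_fin ge0_ler_powR ?nnegrE// ltW.
Qed.

Lemma Lle_weak (M M' : R) v : 0 <= M -> M <= M' -> Lle M v -> Lle M' v.
Proof.
move=> M0 MM h; apply: (le_trans h); rewrite lee_fin ge0_ler_powR ?nnegrE ?(ltW s0)//.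
exact: le_trans MM.
Qed.

Lemma Lle_scale (M c : R) v : measurable_fun setT v -> 0 <= M ->
  Lle M v -> Lle (`|c| * M) (fun x => c * v x).
Proof.
move=> mv M0 h; rewrite /Lle; under eq_integral do rewrite normrM powRM// EFinM.
rewrite ge0_integralZl//; last first.
  by apply/measurable_EFinP; exact: measurable_absX.
by rewrite powRM// EFinM lee_wpmul2l// lee_fin powR_ge0.
Qed.

Lemma Lle_add (M M' : R) v w : measurable_fun setT v -> measurable_fun setT w ->
  0 <= M -> 0 <= M' -> Lle M v -> Lle M' w -> Lle (M + M') (v \+ w).
Proof.
move=> mv mw M0 M0' /(Lle_norm _ M0) hv /(Lle_norm _ M0') hw.
apply/Lle_norm; first exact: addr_ge0.
by rewrite EFinD (le_trans (minkowski_EFin _ mv mw (ltW s1)))// leeD.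
Qed.

Lemma Xle_dom (M : R) v w : measurable_fun setT v ->
  {ae mu, forall x, `|v x| <= `|w x|} -> Xle M w -> Xle M v.
Proof.
move=> mv vw [mw bw lw]; split => //; last by apply: (Lle_ae (w := w)).
by apply: aeS2 vw bw => x; exact: le_trans.
Qed.

Lemma Xle_eq (M : R) v w : measurable_fun setT v ->
  {ae mu, forall x, v x = w x} -> Xle M w -> Xle M v.
Proof. by move=> mv vw; apply: Xle_dom => //; apply: aeS vw => x ->. Qed.

Lemma Xle_weak (M M' : R) v : 0 <= M -> M <= M' -> Xle M v -> Xle M' v.
Proof.
move=> M0 MM [mv bv lv]; split => //; last by apply: (Lle_weak (M := M)).
by apply: aeS bv => x /le_trans; apply.
Qed.

Lemma Xle_add (M M' : R) v w : 0 <= M -> 0 <= M' ->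
  Xle M v -> Xle M' w -> Xle (M + M') (v \+ w).
Proof.
move=> M0 M0' [mv bv lv] [mw bw lw]; split; first exact: measurable_funD.
  by apply: aeS2 bv bw => x h h'; rewrite (le_trans (ler_normD _ _))// lerD.
exact: Lle_add.
Qed.

Lemma Xle_scale (M c : R) v : 0 <= M -> Xle M v -> Xle (`|c| * M) (fun x => c * v x).
Proof.
move=> M0 [mv bv lv]; split; first exact: measurable_funM.
  by apply: aeS bv => x h; rewrite normrM ler_wpM2l.
exact: Lle_scale.
Qed.

Lemma Xle_sub (M M' : R) v w : 0 <= M -> 0 <= M' ->
  Xle M v -> Xle M' w -> Xle (M + M') (v \- w).
Proof.
move=> M0 M0' hv hw; have := Xle_scale (-1) M0' hw; rewrite normrN1 mul1r => hw'.
have := Xle_add M0 M0' hv hw'; congr Xle; apply/funext => x /=.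
by rewrite mulN1r.
Qed.

Lemma Xle0 : Xle 0 (fun=> 0).
Proof.
split => //; first by apply: aeW => x; rewrite normr0.
by rewrite /Lle; under eq_integral do rewrite normr0 powR0 ?gt_eqF//; rewrite integral0 powR0 ?gt_eqF.
Qed.

(** The L^s part is Fatou's lemma; the essential bounds for all [k] hold off a single null set and
    pass to the limit there. *)
Lemma Xle_lim (M : R) (f : nat -> T -> R) v : 0 <= M ->
  (forall k, Xle M (f k)) -> (forall x, f k x @[k --> \oo] --> v x) -> Xle M v.
Proof.
move=> M0 hf fv; have mv : measurable_fun setT v.
  by apply: (measurable_fun_cvg (h := f)) => [k|x _]; [by case: (hf k)|exact: fv].
split => //.
  have : {ae mu, forall x, forall k, `|f k x| <= M} by apply: ae_seq => k; case: (hf k).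
  apply: aeS => x h; apply: (cvgn_le_bound (u := fun k => `|f k x|)) => //.
  exact: cvg_norm (fv x).
rewrite /Lle.
have E x : (`|v x| `^ s)%:E = limn_einf (fun k => (`|f k x| `^ s)%:E).
  have C : (`|f k x| `^ s)%:E @[k --> \oo] --> (`|v x| `^ s)%:E.
    by apply: cvg_EFin; [exact: nearW|apply: cvg_powR_ge0 => //; exact: cvg_norm (fv x)].
  by rewrite is_cvg_limn_einfE; [exact/esym/cvg_lim|apply/cvg_ex; exists (`|v x| `^ s)%:E].
under eq_integral do rewrite E.
apply: (le_trans (fatou _ measurableT _ _)).
- by move=> k; apply/measurable_EFinP/measurable_absX; case: (hf k).
- by move=> k x _; rewrite lee_fin powR_ge0.
rewrite limn_einf_lim; apply: lime_le; first exact: is_cvg_einfs.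
apply: nearW => k; have [_ _ Lk] := hf k; apply: le_trans Lk.
by apply: ereal_inf_lbound; exists k => /=.
Qed.

End measure_space.

Section weighted_integral.
Context d (T : measurableType d) (mu : {sigma_finite_measure set T -> \bar R}).
Context d2 (T2 : measurableType d2) (m2 : {sigma_finite_measure set T2 -> \bar R}).
Variables (g : T2 -> R) (G : T2 -> T -> R) (B M : R).
Hypotheses (mg : measurable_fun setT g) (g0 : forall t, 0 <= g t)
  (B0 : 0 <= B) (M0 : 0 <= M) (gB : (\int[m2]_t (g t)%:E <= B%:E)%E)
  (mG : measurable_fun setT (fun z : T2 * T => G z.1 z.2))
  (gG : forall t x, g t = 0 -> G t x = 0).

(** The quotient of [|G|] by [g], with value 0 where [g] vanishes, as [powR] sends 0 to 0 for
    exponent -1. There [gG] makes [G] vanish too, so [gDE] holds throughout. *)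
Let D t x := `|G t x| * g t `^ (-1).

Let measurable_D : measurable_fun setT (fun z : T2 * T => D z.1 z.2).
Proof.
apply: measurable_funM; first exact: measurableT_comp.
by apply: (measurableT_comp (measurable_powR _)); exact: measurableT_comp.
Qed.

Let gDE t x : g t * D t x = `|G t x|.
Proof.
have [g0'|gn0] := eqVneq (g t) 0; first by rewrite g0' mul0r gG// normr0.
by rewrite /D mulrCA powR_inv1// divff// mulr1.
Qed.

(** True without integrability: where the extended integral is infinite, the real-valued one is
    0. *)
Lemma le_Rintegral_normG x :
  (`|\int[m2]_t G t x|%:E <= \int[m2]_t `|G t x|%:E)%E.
Proof.
have mGx : measurable_fun setT (G^~ x) by exact: (measurable_section2 x mG).
have : (`|\int[m2]_t (G t x)%:E| <= \int[m2]_t `|G t x|%:E)%E.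
  by apply: (le_trans (le_abse_integral _ measurableT _)) => //; exact/measurable_EFinP.
apply: le_trans; rewrite /Rintegral; case: (\int[m2]_t _)%E => //=.
- by rewrite normr0 leey.
- by rewrite normr0 leey.
Qed.

(* Minkowski's integral inequality, from Jensen's inequality for the measure g dt. *)
Lemma Lle_wint : (forall t, Lle mu (g t * M) (G t)) ->
  Lle mu (B * M) (fun x => \int[m2]_t G t x).
Proof.
move=> hG; rewrite /Lle.
have D_ge0 t x : 0 <= D t x by rewrite mulr_ge0 ?powR_ge0.
have mDx x : measurable_fun setT (D^~ x) by exact: (measurable_section2 x measurable_D).
have mgD : measurable_fun setT (fun z : T2 * T => g z.1 * D z.1 z.2 `^ s).
  apply: measurable_funM; first exact: measurableT_comp.
  by apply: (measurableT_comp (measurable_powR _)).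
have step1 x : (((`|\int[m2]_t G t x|) `^ s)%:E <=
    (B `^ (s - 1))%:E * \int[m2]_t (g t * D t x `^ s)%:E)%E.
  apply: (@le_trans _ _ ((\int[m2]_t (g t * D t x)%:E) `^ s)%E); last first.
    exact: (jensen_poweR s1 mg (mDx x)).
  rewrite -poweR_EFin; apply: le_poweR => //.
  by under eq_integral do rewrite gDE; exact: le_Rintegral_normG.
have step2 t : (\int[mu]_x (g t * D t x `^ s)%:E <= (g t * M `^ s)%:E)%E.
  have [g0'|gn0] := eqVneq (g t) 0.
    by rewrite g0' mul0r; under eq_integral do rewrite mul0r; rewrite integral0.
  have mGt : measurable_fun setT (G t) by exact: (measurable_section1 t mG).
  have E x : (g t * D t x `^ s)%:E = ((g t * (g t `^ (-1)) `^ s)%:E * (`|G t x| `^ s)%:E)%E.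
    by rewrite /D powRM ?powR_ge0// -EFinM mulrA mulrAC.
  under eq_integral do rewrite E.
  rewrite ge0_integralZl//; last 2 first.
  - by apply/measurable_EFinP; exact: measurable_absX.
  - by rewrite lee_fin mulr_ge0 ?powR_ge0.
  apply: (@le_trans _ _ ((g t * (g t `^ (-1)) `^ s)%:E * ((g t * M) `^ s)%:E)%E).
    by apply: lee_wpmul2l; [rewrite lee_fin mulr_ge0 ?powR_ge0|exact: hG].
  rewrite -EFinM lee_fin -mulrA -powRM ?powR_ge0 ?mulr_ge0// powR_inv1// mulrA mulVf//.
  by rewrite mul1r.
apply: (@le_trans _ _ (\int[mu]_x ((B `^ (s - 1))%:E * \int[m2]_t (g t * D t x `^ s)%:E))%E).
  apply: ge0_le_integral => //.
  - apply/measurable_EFinP/measurable_absX.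
    by apply: (@measurable_fine_integral _ _ T T2 R m2 (fun x t => G t x)); exact: (measurableT_comp mG (@measurable_swap _ _ T T2)).
  - apply: measurable_funeM.
    apply: (@measurable_ge0_integral _ _ T T2 R m2 (fun x t => g t * D t x `^ s)).
      exact: (measurableT_comp mgD (@measurable_swap _ _ T T2)).
    by move=> *; rewrite mulr_ge0 ?powR_ge0.
rewrite ge0_integralZl ?lee_fin ?powR_ge0//; last 2 first.
- apply: (@measurable_ge0_integral _ _ T T2 R m2 (fun x t => g t * D t x `^ s)).
    exact: (measurableT_comp mgD (@measurable_swap _ _ T T2)).
  by move=> *; rewrite mulr_ge0 ?powR_ge0.
- by move=> x _; apply: integral_ge0 => t _; rewrite lee_fin mulr_ge0 ?powR_ge0.
rewrite -(tonelli m2 mu mgD); last by move=> *; rewrite mulr_ge0 ?powR_ge0.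
apply: (@le_trans _ _ ((B `^ (s - 1))%:E * (B * M `^ s)%:E)%E).
  apply: lee_wpmul2l; first by rewrite lee_fin powR_ge0.
  apply: (@le_trans _ _ (\int[m2]_t (M `^ s * g t)%:E)%E).
    apply: ge0_le_integral => //.
    - by move=> t _; apply: integral_ge0 => x _; rewrite lee_fin mulr_ge0 ?powR_ge0.
    - apply: (@measurable_ge0_integral _ _ T2 T R mu (fun t x => g t * D t x `^ s) mgD).
      by move=> *; rewrite mulr_ge0 ?powR_ge0.
    - by apply/measurable_EFinP; exact: measurable_funM.
    - by move=> t _; rewrite mulrC; exact: step2.
  rewrite integralZl_ge0 ?powR_ge0//.
  by rewrite mulrC EFinM lee_wpmul2l// lee_fin powR_ge0.
rewrite -EFinM lee_fin powRM// mulrA.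
by rewrite -[X in _ * X * _](powRr1 B0)// -powRD ?subrK// gt_eqF ?implybT.
Qed.

Lemma Xle_wint : (forall t x, `|G t x| <= g t * M) ->
  (forall t, Lle mu (g t * M) (G t)) ->
  (forall x, `|\int[m2]_t G t x| <= B * M) /\
  Xle mu (B * M) (fun x => \int[m2]_t G t x).
Proof.
move=> bG hG; have b x : `|\int[m2]_t G t x| <= B * M.
  rewrite -lee_fin; apply: (le_trans (le_Rintegral_normG x)).
  apply: (@le_trans _ _ (\int[m2]_t (M * g t)%:E)%E).
    apply: ge0_le_integral => //.
    - apply/measurable_EFinP/measurableT_comp => //; exact: (measurable_section2 x mG).
    - by apply/measurable_EFinP; exact: measurable_funM.
    - by move=> t _; rewrite lee_fin mulrC; exact: bG.
  rewrite integralZl_ge0//.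
  by rewrite mulrC EFinM lee_wpmul2l// lee_fin.
split => //; split; last exact: Lle_wint.
- by apply: (@measurable_fine_integral _ _ T T2 R m2 (fun x t => G t x)); exact: (measurableT_comp mG (@measurable_swap _ _ T T2)).
- exact: aeW.
Qed.

End weighted_integral.
End Ls_balls.

Section Rintegral_more.
Context d (T : measurableType d) (R : realType) (mu : {measure set T -> \bar R}).

Lemma ae_eq_Rintegral (f g : T -> R) : measurable_fun setT f -> measurable_fun setT g ->
  {ae mu, forall x, f x = g x} -> \int[mu]_x f x = \int[mu]_x g x.
Proof.
move=> mf mg fg; rewrite /Rintegral; congr fine; apply: ae_eq_integral => //.
- exact/measurable_EFinP.
- exact/measurable_EFinP.
- by apply: aeS fg => x /= ->.
Qed.

Lemma Rintegral_indic (D : set T) (f : T -> R) : measurable D ->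
  \int[mu]_(x in D) f x = \int[mu]_x (\1_D x * f x).
Proof.
move=> mD; rewrite Rintegral_mkcond; apply: eq_Rintegral => x _.
by rewrite /restrict /patch indicE; case: ifP => _; rewrite ?mul1r ?mul0r.
Qed.

Lemma le_norm_Rintegral (f g : T -> R) (C : R) : measurable_fun setT f ->
  measurable_fun setT g -> (forall x, `|f x| <= g x) ->
  (\int[mu]_x (g x)%:E <= C%:E)%E -> `|\int[mu]_x f x| <= C.
Proof.
move=> mf mg fg gC; rewrite -lee_fin.
have g0 x : 0 <= g x by apply: le_trans (fg x).
have h : (`|\int[mu]_x (f x)%:E| <= C%:E)%E.
  apply: (le_trans (le_abse_integral _ measurableT _)); first exact/measurable_EFinP.
  apply: le_trans gC; apply: ge0_le_integral => //.
  - by apply: measurableT_comp => //; exact/measurable_EFinP.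
  - exact/measurable_EFinP.
  - by move=> x _; rewrite /= lee_fin.
have iv : (\int[mu]_x (f x)%:E)%E \is a fin_num.
  by rewrite fin_num_abs (le_lt_trans h)// ltry.
by rewrite /Rintegral; move: h; case: (\int[mu]_x _)%E iv.
Qed.

Lemma integrable_dom (f g : T -> R) (C : R) : measurable_fun setT f ->
  measurable_fun setT g -> (forall x, `|f x| <= g x) ->
  (\int[mu]_x (g x)%:E <= C%:E)%E -> mu.-integrable setT (EFin \o f).
Proof.
move=> mf mg fg gC; apply: (le_Rintegrable mf fg); apply: ge0_integrable_lty => //.
- by move=> x; apply: le_trans (fg x).
- exact: le_lt_trans gC (ltry _).
Qed.

End Rintegral_more.

Section norms.
Context {R : realType} (n : nat) (s : R).
Hypotheses (n0 : (0 < n)%N) (s1 : 1 < s).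
Local Notation V := (Rn R n).
Local Notation mu := (leb R n).
Implicit Types v w : V -> R.

Lemma leb_setT_gt0 : (0 < mu setT)%E.
Proof. by rewrite leb_setT. Qed.

Lemma lnorm_ge0 r v : (0 <= lnorm r v)%E.
Proof. exact: Lnorm_ge0. Qed.

Lemma lnorm_oo_le (M : R) v : (lnorm +oo v <= M%:E)%E <-> {ae mu, forall x, `|v x| <= M}.
Proof.
(* The norm at [+oo] unfolds to an essential supremum under the condition that the space has
   positive measure. *)
rewrite /lnorm unlock /= leb_setT_gt0; split.
  by move=> /ess_supP; apply: aeS => x /=; rewrite lee_fin.
by move=> h; apply/ess_supP; apply: aeS h => x /=; rewrite lee_fin.
Qed.

(** [norm_X] adds the two norms that [Xle] bounds separately, hence [M + M]; the converse
    [norm_X_Xle] costs nothing. *)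
Lemma norm_X_le (M : R) v : 0 <= M -> Xle s mu M v -> (norm_X s v <= (M + M)%:E)%E.
Proof.
by move=> M0 [mv bv lv]; rewrite EFinD leeD//; [apply/Lle_norm|apply/lnorm_oo_le].
Qed.

Lemma norm_X_Xle (M : R) v : measurable_fun setT v -> (norm_X s v <= M%:E)%E -> Xle s mu M v.
Proof.
move=> mv h.
have M0 : 0 <= M by rewrite -lee_fin (le_trans _ h)// adde_ge0// lnorm_ge0.
split => //.
- by apply/lnorm_oo_le; apply: le_trans h; rewrite leeDr// lnorm_ge0.
- by apply/Lle_norm => //; apply: le_trans h; rewrite leeDl// lnorm_ge0.
Qed.

Lemma Xle_ex v : v \in Lfun mu s%:E -> v \in Lfun mu +oo%E ->
  exists2 M : R, 0 <= M & Xle s mu M v.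
Proof.
rewrite !inE /= => /andP[]; rewrite !inE /= /finite_norm => mv ns.
move=> /andP[_]; rewrite inE /= /finite_norm => no.
have fX : norm_X s v \is a fin_num.
  by rewrite ge0_fin_numE ?adde_ge0 ?lnorm_ge0// lte_add_pinfty.
exists (fine (norm_X s v)); first by rewrite fine_ge0// adde_ge0 ?lnorm_ge0.
by apply: norm_X_Xle => //; rewrite fineK.
Qed.

Lemma Xle_Lfun (M : R) v : 0 <= M -> Xle s mu M v ->
  v \in Lfun mu s%:E /\ v \in Lfun mu +oo%E.
Proof.
move=> M0 [mv bv lv]; split; rewrite inE; apply/andP; split; rewrite inE//=.
- by rewrite /finite_norm (@le_lt_trans _ _ M%:E) ?ltry//; apply/Lle_norm.
- by rewrite /finite_norm (@le_lt_trans _ _ M%:E) ?ltry//; apply/lnorm_oo_le.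
Qed.

(** Truncation at heights [- M] and [M]. Convolutions do not see the change of representative, and
    with a function bounded everywhere their integrands are integrable at every point. *)
Lemma Xle_rep (M : R) v : 0 <= M -> Xle s mu M v -> exists w,
  [/\ measurable_fun setT w, forall x, `|w x| <= M, {ae mu, forall x, v x = w x} &
      forall x, 0 <= v x -> 0 <= w x].
Proof.
move=> M0 [mv bv _].
exists (fun x => Num.max (- M) (Num.min (v x) M)); split.
- by apply: measurable_maxr => //; exact: measurable_minr.
- by move=> x; rewrite ler_norml le_max lexx/= ge_max ge_min lexx orbT ge0_cp.
- apply: aeS bv => x; rewrite ler_norml => /andP[h1 h2].
  by rewrite min_l// max_r.
- by move=> x v0; rewrite le_max le_min v0 M0 orbT.
Qed.

End norms.

(** * Convolution with an integrable kernel *)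

Section convolution.
Context {R : realType} (n : nat).
Local Notation V := (Rn R n).
Local Notation mu := (leb R n).
Implicit Types v w k : V -> R.

Definition conv k v (x : V) : R := \int[mu]_y (k (subp x y) * v y).

Lemma measurable_subpl (z : V) : measurable_fun setT (fun x : V => subp x z).
Proof. exact: (measurableT_comp (@measurable_subp R n) (pair2_measurable z)). Qed.

Lemma leb_subpl (f : V -> \bar R) (z : V) : measurable_fun setT f ->
  (forall y, 0 <= f y)%E -> (\int[mu]_x f (subp x z) = \int[mu]_x f x)%E.
Proof.
move=> mf f0; pose o : V := origin n.
have E x : subp x z = subp o (subp z x).
  by apply: eq_from_tnth => i; rewrite !tnth_mktuple; lra.
under eq_integral do rewrite E.
rewrite (leb_subp z (f := fun y => f (subp o y)))//; first exact: leb_subp.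
by apply: (measurableT_comp mf); exact: measurable_subpr.
Qed.

Lemma leb_subplR (f : V -> R) (z : V) : measurable_fun setT f ->
  \int[mu]_x f (subp x z) = \int[mu]_x f x.
Proof.
move=> mf; pose o : V := origin n.
have E x : subp x z = subp o (subp z x).
  by apply: eq_from_tnth => i; rewrite !tnth_mktuple; lra.
under eq_Rintegral do rewrite E.
rewrite (leb_subpR z (f := fun y => f (subp o y)))//; first exact: leb_subpR.
by apply: (measurableT_comp mf); exact: measurable_subpr.
Qed.

Lemma measurable_conv_integrand k v x : measurable_fun setT k -> measurable_fun setT v ->
  measurable_fun setT (fun y => k (subp x y) * v y).
Proof.
by move=> mk mv; apply: measurable_funM => //; apply: (measurableT_comp mk); exact: measurable_subpr.
Qed.

Lemma measurable_conv_integrand2 k v : measurable_fun setT k -> measurable_fun setT v ->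
  measurable_fun setT (fun z : V * V => k (subp z.1 z.2) * v z.2).
Proof.
move=> mk mv; apply: measurable_funM; first exact: (measurableT_comp mk (@measurable_subp R n)).
exact: measurableT_comp.
Qed.

Lemma measurable_conv k v : measurable_fun setT k -> measurable_fun setT v ->
  measurable_fun setT (conv k v).
Proof.
move=> mk mv.
exact: (@measurable_fine_integral _ _ V V R mu (fun x y => k (subp x y) * v y)
  (measurable_conv_integrand2 mk mv)).
Qed.

(** Moves the translation onto [v], the form to which Minkowski's integral inequality [Lle_wint]
    applies. *)
Lemma convE k v x : measurable_fun setT k -> measurable_fun setT v ->
  conv k v x = \int[mu]_z (k z * v (subp x z)).
Proof.
move=> mk mv; rewrite /conv -(leb_subpR x (f := fun z => k z * v (subp x z))).
  by apply: eq_Rintegral => y _; rewrite subpK.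
by apply: measurable_funM => //; apply: (measurableT_comp mv); exact: measurable_subpr.
Qed.

Lemma conv_ae k v w x : measurable_fun setT k -> measurable_fun setT v ->
  measurable_fun setT w -> {ae mu, forall y, v y = w y} -> conv k v x = conv k w x.
Proof.
move=> mk mv mw vw; apply: ae_eq_Rintegral; try exact: measurable_conv_integrand.
by apply: aeS vw => y ->.
Qed.

Lemma conv_ge0 k v x : (forall y, 0 <= k y) -> measurable_fun setT k ->
  measurable_fun setT v -> {ae mu, forall y, 0 <= v y} -> 0 <= conv k v x.
Proof.
move=> k0 mk mv v0.
have mw : measurable_fun setT (fun y => Num.max 0 (v y)) by exact: measurable_maxr.
rewrite (@conv_ae k v (fun y => Num.max 0 (v y)))//.
  by apply: Rintegral_ge0 => y _; rewrite mulr_ge0// le_max lexx.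
by apply: aeS v0 => y h; rewrite max_r.
Qed.

Section bounds.
Variables (s : R) (k : V -> R) (B : R).
Hypotheses (s1 : 1 < s) (mk : measurable_fun setT k) (B0 : 0 <= B)
  (kB : (\int[mu]_x `|k x|%:E <= B%:E)%E).

Let mnk : measurable_fun setT (fun x => `|k x|).
Proof. by apply: measurableT_comp => //; exact: normr_measurable. Qed.

Lemma integral_kernel_trans (x : V) (M : R) : 0 <= M ->
  (\int[mu]_y (`|k (subp x y)| * M)%:E <= (B * M)%:E)%E.
Proof.
move=> M0; under eq_integral do rewrite mulrC.
rewrite integralZl_ge0//; last exact: (measurableT_comp mnk (measurable_subpr x)).
rewrite (leb_subp x (f := fun y => `|k y|%:E))//; last exact/measurable_EFinP.
by rewrite mulrC EFinM lee_wpmul2l// lee_fin.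
Qed.

Lemma conv_integrable v (x : V) (M : R) : measurable_fun setT v ->
  (forall y, `|v y| <= M) -> mu.-integrable setT (fun y => (k (subp x y) * v y)%:E).
Proof.
move=> mv vM; have M0 : 0 <= M by apply: le_trans (vM (origin n)).
apply: (@integrable_dom _ _ _ _ _ (fun y => `|k (subp x y)| * M) (B * M)).
- exact: measurable_conv_integrand.
- by apply: measurable_funM => //; exact: (measurableT_comp mnk (measurable_subpr x)).
- by move=> y; rewrite normrM ler_wpM2l.
- exact: integral_kernel_trans.
Qed.

Lemma conv_bound v (x : V) (M : R) : measurable_fun setT v ->
  (forall y, `|v y| <= M) -> `|conv k v x| <= B * M.
Proof.
move=> mv vM; have M0 : 0 <= M by apply: le_trans (vM (origin n)).
apply: (@le_norm_Rintegral _ _ _ _ _ (fun y => `|k (subp x y)| * M)).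
- exact: measurable_conv_integrand.
- by apply: measurable_funM => //; exact: (measurableT_comp mnk (measurable_subpr x)).
- by move=> y; rewrite normrM ler_wpM2l.
- exact: integral_kernel_trans.
Qed.

Lemma conv_Lle v (M : R) : 0 <= M -> measurable_fun setT v -> Lle s mu M v ->
  Lle s mu (B * M) (conv k v).
Proof.
move=> M0 mv lv.
have -> : conv k v = fun x => \int[mu]_z (k z * v (subp x z)).
  by apply/funext => x; exact: convE.
apply: (@Lle_wint _ _ s1 _ _ mu _ _ mu (fun z => `|k z|) (fun z x => k z * v (subp x z))) => //.
- apply: measurable_funM; first exact: measurableT_comp.
  by apply: (measurableT_comp mv); exact: (measurableT_comp (@measurable_subp R n) (@measurable_swap _ _ V V)).
- by move=> z x /normr0_eq0 ->; rewrite mul0r.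
- move=> z; apply: Lle_scale; [exact: (measurableT_comp mv (measurable_subpl z))|exact: M0|].
  rewrite /Lle (leb_subpl (f := fun x => (`|v x| `^ s)%:E))//.
    by apply/measurable_EFinP; exact: measurable_absX.
Qed.

(** Young's inequality for an L^1 kernel. The uniform bound is obtained at every point although [v]
    is only essentially bounded, by passing to the representative of [Xle_rep]. *)
Lemma conv_Xle v (M : R) : 0 <= M -> Xle s mu M v ->
  (forall x, `|conv k v x| <= B * M) /\ Xle s mu (B * M) (conv k v).
Proof.
move=> M0 Xv; have [w [mw wM vw _]] := Xle_rep M0 Xv; have [mv bv lv] := Xv.
have b x : `|conv k v x| <= B * M.
  by rewrite (conv_ae x mk mv mw vw); exact: conv_bound.
split => //; split; [exact: measurable_conv|exact: aeW|exact: conv_Lle].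
Qed.

Lemma convB v w (M M' : R) x : 0 <= M -> 0 <= M' -> Xle s mu M v -> Xle s mu M' w ->
  conv k (v \- w) x = conv k v x - conv k w x.
Proof.
move=> M0 M0' Xv Xw.
have [v' [mv' vM vv' _]] := Xle_rep M0 Xv; have [w' [mw' wM ww' _]] := Xle_rep M0' Xw.
have [mv _ _] := Xv; have [mw _ _] := Xw.
rewrite (conv_ae x mk mv mv' vv') (conv_ae x mk mw mw' ww').
rewrite (@conv_ae k (v \- w) (v' \- w'))//; try exact: measurable_funB.
  rewrite /conv -RintegralB//; last 2 first.
  - exact: conv_integrable vM.
  - exact: conv_integrable wM.
  by apply: eq_Rintegral => y _; rewrite /= mulrBr.
by apply: aeS2 vv' ww' => y /= -> ->.
Qed.

Lemma convD v w (M M' : R) x : 0 <= M -> 0 <= M' -> Xle s mu M v -> Xle s mu M' w ->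
  conv k (v \+ w) x = conv k v x + conv k w x.
Proof.
move=> M0 M0' Xv Xw.
have [v' [mv' vM vv' _]] := Xle_rep M0 Xv; have [w' [mw' wM ww' _]] := Xle_rep M0' Xw.
have [mv _ _] := Xv; have [mw _ _] := Xw.
rewrite (conv_ae x mk mv mv' vv') (conv_ae x mk mw mw' ww').
rewrite (@conv_ae k (v \+ w) (v' \+ w'))//; try exact: measurable_funD.
  rewrite /conv -RintegralD//; last 2 first.
  - exact: conv_integrable vM.
  - exact: conv_integrable wM.
  by apply: eq_Rintegral => y _; rewrite /= mulrDr.
by apply: aeS2 vv' ww' => y /= -> ->.
Qed.

(** Lets the semigroup act under the time integral of a Duhamel term. *)
Lemma conv_Rintegral d2 (T2 : measurableType d2) (m2 : {sigma_finite_measure set T2 -> \bar R})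
    (g : T2 -> R) (G : T2 -> V -> R) (C : R) x :
  measurable_fun setT g -> measurable_fun setT (fun z : T2 * V => G z.1 z.2) ->
  (forall t y, `|G t y| <= g t) -> (\int[m2]_t (g t)%:E <= C%:E)%E ->
  conv k (fun y => \int[m2]_t G t y) x = \int[m2]_t conv k (G t) x.
Proof.
move=> mg mG gG gC.
have g0 t : 0 <= g t by apply: le_trans (gG t (origin n)).
have C0 : 0 <= C by rewrite -lee_fin (le_trans _ gC)// integral_ge0// => t _; rewrite lee_fin.
have iG y : m2.-integrable setT (fun t => (G t y)%:E).
  by apply: (integrable_dom _ mg _ gC) => //; exact: (measurable_section2 y mG).
have mkx : measurable_fun setT (fun y => k (subp x y)) by exact: (measurableT_comp mk (measurable_subpr x)).
transitivity (\int[mu]_y \int[m2]_t (k (subp x y) * G t y)).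
  by apply: eq_Rintegral => y _; rewrite RintegralZl//; exact: iG.
apply: (@RFubini _ _ V T2 R mu m2 (fun y t => k (subp x y) * G t y)
  (fun y t => `|k (subp x y)| * g t) (B * C)).
- apply: measurable_funM; first exact: (measurableT_comp mkx).
  exact: (measurableT_comp mG (@measurable_swap _ _ V T2)).
- apply: measurable_funM; last exact: (measurableT_comp mg).
  by apply: (measurableT_comp (measurableT_comp mnk (measurable_subpr x))).
- by move=> y t; rewrite normrM ler_wpM2l.
- apply: le_trans (integral_kernel_trans x C0); apply: ge0_le_integral => //.
  + by move=> y _; apply: integral_ge0 => t _; rewrite lee_fin mulr_ge0.
  + apply: (@measurable_ge0_integral _ _ V T2 R m2 (fun y t => `|k (subp x y)| * g t)).
      apply: measurable_funM; last exact: (measurableT_comp mg).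
      by apply: (measurableT_comp (measurableT_comp mnk (measurable_subpr x))).
    by move=> *; rewrite mulr_ge0.
  + apply/measurable_EFinP; apply: measurable_funM => //.
    exact: (measurableT_comp mnk (measurable_subpr x)).
  + move=> y _; rewrite integralZl_ge0// EFinM; exact: lee_wpmul2l.
- by move=> y; exact: (RintegrableZl _ (iG y)).
- by move=> t; apply: (conv_integrable _ _ (gG t)); exact: (measurable_section1 t mG).
Qed.

End bounds.

Lemma conv_kernelB s k k' v (B B' M : R) x :
  measurable_fun setT k -> measurable_fun setT k' -> 0 <= M ->
  (\int[mu]_x `|k x|%:E <= B%:E)%E -> (\int[mu]_x `|k' x|%:E <= B'%:E)%E ->
  Xle s mu M v -> conv (k \- k') v x = conv k v x - conv k' v x.
Proof.
move=> mk mk' M0 kB kB' Xv.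
have [w [mw wM vw _]] := Xle_rep M0 Xv; have [mv _ _] := Xv.
rewrite !(conv_ae x _ mv mw vw)//; last exact: measurable_funB.
rewrite /conv -RintegralB//; last 2 first.
- exact: (conv_integrable mk kB x mw wM).
- exact: (conv_integrable mk' kB' x mw wM).
by apply: eq_Rintegral => y _; rewrite /= mulrBl.
Qed.

End convolution.

Lemma measurable_comp2 d0 d1 d2 d3 (T0 : measurableType d0) (T1 : measurableType d1)
    (T2 : measurableType d2) (T3 : measurableType d3) (F : T1 -> T2 -> T3)
    (f : T0 -> T1) (g : T0 -> T2) :
  measurable_fun setT (fun z : T1 * T2 => F z.1 z.2) ->
  measurable_fun setT f -> measurable_fun setT g ->
  measurable_fun setT (fun z => F (f z) (g z)).
Proof. by move=> mF mf mg; exact: (measurableT_comp mF (measurable_fun_pair mf mg)). Qed.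

(** * Time integrals, the semigroup and the Duhamel term *)

Section shift.
Context {R : realType}.
Local Notation mu1 := (@lebesgue_measure R).

Lemma leb1_shift (f : measurableTypeR R -> \bar R) (a : R) : measurable_fun setT f ->
  (forall y, 0 <= f y)%E -> (\int[mu1]_y f (a + y)%R = \int[mu1]_y f y)%E.
Proof.
move=> mf f0; rewrite -(leb1_reflect a mf f0).
have mfa : measurable_fun setT (fun y : measurableTypeR R => f (a - y)).
  by apply: (measurableT_comp mf); exact: measurable_funB.
rewrite -(leb1_reflect 0 mfa)//; apply: eq_integral => y _.
by rewrite sub0r opprK.
Qed.

Lemma leb1_shiftR (f : measurableTypeR R -> R) (a : R) : measurable_fun setT f ->
  \int[mu1]_y f (a + y) = \int[mu1]_y f y.
Proof.
move=> mf; rewrite /Rintegral; congr fine.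
have mf' : measurable_fun setT (EFin \o f) by exact/measurable_EFinP.
rewrite [LHS]integralE [RHS]integralE; congr (_ - _)%E.
  rewrite -(leb1_shift a (measurable_funepos mf'))//.
  by apply: eq_integral => y _; rewrite /= !funeposE.
rewrite -(leb1_shift a (measurable_funeneg mf'))//.
by apply: eq_integral => y _; rewrite /= !funenegE.
Qed.

(* The indicator of ]0, t[, written so that joint measurability in (t, r) is clear. *)
Definition win (t r : R) : R :=
  \1_(`]0, +oo[%classic : set R) r * \1_(`]0, +oo[%classic : set R) (t - r).

Lemma winE t r : win t r = \1_(`]0, t[%classic : set R) r.
Proof.
rewrite /win !indicE -natrM mulnb; congr ((nat_of_bool _)%:R).
by rewrite !mem_setE /= !in_itv/= !andbT subr_gt0.
Qed.

Lemma win_ge0 t r : 0 <= win t r. Proof. by rewrite winE. Qed.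

Lemma win_le1 t r : win t r <= 1. Proof. by rewrite winE indicE lern1 leq_b1. Qed.

Lemma winP t r : (0 < r < t /\ win t r = 1) \/ (~~ (0 < r < t) /\ win t r = 0).
Proof.
rewrite winE indicE mem_setE /= in_itv /=; case: (0 < r < t); [by left|by right].
Qed.

Lemma measurable_win : measurable_fun setT
  (fun z : measurableTypeR R * measurableTypeR R => win z.1 z.2).
Proof.
have mi : measurable_fun setT (\1_(`]0, +oo[%classic : set R) : R -> R) by exact: measurable_indic.
apply: measurable_funM; first exact: (measurableT_comp mi).
by apply: (measurableT_comp mi); exact: measurable_funB.
Qed.

Lemma integral_win (t : R) : 0 <= t -> (\int[mu1]_r (win t r)%:E = t%:E)%E.
Proof.
move=> t0; under eq_integral do rewrite winE -[\1_ _ _]mulr1.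
rewrite -integral_mkcond_indic; last exact: measurable_itv.
by rewrite integral_cst//= lebesgue_measure_itv/= lte_fin mul1e; case: ltgtP t0 => // [|<-]; rewrite ?sube0 ?oppr0 ?adde0.
Qed.

End shift.

(** The properties of the kernel on which the evolution problem rests. [hk_bdd] serves Fubini's
    theorem in the semigroup law [SS], [hk_L1] gives continuity at positive times, and [hk_conc]
    continuity at time 0. *)
Record heat_kernel {R : realType} {n : nat} (K : Rn R n -> R -> R) : Prop := HeatKernel {
  hk_meas : measurable_fun setT (fun z : Rn R n * measurableTypeR R => K z.1 z.2);
  hk_ge0 : forall x t, 0 < t -> 0 <= K x t;
  hk_bdd : forall t, 0 < t -> exists C : R, forall x, `|K x t| <= C;
  hk_int : forall t, 0 < t -> (\int[leb R n]_x (K x t)%:E = 1%:E)%E;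
  hk_sym : forall x y t, K (subp x y) t = K (subp y x) t;
  hk_semi : forall x t r, 0 < t -> 0 < r ->
    \int[leb R n]_y (K (subp x y) t * K y r) = K x (t + r);
  hk_L1 : forall t0 : R, 0 < t0 ->
    \int[leb R n]_x `|K x t - K x t0| @[t --> within [set t | 0 < t] (nbhs t0)] --> (0 : R);
  hk_conc : forall d : R, 0 < d ->
    \int[leb R n]_x (K x t * (1 - gaussn d x)) @[t --> within [set t | 0 < t] (nbhs (0 : R))]
      --> (0 : R) }.

Section semigroup.
Context {R : realType} (n : nat) (s : R) (K : Rn R n -> R -> R).
Hypotheses (n0 : (0 < n)%N) (s1 : 1 < s) (hK : heat_kernel K).
Local Notation V := (Rn R n).
Local Notation mu := (leb R n).
Local Notation mu1 := (@lebesgue_measure R).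
Implicit Types v w : V -> R.

Definition semig (t : R) v : V -> R := conv (K^~ t) v.
Local Notation S := semig.

Lemma measurable_hk t : measurable_fun setT (K^~ t : V -> R).
Proof. exact: (measurableT_comp (hk_meas hK) (pair2_measurable t)). Qed.

Lemma hk_norm t : 0 < t -> (\int[mu]_x `|K x t|%:E <= 1%:E)%E.
Proof.
move=> t0; rewrite -(hk_int hK t0) le_eqVlt; apply/orP; left; apply/eqP.
by apply: eq_integral => x _; rewrite ger0_norm//; exact: hk_ge0.
Qed.

Lemma S_Xle t (M : R) v : 0 < t -> 0 <= M -> Xle s mu M v ->
  (forall x, `|S t v x| <= M) /\ Xle s mu M (S t v).
Proof.
move=> t0 M0 Xv; have := conv_Xle s1 (measurable_hk t) ler01 (hk_norm t0) M0 Xv.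
by rewrite mul1r.
Qed.

Lemma S_ae t v w x : measurable_fun setT v -> measurable_fun setT w ->
  {ae mu, forall y, v y = w y} -> S t v x = S t w x.
Proof. by move=> mv mw; apply: conv_ae => //; exact: measurable_hk. Qed.

Lemma S_ge0 t v x : 0 < t -> measurable_fun setT v -> {ae mu, forall y, 0 <= v y} ->
  0 <= S t v x.
Proof.
by move=> t0 mv v0; apply: conv_ge0 => // [y|]; [exact: hk_ge0|exact: measurable_hk].
Qed.

Lemma S_sub t v w (M M' : R) x : 0 < t -> 0 <= M -> 0 <= M' ->
  Xle s mu M v -> Xle s mu M' w -> S t (v \- w) x = S t v x - S t w x.
Proof. by move=> t0; apply: convB; [exact: measurable_hk|exact: hk_norm]. Qed.

Lemma S_add t v w (M M' : R) x : 0 < t -> 0 <= M -> 0 <= M' ->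
  Xle s mu M v -> Xle s mu M' w -> S t (v \+ w) x = S t v x + S t w x.
Proof. by move=> t0; apply: convD; [exact: measurable_hk|exact: hk_norm]. Qed.

(** The difference is the convolution of [v] with [K t - K r], so continuity in time for both norms
    at once reduces to continuity of the kernel in L^1. *)
Lemma S_diff t r (M : R) v : 0 < t -> 0 < r -> 0 <= M -> Xle s mu M v ->
  Xle s mu ((\int[mu]_x `|K x t - K x r|) * M) (S t v \- S r v).
Proof.
move=> t0 r0 M0 Xv; set w := \int[mu]_x _.
have mtr : measurable_fun setT (fun x => `|K x t - K x r|).
  by apply: measurableT_comp => //; apply: measurable_funB; exact: measurable_hk.
have iB : (\int[mu]_x (`|K x t - K x r|)%:E <= (1 + 1)%:E)%E.
  rewrite EFinD; apply: (le_trans _ (leeD (hk_norm t0) (hk_norm r0))).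
  rewrite -ge0_integralD//; last 2 first.
  - by apply/measurable_EFinP/measurableT_comp => //; exact: measurable_hk.
  - by apply/measurable_EFinP/measurableT_comp => //; exact: measurable_hk.
  apply: ge0_le_integral => //.
  - exact/measurable_EFinP.
  - by apply: emeasurable_funD; apply/measurable_EFinP/measurableT_comp => //; exact: measurable_hk.
  - by move=> x _; rewrite -EFinD lee_fin ler_normB.
have wE : (\int[mu]_x `|K x t - K x r|%:E <= w%:E)%E.
  rewrite /w RintegralK//; apply: ge0_integrable_lty => //.
  by apply: le_lt_trans iB _; rewrite ltry.
have w0 : 0 <= w by apply: Rintegral_ge0.
have mk : measurable_fun setT ((K^~ t) \- (K^~ r) : V -> R).
  by apply: measurable_funB; exact: measurable_hk.
have [_] := conv_Xle s1 mk w0 wE M0 Xv; congr Xle; apply/funext => x.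
by rewrite (conv_kernelB x (measurable_hk t) (measurable_hk r) M0 (hk_norm t0) (hk_norm r0) Xv).
Qed.

(** For the bounded representative [w] of [v], Fubini reduces the law to [hk_semi], after a
    translation by [z] in the inner integral. *)
Lemma SS t r (M : R) v x : 0 < t -> 0 < r -> 0 <= M -> Xle s mu M v ->
  S t (S r v) x = S (t + r) v x.
Proof.
move=> t0 r0 M0 Xv; have [w [mw wM vw _]] := Xle_rep M0 Xv.
have [mv _ _] := Xv.
have mkr := measurable_hk r; have mkt := measurable_hk t.
have -> : S r v = S r w by apply/funext => y; exact: S_ae.
rewrite (S_ae _ _ mv mw vw) {mv vw Xv}.
have mtx : measurable_fun setT (fun y => K (subp x y) t) by exact: (measurableT_comp mkt (measurable_subpr x)).
have mry : measurable_fun setT (fun z : V * V => K (subp z.1 z.2) r) by exact: (measurableT_comp mkr (@measurable_subp R n)).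
have int1 y : (\int[mu]_z (K (subp y z) r)%:E = 1%:E)%E.
  rewrite (leb_subp y (f := fun z => (K z r)%:E)) ?hk_int//; first exact/measurable_EFinP.
  by move=> z; rewrite lee_fin hk_ge0.
have int1' : (\int[mu]_z (K (subp x z) t)%:E = 1%:E)%E.
  rewrite (leb_subp x (f := fun z => (K z t)%:E)) ?hk_int//; first exact/measurable_EFinP.
  by move=> z; rewrite lee_fin hk_ge0.
have ir y : mu.-integrable setT (fun z => (K (subp y z) r * w z)%:E).
  exact: (conv_integrable mkr (hk_norm r0) y mw wM).
have mg : measurable_fun setT (fun z : V * V => K (subp x z.1) t * (M * K (subp z.1 z.2) r)).
  apply: measurable_funM; first exact: (measurableT_comp mtx).
  exact: measurable_funM.
transitivity (\int[mu]_y \int[mu]_z (K (subp x y) t * (K (subp y z) r * w z))).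
  by apply: eq_Rintegral => y _; rewrite RintegralZl//; exact: ir.
rewrite (@RFubini _ _ V V R mu mu (fun y z => K (subp x y) t * (K (subp y z) r * w z))
  (fun y z => K (subp x y) t * (M * K (subp y z) r)) M); first last.
- move=> z; have [C hC] := hk_bdd hK r0.
  apply: (conv_integrable mkt (hk_norm t0) x (M := C * M) (v := fun y => K (subp y z) r * w z)).
    by apply: measurable_funM => //; exact: (measurableT_comp mkr (measurable_subpl z)).
  by move=> y; rewrite normrM ler_pM.
- by move=> y; exact: (RintegrableZl _ (ir y)).
- have -> : (\int[mu]_y \int[mu]_z (K (subp x y) t * (M * K (subp y z) r))%:E =
      \int[mu]_y (M * K (subp x y) t)%:E)%E.
    apply: eq_integral => y _.
    have my : measurable_fun setT (fun z => K (subp y z) r) by exact: (measurableT_comp mkr (measurable_subpr y)).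
    rewrite integralZl_ge0 ?hk_ge0//; first last.
    + by move=> z; rewrite mulr_ge0 ?hk_ge0.
    + exact: measurable_funM.
    rewrite integralZl_ge0//; last by move=> z; rewrite hk_ge0.
    by rewrite int1 mule1 -EFinM mulrC.
  rewrite integralZl_ge0//; last by move=> z; rewrite hk_ge0.
  by rewrite int1' mule1.
- move=> y z; rewrite !normrM ger0_norm ?hk_ge0// ler_wpM2l ?hk_ge0//.
  by rewrite (mulrC M) ger0_norm ?hk_ge0// ler_wpM2l ?hk_ge0.
- exact: mg.
- apply: measurable_funM; first exact: (measurableT_comp mtx).
  by apply: measurable_funM => //; exact: (measurableT_comp mw).
apply: eq_Rintegral => z _.
transitivity (w z * \int[mu]_y (K (subp x y) t * K (subp y z) r)).
  rewrite -RintegralZl//; first by apply: eq_Rintegral => y _; lra.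
  have [C hC] := hk_bdd hK r0.
  apply: (conv_integrable mkt (hk_norm t0) x (M := C) (v := fun y => K (subp y z) r)) => //.
  exact: (measurableT_comp mkr (measurable_subpl z)).
rewrite mulrC; congr (_ * _).
rewrite -(hk_semi hK (subp x z) t0 r0).
rewrite -(leb_subplR (f := fun y => K (subp (subp x z) y) t * K y r) z); last first.
  by apply: measurable_funM => //; exact: (measurableT_comp mkt (measurable_subpr _)).
apply: eq_Rintegral => y _; congr (K _ _ * _).
by apply: eq_from_tnth => i; rewrite !tnth_mktuple; lra.
Qed.

(** The time, the point and the function may all depend on the parameter, which is the case in the
    Duhamel integrand. *)
Lemma measurable_S_family d (T : measurableType d) (a : T -> measurableTypeR R) (b : T -> V)
    (F : T -> V -> R) : measurable_fun setT a -> measurable_fun setT b ->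
  measurable_fun setT (fun z : T * V => F z.1 z.2) ->
  measurable_fun setT (fun z => S (a z) (F z) (b z)).
Proof.
move=> ma mb mF.
apply: (@measurable_fine_integral _ _ T V R mu (fun z y => K (subp (b z) y) (a z) * F z y)).
apply: measurable_funM => //.
apply: (measurable_comp2 (F := K) (hk_meas hK)); last exact: (measurableT_comp ma).
by apply: (measurable_comp2 (F := @subp R n) (@measurable_subp R n)) => //; exact: (measurableT_comp mb).
Qed.

Section duhamel_int.
Variable f : R -> V -> R.
Hypothesis mf : measurable_fun setT (fun z : measurableTypeR R * V => f z.1 z.2).

(** The factor [win t r] stands for the domain []0, t[] and annihilates the values of the kernel at
    times [t - r <= 0], about which nothing is known. *)
Definition duhamel_int (t : R) (x : V) : R := \int[mu1]_r (win t r * S (t - r) (f r) x).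

Lemma measurable_duhamel_integrand : measurable_fun setT
  (fun z : (measurableTypeR R * V) * measurableTypeR R =>
     win z.1.1 z.2 * S (z.1.1 - z.2) (f z.2) z.1.2).
Proof.
apply: measurable_funM.
  apply: (measurable_comp2 (F := win : measurableTypeR R -> measurableTypeR R -> R) measurable_win) => //.
  exact: measurableT_comp.
apply: (measurable_S_family (a := fun z : (measurableTypeR R * V) * measurableTypeR R => z.1.1 - z.2)
  (b := fun z => z.1.2) (F := fun z => f z.2)).
- by apply: measurable_funB => //; exact: measurableT_comp.
- exact: measurableT_comp.
- apply: (measurable_comp2 (F := f : measurableTypeR R -> V -> R) mf) => //.
  exact: measurableT_comp.
Qed.

Lemma measurable_duhamel : measurable_fun setT
  (fun z : measurableTypeR R * V => duhamel_int z.1 z.2).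
Proof.
exact: (@measurable_fine_integral _ _ (measurableTypeR R * V)%type (measurableTypeR R) R mu1
  (fun z r => win z.1 r * S (z.1 - r) (f r) z.2) measurable_duhamel_integrand).
Qed.

Lemma measurable_duhamel_at t : measurable_fun setT
  (fun z : measurableTypeR R * V => win t z.1 * S (t - z.1) (f z.1) z.2).
Proof.
apply: (measurable_comp2 (T1 := (measurableTypeR R * V)%type) (T2 := measurableTypeR R)
  (F := fun z r => win z.1 r * S (z.1 - r) (f r) z.2)
  (f := fun z : measurableTypeR R * V => (t : measurableTypeR R, z.2)) measurable_duhamel_integrand) => //.
exact: measurable_fun_pair.
Qed.

Lemma measurable_duhamel_at1 t x : measurable_fun setT
  (fun r : measurableTypeR R => win t r * S (t - r) (f r) x).
Proof. exact: (measurableT_comp (measurable_duhamel_at t) (pair2_measurable x)). Qed.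

Variables (g : R -> R) (t B : R).
Hypotheses (mg : measurable_fun setT (g : measurableTypeR R -> R)) (g0 : forall r, 0 <= g r)
  (gB : (\int[mu1]_r (win t r * g r)%:E <= B%:E)%E) (B0 : 0 <= B)
  (fg : forall r, 0 < r < t -> Xle s mu (g r) (f r)).

Let mwg : measurable_fun setT (fun r : measurableTypeR R => win t r * g r).
Proof.
by apply: measurable_funM => //; exact: (measurableT_comp measurable_win (pair1_measurable t)).
Qed.

Lemma duhamel_integrand_le r x : `|win t r * S (t - r) (f r) x| <= win t r * g r.
Proof.
have [[/andP[r0 rt] ->]|[_ ->]] := winP t r; last by rewrite !mul0r normr0.
by rewrite !mul1r; apply: (S_Xle _ _ (fg _)).1; rewrite ?subr_gt0 ?r0.
Qed.

(** Minkowski's inequality in time, [S] being a contraction. The weight [g] may vary with time: a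
    constant is used for existence, an exponential for uniqueness. *)
Lemma duhamel_Xle : (forall x, `|duhamel_int t x| <= B) /\ Xle s mu B (duhamel_int t).
Proof.
have := @Xle_wint _ _ s1 _ _ mu _ _ mu1 (fun r => win t r * g r)
  (fun r x => win t r * S (t - r) (f r) x) B 1 mwg _ B0 ler01 gB (measurable_duhamel_at t).
rewrite mulr1; apply.
- by move=> r; rewrite mulr_ge0 ?win_ge0.
- by move=> r x h; apply/eqP; rewrite -normr_le0 -h; exact: duhamel_integrand_le.
- by move=> r x; rewrite mulr1; exact: duhamel_integrand_le.
- move=> r; have [[/andP[r0 rt] ->]|[_ ->]] := winP t r.
    have rrt : 0 < r < t by rewrite r0.
    have tr0 : 0 < t - r by rewrite subr_gt0.
    have [_ [_ _]] := S_Xle tr0 (g0 r) (fg rrt).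
    by rewrite mul1r mulr1; congr Lle; apply/funext => x; rewrite mul1r.
  have [_ _] := @Xle0 _ s s1 _ _ mu; rewrite mul0r mul0r; congr Lle; apply/funext => x.
  by rewrite mul0r.
Qed.

Lemma duhamel_integrable x :
  mu1.-integrable `]0, t[ (EFin \o (fun r => S (t - r) (f r) x)).
Proof.
apply/integrable_mkcond; first exact: measurable_itv.
have := @integrable_dom _ _ _ mu1 _ _ B (measurable_duhamel_at1 t x) mwg
  (fun r => duhamel_integrand_le r x) gB.
congr (mu1.-integrable setT); apply/funext => r.
by rewrite /restrict /patch /= winE indicE; case: ifP => _; rewrite ?mul1r ?mul0r.
Qed.

Lemma duhamelE x : duhamel_int t x = \int[mu1]_(r in `]0, t[) S (t - r) (f r) x.
Proof.
rewrite Rintegral_indic; last exact: measurable_itv.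
by apply: eq_Rintegral => r _; rewrite winE.
Qed.

Lemma S_duhamel h x : 0 < h ->
  S h (duhamel_int t) x = \int[mu1]_r (win t r * S (t + h - r) (f r) x).
Proof.
move=> h0; rewrite /semig /duhamel_int.
rewrite (conv_Rintegral (measurable_hk h) (hk_norm h0) x mwg (measurable_duhamel_at t)
  duhamel_integrand_le gB).
apply: eq_Rintegral => r _.
have [[/andP[r0 rt] ->]|[_ ->]] := winP t r; last first.
  by rewrite mul0r /conv /Rintegral; under eq_integral do rewrite mul0r mulr0; rewrite integral0.
have rrt : 0 < r < t by rewrite r0.
have tr0 : 0 < t - r by rewrite subr_gt0.
rewrite mul1r; have -> : (fun y => 1 * S (t - r) (f r) y) = S (t - r) (f r).
  by apply/funext => y; rewrite mul1r.
have := SS x h0 tr0 (g0 r) (fg rrt); rewrite /semig => ->.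
by rewrite addrCA addrA.
Qed.

End duhamel_int.
End semigroup.

(** * Strong continuity of the semigroup at time 0 *)

Section strong_continuity.
Context {R : realType} (n : nat) (K : Rn R n -> R -> R).
Hypothesis hK : heat_kernel K.
Local Notation V := (Rn R n).
Local Notation mu := (leb R n).
Local Notation S := (semig K).
Implicit Types f g : V -> R.

Definition bdd_meas f := measurable_fun setT f /\ exists C : R, forall x, `|f x| <= C.

Lemma bdd_meas_lin a b f g : bdd_meas f -> bdd_meas g -> bdd_meas (fun y => a * f y + b * g y).
Proof.
move=> [mf [C fC]] [mg [D gD]]; split.
  by apply: measurable_funD; exact: measurable_funM.
exists (`|a| * C + `|b| * D) => x.
by rewrite (le_trans (ler_normD _ _))// !normrM lerD// ler_wpM2l.
Qed.

Lemma bdd_meas_indic (A : set V) : measurable A -> bdd_meas (\1_A : V -> R).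
Proof.
move=> mA; split; first exact: measurable_indic.
by exists 1 => x; rewrite ger0_norm// indicE lern1 leq_b1.
Qed.

Lemma bdd_meas_norm f : bdd_meas f -> bdd_meas (fun y => `|f y|).
Proof.
move=> [mf [C fC]]; split; first exact: measurableT_comp.
by exists C => x; rewrite normr_id.
Qed.

Lemma bdd_meas_cst c : bdd_meas (fun=> c).
Proof. by split => //; exists `|c|. Qed.

Lemma bdd_meas_integrable t f x : 0 < t -> bdd_meas f ->
  mu.-integrable setT (fun y => (K (subp x y) t * f y)%:E).
Proof.
move=> t0 [mf [C fC]].
exact: (conv_integrable (measurable_hk hK t) (hk_norm hK t0) x mf fC).
Qed.

Lemma bdd_meas_S t f : 0 < t -> bdd_meas f -> bdd_meas (S t f).
Proof.
move=> t0 [mf [C fC]]; split; first exact: (measurable_conv (measurable_hk hK t)).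
exists C => x; rewrite -[leRHS]mul1r.
exact: (conv_bound (measurable_hk hK t) (hk_norm hK t0) x mf fC).
Qed.

Lemma S_lin t a b f g x : 0 < t -> bdd_meas f -> bdd_meas g ->
  S t (fun y => a * f y + b * g y) x = a * S t f x + b * S t g x.
Proof.
move=> t0 bf bg; rewrite /semig /conv -!RintegralZl//; try exact: bdd_meas_integrable.
rewrite -RintegralD//; try (by apply: RintegrableZl; exact: bdd_meas_integrable).
by apply: eq_Rintegral => y _; rewrite mulrDr; congr (_ + _); rewrite mulrCA.
Qed.

Lemma S_one t x : 0 < t -> S t (fun=> 1) x = 1.
Proof.
move=> t0; rewrite /semig /conv; under eq_Rintegral do rewrite mulr1.
rewrite (leb_subpR x (f := fun y => K y t)); last exact: measurable_hk.
by rewrite /Rintegral hk_int.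
Qed.

Lemma S_le t f g x : 0 < t -> bdd_meas f -> bdd_meas g -> (forall y, f y <= g y) -> S t f x <= S t g x.
Proof.
move=> t0 bf bg fg; apply: le_Rintegral => //; try exact: bdd_meas_integrable.
by move=> y _; rewrite ler_wpM2l// hk_ge0.
Qed.

Lemma S_norm_le t f x : 0 < t -> bdd_meas f -> `|S t f x| <= S t (fun y => `|f y|) x.
Proof.
move=> t0 bf; apply: (le_trans (le_normr_Rintegral _ _)) => //; first exact: bdd_meas_integrable.
rewrite le_eqVlt; apply/orP; left; apply/eqP; apply: eq_Rintegral => y _.
by rewrite normrM ger0_norm// hk_ge0.
Qed.

Lemma integral_S t f : 0 < t -> bdd_meas f -> (forall y, 0 <= f y) ->
  (\int[mu]_x (S t f x)%:E = \int[mu]_x (f x)%:E)%E.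
Proof.
move=> t0 bf f0; have [mf _] := bf.
transitivity (\int[mu]_x \int[mu]_y (K (subp x y) t * f y)%:E)%E.
  by apply: eq_integral => x _; rewrite -RintegralK//; exact: bdd_meas_integrable.
have mk := measurable_hk hK t.
rewrite (@tonelli _ _ _ _ _ mu mu (fun x y => K (subp x y) t * f y)); first last.
- by move=> x y; rewrite mulr_ge0// hk_ge0.
- exact: (measurable_conv_integrand2 mk mf).
apply: eq_integral => y _; under eq_integral do rewrite mulrC.
rewrite integralZl_ge0//; first last.
- by move=> x; rewrite hk_ge0.
- exact: (measurableT_comp mk (measurable_subpl y)).
rewrite (leb_subpl (f := fun y => (K y t)%:E)) ?hk_int ?mule1//.
- exact/measurable_EFinP.
- by move=> x; rewrite lee_fin hk_ge0.
Qed.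

Definition osc t f : \bar R := (\int[mu]_x `|S t f x - f x|%:E)%E.

(** Strong continuity at time 0, in L^1 and for the single function [f]. *)
Definition osc_small f := forall e : R, 0 < e -> \forall t \near 0^'+, (osc t f <= e%:E)%E.

Lemma measurable_osc t f : 0 < t -> bdd_meas f -> measurable_fun setT (fun x => `|S t f x - f x|).
Proof.
move=> t0 bf; have [mS _] := bdd_meas_S t0 bf; have [mf _] := bf.
by apply: measurableT_comp => //; exact: measurable_funB.
Qed.

Lemma osc_lin t a b f g : 0 < t -> bdd_meas f -> bdd_meas g ->
  (osc t (fun y => a * f y + b * g y)%R <= `|a|%:E * osc t f + `|b|%:E * osc t g)%E.
Proof.
move=> t0 bf bg; have mf := measurable_osc t0 bf; have mg := measurable_osc t0 bg.
rewrite /osc -!integralZl_ge0// -ge0_integralD//; last 2 first.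
- by apply/measurable_EFinP; exact: measurable_funM.
- by apply/measurable_EFinP; exact: measurable_funM.
apply: ge0_le_integral => //.
- by apply/measurable_EFinP; apply: measurable_osc => //; exact: bdd_meas_lin.
- by apply: emeasurable_funD; apply/measurable_EFinP; exact: measurable_funM.
- move=> x _; rewrite -EFinD lee_fin S_lin// -!normrM.
  rewrite (le_trans _ (ler_normD _ _))//.
  by rewrite le_eqVlt; apply/orP; left; apply/eqP; congr `|_|; ring.
Qed.

Lemma osc_small_lin a b f g : bdd_meas f -> bdd_meas g -> osc_small f -> osc_small g ->
  osc_small (fun y => a * f y + b * g y).
Proof.
move=> bf bg hf hg e e0.
have a1 : 0 < `|a| + `|b| + 1 by rewrite ltr_wpDl.
have e1 : 0 < e / (`|a| + `|b| + 1) by rewrite divr_gt0.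
near=> t; have t0 : 0 < t by near: t; exact: nbhs_right_gt.
apply: (le_trans (osc_lin a b t0 bf bg)).
apply: (@le_trans _ _ (`|a|%:E * (e / (`|a| + `|b| + 1))%:E + `|b|%:E * (e / (`|a| + `|b| + 1))%:E)%E).
  by apply: leeD; apply: lee_wpmul2l => //; near: t; [exact: hf|exact: hg].
rewrite -!EFinM -EFinD lee_fin -mulrDl mulrCA ler_piMr ?ltW// ?ler_pdivrMr//.
by rewrite ltr_pdivrMr// mul1r ltrDl.
Unshelve. all: by end_near.
Qed.

Lemma integral_norm_S t f : 0 < t -> bdd_meas f ->
  (\int[mu]_x `|S t f x|%:E <= \int[mu]_x `|f x|%:E)%E.
Proof.
move=> t0 bf; have bnf := bdd_meas_norm bf.
rewrite -(integral_S t0 bnf)//; apply: ge0_le_integral => //.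
- by apply/measurable_EFinP/measurableT_comp => //; have [] := bdd_meas_S t0 bf.
- by apply/measurable_EFinP; have [] := bdd_meas_S t0 bnf.
- by move=> x _; rewrite lee_fin S_norm_le.
Qed.

Lemma osc_le t f : 0 < t -> bdd_meas f -> (osc t f <= \int[mu]_x `|f x|%:E + \int[mu]_x `|f x|%:E)%E.
Proof.
move=> t0 bf; have [mf _] := bf; have [mS _] := bdd_meas_S t0 bf.
have mnf : measurable_fun setT (fun x => `|f x|%:E) by apply/measurable_EFinP/measurableT_comp.
have mnS : measurable_fun setT (fun x => `|S t f x|%:E) by apply/measurable_EFinP/measurableT_comp.
apply: (le_trans _ (leeD (integral_norm_S t0 bf) (le_refl _))).
rewrite -ge0_integralD//; apply: ge0_le_integral => //.
- by apply/measurable_EFinP; exact: measurable_osc.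
- exact: emeasurable_funD.
- by move=> x _; rewrite -EFinD lee_fin ler_normB.
Qed.

(** [S] contracts L^1, so replacing [f] by [g] changes the oscillation by at most twice their
    distance. *)
Lemma osc_approx f : bdd_meas f -> (forall e : R, 0 < e ->
    exists g, [/\ bdd_meas g, osc_small g & (\int[mu]_x `|f x - g x|%:E <= e%:E)%E]) ->
  osc_small f.
Proof.
move=> bf H e e0; have e4 : 0 < e / 4 by rewrite divr_gt0.
have [g [bg og fg]] := H _ e4.
near=> t; have t0 : 0 < t by near: t; exact: nbhs_right_gt.
have fE : f = (fun y => 1 * g y + 1 * (1 * f y + (-1) * g y)).
  by apply/funext => y; ring.
have bfg := bdd_meas_lin 1 (-1) bf bg.
rewrite fE; apply: (le_trans (osc_lin 1 1 t0 bg bfg)).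
rewrite normr1 !mul1e.
apply: (@le_trans _ _ ((e / 4)%:E + ((e / 4)%:E + (e / 4)%:E))%E).
  apply: leeD; first by near: t; exact: og.
  apply: (le_trans (osc_le t0 bfg)).
  have -> : (\int[mu]_x `|1 * f x + -1 * g x|%:E = \int[mu]_x `|f x - g x|%:E)%E.
    by apply: eq_integral => x _; congr (`|_|%:E); ring.
  exact: leeD.
by rewrite -!EFinD lee_fin; lra.
Unshelve. all: by end_near.
Qed.

(** Open sets are the typical members, by concentration of the kernel. The property is pointwise,
    hence passes to intersections, which provides the pi-system for the Dynkin argument of
    [osc_small_indic]. *)
Definition density_class (A : set V) := measurable A /\
  forall x, A x -> S t \1_A x @[t --> 0^'+] --> (1 : R).

Lemma S_indic_bounds t A x : 0 < t -> measurable A -> 0 <= S t \1_A x <= 1.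
Proof.
move=> t0 mA; have bA := bdd_meas_indic mA; apply/andP; split.
  by apply: Rintegral_ge0 => y _; rewrite mulr_ge0// hk_ge0.
rewrite -(S_one x t0); apply: S_le => //; first exact: bdd_meas_cst.
Qed.

(* [density_class] is a pi-system because \1_(A `&` B) >= \1_A + \1_B - 1. *)
Lemma density_classI A B : density_class A -> density_class B -> density_class (A `&` B).
Proof.
move=> [mA hA] [mB hB]; have mAB := measurableI _ _ mA mB; split => // x [Ax Bx].
have bA := bdd_meas_indic mA; have bB := bdd_meas_indic mB; have bAB := bdd_meas_indic mAB.
have low : 1 * (S t \1_A x) + 1 * (S t \1_B x + - 1) @[t --> 0^'+] --> (1 : R).
  rewrite [X in _ --> X](_ : 1 = 1 * 1 + 1 * (1 + - 1)); last by ring.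
  apply: cvgD; apply: cvgMr; first exact: hA.
  by apply: cvgB; [exact: hB|exact: cvg_cst].
apply: (@squeeze_cvgr _ _ _ _ _ (fun=> 1 : R) _ _ _ low); last exact: cvg_cst.
near=> t; have t0 : 0 < t by near: t; exact: nbhs_right_gt.
have /andP[_ ->] := S_indic_bounds x t0 mAB; rewrite andbT.
have -> : 1 * S t \1_A x + 1 * (S t \1_B x + -1) =
    S t (fun y => 1 * \1_A y + 1 * (1 * \1_B y + (-1) * 1)) x.
  have b1 := bdd_meas_lin 1 (-1) bB (bdd_meas_cst 1).
  by rewrite (S_lin 1 1 x t0 bA b1) (S_lin 1 (-1) x t0 bB (bdd_meas_cst 1)) S_one//; ring.
apply: S_le => //; first by apply: bdd_meas_lin => //; apply: bdd_meas_lin => //; exact: bdd_meas_cst.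
move=> y; rewrite !indicE in_setI !mul1r mulr1.
by case: (y \in A); case: (y \in B) => /=; lra.
Unshelve. all: by end_near.
Qed.

(* The mass of K outside a ball is controlled by the Gaussian concentration. *)
Lemma density_class_far (A : set V) : measurable A ->
  (forall x, A x -> exists2 d : R, 0 < d & forall y, ~ A y -> d <= enorm (subp x y)) ->
  density_class A.
Proof.
move=> mA H; split => // x Ax; have [d d0 hd] := H x Ax.
have bA := bdd_meas_indic mA.
(* A lower bound of [1 - gaussn 1] at distance at least [d], so that [1 - (1 - gaussn 1) / c] stays
   below the indicator of [A]. *)
pose c : R := 1 - expR (- d ^+ 2).
have c0 : 0 < c by rewrite subr_gt0 expR_lt1 oppr_lt0 exprn_gt0.
have low : 1 - c^-1 * \int[mu]_x (K x t * (1 - gaussn 1 x)) @[t --> 0^'+] --> (1 : R).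
  rewrite [X in _ --> X](_ : 1 = 1 - c^-1 * 0); last by ring.
  by apply: cvgB; [exact: cvg_cst|apply: cvgMr; exact: (hk_conc hK ltr01)].
apply: (@squeeze_cvgr _ _ _ _ _ (fun=> 1 : R) _ _ _ low); last exact: cvg_cst.
near=> t; have t0 : 0 < t by near: t; exact: nbhs_right_gt.
have /andP[_ ->] := S_indic_bounds x t0 mA; rewrite andbT.
have bG : bdd_meas (fun y => 1 - gaussn 1 (subp x y)).
  split.
    apply: measurable_funB => //.
    exact: (measurableT_comp (@measurable_gaussn R n 1) (measurable_subpr x)).
  exists 1 => y; have g0 := @gaussn_ge0 R n 1 (subp x y).
  have g1 := @gaussn_le1 R n 1 (subp x y) ler01.
  by move: (gaussn _ _) g0 g1 => u g0 g1; rewrite ger0_norm; lra.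
have -> : \int[mu]_x (K x t * (1 - gaussn 1 x)) = S t (fun y => 1 - gaussn 1 (subp x y)) x.
  rewrite /semig /conv (leb_subpR x (f := fun z => K z t * (1 - gaussn 1 z)))//.
  apply: measurable_funM; first exact: measurable_hk.
  by apply: measurable_funB => //; exact: measurable_gaussn.
have -> : 1 - c^-1 * S t (fun y => 1 - gaussn 1 (subp x y)) x =
    S t (fun y => 1 * 1 + (- c^-1) * (1 - gaussn 1 (subp x y))) x.
  by rewrite (S_lin 1 (- c^-1) x t0 (bdd_meas_cst 1) bG) S_one// mulr1 mulNr.
apply: S_le => //; first by apply: bdd_meas_lin => //; exact: bdd_meas_cst.
move=> y; rewrite mulr1 indicE.
have g1 := @gaussn_le1 R n 1 (subp x y) ler01.
have [yA|yA] := boolP (y \in A).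
  rewrite mulNr gerBl mulr_ge0//; first by rewrite invr_ge0 ltW.
  by rewrite subr_ge0.
have /hd dy : ~ A y by move=> Ay; move: yA; rewrite mem_set.
rewrite mulNr subr_le0 mulrC ler_pdivlMr// mul1r lerD2l lerN2 /gaussn ler_expR mul1r lerN2.
by rewrite -enorm_sqr ler_sqr ?nnegrE ?(ltW d0) ?enorm_ge0.
Unshelve. all: by end_near.
Qed.

Lemma tnth_subp (x y : V) i : tnth (subp x y) i = (tnth x i : R) - (tnth y i : R).
Proof. by rewrite tnth_mktuple. Qed.

Lemma measurable_coord (i : 'I_n) : measurable_fun setT (fun x : V => tnth x i).
Proof. exact: measurable_tnth. Qed.

Lemma density_class_half (i : 'I_n) (a : R) : density_class [set x : V | a < (tnth x i : R)].
Proof.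
apply: density_class_far.
  rewrite -[X in measurable X]setTI.
  rewrite (_ : [set x | _] = (fun x : V => tnth x i) @^-1` `]a, +oo[%classic).
    exact: (measurable_coord i measurableT (measurable_itv `]a, +oo[)).
  by apply/seteqP; split => x /=; rewrite in_itv/= andbT.
move=> x /= ax; exists ((tnth x i : R) - a); first by rewrite subr_gt0.
move=> y /negP; rewrite -leNgt => ya; apply: le_trans (tnth_le_enorm (subp x y) i).
rewrite tnth_subp (le_trans _ (ler_norm _))// lerD2l lerN2//.
Qed.

Definition slab (r : R) (i : 'I_n) : set V := [set x | `|tnth x i : R| < r].

Lemma density_class_slab (i : 'I_n) (r : R) : density_class (slab r i).
Proof.
apply: density_class_far.
  rewrite -[X in measurable X]setTI (_ : slab r i = (fun x : V => tnth x i) @^-1` `]- r, r[%classic).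
    exact: (measurable_coord i measurableT (measurable_itv `]- r, r[)).
  by apply/seteqP; split => x /=; rewrite /slab /= in_itv/= ltr_norml.
move=> x /= xr; exists (r - `|tnth x i : R|); first by rewrite subr_gt0.
move=> y /negP; rewrite -leNgt => ya; apply: le_trans (tnth_le_enorm (subp x y) i).
rewrite tnth_subp distrC (le_trans _ (lerB_dist _ _))// lerD2r//.
Qed.

Definition cube (r : R) : set V := [set x | forall i, slab r i x].

Lemma density_classT : density_class setT.
Proof. apply: density_class_far => // x _; exists 1 => // y; by move=> /(_ Logic.I). Qed.

Lemma density_class_cube r : density_class (cube r).
Proof.
have H (m : nat) : density_class [set x : V | forall i : 'I_n, (i < m)%N -> slab r i x].
  elim: m => [|m ih].
    by rewrite (_ : mkset _ = setT); [exact: density_classT|apply/seteqP; split].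
  have [mn|nm] := ltnP m n.
    rewrite (_ : mkset _ = [set x | forall i : 'I_n, (i < m)%N -> slab r i x] `&` slab r (Ordinal mn)).
      by apply: density_classI => //; exact: density_class_slab.
    apply/seteqP; split => x /=.
      by move=> h; split => [i im|]; apply: h => //; exact: ltnW.
    move=> [h hm] i; rewrite ltnS leq_eqVlt => /orP[/eqP im|]; last exact: h.
    by have -> : i = Ordinal mn by exact/val_inj.
  rewrite (_ : mkset _ = [set x | forall i : 'I_n, (i < m)%N -> slab r i x])//.
  apply/seteqP; split => x /= h i im; apply: h; first exact: ltnW.
  by rewrite (leq_trans (ltn_ord i)).
rewrite (_ : cube r = [set x : V | forall i : 'I_n, (i < n)%N -> slab r i x])//.
by apply/seteqP; split => x /= h i => [_|]; apply: h.
Qed.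

Lemma measurable_cube r : measurable (cube r).
Proof. by case: (density_class_cube r). Qed.

(** On the cube [|x|^2 <= n r^2], so its indicator is at most [exp (n r^2)] times an integrable
    Gaussian. *)
Lemma cube_finite r : (mu (cube r) < +oo)%E.
Proof.
have mc := measurable_cube r.
have -> : mu (cube r) = (\int[mu]_x (\1_(cube r) x)%:E)%E by rewrite integral_indic// setIT.
have b x : \1_(cube r) x <= expR (n%:R * r ^+ 2) * gaussn 1 x.
  rewrite indicE; have [xc|_] := boolP (x \in cube r); last by rewrite mulr_ge0 ?expR_ge0 ?gaussn_ge0.
  rewrite /gaussn -expRD -[leLHS]expR0 ler_expR mul1r subr_ge0 /dotp.
  apply: (@le_trans _ _ (\sum_(i < n) r ^+ 2)).
    apply: ler_sum => i _; have /(_ i) xr := set_mem xc.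
    rewrite -expr2 -[leLHS]real_normK ?num_real// ler_sqr ?nnegrE ?(ltW xr)//.
    by apply: le_trans (ltW xr).
  by rewrite sumr_const card_ord mulr_natl.
apply: (@le_lt_trans _ _ (\int[mu]_x (expR (n%:R * r ^+ 2) * gaussn 1 x)%:E)%E).
  apply: ge0_le_integral => //.
  - by apply/measurable_EFinP; exact: measurable_indic.
  - by apply/measurable_EFinP; apply: measurable_funM => //; exact: measurable_gaussn.
  - by move=> x _; rewrite lee_fin.
rewrite integralZl_ge0 ?expR_ge0//; first last.
- exact: gaussn_ge0.
- exact: measurable_gaussn.
by rewrite integral_gaussn// -EFinM ltry.
Qed.

(** Coordinate half spaces are in the class, so the coordinates are measurable for the sigma-algebra
    it generates; this gives the nontrivial inclusion. *)
Lemma measurable_density_class : @measurable _ V = <<s density_class >>.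
Proof.
apply/seteqP; split; last by apply: smallest_sub; [exact: sigma_algebra_measurable|move=> A []].
apply: smallest_sub; first exact: smallest_sigma_algebra.
move=> A; elim/big_ind: _ => [//|X Y hX hY [/hX//|/hY//]|i _ [B mB <-]].
pose T' := g_sigma_algebraType density_class.
have mi : measurable_fun setT ((fun x : V => tnth x i) : T' -> measurableTypeR R).
  apply: (measurability _ (RGenOInfty.measurableE R)) => _ [_ [a ->] <-].
  rewrite setTI; apply: sub_sigma_algebra.
  rewrite (_ : _ @^-1` _ = [set x : V | a < (tnth x i : R)]); first exact: density_class_half.
  by apply/seteqP; split => x /=; rewrite in_itv/= andbT.
exact: (mi measurableT B mB).
Qed.

Lemma integral_norm_indic (A : set V) : measurable A ->
  (\int[mu]_x `|\1_A x : R|%:E = mu A)%E.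
Proof.
move=> mA; under eq_integral do rewrite ger0_norm//.
by rewrite integral_indic// setIT.
Qed.

(** [S t] preserves the integral of the indicator and keeps it between 0 and 1, so the minimum of
    both functions is their product. [Rintegral_norm_sub] then involves [S t] on [A] only, where it
    tends to 1, dominated by the indicator. *)
Lemma osc_small_density_class A : density_class A -> (mu A < +oo)%E -> osc_small \1_A.
Proof.
move=> [mA hA] Aoo; have bA := bdd_meas_indic mA; have [mi _] := bA.
have iA : mu.-integrable setT (EFin \o (\1_A : V -> R)).
  by apply: ge0_integrable_lty => //; rewrite integral_indic// setIT.
have iS t : 0 < t -> mu.-integrable setT (EFin \o (S t \1_A)).
  move=> t0; have [mS _] := bdd_meas_S t0 bA; apply: ge0_integrable_lty => //.
    by move=> x; have /andP[] := S_indic_bounds x t0 mA.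
  by rewrite integral_S// integral_indic// setIT.
have E t : 0 < t -> \int[mu]_x `|S t \1_A x - \1_A x| =
    2 * \int[mu]_x \1_A x - 2 * \int[mu]_x (\1_A x * S t \1_A x).
  move=> t0; have [mS _] := bdd_meas_S t0 bA.
  rewrite Rintegral_norm_sub//; [| |exact: iS].
    have -> : \int[mu]_x S t \1_A x = \int[mu]_x \1_A x.
      by rewrite /Rintegral integral_S.
    have -> : \int[mu]_x Num.min (S t \1_A x) (\1_A x) = \int[mu]_x (\1_A x * S t \1_A x).
      apply: eq_Rintegral => x _; have /andP[h0 h1] := S_indic_bounds x t0 mA.
      rewrite indicE; case: (x \in A); last by rewrite mul0r min_r.
      by rewrite mul1r min_l.
    by ring.
  by move=> x; have /andP[] := S_indic_bounds x t0 mA.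
have lim : \int[mu]_x (\1_A x * S t \1_A x) @[t --> 0^'+] --> \int[mu]_x \1_A x.
  apply/cvg_at_rightP => u [u0 uc].
  have [] := @dominated_Rintegral _ _ _ mu (fun k x => \1_A x * S (u k) \1_A x) (\1_A) (\1_A).
  - by move=> k; have [mS _] := bdd_meas_S (u0 k) bA; exact: measurable_funM.
  - move=> x; rewrite indicE; have [xA|_] := boolP (x \in A); last first.
      by under eq_fun do rewrite mul0r; exact: cvg_cst.
    under eq_fun do rewrite mul1r; rewrite -/(1%:R).
    have /cvg_at_rightP h := hA x (set_mem xA); exact: h.
  - exact: iA.
  - move=> k x; have /andP[h0 h1] := S_indic_bounds x (u0 k) mA.
    by rewrite normrM ger0_norm// ger0_norm// ler_piMr.
  - by [].
have lim2 : 2 * \int[mu]_x \1_A x - 2 * \int[mu]_x (\1_A x * S t \1_A x) @[t --> 0^'+] --> (0 : R).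
  rewrite [X in _ --> X](_ : 0 = 2 * \int[mu]_x \1_A x - 2 * \int[mu]_x \1_A x); last by rewrite subrr.
  by apply: cvgB; [exact: cvg_cst|exact: cvgMr].
move=> e e0; near=> t; have t0 : 0 < t by near: t; exact: nbhs_right_gt.
have [mS _] := bdd_meas_S t0 bA.
rewrite /osc -RintegralK; last first.
  apply: ge0_integrable_lty => //; first exact: measurable_osc.
  by apply: (le_lt_trans (osc_le t0 bA)); rewrite integral_norm_indic// lte_add_pinfty.
rewrite lee_fin E//; apply: ltW; near: t.
exact: (cvgr_lt _ lim2 e e0).
Unshelve. all: by end_near.
Qed.

Section in_cube.
Variable r : R.
Local Notation Q := (cube r).

(** Dynkin's theorem from the pi-system [density_class]. Intersecting with a cube keeps all measures
    finite, so complements are differences and countable disjoint unions are limits in L^1. *)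
Lemma osc_small_indic A : measurable A -> osc_small (\1_(A `&` Q)).
Proof.
move=> mA; have mQ := measurable_cube r.
have pQ : osc_small \1_Q by apply: osc_small_density_class; [exact: density_class_cube|exact: cube_finite].
apply: (@dynkin_induction _ V density_class (fun A => osc_small (\1_(A `&` Q)))).
- exact: measurable_density_class.
- by move=> B C; exact: density_classI.
- by rewrite setTI.
- move=> B pB; apply: osc_small_density_class; first by apply: density_classI => //; exact: density_class_cube.
  apply: (le_lt_trans _ (cube_finite r)); apply: le_measure; rewrite ?inE//.
  by case: pB => mB _; exact: measurableI.
- move=> B mB hB.
  have -> : \1_(~` B `&` Q) = (fun y => 1 * \1_Q y + (-1) * \1_(B `&` Q) y) :> (V -> R).
    apply/funext => y; rewrite !indicE !in_setI in_setC.
    by case: (y \in B); case: (y \in Q) => /=; rewrite ?(mulr0, mulr1, mul0r, addr0, add0r, subrr, mul1r).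
  apply: osc_small_lin => //; apply: bdd_meas_indic => //; exact: measurableI.
- move=> F mF tF hF.
  (* Linearity reaches the finite unions [U N]; they converge in L^1 to the full union, the
     indicator of the cube being a majorant, and [osc_approx] applies. *)
  pose U N := (\bigcup_(k in `I_N) F k) `&` Q.
  have mUN N : measurable (U N) by apply: measurableI => //; apply: bigcup_measurable.
  have oU N : osc_small \1_(U N).
    elim: N => [|N ih].
      have -> : \1_(U 0%N) = (fun y => 0 * \1_Q y + 0 * \1_Q y) :> (V -> R).
        apply/funext => y; rewrite !mul0r addr0 indicE memNset// => -[[k]] //.
      by apply: osc_small_lin => //; exact: bdd_meas_indic.
    have -> : \1_(U N.+1) = (fun y => 1 * \1_(U N) y + 1 * \1_(F N `&` Q) y) :> (V -> R).
      apply/funext => y; rewrite !mul1r !indicE.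
      have [yF|yF] := pselect ((F N `&` Q) y).
        rewrite (mem_set yF) (_ : (y \in U N.+1) = true); last first.
          by apply/mem_set; case: yF => yF yQ; split => //; exists N => /=.
        rewrite memNset ?add0r// => -[[k /= kN Fk] _].
        case: yF => FN _; have := tF k N Logic.I Logic.I.
        by move=> /(_ (ex_intro _ y (conj Fk FN))) kE; rewrite kE ltnn in kN.
      rewrite (memNset yF) addr0; congr ((nat_of_bool _)%:R); apply/idP/idP => /set_mem [[k /= kN Fk] yQ].
        apply/mem_set; split => //; exists k => //=; move: kN; rewrite ltnS leq_eqVlt => /orP[/eqP kE|//].
        by exfalso; apply: yF; rewrite -kE.
      by apply/mem_set; split => //; exists k => //=; exact: ltnW.
    by apply: osc_small_lin => //; apply: bdd_meas_indic => //; exact: measurableI.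
  have mUU : measurable (\bigcup_k F k `&` Q) by apply: measurableI => //; apply: bigcup_measurable.
  apply: osc_approx; first exact: bdd_meas_indic.
  have iQ : mu.-integrable setT (EFin \o (\1_Q : V -> R)).
    by apply: ge0_integrable_lty => //; rewrite integral_indic// setIT cube_finite.
  have dle N x : `|\1_(\bigcup_k F k `&` Q) x - \1_(U N) x| <= \1_Q x :> R.
    rewrite !indicE; have [xQ|xQ] := boolP (x \in Q).
      by case: (x \in _ `&` Q); case: (x \in U N); rewrite ?subrr ?subr0 ?sub0r ?normrN ?normr1 ?normr0.
    have nQ : ~ Q x by move=> h; move: xQ; rewrite mem_set.
    by rewrite !memNset ?subrr ?normr0// => -[].
  move=> e e0.
  have C : \int[mu]_x `|\1_(\bigcup_k F k `&` Q) x - \1_(U N) x| @[N --> \oo] --> (0 : R).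
    have -> : (0 : R) = \int[mu]_x (0 : R) by rewrite /Rintegral integral0.
    apply: (@dominated_Rintegral _ _ _ mu
      (fun N x => `|\1_(\bigcup_k F k `&` Q) x - \1_(U N) x|) (fun=> 0) (\1_Q) _ _ _ _).2 => //.
    - by move=> N; apply: measurableT_comp => //; apply: measurable_funB; exact: measurable_indic.
    - move=> x; have [[[k _ Fk] Qx]|nx] := pselect ((\bigcup_k F k `&` Q) x).
        apply: cvg_near_cst; exists k.+1 => // N /= kN.
        have U1 : (\bigcup_k F k `&` Q) x by split => //; exists k.
        have U2 : U N x by split => //; exists k.
        by rewrite !indicE !mem_set// subrr normr0.
      apply: cvg_near_cst; apply: nearW => N.
      rewrite !indicE !memNset ?subrr ?normr0// => -[[k /= _ Fk] Qx]; apply: nx.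
      by split => //; exists k.
    - by move=> N x; rewrite normr_id.
  have /= := cvgr_lt _ C e e0 => -[N _ /(_ N (leqnn N))] /= hN.
  exists \1_(U N); split => //; first exact: bdd_meas_indic.
  rewrite -RintegralK ?lee_fin ?ltW//.
  apply: (le_Rintegrable _ _ iQ) => //; last by move=> x; rewrite normr_id.
  by apply: measurableT_comp => //; apply: measurable_funB; exact: measurable_indic.
by rewrite -measurable_density_class.
Qed.

(** The sum counts the integers [j < m] below [a]: it is the smaller of [m] and the ceiling of
    [a]. *)
Lemma layer_count (m : nat) (a : R) : 0 <= a ->
  Num.min a m%:R <= \sum_(j < m) (((j%:R < a)%R)%:R : R) <= Num.min (a + 1) m%:R.
Proof.
move=> a0; elim: m => [|m /andP[ih1 ih2]].
  by rewrite big_ord0 min_r// min_r ?lexx// addr_ge0.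
rewrite big_ord_recr/=; move: ih1 ih2; set s := \sum_(_ < _) _ => ih1 ih2.
have mS : m.+1%:R = m%:R + 1 :> R by rewrite -natr1.
move: ih1 ih2; rewrite mS; set u : R := m%:R => ih1 ih2.
have [ua|au] /= := ltP u a.
  rewrite (min_r (ltW ua)) in ih1; rewrite (@min_r _ _ (a + 1)) in ih2; last by rewrite ler_wpDr// ltW.
  rewrite ge_min le_min; apply/andP; split; last by apply/andP; split; lra.
  by apply/orP; right; lra.
move: ih1 ih2; rewrite (min_l au) addr0 => ih1 ih2.
rewrite ge_min ih1/=; move: ih2; rewrite !le_min => /andP[h1 h2].
by rewrite h1/=; lra.
Qed.

(* A bounded function on the cube is a uniform limit of averages of the
   indicators of its superlevel sets. *)
Lemma osc_small_bounded f : measurable_fun setT f -> (forall x, 0 <= f x <= 1) ->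
  (forall x, ~ Q x -> f x = 0) -> osc_small f.
Proof.
move=> mf f01 fQ; have mQ := measurable_cube r.
pose B m j := [set x : V | (j%:R < m.+1%:R * f x)%R].
have mB m j : measurable (B m j).
  rewrite -[X in measurable X]setTI.
  have mg : measurable_fun setT (fun x => m.+1%:R * f x) by exact: measurable_funM.
  have := mg measurableT _ (measurable_itv `]j%:R, +oo[).
  by congr measurable; apply/seteqP; split => x /=; rewrite /B /= in_itv/= andbT.
have BQ m j : B m j `&` Q = B m j.
  apply/seteqP; split => x /=; first by case.
  move=> Bx; split => //; apply: contrapT => nQ; move: Bx.
  by rewrite /B /= fQ// mulr0 ltrn0.
have bf : bdd_meas f by split => //; exists 1 => x; have /andP[? ?] := f01 x; rewrite ger0_norm.
pose g m k x := \sum_(j < k) (m.+1%:R^-1 * \1_(B m j) x) : R.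
have bg m k : bdd_meas (g m k) /\ osc_small (g m k).
  elim: k => [|k [ih1 ih2]].
    have -> : g m 0%N = (fun y => 0 * \1_(setT `&` Q) y + 0 * \1_(setT `&` Q) y).
      by apply/funext => y; rewrite /g big_ord0 !mul0r addr0.
    have bQ : bdd_meas (\1_(setT `&` Q) : V -> R) by apply: bdd_meas_indic; exact: measurableI.
    split; first exact: bdd_meas_lin.
    by apply: osc_small_lin => //; exact: osc_small_indic.
  have -> : g m k.+1 = (fun y => 1 * g m k y + m.+1%:R^-1 * \1_(B m k) y).
    by apply/funext => y; rewrite /g big_ord_recr/= mul1r.
  have bB : bdd_meas (\1_(B m k) : V -> R) by exact: bdd_meas_indic.
  split; first exact: bdd_meas_lin.
  by apply: osc_small_lin => //; rewrite -BQ; exact: osc_small_indic.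
apply: osc_approx => // e e0.
have fQoo := cube_finite r.
have Qf : mu Q \is a fin_num by rewrite ge0_fin_numE.
pose q := fine (mu Q); have q0 : 0 <= q by rewrite fine_ge0.
(* The approximation by [m + 1] layers has an error of at most [1 / (m+1)] on the cube, whose
   measure is [q]. *)
have [m hm] : exists m : nat, q / e < m.+1%:R.
  exists (Num.truncn (q / e)); exact: truncnS_gt.
exists (g m m.+1); have [b1 b2] := bg m m.+1; split => //.
have m0 : 0 < m.+1%:R :> R by [].
have d x : `|f x - g m m.+1 x| <= m.+1%:R^-1 * \1_Q x.
  have gE : g m m.+1 x = m.+1%:R^-1 * \sum_(j < m.+1) (((j%:R < m.+1%:R * f x)%R)%:R : R).
    rewrite /g -mulr_sumr; congr (_ * _); apply: eq_bigr => j _.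
    by rewrite indicE; congr ((nat_of_bool _)%:R); apply/idP/idP; [move=> /set_mem|move=> h; exact/mem_set].
  rewrite indicE; have [xQ|xQ] := boolP (x \in Q); last first.
    have nQ : ~ Q x by move=> h; move: xQ; rewrite mem_set.
    rewrite gE fQ// mulr0 mulr0 big1 ?mulr0 ?subrr ?normr0// => j _.
    by rewrite ltrn0.
  have /andP[f0 f1] := f01 x.
  have a0 : 0 <= m.+1%:R * f x by rewrite mulr_ge0.
  have am : m.+1%:R * f x <= m.+1%:R by rewrite ler_piMr.
  have /andP[] := layer_count m.+1 a0.
  rewrite (min_l am) le_min => h1 /andP[h2 _].
  rewrite gE mulr1; move: h1 h2; set s := \sum_(_ < _) _ => h1 h2.
  have -> : f x - m.+1%:R^-1 * s = m.+1%:R^-1 * (m.+1%:R * f x - s).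
    by rewrite mulrBr mulrA mulVf ?mul1r// gt_eqF.
  rewrite normrM gtr0_norm ?invr_gt0//; apply: ler_piMr; first by rewrite invr_ge0 ltW.
  by rewrite ler_norml; lra.
apply: (@le_trans _ _ (\int[mu]_x (m.+1%:R^-1 * \1_Q x)%:E)%E).
  apply: ge0_le_integral => //.
  - apply/measurable_EFinP; apply: measurableT_comp => //; apply: measurable_funB => //.
    by case: b1.
  - by apply/measurable_EFinP; apply: measurable_funM.
  - by move=> x _; rewrite lee_fin.
have -> : (\int[mu]_x (m.+1%:R^-1 * \1_Q x)%:E = (m.+1%:R^-1 * q)%:E)%E.
  by rewrite integralZl_ge0// integral_indic// setIT EFinM /q fineK.
rewrite lee_fin.
rewrite mulrC ler_pdivrMr// -ler_pdivrMl// mulrC; exact: ltW.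
Qed.

(** Adding [M] on the cube and dividing by [2 M] brings the values of [f] into [[0, 1]]; the
    correction is an indicator. *)
Lemma osc_small_cube f (M : R) : measurable_fun setT f -> 0 < M -> (forall x, `|f x| <= M) ->
  (forall x, ~ Q x -> f x = 0) -> osc_small f.
Proof.
move=> mf M0 fM fQ; have mQ := measurable_cube r.
pose h x := (2 * M)^-1 * (f x + M * \1_Q x).
have mh : measurable_fun setT h.
  by apply: measurable_funM => //; apply: measurable_funD => //; apply: measurable_funM.
have h01 x : 0 <= h x <= 1.
  have := fM x; rewrite ler_norml => /andP[l u]; rewrite /h.
  have M2 : 0 < 2 * M by rewrite mulr_gt0.
  rewrite indicE; have [xQ|xQ] := boolP (x \in Q).
    rewrite mulr1 mulr_ge0 ?invr_ge0 ?(ltW M2)//=; last lra.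
    by rewrite mulrC ler_pdivrMr// mul1r; lra.
  rewrite fQ ?mulr0 ?addr0 ?mulr0 ?lexx ?ler01//.
  by move=> h'; move: xQ; rewrite mem_set.
have hQ x : ~ Q x -> h x = 0.
  by move=> nQ; rewrite /h fQ// indicE memNset// mulr0 addr0 mulr0.
have oh := osc_small_bounded mh h01 hQ.
have bh : bdd_meas h by split => //; exists 1 => x; have /andP[? ?] := h01 x; rewrite ger0_norm.
have -> : f = (fun x => (2 * M) * h x + (- M) * \1_(setT `&` Q) x).
  apply/funext => x; rewrite setTI /h; field.
  by rewrite gt_eqF.
by apply: osc_small_lin => //; [apply: bdd_meas_indic; exact: measurableI|exact: osc_small_indic].
Qed.

End in_cube.

Section Ls.
Variable s : R.
Hypothesis s1 : 1 < s.
Let s0 : 0 < s. Proof. exact: lt_trans s1. Qed.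

(** Interpolation: [|f|^s <= C^(s-1) |f|], so smallness in L^1 becomes smallness in L^s for bounded
    functions. *)
Lemma Lle_bounded (C e : R) f : 0 < C -> 0 <= e -> measurable_fun setT f ->
  (forall x, `|f x| <= C) ->
  (\int[mu]_x `|f x|%:E <= (e `^ s / C `^ (s - 1))%:E)%E -> Lle s mu e f.
Proof.
move=> C0 e0 mf fC h; rewrite /Lle.
have mnf : measurable_fun setT (fun x => `|f x|) by exact: measurableT_comp.
apply: (@le_trans _ _ (\int[mu]_x (C `^ (s - 1) * `|f x|)%:E)%E).
  apply: ge0_le_integral => //.
  - by apply/measurable_EFinP; exact: measurable_absX.
  - by apply/measurable_EFinP; exact: measurable_funM.
  - move=> x _; rewrite lee_fin -(mulr_powRB1 (normr_ge0 _) s0) mulrC ler_wpM2r//.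
    by rewrite ge0_ler_powR ?nnegrE ?subr_ge0 ?(ltW s1)// ltW.
rewrite integralZl_ge0 ?powR_ge0//.
apply: (le_trans (lee_wpmul2l _ h)); first by rewrite lee_fin powR_ge0.
by rewrite -EFinM lee_fin mulrC divfK// gt_eqF// powR_gt0.
Qed.

Lemma cube_trunc_approx f (M e : R) : measurable_fun setT f -> Lle s mu M f -> 0 < e ->
  exists r : R, Lle s mu e (fun x => f x - f x * \1_(cube r) x).
Proof.
move=> mf lf e0; have mQ (k : nat) : measurable (cube k%:R) by exact: measurable_cube.
have mfs := @measurable_absX _ s _ _ f mf.
have ifs : mu.-integrable setT (EFin \o (fun x => `|f x| `^ s)).
  apply: ge0_integrable_lty => //.
  by apply: (le_lt_trans lf); rewrite ltry.
have md (k : nat) : measurable_fun setT (fun x => f x - f x * \1_(cube k%:R) x).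
  by apply: measurable_funB => //; apply: measurable_funM => //; exact: measurable_indic.
have mds (k : nat) : measurable_fun setT (fun x => `|f x - f x * \1_(cube k%:R) x| `^ s).
  exact: measurable_absX.
have dom (k : nat) x : `|f x - f x * \1_(cube k%:R) x| `^ s <= `|f x| `^ s.
  apply: ge0_ler_powR; rewrite ?nnegrE ?(ltW s0)//.
  by rewrite indicE; case: (x \in _); rewrite ?mulr1 ?mulr0 ?subrr ?subr0 ?normr0.
have C : \int[mu]_x (`|f x - f x * \1_(cube k%:R) x| `^ s) @[k --> \oo] --> (0 : R).
  have -> : (0 : R) = \int[mu]_x (0 : R) by rewrite /Rintegral integral0.
  apply: (@dominated_Rintegral _ _ _ mu
    (fun k x => `|f x - f x * \1_(cube k%:R) x| `^ s) (fun=> 0) (fun x => `|f x| `^ s) _ _ _ _).2 => //.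
    move=> x; apply: cvg_near_cst.
    have /archi_boundP h : 0 <= enorm x by exact: enorm_ge0.
    exists (Num.bound (enorm x)) => // k /= hk.
    rewrite indicE mem_set ?mulr1 ?subrr ?normr0 ?powR0 ?gt_eqF// => i.
    apply: (le_lt_trans (tnth_le_enorm x i)); apply: (lt_le_trans h).
    by rewrite ler_nat.
  by move=> k x; rewrite ger0_norm ?powR_ge0.
have es0 : 0 < e `^ s by rewrite powR_gt0.
have /= := cvgr_lt _ C _ es0 => -[k _ /(_ k (leqnn k))] /= hk.
exists k%:R; rewrite /Lle -RintegralK ?lee_fin ?ltW//.
by apply: (le_Rintegrable _ _ ifs) => // x; rewrite ger0_norm ?powR_ge0.
Qed.

(** With [w] the bounded representative and [g] its restriction to a large cube, there are three
    errors of size [e / 4]: [S t (w - g)], by contraction, then [S t g - g], small in L^1 and hence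
    in L^s because [g] is bounded, and [g - w]. *)
Lemma S_continuous (M e : R) (v : V -> R) : 0 <= M -> Xle s mu M v -> 0 < e ->
  \forall t \near 0^'+, Lle s mu e (S t v \- v).
Proof.
move=> M0 Xv e0; have [w [mw wM vw _]] := Xle_rep M0 Xv; have [mv _ _] := Xv.
have Xw : Xle s mu M w.
  by apply: (Xle_eq s1 mw _ Xv); apply: aeS vw => x ->.
have lw : Lle s mu M w by case: Xw.
have e4 : 0 < e / 4 by rewrite divr_gt0.
have [r hr] := cube_trunc_approx mw lw e4.
pose g x := w x * \1_(cube r) x.
have mg : measurable_fun setT g.
  by apply: measurable_funM => //; apply: measurable_indic; exact: measurable_cube.
have gw x : `|g x| <= `|w x|.
  by rewrite /g normrM ler_piMr// indicE; case: (x \in _); rewrite ?normr1 ?normr0.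
have Xg : Xle s mu M g by apply: (Xle_dom s1 mg _ Xw); exact: aeW.
have M1 : 0 < M + 1 by rewrite ltr_wpDl.
have gM x : `|g x| <= M + 1 by rewrite (le_trans (gw x))// (le_trans (wM x))// lerDl.
have bg : bdd_meas g by split => //; exists (M + 1).
have og : osc_small g.
  apply: (osc_small_cube mg M1 gM (r := r)) => x nx.
  by rewrite /g indicE memNset// mulr0.
have C0 : 0 < (M + 1) + (M + 1) by rewrite addr_gt0.
have e1 : 0 < (e / 4) `^ s / ((M + 1) + (M + 1)) `^ (s - 1) by rewrite divr_gt0 ?powR_gt0.
near=> t; have t0 : 0 < t by near: t; exact: nbhs_right_gt.
have mk := measurable_hk hK t.
have [mSg _] := bdd_meas_S t0 bg.
have L2 : Lle s mu (e / 4) (fun x => S t g x - g x).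
  apply: (Lle_bounded C0 (ltW e4)).
  - exact: measurable_funB.
  - move=> x; rewrite (le_trans (ler_normB _ _))// lerD//.
    by rewrite -[leRHS]mul1r; exact: (conv_bound mk (hk_norm hK t0) x mg gM).
  - by near: t; exact: og.
have mwg : measurable_fun setT (w \- g) by exact: measurable_funB.
have L1 : Lle s mu (1 * (e / 4)) (conv (K^~ t) (w \- g)).
  exact: (conv_Lle s1 mk ler01 (hk_norm hK t0) (ltW e4) mwg hr).
have L3 : Lle s mu (`|-1| * (e / 4)) (fun x => -1 * (w \- g) x).
  exact: (Lle_scale (-1) mwg (ltW e4) hr).
rewrite normrN1 in L3; rewrite !mul1r in L1 L3.
have mc : measurable_fun setT (conv (K^~ t) (w \- g)) by exact: measurable_conv.
have mm : measurable_fun setT (fun x => -1 * (w \- g) x) by exact: measurable_funM.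
have mSgg : measurable_fun setT (fun x => S t g x - g x) by exact: measurable_funB.
have L12 := Lle_add s1 mc mSgg (ltW e4) (ltW e4) L1 L2.
have L123 := Lle_add s1 (measurable_funD mc mSgg) mm (addr_ge0 (ltW e4) (ltW e4)) (ltW e4) L12 L3.
apply: (@Lle_weak _ s s1 _ _ mu (e / 4 + e / 4 + e / 4) e); [lra|lra|].
apply: (Lle_ae s1 _ _ _ L123).
- by apply: measurable_funB => //; exact: measurable_conv.
- by apply: measurable_funD => //; exact: measurable_funD.
have Svw x : S t v x = S t w x by exact: (S_ae hK t x mv mw vw).
apply: aeS vw => x vx.
have E := S_sub hK x t0 M0 M0 Xw Xg.
rewrite /= vx Svw; move: E; rewrite /semig => ->.
by rewrite le_eqVlt; apply/orP; left; apply/eqP; congr `|_|; ring.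
Unshelve. all: by end_near.
Qed.

End Ls.
End strong_continuity.

Lemma heat_kernel_stable (R : realType) (n : nat) (beta : R) : (0 < n)%N -> 0 < beta <= 2 ->
  heat_kernel (@stable_kernel R n beta).
Proof.
move=> n0 b02; split.
- exact: measurable_kernel2.
- by move=> x t t0; exact: kernel_ge0.
- move=> t t0; exists ((2 * pi) ^- n * \int[leb R n]_xi symb beta t xi) => x.
  by apply: kernel_bound => //; case/andP: b02.
- by move=> t t0; exact: integral_kernel.
- by move=> x y t; exact: kernel_subpC.
- by move=> x t r t0 r0; exact: kernel_semigroup.
- by move=> t0 t00; exact: kernel_L1_cvg.
- by move=> d d0; exact: kernel_concentration.
Qed.

(** * The nonlinearity with a Riesz potential *)

Section powers.
Context {R : realType}.
Implicit Types a b p : R.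

(** Young's inequality for [a] and [b^(p-1)], with exponents [p] and [p / (p-1)], gives
    [p a b^(p-1) <= a^p + (p-1) b^p], which is the claim rearranged. *)
Lemma powRB_le a b p : 0 <= a -> a <= b -> 1 <= p ->
  b `^ p - a `^ p <= p * b `^ (p - 1) * (b - a).
Proof.
move=> a0 ab p1; have b0 : 0 <= b by exact: le_trans ab.
move: p1; rewrite le_eqVlt => /orP[/eqP <-|p1].
  by rewrite subrr powRr0 !powRr1// !mul1r.
have p0 : 0 < p by exact: lt_trans p1.
have p10 : 0 < p - 1 by rewrite subr_gt0.
have := @conjugate_powR _ a (b `^ (p - 1)) p (p / (p - 1)) a0 (powR_ge0 _ _) p0 (divr_gt0 p0 p10).
have E1 : (p - 1) * (p / (p - 1)) = p by rewrite mulrC divfK ?gt_eqF.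
rewrite -powRrM E1.
have -> : p^-1 + (p / (p - 1))^-1 = 1 by field; rewrite !gt_eqF.
move=> /(_ erefl) Y.
have bE : b `^ p = b * b `^ (p - 1) by rewrite mulr_powRB1.
have Y2 : p * (b `^ (p - 1) * a) <= a `^ p + (p - 1) * b `^ p.
  rewrite -ler_pdivlMl// (mulrC _ a); apply: (le_trans Y); rewrite le_eqVlt; apply/orP; left; apply/eqP.
  by field; rewrite !gt_eqF.
move: Y2 bE; move: (b `^ p) (b `^ (p - 1)) (a `^ p) => X Z W Y2 XE.
rewrite -mulrA mulrBr (mulrC Z b) -XE mulrBr; lra.
Qed.

Lemma powR_norm_diff (x y p : R) : 1 <= p ->
  `| `|x| `^ p - `|y| `^ p | <= p * (Num.max `|x| `|y|) `^ (p - 1) * `|x - y|.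
Proof.
move=> p1; have p0 : 0 <= p by exact: le_trans p1.
wlog xy : x y / `|y| <= `|x|.
  move=> H; have [h|h] := boolP (`|y| <= `|x|); first exact: H.
  by rewrite -ltNge in h; rewrite distrC maxC (distrC x); exact/H/ltW.
rewrite max_l// ger0_norm; last by rewrite subr_ge0 ge0_ler_powR ?nnegrE.
apply: (le_trans (powRB_le (normr_ge0 y) xy p1)).
by rewrite ler_wpM2l ?mulr_ge0 ?powR_ge0//; exact: lerB_dist.
Qed.

Lemma powR_split (x p : R) : 0 <= x -> 1 <= p -> x `^ p = x `^ (p - 1) * x.
Proof. by move=> x0 p1; rewrite mulrC mulr_powRB1// (lt_le_trans ltr01). Qed.

Lemma young_max (x y p : R) : 0 <= x -> 0 <= y -> 1 <= p ->
  x `^ (p - 1) * y <= x `^ p + y `^ p.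
Proof.
move=> x0 y0 p1; have p10 : 0 <= p - 1 by rewrite subr_ge0.
have [xy|yx] := leP x y.
  apply: (@le_trans _ _ (y `^ p)); last by rewrite lerDr powR_ge0.
  by rewrite (powR_split y0 p1) ler_wpM2r// ge0_ler_powR ?nnegrE.
apply: (@le_trans _ _ (x `^ p)); last by rewrite lerDl powR_ge0.
by rewrite (powR_split x0 p1) ler_wpM2l ?powR_ge0// ltW.
Qed.

Lemma powR_max_le (x y p : R) : 0 <= x -> 0 <= y -> (Num.max x y) `^ p <= x `^ p + y `^ p.
Proof.
move=> x0 y0; have [xy|yx] := leP x y; first by rewrite lerDr powR_ge0.
by rewrite lerDl powR_ge0.
Qed.

End powers.

(** [L M] is a Lipschitz constant on the ball of radius [M]; with [nl_zero] it also bounds [N]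
    itself, see [N_Xle]. [nl_meas] is stated for families, so that joint measurability in time and
    space is preserved. *)
Record lip_nonlinearity {R : realType} {n : nat} (s : R)
    (N : (Rn R n -> R) -> Rn R n -> R) (L : R -> R) : Prop := LipNonlinearity {
  nl_meas : forall d (T : measurableType d) (F : T -> Rn R n -> R),
    measurable_fun setT (fun z : T * Rn R n => F z.1 z.2) ->
    measurable_fun setT (fun z : T * Rn R n => N (F z.1) z.2);
  nl_ae : forall v w, measurable_fun setT v -> measurable_fun setT w ->
    {ae leb R n, forall x, v x = w x} -> {ae leb R n, forall x, N v x = N w x};
  nl_ge0 : forall v x, 0 <= N v x;
  nl_L0 : forall M, 0 <= M -> 0 <= L M;
  nl_zero : forall x, N (fun=> 0) x = 0;
  nl_lip : forall M D v w, 0 < M -> 0 < D ->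
    Xle s (leb R n) M v -> Xle s (leb R n) M w -> Xle s (leb R n) D (v \- w) ->
    Xle s (leb R n) (L M * D) (N v \- N w) }.

Section riesz.
Context {R : realType} (n : nat) (alpha p q s : R).
Hypotheses (n0 : (0 < n)%N) (a0 : 0 < alpha) (an : alpha < n%:R).
Hypotheses (p1 : 1 < p) (q1 : 1 <= q) (s1 : 1 < s) (sp : s < n%:R * p / alpha).
Local Notation V := (Rn R n).
Local Notation mu := (leb R n).
Let gam : R := n%:R - alpha.
Let gam0 : 0 < gam. Proof. by rewrite subr_gt0. Qed.
Let nR0 : 0 < n%:R :> R. Proof. by rewrite ltr0n. Qed.
Let s0 : 0 < s. Proof. exact: lt_trans s1. Qed.
Let p0 : 0 < p. Proof. exact: lt_trans p1. Qed.

Definition rker (z : V) : R := (enorm z `^ gam)^-1.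

Lemma rker_ge0 z : 0 <= rker z. Proof. by rewrite invr_ge0 powR_ge0. Qed.

Lemma rkerE z : rker z = (enorm z `^ gam) `^ (-1).
Proof. by rewrite powR_inv1// powR_ge0. Qed.

Lemma measurable_rker : measurable_fun setT rker.
Proof.
rewrite (_ : rker = fun z => (enorm z `^ gam) `^ (-1)); last by apply/funext => z; exact: rkerE.
apply: (measurableT_comp (measurable_powR _)); apply: (measurableT_comp (measurable_powR _)).
exact: measurable_enorm.
Qed.

(* The first bound makes the far part of the Riesz kernel integrable to the power
   [r]; the second one gives [|v|^(p r') <= |v|^s] where [|v| <= 1]. *)
Lemma conjugate_exponent : exists r r' : R,
  [/\ 0 < r, 0 < r', r^-1 + r'^-1 = 1, n%:R < gam * r & s <= p * r'].
Proof.
(* [rho] is [1 / r]: the condition [s <= p r'] reads [1 - p / s <= rho], and [n < gam r] reads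
   [rho < gam / n]. The second argument of the maximum keeps [rho] positive. *)
pose rho := Num.max (1 - p / s) (gam / n%:R / 2).
have gn : gam / n%:R < 1 by rewrite ltr_pdivrMr// mul1r gtrBl.
have gn0 : 0 < gam / n%:R by rewrite divr_gt0.
have rho0 : 0 < rho by rewrite lt_max (_ : 0 < gam / n%:R / 2) ?orbT// divr_gt0.
have rhog : rho < gam / n%:R.
  rewrite gt_max; apply/andP; split; last by move: (gam / n%:R) gn0 => u u0; lra.
  have -> : gam / n%:R = 1 - alpha / n%:R by rewrite /gam; field; rewrite gt_eqF.
  rewrite ltrD2l ltrN2 ltr_pdivlMr// mulrC mulrA ltr_pdivrMr//.
  by move: sp; rewrite ltr_pdivlMr// mulrC (mulrC p).
have rho1 : rho < 1 by exact: lt_trans gn.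
have r10 : 0 < 1 - rho by rewrite subr_gt0.
exists rho^-1, (1 - rho)^-1; split.
- by rewrite invr_gt0.
- by rewrite invr_gt0.
- by rewrite !invrK addrCA subrr addr0.
- by rewrite ltr_pdivlMr// mulrC -ltr_pdivlMr.
- rewrite ler_pdivlMr// mulrC -ler_pdivlMr// lerBlDr -lerBlDl le_max lexx//.
Qed.

(** In the unit ball [|v| <= 1] almost everywhere, which allows powers of [|v|] to be compared;
    [potential_bound] reaches the other radii by homogeneity. Far from [x], the scalar Young
    inequality with the exponents of [conjugate_exponent] separates [v] from the kernel. *)
Lemma potential_unit : exists2 C : R, 0 <= C & forall v x, Xle s mu 1 v ->
  (\int[mu]_y (`|v y| `^ p * rker (subp x y))%:E <= C%:E)%E.
Proof.
have [r [r' [r0 r0' rr' nr sr]]] := conjugate_exponent.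
pose near1 (z : V) : R := if enorm z <= 1 then (enorm z `^ gam)^-1 else 0.
pose far (z : V) : R := (1 + enorm z) `^ (- (gam * r)).
have hnear : (\int[mu]_z (near1 z)%:E < +oo)%E.
  by apply: enorm_near_lty => //; rewrite gam0 /gam gtrBl a0.
have hfar : (\int[mu]_z (far z)%:E < +oo)%E by exact: enorm_far_lty.
have mnear : measurable_fun setT near1.
  rewrite (_ : near1 = fun z => \1_(`]-oo, 1%R]%classic : set R) (enorm z) * rker z).
    apply: measurable_funM; last exact: measurable_rker.
    exact: (measurableT_comp (measurable_indic (measurable_itv `]-oo, 1%R])) (@measurable_enorm R n)).
  apply/funext => z; rewrite /near1 indicE mem_setE /= in_itv/=.
  by case: ifP => _; rewrite ?mul1r ?mul0r.
have mfar : measurable_fun setT far.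
  apply: (measurableT_comp (measurable_powR _)); apply: measurable_funD => //.
  exact: measurable_enorm.
have near0 z : 0 <= near1 z by rewrite /near1; case: ifP => // _; rewrite invr_ge0 powR_ge0.
have far0 z : 0 <= far z by exact: powR_ge0.
(* Since [1 + |z| <= 2 |z|] for [|z| > 1], the power [r] of the kernel is there at most
   [A * far z]. *)
pose A := 2 `^ (gam * r) : R.
have A0 : 0 <= A by exact: powR_ge0.
(* The final 1 bounds the integral of [|v|^s] for [v] in the unit ball. *)
exists (fine (\int[mu]_z (near1 z)%:E) + A * fine (\int[mu]_z (far z)%:E) + 1).
  by rewrite !addr_ge0// ?mulr_ge0// fine_ge0// integral_ge0// => z _; rewrite lee_fin.
move=> v x [mv bv lv].
have mvs : measurable_fun setT (fun y => `|v y| `^ s) by exact: measurable_absX.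
have mvp : measurable_fun setT (fun y => `|v y| `^ p) by exact: measurable_absX.
have mn : measurable_fun setT (fun y => near1 (subp x y)) by exact: (measurableT_comp mnear (measurable_subpr x)).
have mf : measurable_fun setT (fun y => far (subp x y)) by exact: (measurableT_comp mfar (measurable_subpr x)).
have mAf : measurable_fun setT (fun y => A * far (subp x y)) by exact: measurable_funM.
apply: (@le_trans _ _ (\int[mu]_y (near1 (subp x y) + A * far (subp x y) + `|v y| `^ s)%:E)%E).
  apply: ae_ge0_le_integral => //.
  - by move=> y _; rewrite lee_fin mulr_ge0 ?powR_ge0 ?rker_ge0.
  - apply/measurable_EFinP; apply: measurable_funM => //.
    exact: (measurableT_comp measurable_rker (measurable_subpr x)).
  - by move=> y _; rewrite lee_fin !addr_ge0 ?mulr_ge0 ?powR_ge0.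
  - by apply/measurable_EFinP; apply: measurable_funD => //; exact: measurable_funD.
  apply: aeS bv => y v1 _; rewrite lee_fin; move: (subp x y) => z.
  have [z1|z1] := leP (enorm z) 1.
    rewrite /near1 z1 -/(rker z).
    apply: (@le_trans _ _ (rker z)); last by rewrite -addrA lerDl addr_ge0 ?mulr_ge0 ?powR_ge0.
    have : `|v y| `^ p <= 1 `^ p by rewrite ge0_ler_powR ?nnegrE// ltW.
    by rewrite powR1 => h1; rewrite ler_piMl ?rker_ge0.
  rewrite /near1 (lt_geF z1) add0r.
  apply: (le_trans (conjugate_powR (powR_ge0 _ p) (rker_ge0 z) r0' r0 _)); first by rewrite addrC.
  rewrite addrC; apply: lerD.
    have r1 : 1 <= r.
      by rewrite -invf_le1// -rr' lerDl invr_ge0 ltW.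
    apply: (@le_trans _ _ (rker z `^ r)).
      by rewrite ler_pdivrMr// ler_peMr ?powR_ge0.
    have e0 : 0 < enorm z by exact: lt_trans z1.
    rewrite /rker -powRN -powRrM mulNr /far /A !powRN.
    have c0 : 0 <= gam * r by rewrite mulr_ge0 ?ltW.
    rewrite ler_pdivlMr ?powR_gt0 ?addr_gt0// mulrC ler_pdivrMr ?powR_gt0//.
    rewrite -powRM ?(ltW e0)//; apply: ge0_ler_powR => //; rewrite ?nnegrE ?mulr_ge0 ?addr_ge0 ?(ltW e0)//.
    by move: z1; lra.
  have r1 : 1 <= r'.
    by rewrite -invf_le1// -rr' lerDr invr_ge0 ltW.
  apply: (@le_trans _ _ ((`|v y| `^ p) `^ r')).
    by rewrite ler_pdivrMr// ler_peMr ?powR_ge0.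
  rewrite -powRrM; have [->|vy] := eqVneq `|v y| 0.
    by rewrite !powR0 ?gt_eqF ?mulr_gt0.
  by rewrite ger_powR// v1 lt_neqAle eq_sym vy normr_ge0.
under eq_integral do rewrite EFinD EFinD.
rewrite ge0_integralD//; last 3 first.
- by move=> y _; rewrite -EFinD lee_fin addr_ge0 ?mulr_ge0.
- by apply: emeasurable_funD; exact/measurable_EFinP.
- exact/measurable_EFinP.
rewrite EFinD; apply: leeD; last by move: lv; rewrite /Lle powR1.
rewrite ge0_integralD//; last 4 first.
- by move=> y _; rewrite lee_fin.
- exact/measurable_EFinP.
- by move=> y _; rewrite lee_fin mulr_ge0.
- exact/measurable_EFinP.
have In : (\int[mu]_z (near1 z)%:E)%E \is a fin_num.
  by rewrite ge0_fin_numE; [exact: hnear|apply: integral_ge0 => z _; rewrite lee_fin near0].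
have If : (\int[mu]_z (far z)%:E)%E \is a fin_num.
  by rewrite ge0_fin_numE; [exact: hfar|apply: integral_ge0 => z _; rewrite lee_fin far0].
have En : (\int[mu]_y (near1 (subp x y))%:E = \int[mu]_y (near1 y)%:E)%E.
  apply: (leb_subp x (f := fun y => (near1 y)%:E)); first by apply/measurable_EFinP; exact: mnear.
  by move=> y; rewrite lee_fin near0.
have Ef : (\int[mu]_y (far (subp x y))%:E = \int[mu]_y (far y)%:E)%E.
  apply: (leb_subp x (f := fun y => (far y)%:E)); first by apply/measurable_EFinP; exact: mfar.
  by move=> y; rewrite lee_fin far0.
rewrite (integralZl_ge0 mu mf (fun y => far0 _) A0) EFinD EFinM (fineK In) (fineK If) -En -Ef.
exact: lexx.
Qed.

Lemma potential_bound : exists2 C : R, 0 <= C & forall M v x, 0 < M -> Xle s mu M v ->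
  (\int[mu]_y (`|v y| `^ p * rker (subp x y))%:E <= (C * M `^ p)%:E)%E.
Proof.
have [C C0 HC] := potential_unit; exists C => // M v x M0 Xv.
have := Xle_scale M^-1 (ltW M0) Xv.
rewrite gtr0_norm ?invr_gt0// mulVf ?gt_eqF// => Xv1.
have [mv _ _] := Xv.
have E y : `|v y| `^ p * rker (subp x y) =
    M `^ p * (`|M^-1 * v y| `^ p * rker (subp x y)).
  rewrite normrM gtr0_norm ?invr_gt0// powRM ?invr_ge0 ?(ltW M0)// !mulrA -powRM ?invr_ge0 ?(ltW M0)//.
  by rewrite divff ?gt_eqF// powR1 mul1r.
under eq_integral do rewrite E.
rewrite integralZl_ge0 ?powR_ge0//; first last.
- by move=> y; rewrite mulr_ge0 ?powR_ge0 ?rker_ge0.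
- apply: measurable_funM; last exact: (measurableT_comp measurable_rker (measurable_subpr x)).
  by apply: measurable_absX; exact: measurable_funM.
by rewrite mulrC EFinM; apply: lee_wpmul2l; [rewrite lee_fin powR_ge0|exact: HC].
Qed.

Definition pot (v : V -> R) (x : V) : R := \int[mu]_y (`|v y| `^ p * rker (subp x y)).

Lemma measurable_pot_integrand (v : V -> R) (x : V) : measurable_fun setT v ->
  measurable_fun setT (fun y => `|v y| `^ p * rker (subp x y)).
Proof.
move=> mv; apply: measurable_funM; first exact: measurable_absX.
exact: (measurableT_comp measurable_rker (measurable_subpr x)).
Qed.

Lemma pot_ge0 v x : 0 <= pot v x.
Proof. by apply: Rintegral_ge0 => y _; rewrite mulr_ge0 ?powR_ge0 ?rker_ge0. Qed.

(** With [v] and [w] divided by [M] and [v - w] by [D], [young_max] splits the product of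
    [max (|v|, |w|)^(p-1)] and [|v - w|] into pure [p]-th powers. Each resulting potential is that
    of a function in a unit ball, so [potential_bound] suffices and no bilinear estimate is
    needed. *)
Lemma pot_diff_integrand (M D v w : R) (z : V) : 0 < M -> 0 < D ->
  `| `|v| `^ p - `|w| `^ p | * rker z <=
  p * M `^ (p - 1) * D * ((M^-1) `^ p * (`|v| `^ p * rker z) + ((M^-1) `^ p * (`|w| `^ p * rker z) +
    (D^-1) `^ p * (`|v - w| `^ p * rker z))).
Proof.
move=> M0 D0; have k0 := rker_ge0 z; move: (rker z) k0 => k k0.
have Mi : 0 <= M^-1 by rewrite invr_ge0 ltW.
have Di : 0 <= D^-1 by rewrite invr_ge0 ltW.
have -> : (M^-1) `^ p * (`|v| `^ p * k) + ((M^-1) `^ p * (`|w| `^ p * k) + (D^-1) `^ p * (`|v - w| `^ p * k)) =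
    ((M^-1) `^ p * (`|v| `^ p + `|w| `^ p) + (D^-1) `^ p * `|v - w| `^ p) * k by ring.
rewrite mulrA; apply: ler_wpM2r => //.
apply: (le_trans (powR_norm_diff v w (ltW p1))).
set m := Num.max _ _; set d := `|v - w|.
have m0 : 0 <= m by rewrite le_max normr_ge0.
have -> : p * m `^ (p - 1) * d = p * M `^ (p - 1) * D * ((M^-1 * m) `^ (p - 1) * (D^-1 * d)).
  rewrite powRM//; have : M `^ (p - 1) * M^-1 `^ (p - 1) = 1.
    by rewrite -powRM ?(ltW M0)// divff ?gt_eqF// powR1.
  move: (M `^ (p - 1)) (M^-1 `^ (p - 1)) (m `^ (p - 1)) => X Y Z XY.
  have DD : D * D^-1 = 1 by rewrite divff// gt_eqF.
  by rewrite -[LHS]mulr1 -DD -[LHS]mulr1 -XY; ring.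
apply: ler_wpM2l; first by rewrite !mulr_ge0 ?powR_ge0// ltW.
have d0 : 0 <= D^-1 * d by rewrite mulr_ge0 ?normr_ge0.
apply: (le_trans (young_max (mulr_ge0 Mi m0) d0 (ltW p1))).
rewrite (@powRM R M^-1 m p Mi m0) (@powRM R D^-1 d p Di (normr_ge0 _)) lerD2r.
apply: ler_wpM2l; first exact: powR_ge0.
exact: powR_max_le.
Qed.

(** The factor 3 counts the potentials of [pot_diff_integrand], each at most [C] after
    normalisation. *)
Lemma pot_estimates : exists2 C : R, 0 <= C &
  (forall M v x, 0 < M -> Xle s mu M v -> pot v x <= C * M `^ p) /\
  (forall M D v w x, 0 < M -> 0 < D -> Xle s mu M v -> Xle s mu M w -> Xle s mu D (v \- w) ->
    `|pot v x - pot w x| <= 3 * C * p * M `^ (p - 1) * D).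
Proof.
have [C C0 HC] := potential_bound; exists C => //.
have iP M v x : 0 < M -> Xle s mu M v ->
    mu.-integrable setT (EFin \o (fun y => `|v y| `^ p * rker (subp x y))).
  move=> M0 Xv; have [mv _ _] := Xv; apply: ge0_integrable_lty.
  - exact: measurable_pot_integrand.
  - by move=> y; rewrite mulr_ge0 ?powR_ge0 ?rker_ge0.
  - by apply: (le_lt_trans (HC _ _ _ M0 Xv)); rewrite ltry.
split=> [M v x M0 Xv|M D v w x M0 D0 Xv Xw Xvw].
  by rewrite -lee_fin RintegralK; [exact: HC|exact: iP Xv].
rewrite /pot -RintegralB//; [|exact: iP Xv|exact: iP Xw].
have [mv _ _] := Xv; have [mw _ _] := Xw; have [mvw _ _] := Xvw.
pose g y := p * M `^ (p - 1) * D * ((M^-1) `^ p * (`|v y| `^ p * rker (subp x y)) +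
  ((M^-1) `^ p * (`|w y| `^ p * rker (subp x y)) + (D^-1) `^ p * (`|(v \- w) y| `^ p * rker (subp x y)))).
have m1 := measurable_pot_integrand x mv; have m2 := measurable_pot_integrand x mw.
have m3 := measurable_pot_integrand x mvw.
have mc c (h : V -> R) : measurable_fun setT h -> measurable_fun setT (fun y => c * h y).
  by move=> mh; exact: measurable_funM.
have m23 := measurable_funD (mc (M^-1 `^ p) _ m2) (mc (D^-1 `^ p) _ m3).
have m123 := measurable_funD (mc (M^-1 `^ p) _ m1) m23.
have g0 c (h : V -> R) : 0 <= c -> (forall y, 0 <= h y) -> forall y, 0 <= c * h y.
  by move=> c0 h0 y; rewrite mulr_ge0.
have f0 (h : V -> R) y : 0 <= `|h y| `^ p * rker (subp x y) by rewrite mulr_ge0 ?powR_ge0 ?rker_ge0.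
have c0 : 0 <= p * M `^ (p - 1) * D by rewrite !mulr_ge0 ?powR_ge0 ?ltW.
have iM c (h : V -> R) A : 0 < A -> c = A^-1 -> Xle s mu A h ->
    (\int[mu]_y (c `^ p * (`|h y| `^ p * rker (subp x y)))%:E <= C%:E)%E.
  move=> A0 -> Xh; have [mh _ _] := Xh.
  rewrite integralZl_ge0 ?powR_ge0//; last exact: measurable_pot_integrand.
  apply: (le_trans (lee_wpmul2l _ (HC _ _ x A0 Xh))); first by rewrite lee_fin powR_ge0.
  rewrite -EFinM lee_fin mulrCA -powRM ?invr_ge0 ?(ltW A0)// mulVf ?gt_eqF//.
  by rewrite powR1 mulr1.
apply: (@le_norm_Rintegral _ _ _ _ _ g).
- exact: measurable_funB.
- exact: mc.
- move=> y; rewrite -mulrBl normrM (ger0_norm (rker_ge0 _)).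
  exact: pot_diff_integrand.
rewrite integralZl_ge0//; last by move=> y; rewrite !addr_ge0 ?mulr_ge0 ?powR_ge0 ?rker_ge0.
under eq_integral do rewrite EFinD EFinD.
rewrite ge0_integralD//; last 4 first.
- by move=> y _; rewrite lee_fin mulr_ge0 ?powR_ge0.
- by apply/measurable_EFinP; exact: mc.
- by move=> y _; rewrite -EFinD lee_fin addr_ge0 ?mulr_ge0 ?powR_ge0 ?rker_ge0.
- by rewrite /=; apply: emeasurable_funD; apply/measurable_EFinP; exact: mc.
rewrite ge0_integralD//; last 4 first.
- by move=> y _; rewrite lee_fin mulr_ge0 ?powR_ge0.
- by apply/measurable_EFinP; exact: mc.
- by move=> y _; rewrite lee_fin mulr_ge0 ?powR_ge0.
- by apply/measurable_EFinP; exact: mc.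
apply: (@le_trans _ _ ((p * M `^ (p - 1) * D)%:E * (C%:E + (C%:E + C%:E)))%E).
  apply: lee_wpmul2l; first by rewrite lee_fin.
  by apply: leeD; [exact: (iM _ _ M)|apply: leeD; [exact: (iM _ _ M)|exact: (iM _ _ D)]].
rewrite -!EFinD -EFinM lee_fin le_eqVlt; apply/orP; left; apply/eqP; ring.
Qed.

Lemma Gamma_ge0 (z : R) : 0 <= Gamma z.
Proof.
apply: Rintegral_ge0 => x /=; rewrite in_itv/= andbT => x0.
by rewrite mulr_ge0 ?powR_ge0 ?expR_ge0.
Qed.

Lemma riesz_const_ge0 : 0 <= @riesz_const R n alpha.
Proof. by rewrite /riesz_const divr_ge0 ?mulr_ge0 ?Gamma_ge0 ?powR_ge0. Qed.

Local Notation N := (@nonlinearity R n alpha p q).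
Local Notation c := (@riesz_const R n alpha).

Let q0 : 0 < q. Proof. exact: lt_le_trans q1. Qed.

Lemma measurable_pot d (T : measurableType d) (F : T -> V -> R) :
  measurable_fun setT (fun z : T * V => F z.1 z.2) ->
  measurable_fun setT (fun z : T * V => pot (F z.1) z.2).
Proof.
move=> mF.
apply: (@measurable_fine_integral _ _ (T * V)%type V R mu
  (fun z y => `|F z.1 y| `^ p * rker (subp z.2 y))).
apply: measurable_funM.
  apply: (measurableT_comp (measurable_powR _)); apply: measurableT_comp => //.
  by apply: (measurable_comp2 (F := F) mF) => //; exact: measurableT_comp.
apply: (measurableT_comp measurable_rker).
by apply: (measurable_comp2 (F := @subp R n) (@measurable_subp R n)) => //; exact: measurableT_comp.
Qed.

Lemma nonlinearity_diff (M v w : R) : 0 <= M -> `|v| <= M -> `|w| <= M ->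
  `| `|v| `^ q - `|w| `^ q | <= q * M `^ (q - 1) * `|v - w|.
Proof.
move=> M0 vM wM; apply: (le_trans (powR_norm_diff v w q1)).
rewrite ler_wpM2r// ler_wpM2l ?(ltW q0)// ge0_ler_powR ?nnegrE ?subr_ge0//;
  by rewrite ?le_max ?ge_max ?normr_ge0 ?vM ?wM.
Qed.

(** With [P], [P'] the potentials and [a], [b] the local powers,
    [P a - P' b = P (a - b) + (P - P') b]. As potentials are bounded uniformly, the difference is
    dominated pointwise by [A |v - w| + B |w|], where [B] carries the factor [D]; this lies in the
    required ball by [Xle_dom]. *)
Lemma lip_nonlinearity_riesz : exists L, lip_nonlinearity s N L.
Proof.
have [C C0 [HP HD]] := pot_estimates.
have [cst c0 NE] : exists2 cst, 0 <= cst & forall v x, N v x = cst * pot v x * `|v x| `^ q.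
  by exists c => //; exact: riesz_const_ge0.
pose L M := cst * C * M `^ p * (q * M `^ (q - 1)) + cst * (3 * C * p * M `^ (p - 1)) * (M `^ (q - 1) * M).
exists L; split.
- move=> d T F mF; under eq_fun do rewrite NE.
  apply: measurable_funM; first by apply: measurable_funM => //; exact: measurable_pot.
  by apply: (measurableT_comp (measurable_powR _)); exact: measurableT_comp.
- move=> v w mv mw vw; have P x : pot v x = pot w x.
    apply: ae_eq_Rintegral; [exact: measurable_pot_integrand|exact: measurable_pot_integrand|].
    by apply: aeS vw => y ->.
  by apply: aeS vw => x vx; rewrite (NE v) (NE w) vx P.
- by move=> v x; rewrite NE; exact: (mulr_ge0 (mulr_ge0 c0 (pot_ge0 v x)) (powR_ge0 _ _)).
- by move=> M M0; rewrite addr_ge0 ?mulr_ge0 ?powR_ge0 ?(ltW q0) ?(ltW p0).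
- by move=> x; rewrite NE normr0 powR0 ?mulr0// gt_eqF.
move=> M D v w M0 D0 Xv Xw Xd.
have [mv bv _] := Xv; have [mw bw _] := Xw; have [md _ _] := Xd.
have mp u : measurable_fun setT u -> measurable_fun setT (pot u).
  move=> mu'; have := @measurable_pot _ (measurableTypeR R) (fun _ => u).
  move=> /(_ (measurableT_comp mu' measurable_snd)) H.
  exact: (measurableT_comp H (pair1_measurable (0 : measurableTypeR R))).
have mN u : measurable_fun setT u -> measurable_fun setT (N u).
  move=> mu'; rewrite (_ : N u = fun x => cst * pot u x * `|u x| `^ q); last by apply/funext => x; exact: NE.
  by apply: measurable_funM; [apply: measurable_funM => //; exact: mp|exact: measurable_absX].
pose A := cst * C * M `^ p * (q * M `^ (q - 1)).
pose B := cst * (3 * C * p * M `^ (p - 1) * D) * M `^ (q - 1).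
have A0 : 0 <= A by rewrite ?mulr_ge0 ?powR_ge0 ?(ltW q0) ?(ltW p0) ?(ltW D0).
have B0 : 0 <= B by rewrite ?mulr_ge0 ?powR_ge0 ?(ltW q0) ?(ltW p0) ?(ltW D0).
have nrm (u : V -> R) E : Xle s mu E u -> Xle s mu E (fun x => `|u x|).
  move=> Xu; have [mu' _ _] := Xu; apply: (Xle_dom s1 _ _ Xu); first exact: measurableT_comp.
  by apply: aeW => x; rewrite normr_id.
have XA := Xle_scale A (ltW D0) (nrm _ _ Xd).
have XB := Xle_scale B (ltW M0) (nrm _ _ Xw).
have XAB := Xle_add s1 (mulr_ge0 (normr_ge0 A) (ltW D0)) (mulr_ge0 (normr_ge0 B) (ltW M0)) XA XB.
rewrite !ger0_norm// in XAB.
have -> : L M * D = A * D + B * M by rewrite /L /A /B; ring.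
apply: (Xle_dom s1 _ _ XAB); first by apply: measurable_funB; exact: mN.
apply: aeS2 bv bw => x vM wM; rewrite [leRHS]ger0_norm; last exact: (addr_ge0 (mulr_ge0 A0 (normr_ge0 _)) (mulr_ge0 B0 (normr_ge0 _))).
rewrite /= (NE v) (NE w).
have := pot_ge0 v x; have := HP _ _ x M0 Xv; have := HD _ _ _ _ x M0 D0 Xv Xw Xd.
have := nonlinearity_diff (ltW M0) vM wM.
have : `|w x| `^ q <= M `^ (q - 1) * `|w x|.
  rewrite (powR_split (normr_ge0 _) q1); apply: ler_wpM2r => //.
  by rewrite ge0_ler_powR ?nnegrE ?subr_ge0// ltW.
have := powR_ge0 `|w x| q; have := normr_ge0 (v x - w x).
rewrite /A /B; move: (pot v x) (pot w x) (`|v x| `^ q) (`|w x| `^ q) (M `^ p) (M `^ (p - 1)) (M `^ (q - 1)).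
move: `|v x - w x| `|w x| => d aw P P' a b Mp Mp1 Mq1 d0 b0 hb hab hP hP0 P0.
rewrite (_ : cst * P * a - cst * P' * b = cst * P * (a - b) + cst * (P - P') * b); last by ring.
apply: (le_trans (ler_normD _ _)); rewrite !normrM (ger0_norm c0) (ger0_norm P0) (ger0_norm b0).
apply: lerD.
  rewrite (_ : cst * C * Mp * (q * Mq1) * d = cst * (C * Mp) * (q * Mq1 * d)); last by ring.
  by apply: ler_pM => //; [rewrite mulr_ge0|rewrite ler_wpM2l].
rewrite (_ : cst * (3 * C * p * Mp1 * D) * Mq1 * aw = cst * (3 * C * p * Mp1 * D) * (Mq1 * aw)); last by ring.
by apply: ler_pM => //; [rewrite mulr_ge0|rewrite ler_wpM2l].
Qed.

End riesz.

(** * Pointwise solutions: restarting, gluing and uniqueness *)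

Section real_facts.
Context {R : realType}.
Local Notation mu1 := (@lebesgue_measure R).

Lemma cvgn_half (a : nat -> R) (D : R) :
  (forall k, `|a k.+1 - a k| <= D * 2^-1 ^+ k) -> cvgn a.
Proof.
move=> aD.
suff C : cvgn (series (telescope a)).
  have -> : a = (fun n => a 0%N + series (telescope a) n).
    by apply/funext => n; exact: eq_sum_telescope.
  by apply: is_cvgD; [exact: is_cvg_cst|exact: C].
apply: normed_cvg; apply: (@series_le_cvg _ _ (geometric D 2^-1)).
- by move=> k; exact: normr_ge0.
- by move=> k; apply: le_trans (aD k); exact: normr_ge0.
- by move=> k; exact: aD.
- by apply: is_cvg_geometric_series; rewrite ger0_norm ?invr_ge0// invf_lt1// ltr1n.
Qed.

Lemma cvg_half (D : R) : D * 2^-1 ^+ k @[k --> \oo] --> (0 : R).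
Proof. by apply: cvg_geometric; rewrite ger0_norm ?invr_ge0// invf_lt1// ltr1n. Qed.

Lemma le0_half (x D : R) : (forall k, x <= D * 2^-1 ^+ k) -> x <= 0.
Proof. by move=> h; apply: (cvgn_ge_bound (cvg_half D) h). Qed.

(** Integrating the exponential weight gains the factor [1 / l], which for large [l] beats the
    Lipschitz constant whatever the length of the time interval. *)
Lemma integral_win_expR (t l : R) : 0 < t -> 0 < l ->
  (\int[mu1]_r (win t r * expR (l * r))%:E <= (expR (l * t) / l)%:E)%E.
Proof.
move=> t0 l0.
have mexp : measurable_fun setT (fun r : measurableTypeR R => expR (l * r)).
  by apply: measurableT_comp => //; exact: measurable_funM.
under eq_integral do rewrite winE.
rewrite -integral_mkcond_indic; last exact: measurable_itv.
apply: (@le_trans _ _ (\int[mu1]_(r in `[0%R, t]) (expR (l * r))%:E)%E).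
  apply: ge0_subset_integral; [exact: measurable_itv|exact: measurable_itv| | |exact: subset_itv_oo_cc].
    by apply/measurable_EFinP; exact: measurable_funTS.
  by move=> r _; rewrite lee_fin expR_ge0.
have dE (r : R) : is_derive r 1 (fun r => l^-1 * expR (l * r)) (expR (l * r)).
  have dl : is_derive r (1 : R) (fun r => l * r) (l * 1).
    by apply: (is_derive_eq (is_deriveZ l (is_derive_id r 1))).
  have de := @is_derive1_comp R expR (fun r => l * r) r _ _ (is_derive_expR (l * r)) dl.
  apply: (is_derive_eq (is_deriveZ l^-1 de)); rewrite /GRing.scale/= mulr1.
  by rewrite mulrC mulfK// gt_eqF.
have cE (r : R) : {for r, continuous (fun r => expR (l * r))}.
  by apply: continuous_comp; [exact: mulrl_continuous|exact: continuous_expR].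
rewrite (FTC2_itv t0 (fun r _ => dE r) (fun r _ => cE r)).
by rewrite lee_fin mulr0 expR0 mulr1 mulrC gerBl invr_ge0 ltW.
Qed.

(** At [r = t] the left side is 1 and the right side 0; this single time is negligible in
    [duhamel_restart]. *)
Lemma win_split (t h r : R) : 0 < t -> 0 < h -> r != t ->
  win (t + h) r = win t r + win h (r - t).
Proof.
move=> t0 h0 rt.
have [[/andP[a b] ->]|[/negP nab ->]] := winP (t + h) r;
have [[/andP[c d] ->]|[/negP ncd ->]] := winP t r;
have [[/andP[e f] ->]|[/negP nef ->]] := winP h (r - t); rewrite ?addr0 ?add0r//; exfalso.
- lra.
- case: (ltgtP r t) rt => // rt _; [apply: ncd|apply: nef]; apply/andP; split; lra.
- lra.
- by apply: nab; apply/andP; split; lra.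
- by apply: nab; apply/andP; split; lra.
Qed.

End real_facts.

Section mild.
Context {R : realType} (n : nat) (s : R) (K : Rn R n -> R -> R)
  (N : (Rn R n -> R) -> Rn R n -> R) (L : R -> R).
Hypotheses (n0 : (0 < n)%N) (s1 : 1 < s) (hK : heat_kernel K) (hN : lip_nonlinearity s N L).
Local Notation V := (Rn R n).
Local Notation mu := (leb R n).
Local Notation mu1 := (@lebesgue_measure R).
Local Notation S := (semig K).
Local Notation duhamel := (duhamel_int K).
Local Notation X := (Xle s mu).
Implicit Types (v w : V -> R) (f u : R -> V -> R).

Definition jmeas f := measurable_fun setT (fun z : measurableTypeR R * V => f z.1 z.2).

Lemma N_Xle (M : R) v : 0 < M -> X M v -> X (L M * M) (N v).
Proof.
move=> M0 Xv; have X0 : X M (fun=> 0) by apply: (Xle_weak s1 (lexx 0) (ltW M0)); exact: Xle0.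
have Xv0 : X M (v \- (fun=> 0)) by move: Xv; congr Xle; apply/funext => x /=; rewrite subr0.
have := nl_lip hN M0 M0 Xv X0 Xv0; congr Xle; apply/funext => x /=.
by rewrite (nl_zero hN) subr0.
Qed.

Lemma LM0 (M : R) : 0 < M -> 0 <= L M * M.
Proof. by move=> M0; rewrite mulr_ge0 ?(nl_L0 hN) ?ltW. Qed.

Lemma jmeas_N f : jmeas f -> jmeas (fun r => N (f r)).
Proof. move=> mf; exact: (nl_meas hN mf). Qed.

Lemma jmeas_shift f (t : R) : jmeas f -> jmeas (fun r => f (t + r)).
Proof.
move=> mf; apply: (measurable_comp2 (F := f : measurableTypeR R -> V -> R)
  (f := fun z : measurableTypeR R * V => t + z.1)) => //.
by apply: measurable_funD => //; exact: measurableT_comp.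
Qed.

Lemma jmeas_at f (t : R) : jmeas f -> measurable_fun setT (f t).
Proof. by move=> mf; exact: (measurable_section1 (t : measurableTypeR R) mf). Qed.

Lemma jmeas_sub f1 f2 : jmeas f1 -> jmeas f2 -> jmeas (fun r => f1 r \- f2 r).
Proof. by move=> m1 m2; exact: measurable_funB m1 m2. Qed.

Lemma jmeas_S v : measurable_fun setT v -> jmeas (fun t => S t v).
Proof.
move=> mv; apply: (measurable_S_family hK (a := fun z : measurableTypeR R * V => z.1)
  (b := fun z => z.2) (F := fun _ => v)).
- exact: measurable_fst.
- exact: measurable_snd.
- exact: (measurableT_comp mv measurable_snd).
Qed.

Section constant_weight.
Variables (f : R -> V -> R) (t C : R).
Hypotheses (mf : jmeas f) (t0 : 0 < t) (C0 : 0 <= C) (fC : forall r, 0 < r < t -> X C (f r)).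

Let gB : (\int[mu1]_r (win t r * (fun=> C) r)%:E <= (C * t)%:E)%E.
Proof.
under eq_integral do rewrite mulrC.
rewrite integralZl_ge0//; last 2 first.
- exact: (measurableT_comp measurable_win (pair1_measurable t)).
- by move=> r; exact: win_ge0.
by rewrite integral_win ?(ltW t0)// EFinM.
Qed.

Let mC : measurable_fun setT ((fun=> C) : measurableTypeR R -> R).
Proof. exact: measurable_cst. Qed.

Lemma duhamel_cst : (forall x, `|duhamel f t x| <= C * t) /\ X (C * t) (duhamel f t).
Proof.
by apply: (duhamel_Xle s1 hK mf mC _ gB) => //; rewrite mulr_ge0 ?(ltW t0).
Qed.

Lemma duhamel_cst_le r x : `|win t r * S (t - r) (f r) x| <= win t r * C.
Proof. exact: (duhamel_integrand_le s1 hK (g := fun=> C) (fun _ => C0) fC). Qed.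

Lemma duhamel_cst_integrable x :
  mu1.-integrable setT (fun r : measurableTypeR R => (win t r * S (t - r) (f r) x)%:E).
Proof.
apply: (@integrable_dom _ _ _ mu1 _ (fun r => win t r * C) (C * t)) => //.
- exact: (measurable_duhamel_at1 hK mf t x).
- by apply: measurable_funM => //; exact: (measurableT_comp measurable_win (pair1_measurable t)).
- by move=> r; exact: duhamel_cst_le.
Qed.

Lemma S_duhamel_cst h x : 0 < h ->
  S h (duhamel f t) x = \int[mu1]_r (win t r * S (t + h - r) (f r) x).
Proof. by move=> h0; exact: (S_duhamel s1 hK mf mC (fun _ => C0) gB). Qed.

End constant_weight.

Lemma duhamel_ext f1 f2 t x : (forall r, 0 < r < t -> f1 r = f2 r) ->
  duhamel f1 t x = duhamel f2 t x.
Proof.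
move=> h; apply: eq_Rintegral => r _.
by have [[/h -> _]//|[_ ->]] := winP t r; rewrite !mul0r.
Qed.

Lemma duhamel_sub f1 f2 t x (C : R) : jmeas f1 -> jmeas f2 -> 0 < t -> 0 <= C ->
  (forall r, 0 < r < t -> X C (f1 r)) -> (forall r, 0 < r < t -> X C (f2 r)) ->
  duhamel (fun r => f1 r \- f2 r) t x = duhamel f1 t x - duhamel f2 t x.
Proof.
move=> m1 m2 t0 C0 h1 h2; rewrite /duhamel_int -RintegralB//; last 2 first.
- exact: (duhamel_cst_integrable m1 t0 C0 h1).
- exact: (duhamel_cst_integrable m2 t0 C0 h2).
apply: eq_Rintegral => r _; have [[rt ->]|[_ ->]] := winP t r; last by rewrite !mul0r subrr.
rewrite !mul1r; apply: (S_sub hK x _ C0 C0); [|exact: h1|exact: h2].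
by case/andP: rt; rewrite subr_gt0.
Qed.

(** The integral over []0, t + h[] is cut at [t]. By the semigroup law the past contributes [S h] of
    the Duhamel term at [t]; a translation in time turns the rest into a Duhamel term of length
    [h]. *)
Lemma duhamel_restart f t h x (C : R) : jmeas f -> 0 < t -> 0 < h -> 0 <= C ->
  (forall r, 0 < r < t + h -> X C (f r)) ->
  duhamel f (t + h) x = S h (duhamel f t) x + duhamel (fun r => f (t + r)) h x.
Proof.
move=> mf t0 h0 C0 fC.
have fC1 r : 0 < r < t -> X C (f r).
  by move=> /andP[r0 rt]; apply: fC; rewrite r0 (lt_trans rt)// ltrDl.
have fC2 r : 0 < r < h -> X C (f (t + r)).
  by move=> /andP[r0 rt]; apply: fC; rewrite addr_gt0//= ltrD2l.
have th0 : 0 < t + h by rewrite addr_gt0.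
have i0 := duhamel_cst_integrable mf th0 C0 fC x.
have m0 := measurable_duhamel_at1 hK mf (t + h) x.
rewrite (S_duhamel_cst mf t0 C0 fC1)//.
pose F (r : measurableTypeR R) : R := win h (r - t) * S (t + h - r) (f r) x.
pose G (r : measurableTypeR R) : R := win t r * S (t + h - r) (f r) x.
have mS : measurable_fun setT (fun r : measurableTypeR R => S (t + h - r) (f r) x).
  apply: (measurable_S_family hK (a := fun r : measurableTypeR R => t + h - r)
    (b := fun _ => x) (F := f)) => //.
  exact: measurable_funB.
have mF : measurable_fun setT F.
  apply: measurable_funM => //.
  apply: (measurable_comp2 (F := win : measurableTypeR R -> measurableTypeR R -> R)
    (f := fun=> h) measurable_win) => //.
  exact: measurable_funB.
have mG : measurable_fun setT G.
  by apply: measurable_funM => //; exact: (measurableT_comp measurable_win (pair1_measurable t)).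
have FE : \int[mu1]_r F r = duhamel (fun r => f (t + r)) h x.
  rewrite -(leb1_shiftR t mF); apply: eq_Rintegral => r _.
  by rewrite /F (addrC t r) addrK (addrC t h) opprD (addrC (- r)) addrA addrK (addrC r t).
have le1 r : `|F r| <= win (t + h) r * C /\ `|G r| <= win (t + h) r * C.
  have [rth|rth] := boolP (0 < r < t + h).
    have -> : win (t + h) r = 1 by have [[]//|[]] := winP (t + h) r; rewrite rth.
    have rt0 : 0 < t + h - r by rewrite subr_gt0; case/andP: rth.
    have [hS _] := S_Xle s1 hK rt0 C0 (fC _ rth).
    rewrite mul1r; split; rewrite normrM -[leRHS]mul1r ler_pM// ger0_norm ?win_ge0 ?win_le1//.
  have z1 : win h (r - t) = 0.
    have [[/andP[a b] _]|[]//] := winP h (r - t); exfalso; move/negP: rth; apply.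
    by apply/andP; split; lra.
  have z2 : win t r = 0.
    have [[/andP[a b] _]|[]//] := winP t r; exfalso; move/negP: rth; apply.
    by apply/andP; split; lra.
  by rewrite /F /G z1 z2 !mul0r normr0 mulr_ge0 ?win_ge0.
have mw : measurable_fun setT (fun r : measurableTypeR R => win (t + h) r * C).
  by apply: measurable_funM => //; exact: (measurableT_comp measurable_win (pair1_measurable (t + h))).
have wB : (\int[mu1]_r (win (t + h) r * C)%:E <= ((t + h) * C)%:E)%E.
  under eq_integral do rewrite mulrC.
  rewrite (integralZl_ge0 mu1 (measurableT_comp measurable_win (pair1_measurable (t + h : measurableTypeR R))) (win_ge0 (t + h)) C0).
  by rewrite integral_win ?(ltW th0)// -EFinM mulrC.
have iF : mu1.-integrable setT (EFin \o F).
  by apply: (integrable_dom mF mw _ wB) => r; case: (le1 r).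
have iG : mu1.-integrable setT (EFin \o G).
  by apply: (integrable_dom mG mw _ wB) => r; case: (le1 r).
rewrite -FE -(RintegralD measurableT iG iF).
apply: ae_eq_Rintegral => //; first exact: measurable_funD.
exists [set t]; split; [exact: measurable_set1|exact: lebesgue_measure_set1|].
move=> r /= h'; apply: contrapT => /eqP rt; apply: h'.
by rewrite /F /G -mulrDl -win_split.
Qed.

(* Here the equation holds at every point: gluing solutions and passing to the
   limit then involve no null sets. *)
Record nice v (T : R) u : Prop := Nice {
  nice_meas : jmeas u;
  nice_bdd : exists2 M : R, 0 < M & forall t, 0 < t <= T -> X M (u t);
  nice_eq : forall t x, 0 < t <= T -> u t x = S t v x + duhamel (fun r => N (u r)) t x }.

Lemma nice_le v T T' u : T' <= T -> nice v T u -> nice v T' u.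
Proof.
move=> TT [mu' [M M0 hM] eu]; split => //.
  by exists M => // t /andP[t0 tT]; apply: hM; rewrite t0 (le_trans tT).
by move=> t x /andP[t0 tT]; apply: eu; rewrite t0 (le_trans tT).
Qed.

Lemma nice_restart v (M T t : R) u : 0 < M -> X M v -> nice v T u -> 0 < t <= T ->
  nice (u t) (T - t) (fun r => u (t + r)).
Proof.
move=> M0 Xv [mju [A A0 hA] eu] /andP[t0 tT]; split.
- exact: jmeas_shift.
- exists A => // r /andP[r0 rT]; apply: hA; rewrite addr_gt0//=.
  by rewrite addrC -lerBrDr.
move=> h x /andP[h0 hT]; have thT : t + h <= T by rewrite addrC -lerBrDr.
have mNu := jmeas_N mju; have C0 := LM0 A0.
have fC r : 0 < r < t + h -> X (L A * A) (N (u r)).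
  by move=> /andP[r0 rt]; apply: N_Xle => //; apply: hA; rewrite r0 ltW// (lt_le_trans rt).
have fC1 r : 0 < r < t -> X (L A * A) (N (u r)).
  by move=> /andP[r0 rt]; apply: fC; rewrite r0 (lt_trans rt)// ltrDl.
have thT1 : 0 < t + h <= T by rewrite addr_gt0.
rewrite (eu _ _ thT1) (duhamel_restart x mNu t0 h0 C0 fC) addrA; congr (_ + _).
have -> : u t = S t v \+ duhamel (fun r => N (u r)) t.
  have t0T : 0 < t <= T by rewrite t0.
  by apply/funext => y; rewrite (eu _ _ t0T).
have [_ Xd] := duhamel_cst mNu t0 C0 fC1.
have [_ XS] := S_Xle s1 hK t0 (ltW M0) Xv.
rewrite (S_add hK x h0 (ltW M0) (mulr_ge0 C0 (ltW t0)) XS Xd) (SS hK x h0 t0 (ltW M0) Xv).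
by rewrite (addrC h).
Qed.

Definition glue (T1 : R) u1 u2 : R -> V -> R := fun t => if t <= T1 then u1 t else u2 (t - T1).

Lemma jmeas_glue T1 u1 u2 : jmeas u1 -> jmeas u2 -> jmeas (glue T1 u1 u2).
Proof.
move=> m1 m2; rewrite /jmeas.
rewrite (_ : (fun z => _) = fun z : measurableTypeR R * V =>
   \1_(`]-oo, T1]%classic : set R) z.1 * u1 z.1 z.2 +
   (1 - \1_(`]-oo, T1]%classic : set R) z.1) * u2 (- T1 + z.1) z.2).
  have mi : measurable_fun setT (fun z : measurableTypeR R * V => \1_(`]-oo, T1]%classic : set R) z.1 : R).
    exact: (measurableT_comp (measurable_indic (measurable_itv `]-oo, T1])) measurable_fst).
  apply: measurable_funD; apply: measurable_funM => //.
    exact: measurable_funB.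
  exact: (jmeas_shift (- T1) m2).
apply/funext => z; rewrite /glue indicE mem_setE /= in_itv/= (addrC (- T1)).
by case: ifP => _; rewrite ?(mul1r, mul0r, subrr, subr0, addr0, add0r).
Qed.

(** Converse to [nice_restart]: after [T1] the equation of [w] starts from [u T1], and
    [duhamel_restart] read backwards absorbs the past into the equation started from [v]. *)
Lemma nice_glue v (M T1 h : R) (u w : R -> V -> R) : 0 < M -> X M v -> 0 < T1 -> nice v T1 u -> nice (u T1) h w ->
  nice v (T1 + h) (glue T1 u w).
Proof.
move=> M0 Xv T10 [mju [A A0 hA] eu] [mjw [B B0 hB] ew].
have mjg := jmeas_glue T1 mju mjw.
have bd t : 0 < t <= T1 + h -> X (A + B) (glue T1 u w t).
  move=> /andP[t0 th]; rewrite /glue; case: leP => [tT|Tt].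
    by apply: (Xle_weak s1 (ltW A0)); [rewrite lerDl ltW|apply: hA; rewrite t0].
  apply: (Xle_weak s1 (ltW B0)); [by rewrite lerDr ltW|apply: hB].
  by rewrite subr_gt0 Tt/= lerBlDl.
have AB0 : 0 < A + B by rewrite addr_gt0.
split => //; first by exists (A + B).
have mNg := jmeas_N mjg; have C0 := LM0 AB0.
move=> t x /andP[t0 th]; have [tT|Tt] := leP t T1.
  have tT1 : 0 < t <= T1 by rewrite t0.
  rewrite {1}/glue tT (eu _ _ tT1); congr (_ + _); apply: duhamel_ext => r /andP[r0 rt].
  by rewrite /glue (le_trans (ltW rt) tT).
rewrite {1}/glue leNgt Tt/=.
pose h1 := t - T1; have h10 : 0 < h1 by rewrite subr_gt0.
have tE : t = T1 + h1 by rewrite /h1 addrC subrK.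
have fC r : 0 < r < T1 + h1 -> X (L (A + B) * (A + B)) (N (glue T1 u w r)).
  move=> /andP[r0 rt]; apply: N_Xle => //; apply: bd; rewrite r0 ltW//.
  by rewrite (lt_le_trans rt)// -tE.
have fC1 r : 0 < r < T1 -> X (L (A + B) * (A + B)) (N (glue T1 u w r)).
  by move=> /andP[r0 rt]; apply: fC; rewrite r0 (lt_trans rt)// ltrDl.
rewrite {2 3}tE (duhamel_restart x mNg T10 h10 C0 fC) addrA -/h1 ew; last first.
  by rewrite h10/= /h1 lerBlDl.
congr (_ + _); last first.
  apply: duhamel_ext => r /andP[r0 rt]; rewrite /glue.
  by rewrite leNgt ltrDl r0/= (addrC T1) addrK.
have [_ Xd] := duhamel_cst mNg T10 C0 fC1.
have [_ XS] := S_Xle s1 hK T10 (ltW M0) Xv.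
have -> : u T1 = S T1 v \+ duhamel (fun r => N (glue T1 u w r)) T1.
  have TT1 : 0 < T1 <= T1 by rewrite T10 lexx.
  apply/funext => y; rewrite (eu _ _ TT1); congr (_ + _).
  by apply: duhamel_ext => r /andP[r0 rt]; rewrite /glue ltW.
rewrite (S_add hK x h10 (ltW M0) (mulr_ge0 C0 (ltW T10)) XS Xd) (SS hK x h10 T10 (ltW M0) Xv).
by rewrite (addrC h1).
Qed.

(* Each Duhamel step halves the bound [D k t] on the difference, thanks to the
   weight [expR (l * t)]. *)
Lemma nice_unique v (T : R) (u w : R -> V -> R) : nice v T u -> nice v T w ->
  forall t x, 0 < t <= T -> u t x = w t x.
Proof.
move=> [mju [A A0 hA] eu] [mjw [B B0 hB] ew].
pose M := A + B; have M0 : 0 < M by rewrite addr_gt0.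
have hu t : 0 < t <= T -> X M (u t).
  by move=> tT; apply: (Xle_weak s1 (ltW A0) _ (hA _ tT)); rewrite lerDl ltW.
have hw t : 0 < t <= T -> X M (w t).
  by move=> tT; apply: (Xle_weak s1 (ltW B0) _ (hB _ tT)); rewrite lerDr ltW.
have C0 := LM0 M0.
have mNu := jmeas_N mju; have mNw := jmeas_N mjw.
(* Makes [L M / l <= 1/2], whence the halving. *)
pose l := 2 * L M + 1; have LM : 0 <= L M by apply: (nl_L0 hN); exact: ltW.
have l0 : 0 < l by rewrite ltr_wpDl// mulr_ge0.
pose D k (t : R) : R := (M + M) * 2^-1 ^+ k * expR (l * t).
have D0 k t : 0 < D k t by rewrite !mulr_gt0 ?expR_gt0 ?exprn_gt0 ?invr_gt0 ?addr_gt0.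
have step k : (forall t, 0 < t <= T -> X (D k t) (u t \- w t)) ->
    forall t, 0 < t <= T -> (forall x, `|u t x - w t x| <= D k.+1 t) /\ X (D k.+1 t) (u t \- w t).
  move=> hk t /andP[t0 tT].
  have sub r : 0 < r < t -> 0 < r <= T by move=> /andP[-> rt]; rewrite /= ltW// (lt_le_trans rt).
  have E x : u t x - w t x = duhamel (fun r => N (u r) \- N (w r)) t x.
    have fu r : 0 < r < t -> X (L M * M) (N (u r)) by move=> /sub rT; apply: N_Xle => //; exact: hu.
    have fw r : 0 < r < t -> X (L M * M) (N (w r)) by move=> /sub rT; apply: N_Xle => //; exact: hw.
    rewrite (duhamel_sub x mNu mNw t0 C0 fu fw).
    have t0T : 0 < t <= T by rewrite t0.
    by rewrite (eu _ _ t0T) (ew _ _ t0T); ring.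
  have -> : u t \- w t = duhamel (fun r => N (u r) \- N (w r)) t by apply/funext => x; exact: E.
  have mg : measurable_fun setT ((fun r => L M * D k r) : measurableTypeR R -> R).
    do 2 apply: measurable_funM => //; apply: measurableT_comp => //; exact: measurable_funM.
  have g0 r : 0 <= L M * D k r by rewrite mulr_ge0// ltW.
  have fg r : 0 < r < t -> X (L M * D k r) (N (u r) \- N (w r)).
    by move=> /sub rT; apply: (nl_lip hN) => //; [exact: hu|exact: hw|exact: hk].
  have gB : (\int[mu1]_r (win t r * (L M * D k r))%:E <= (D k.+1 t)%:E)%E.
    have Er r : win t r * (L M * D k r) = (L M * ((M + M) * 2^-1 ^+ k)) * (win t r * expR (l * r)).
      by rewrite /D; ring.
    under eq_integral do rewrite Er.
    have h0 : 0 <= (M + M) * 2^-1 ^+ k.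
      by apply: mulr_ge0; [rewrite addr_ge0 ?(ltW M0)|rewrite exprn_ge0 ?invr_ge0].
    have c0 : 0 <= L M * ((M + M) * 2^-1 ^+ k) by exact: mulr_ge0.
    have mwe : measurable_fun setT (fun r : measurableTypeR R => win t r * expR (l * r)).
      apply: measurable_funM; first exact: (measurableT_comp measurable_win (pair1_measurable t)).
      by apply: measurableT_comp => //; exact: measurable_funM.
    have we0 (r : measurableTypeR R) : 0 <= win t r * expR (l * r).
      by rewrite mulr_ge0 ?win_ge0 ?expR_ge0.
    rewrite (integralZl_ge0 mu1 mwe we0 c0).
    apply: (le_trans (lee_wpmul2l _ (integral_win_expR t0 l0))); first by rewrite lee_fin.
    rewrite -EFinM lee_fin /D exprS.
    have e0 := expR_ge0 (l * t).
    rewrite (_ : L M * _ * _ = ((M + M) * 2^-1 ^+ k) * expR (l * t) * (L M / l)); last by ring.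
    rewrite (_ : (M + M) * (2^-1 * _) * _ = ((M + M) * 2^-1 ^+ k) * expR (l * t) * 2^-1); last by ring.
    apply: ler_wpM2l; first exact: mulr_ge0.
    by rewrite ler_pdivrMr// /l; lra.
  have [b Xb] := duhamel_Xle s1 hK (jmeas_sub mNu mNw) mg g0 gB (ltW (D0 _ _)) fg.
  by split => // x; rewrite E.
have all k : forall t, 0 < t <= T -> X (D k t) (u t \- w t).
  elim: k => [|k ih] t tT; last by have [] := step k ih t tT.
  apply: (@Xle_weak _ s s1 _ _ mu (M + M) _ _ (addr_ge0 (ltW M0) (ltW M0))); last first.
    by apply: Xle_sub => //; rewrite ?(ltW M0)//; [exact: hu|exact: hw].
  rewrite /D expr0 mulr1; apply: ler_peMr; first exact: (addr_ge0 (ltW M0) (ltW M0)).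
  rewrite -[leLHS]expR0 ler_expR mulr_ge0 ?(ltW l0)//.
  by case/andP: tT => /ltW.
move=> t x tT; apply/eqP; rewrite -subr_eq0 -normr_le0.
apply: (@le0_half _ _ ((M + M) * expR (l * t))) => k.
have [/(_ x) h _] := step k (all k) t tT; apply: (le_trans h).
rewrite /D mulrAC; apply: ler_wpM2l; first exact: (mulr_ge0 (addr_ge0 (ltW M0) (ltW M0)) (expR_ge0 _)).
by rewrite exprS ler_piMl ?exprn_ge0 ?invr_ge0// invf_le1// ler1n.
Qed.

End mild.

(** * Local existence and continuity in time *)

Section local_existence.
Context {R : realType} (n : nat) (s : R) (K : Rn R n -> R -> R)
  (N : (Rn R n -> R) -> Rn R n -> R) (L : R -> R).
Hypotheses (n0 : (0 < n)%N) (s1 : 1 < s) (hK : heat_kernel K) (hN : lip_nonlinearity s N L).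
Local Notation V := (Rn R n).
Local Notation mu := (leb R n).
Local Notation mu1 := (@lebesgue_measure R).
Local Notation S := (semig K).
Local Notation duhamel := (duhamel_int K).
Local Notation X := (Xle s mu).
Local Notation nice := (nice s K N).

Section picard.
Variables (M : R) (v : V -> R).
Hypotheses (M0 : 0 < M) (Xv : X M v).
(** The iterates stay in the ball of radius [2 M], on which [C] is a Lipschitz constant. The length
    [h] gives [C * h <= 1/2], which both keeps them in that ball and makes the Duhamel map a
    contraction of ratio 1/2. *)
Let C := L (M + M).
Let h := (2 * C + 1)^-1.
Let MM0 : 0 < M + M. Proof. by rewrite addr_gt0. Qed.
Let C0 : 0 <= C. Proof. by apply: (nl_L0 hN); exact: ltW. Qed.
Let c1 : 0 < 2 * C + 1. Proof. by rewrite ltr_wpDl// mulr_ge0. Qed.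
Let h0 : 0 < h. Proof. by rewrite invr_gt0. Qed.
Let Ch (t : R) : 0 < t <= h -> C * t <= 2^-1.
Proof.
move=> /andP[t0 th]; apply: (@le_trans _ _ (C * h)); first by rewrite ler_wpM2l.
by rewrite /h ler_pdivrMr//; lra.
Qed.

(** Makes the iterates vanish outside []0, h]], so that their limit exists at every [(t, x)] and is
    jointly measurable. *)
Let on (t : R) : R := \1_(`]0, h]%classic : set R) t.
Let onE t : on t = ((0 < t <= h)%R)%:R.
Proof. by rewrite /on indicE mem_setE /= in_itv. Qed.

Fixpoint iter_sol (k : nat) : R -> V -> R :=
  if k is j.+1 then fun t x => on t * (S t v x + duhamel (fun r => N (iter_sol j r)) t x)
  else fun _ _ => 0.

Lemma iter_solE k t x : 0 < t <= h ->
  iter_sol k.+1 t x = S t v x + duhamel (fun r => N (iter_sol k r)) t x.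
Proof. by move=> th; rewrite /= onE th mul1r. Qed.

Lemma jmeas_iter k : jmeas (iter_sol k).
Proof.
elim: k => [|k ih]; first exact: measurable_cst.
have mon : measurable_fun setT (fun z : measurableTypeR R * V => on z.1).
  exact: (measurableT_comp (measurable_indic (measurable_itv `]0, h])) measurable_fst).
have [mv _ _] := Xv.
apply: measurable_funM => //; apply: measurable_funD; first exact: (jmeas_S hK mv).
exact: (measurable_duhamel hK (jmeas_N hN ih)).
Qed.

Lemma sub_h t r : 0 < t <= h -> 0 < r < t -> 0 < r <= h.
Proof. by move=> /andP[_ th] /andP[-> rt]; rewrite /= ltW// (lt_le_trans rt). Qed.

Lemma iter_N k t : (forall t, 0 < t <= h -> X (M + M) (iter_sol k t)) -> 0 < t <= h ->
  forall r, 0 < r < t -> X (C * (M + M)) (N (iter_sol k r)).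
Proof. by move=> ih th r rt; apply: (N_Xle s1 hN MM0); apply: ih; exact: sub_h rt. Qed.

Lemma iter_bound k : (forall t x, 0 < t <= h -> `|iter_sol k t x| <= M + M) /\
  (forall t, 0 < t <= h -> X (M + M) (iter_sol k t)).
Proof.
elim: k => [|k [_ ih]].
  split=> [t x _|t _] /=; first by rewrite normr0 ltW.
  by apply: (Xle_weak s1 (lexx 0) (ltW MM0)); exact: Xle0.
have H t : 0 < t <= h -> (forall x, `|iter_sol k.+1 t x| <= M + M) /\ X (M + M) (iter_sol k.+1 t).
  move=> th; have /andP[t0 _] := th.
  have CM0 : 0 <= C * (M + M) by rewrite mulr_ge0// ltW.
  have [b1 X1] := S_Xle s1 hK t0 (ltW M0) Xv.
  have [b2 X2] := duhamel_cst s1 hK (jmeas_N hN (jmeas_iter k)) t0 CM0 (iter_N ih th).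
  have le1 : C * (M + M) * t <= M.
    rewrite mulrAC; apply: (le_trans (ler_wpM2r (ltW MM0) (Ch th))).
    by move: M0; lra.
  have d0 : 0 <= C * (M + M) * t by rewrite mulr_ge0// ltW.
  have -> : iter_sol k.+1 t = S t v \+ duhamel (fun r => N (iter_sol k r)) t.
    by apply/funext => x; rewrite iter_solE.
  split.
    by move=> x; rewrite (le_trans (ler_normD _ _))// lerD// (le_trans (b2 x)).
  apply: (Xle_weak s1 (addr_ge0 (ltW M0) d0)); last exact: (Xle_add s1 (ltW M0) d0 X1 X2).
  by rewrite lerD2l.
by split=> [t x th|t th]; have [] := H t th.
Qed.

Let E (k : nat) : R := (M + M) * 2^-1 ^+ k.
Let E0 k : 0 < E k. Proof. by rewrite mulr_gt0// exprn_gt0// invr_gt0. Qed.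
Let ES k : E k.+1 = E k / 2. Proof. by rewrite /E exprSr mulrA. Qed.

Lemma duhamel_lip (f1 f2 : R -> V -> R) (D t : R) : jmeas f1 -> jmeas f2 -> 0 < D -> 0 < t <= h ->
  (forall r, 0 < r <= h -> X (M + M) (f1 r)) -> (forall r, 0 < r <= h -> X (M + M) (f2 r)) ->
  (forall r, 0 < r <= h -> X D (f1 r \- f2 r)) ->
  let d := duhamel (fun r => N (f1 r)) t \- duhamel (fun r => N (f2 r)) t in
  (forall x, `|d x| <= D / 2) /\ X (D / 2) d.
Proof.
move=> m1 m2 D0 th X1 X2 XD d; have /andP[t0 _] := th.
have CM0 : 0 <= C * (M + M) by rewrite mulr_ge0// ltW.
have mN1 := jmeas_N hN m1; have mN2 := jmeas_N hN m2.
have XN1 r : 0 < r < t -> X (C * (M + M)) (N (f1 r)).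
  by move=> rt; apply: (N_Xle s1 hN MM0); apply: X1; exact: sub_h rt.
have XN2 r : 0 < r < t -> X (C * (M + M)) (N (f2 r)).
  by move=> rt; apply: (N_Xle s1 hN MM0); apply: X2; exact: sub_h rt.
have dE : d = duhamel (fun r => N (f1 r) \- N (f2 r)) t.
  by apply/funext => x; rewrite (duhamel_sub s1 hK x mN1 mN2 t0 CM0 XN1 XN2).
have CD0 : 0 <= C * D by rewrite mulr_ge0// ltW.
have XNd r : 0 < r < t -> X (C * D) (N (f1 r) \- N (f2 r)).
  move=> rt; have rh := sub_h th rt.
  by apply: (nl_lip hN) => //; [exact: X1|exact: X2|exact: XD].
have [b Xd] := duhamel_cst s1 hK (jmeas_sub mN1 mN2) t0 CD0 XNd.
have le1 : C * D * t <= D / 2.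
  by rewrite mulrAC (mulrC D); apply: ler_wpM2r; [exact: ltW|exact: Ch].
rewrite dE; split; first by move=> x; exact: le_trans (b x) le1.
by apply: (Xle_weak s1 _ le1 Xd); rewrite mulr_ge0// ltW.
Qed.

Lemma iter_cauchy k : (forall t x, 0 < t <= h -> `|iter_sol k.+1 t x - iter_sol k t x| <= E k) /\
  (forall t, 0 < t <= h -> X (E k) (iter_sol k.+1 t \- iter_sol k t)).
Proof.
elim: k => [|k [_ ih]].
  have E0' : E 0%N = M + M by rewrite /E expr0 mulr1.
  have [b1 X1] := iter_bound 1%N; split=> [t x th|t th].
    by rewrite E0' subr0; exact: b1.
  by rewrite E0'; have := X1 t th; congr Xle; apply/funext => x /=; rewrite subr0.
have H t : 0 < t <= h -> iter_sol k.+2 t \- iter_sol k.+1 t =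
    duhamel (fun r => N (iter_sol k.+1 r)) t \- duhamel (fun r => N (iter_sol k r)) t.
  move=> th; apply/funext => x.
  have E1 := iter_solE k.+1 x th; have E2 := iter_solE k x th.
  rewrite [LHS](_ : _ = iter_sol k.+2 t x - iter_sol k.+1 t x)// E1 E2.
  by rewrite opprD addrACA subrr add0r.
have B t th := @duhamel_lip _ _ (E k) t (jmeas_iter k.+1) (jmeas_iter k) (E0 k) th
  (iter_bound k.+1).2 (iter_bound k).2 ih.
split=> [t x th|t th]; rewrite ES.
  by have [b _] := B t th; have := b x; rewrite -(H t th).
by rewrite (H t th); have [] := B t th.
Qed.

Let cvg_iter t x : cvgn (fun k => iter_sol k t x).
Proof.
apply: (@cvgn_half _ _ (M + M)) => k.
have [th|th] := boolP (0 < t <= h); first by have [b _] := iter_cauchy k; exact: b.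
have z j : iter_sol j t x = 0 by case: j => //= j; rewrite onE (negbTE th) mul0r.
by rewrite !z subrr normr0 ltW// E0.
Qed.

Let u (t : R) (x : V) : R := limn (fun k => iter_sol k t x).

Let u_cvg t x : iter_sol k t x @[k --> \oo] --> u t x.
Proof. exact: cvg_iter. Qed.

Let jmeas_u : jmeas u.
Proof.
apply: (measurable_fun_cvg (h := fun k (z : measurableTypeR R * V) => iter_sol k z.1 z.2)).
  by move=> k; exact: jmeas_iter.
by move=> z _; exact: u_cvg.
Qed.

Let X_u t : 0 < t <= h -> X (M + M) (u t).
Proof.
move=> th; apply: (Xle_lim s1 (ltW MM0) (f := fun k => iter_sol k t)).
  by move=> k; have [_] := iter_bound k; exact.
by move=> x; exact: u_cvg.
Qed.

(** Tail of a geometric series. The sharper radius [2 E k - 2 E (k + m)] makes the induction on [m]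
    go through, and [Xle_lim] lets [m] tend to infinity. *)
Let X_diff t k : 0 < t <= h -> X (2 * E k) (u t \- iter_sol k t).
Proof.
move=> th; have B m : X (2 * E k - 2 * E (k + m)%N) (iter_sol (k + m)%N t \- iter_sol k t).
  elim: m => [|m ih].
    rewrite addn0 subrr; have := @Xle0 _ s s1 _ _ mu; congr Xle.
    by apply/funext => x /=; rewrite subrr.
  have [_ /(_ t th) hX] := iter_cauchy (k + m)%N.
  have le0 : 0 <= 2 * E k - 2 * E (k + m)%N.
    rewrite subr_ge0 ler_wpM2l// /E ler_wpM2l ?(ltW MM0)// exprD ler_piMr ?exprn_ge0 ?invr_ge0//.
    by rewrite exprn_ile1 ?invr_ge0// invf_le1// ler1n.
  have := Xle_add s1 le0 (ltW (E0 _)) ih hX; rewrite addnS.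
  have -> : 2 * E k - 2 * E (k + m)%N + E (k + m)%N = 2 * E k - 2 * E (k + m).+1.
    by rewrite ES; field.
  by congr Xle; apply/funext => x /=; ring.
apply: (Xle_lim s1 (f := fun m => iter_sol (k + m)%N t \- iter_sol k t)).
- by rewrite mulr_ge0// ltW.
- move=> m; apply: (Xle_weak s1 _ _ (B m)); last by rewrite gerBl mulr_ge0// ltW.
  rewrite subr_ge0 ler_wpM2l// /E ler_wpM2l ?(ltW MM0)// exprD ler_piMr ?exprn_ge0 ?invr_ge0//.
  by rewrite exprn_ile1 ?invr_ge0// invf_le1// ler1n.
- move=> x /=; apply: cvgB; last exact: cvg_cst.
  rewrite (_ : (fun m => iter_sol (k + m)%N t x) = (fun m => (fun j => iter_sol j t x) (m + k)%N)).
    by have := @u_cvg t x; rewrite -(cvg_shiftn k).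
  by apply/funext => m; rewrite addnC.
Qed.

Lemma picard_nice : nice v h u.
Proof.
split; first exact: jmeas_u.
  by exists (M + M) => // t; exact: X_u.
move=> t x th.
have C1 : iter_sol k.+1 t x @[k --> \oo] --> u t x by have := @u_cvg t x; rewrite -cvg_shiftS.
have C2 : iter_sol k.+1 t x @[k --> \oo] --> S t v x + duhamel (fun r => N (u r)) t x.
  under eq_fun do rewrite iter_solE//.
  apply: cvgD; first exact: cvg_cst.
  (* [X_diff] puts the limit within [2 * E k] of the iterate, and the Duhamel map halves this
     distance. *)
  have B k : `|duhamel (fun r => N (iter_sol k r)) t x - duhamel (fun r => N (u r)) t x| <= E k.
    have E20 : 0 < 2 * E k by rewrite mulr_gt0.
    have [b _] := @duhamel_lip _ _ (2 * E k) t jmeas_u (jmeas_iter k) E20 th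
      X_u (iter_bound k).2 (fun r rh => X_diff k rh).
    by rewrite distrC; apply: (le_trans (b x)); rewrite mulrC mulKf.
  apply/cvgrPdist_le => e e0.
  have := cvg_half (M + M) => /cvgrPdist_le /(_ e e0); apply: filterS => k.
  rewrite sub0r normrN distrC => hk; apply: (le_trans (B k)); apply: le_trans hk.
  exact: ler_norm.
by apply: (cvg_unique _ C1 C2).
Qed.

End picard.

Lemma local_existence (M : R) : 0 < M -> exists2 h : R, 0 < h &
  forall v, X M v -> exists u, nice v h u.
Proof.
move=> M0; exists (2 * L (M + M) + 1)^-1.
  by rewrite invr_gt0 ltr_wpDl// mulr_ge0// (nl_L0 hN)// addr_ge0 ?ltW.
by move=> v Xv; exists (fun t x => limn (fun k => iter_sol M v k t x)); exact: picard_nice.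
Qed.

(** Restarting at [t1 = t0 - d] writes [u t] and [u t0] as [S (t - t1)] and [S d] of the same
    function plus short Duhamel terms. The times [t - t1] and [d] being positive, continuity of the
    kernel in L^1 applies, in both norms. *)
Lemma nice_continuous v (M T t0 e : R) u : 0 < M -> X M v -> nice v T u -> 0 < t0 <= T -> 0 < e ->
  \forall t \near t0, 0 < t <= T -> X e (u t \- u t0).
Proof.
move=> M0 Xv hu /andP[t00 t0T] e0; have [mju [A A0 hA] eu] := hu.
pose C := L A * A; have C0 : 0 <= C by exact: (LM0 hN A0).
(* For [t] within [d] of [t0] the two Duhamel terms together cost at most [3 C d <= e / 2]; the
   other half of [e] is left to the kernel. *)
pose d := Num.min (t0 / 2) (e / (6 * C + 6)).
have c6 : 0 < 6 * C + 6 by rewrite ltr_wpDl// mulr_ge0.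
have d0 : 0 < d by rewrite lt_min !divr_gt0.
have dt : d < t0 by rewrite gt_min; apply/orP; left; move: t00; lra.
have dC : 3 * C * d <= e / 2.
  have : d * (6 * C + 6) <= e by rewrite -ler_pdivlMr// ge_min lexx orbT.
  by move: d0 C0; nra.
pose t1 := t0 - d; have t10 : 0 < t1 by rewrite subr_gt0.
have t1T : t1 <= T by rewrite (le_trans _ t0T)// gerBl ltW.
have t1r : 0 < t1 <= T by rewrite t10.
have [_ _ er] := nice_restart s1 hK hN M0 Xv hu t1r.
have XA := hA _ t1r.
have omega : \forall r \near d, 0 < r -> \int[mu]_x `|K x r - K x d| < e / (2 * A).
  have e2 : 0 < e / (2 * A) by rewrite divr_gt0// mulr_gt0.
  have := cvgr_lt _ (hk_L1 hK d0) _ e2.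
  by move=> H; exact: (H (within_filter _ _)).
have near1 : \forall t \near t0, 0 < t - t1 -> \int[mu]_x `|K x (t - t1) - K x d| < e / (2 * A).
  have cs : t - t1 @[t --> t0] --> d.
    have -> : d = t0 - t1 by rewrite /t1 subKr.
    by apply: cvgB; [exact: cvg_id|exact: cvg_cst].
  exact: (cs _ omega).
have near2 : \forall t \near t0, `|t0 - t| < d by exists d.
near=> t => /andP[tt0 tT].
have td : `|t0 - t| < d by near: t.
have tt1 : 0 < t - t1 by move: td; rewrite ltr_norml /t1 => /andP[? ?]; lra.
have td2 : t - t1 <= 2 * d by move: td; rewrite ltr_norml /t1 => /andP[? ?]; lra.
have om : \int[mu]_x `|K x (t - t1) - K x d| < e / (2 * A).
  by move: tt1; near: t.
pose f r := N (u (t1 + r)).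
have mf : jmeas f by exact: (jmeas_N hN (jmeas_shift t1 mju)).
have fC r : 0 < r <= T - t1 -> X C (f r).
  move=> /andP[r0 rT]; apply: (N_Xle s1 hN A0); apply: hA; rewrite addr_gt0//=.
  by rewrite addrC -lerBrDr.
have E r : 0 < r <= T - t1 -> u (t1 + r) = S r (u t1) \+ duhamel f r.
  by move=> rT; apply/funext => x; exact: er.
have rt : 0 < t - t1 <= T - t1 by rewrite tt1 lerD2r.
have rd : 0 < d <= T - t1 by rewrite d0 /t1 /=; move: t0T; lra.
have fC1 r' : 0 < r' <= T - t1 -> forall r, 0 < r < r' -> X C (f r).
  by move=> /andP[_ rT] r /andP[r0 rr]; apply: fC; rewrite r0 ltW// (lt_le_trans rr).
have -> : u t = S (t - t1) (u t1) \+ duhamel f (t - t1) by rewrite -E// addrC subrK.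
have -> : u t0 = S d (u t1) \+ duhamel f d by rewrite -E// /t1 subrK.
have [_ X1] := duhamel_cst s1 hK mf tt1 C0 (fC1 _ rt).
have [_ X2] := duhamel_cst s1 hK mf d0 C0 (fC1 _ rd).
have X3 := S_diff s1 hK tt1 d0 (ltW A0) XA.
have w0 : 0 <= (\int[mu]_x `|K x (t - t1) - K x d|) * A by rewrite mulr_ge0 ?(ltW A0)// Rintegral_ge0.
have p1 : 0 <= C * (t - t1) by rewrite mulr_ge0 ?(ltW tt1).
have p2 : 0 <= C * d by rewrite mulr_ge0 ?(ltW d0).
have X12 := Xle_sub s1 p1 p2 X1 X2.
have X123 := Xle_add s1 w0 (addr_ge0 p1 p2) X3 X12.
have le1 : (\int[mu]_x `|K x (t - t1) - K x d|) * A + (C * (t - t1) + C * d) <= e.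
  have h1 : (\int[mu]_x `|K x (t - t1) - K x d|) * A <= e / 2.
    have -> : e / 2 = e / (2 * A) * A by field; rewrite gt_eqF.
    by rewrite ler_wpM2r ?(ltW A0)// ltW.
  have h2 : C * (t - t1) <= C * (2 * d) by rewrite ler_wpM2l.
  by move: h1 h2 dC; lra.
have := Xle_weak s1 (addr_ge0 w0 (addr_ge0 p1 p2)) le1 X123.
by congr Xle; apply/funext => x /=; ring.
Unshelve. all: by end_near.
Qed.

(** The Duhamel term is [O(t)] in both norms, but [S_continuous] is a statement in L^s: in L^oo the
    semigroup is not strongly continuous at time 0. *)
Lemma nice_initial v (M T e : R) u : 0 < M -> X M v -> 0 < T -> nice v T u -> 0 < e ->
  \forall t \near 0^'+, Lle s mu e (u t \- v).
Proof.
move=> M0 Xv T0 [mju [A A0 hA] eu] e0.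
pose C := L A * A; have C0 : 0 <= C by exact: (LM0 hN A0).
have e2 : 0 < e / 2 by rewrite divr_gt0.
pose d := Num.min T (e / (2 * C + 2)).
have c2 : 0 < 2 * C + 2 by rewrite ltr_wpDl// mulr_ge0.
have d0 : 0 < d by rewrite lt_min T0 divr_gt0.
near=> t; have t0 : 0 < t by near: t; exact: nbhs_right_gt.
have td : t <= d by near: t; exact: nbhs_right_le.
have tT : t <= T by rewrite (le_trans td)// ge_min lexx.
have Ct : C * t <= e / 2.
  have : t * (2 * C + 2) <= e.
    by rewrite -ler_pdivlMr// (le_trans td)// ge_min lexx orbT.
  by move: t0 C0; nra.
have fC r : 0 < r < t -> X C (N (u r)).
  move=> /andP[r0 rt]; apply: (N_Xle s1 hN A0); apply: hA.
  by rewrite r0 ltW// (lt_le_trans rt).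
have [_ [md _ ld]] := duhamel_cst s1 hK (jmeas_N hN mju) t0 C0 fC.
have LS : Lle s mu (e / 2) (S t v \- v) by near: t; exact: (S_continuous hK s1 (ltW M0) Xv).
have [_ [mS _ _]] := S_Xle s1 hK t0 (ltW M0) Xv; have [mv _ _] := Xv.
have ld' : Lle s mu (e / 2) (duhamel (fun r => N (u r)) t).
  by apply: (Lle_weak s1 _ Ct ld); rewrite mulr_ge0// ltW.
have := Lle_add s1 (measurable_funB mS mv) md (ltW e2) (ltW e2) LS ld'.
rewrite -splitr; congr Lle; apply/funext => x /=.
have tr : 0 < t <= T by rewrite t0.
by rewrite (eu _ _ tr); ring.
Unshelve. all: by end_near.
Qed.

End local_existence.

(** * From pointwise solutions to mild solutions, and back *)

Section spaces_facts.
Context {R : realType} (n : nat).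
Local Notation V := (Rn R n).

Lemma cvge0P (T : Type) (F : set_system T) {FF : Filter F} (f : T -> \bar R) :
  (forall e : R, 0 < e -> \forall t \near F, (0 <= f t <= e%:E)%E) -> f t @[t --> F] --> 0%E.
Proof.
move=> H; apply/fine_cvgP; split.
  by apply: filterS (H 1 ltr01) => t /andP[f0 f1]; rewrite ge0_fin_numE// (le_lt_trans f1)// ltry.
apply/cvgrPdist_le => e e0; apply: filterS (H e e0) => t /andP[f0 f1] /=.
rewrite sub0r normrN ger0_norm ?fine_ge0//.
by case: (f t) f0 f1 => //= r _; rewrite lee_fin.
Qed.

(** The same simple maps approximate in a smaller norm; this yields the [norm_Linfty] clause of a
    solution from the [norm_X] one. *)
Lemma Linfty_le (D : set R) (N1 N2 : (V -> R) -> \bar R) (u : R -> V -> R) :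
  (forall v, (0 <= N2 v)%E) -> (forall v, (N2 v <= N1 v)%E) -> Linfty D N1 u -> Linfty D N2 u.
Proof.
move=> N20 N21 [h1 [phi sphi cphi] [M hM]]; split.
- by apply: aeS h1 => t h /h [mu' fu]; split => //; exact: le_lt_trans fu.
- exists phi.
    move=> k; have [m [A [g [mA hg pE]]]] := sphi k; exists m, A, g; split => // i.
    by have [mg fg] := hg i; split => //; exact: le_lt_trans fg.
  apply: aeS cphi => t h /h c; apply: (squeeze_cvge _ (cvg_cst 0%E) c).
  by apply: nearW => k; rewrite N20 N21.
- by exists M; apply: aeS hM => t h /h; exact: le_trans.
Qed.

Lemma jmeas_simple (N1 : (V -> R) -> \bar R) phi : simple_map N1 phi -> jmeas phi.
Proof.
move=> [m [A [g [mA hg pE]]]]; rewrite /jmeas.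
under eq_fun do rewrite pE.
apply: measurable_sum => i; apply: measurable_funM.
  exact: (measurableT_comp (measurable_indic (mA i)) measurable_fst).
by have [mg _] := hg i; exact: (measurableT_comp mg measurable_snd).
Qed.

End spaces_facts.

Section conversion.
Context {R : realType} (n : nat) (s : R) (K : Rn R n -> R -> R)
  (N : (Rn R n -> R) -> Rn R n -> R) (L : R -> R).
Hypotheses (n0 : (0 < n)%N) (s1 : 1 < s) (hK : heat_kernel K) (hN : lip_nonlinearity s N L).
Local Notation V := (Rn R n).
Local Notation mu := (leb R n).
Local Notation mu1 := (@lebesgue_measure R).
Local Notation S := (semig K).
Local Notation duhamel := (duhamel_int K).
Local Notation X := (Xle s mu).
Local Notation nice := (nice s K N).
Variables (M : R) (v : V -> R).
Hypotheses (M0 : 0 < M) (Xv : X M v).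

(* With the stable kernel and the Riesz nonlinearity, [amild] and [amild_CL] are
   convertible to [mild_solution] and [mild_solution_CL]. *)
Definition amild (T : R) (u : R -> V -> R) : Prop :=
  [/\ Linfty `]0, T[ (norm_X s) u, u 0 = v %[ae mu] &
      forall t, 0 < t <= T -> {ae mu, forall x,
        mu1.-integrable `]0, t[ (EFin \o (fun r => S (t - r) (N (u r)) x)) /\
        u t x = S t v x + \int[mu1]_(r in `]0, t[) S (t - r) (N (u r)) x}].

Definition amild_CL (T : R) (u : R -> V -> R) : Prop :=
  [/\ amild T u, C_Lr `[0, T] s%:E u & Linfty `]0, T[ (@norm_Linfty R n) u].

Lemma norm_X_ge0 (w : V -> R) : (0 <= norm_X s w)%E.
Proof. by rewrite adde_ge0// lnorm_ge0. Qed.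

Section to_mild.
Variables (T : R) (u w : R -> V -> R).
Hypotheses (T0 : 0 < T) (hu : nice v T u) (wu : forall t, 0 < t <= T -> w t = u t) (w0 : w 0 = v).

Lemma w_X : exists2 A : R, 0 < A & forall t, 0 < t <= T -> X A (w t).
Proof.
have [mju [A A0 hA] eu] := hu; exists A; first exact: A0.
by move=> t tT; rewrite (wu tT); exact: hA.
Qed.

(** Each subinterval is paired with its right end point, so that all nodes lie in []0, T]], where
    [nice_continuous] applies; at time 0 continuity holds in L^s only. *)
Let part (k i : nat) : set (measurableTypeR R) := `[T * i%:R / k.+1%:R, T * i.+1%:R / k.+1%:R[%classic.
Let node (k i : nat) : R := T * i.+1%:R / k.+1%:R.

Definition step_map (k : nat) (t : R) (x : V) : R :=
  \sum_(i < k.+1) \1_(part k i) t * w (node k i) x.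

Let k0 (k : nat) : 0 < k.+1%:R :> R. Proof. by []. Qed.

Let partP k i t : part k i t = (i%:R <= t * k.+1%:R / T < i.+1%:R) :> Prop.
Proof.
rewrite /part /= in_itv/= ler_pdivrMr// ltr_pdivlMr// mulrC -ler_pdivlMr// (mulrC T).
by rewrite -ltr_pdivrMr.
Qed.

Lemma step_mapE k t : 0 < t < T -> exists2 i : nat, 0 < node k i <= T &
  step_map k t = w (node k i) /\ `|node k i - t| <= T / k.+1%:R.
Proof.
move=> /andP[t0 tT]; pose a := t * k.+1%:R / T.
have a0 : 0 <= a by rewrite divr_ge0 ?mulr_ge0 ?ltW.
have /andP[ia ai] := truncn_itv a0; set i := Num.truncn a in ia ai.
have ak : a < k.+1%:R by rewrite /a ltr_pdivrMr// mulrC ltr_pM2l.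
have ik : (i < k.+1)%N by rewrite -(ltr_nat R) (le_lt_trans ia).
exists i.
  rewrite /node divr_gt0 ?mulr_gt0//= ler_pdivrMr// ler_pM2l// ler_nat.
  exact: ik.
split.
  apply/funext => x; rewrite /step_map (bigD1 (Ordinal ik))//= big1 ?addr0 => [|j ji].
    rewrite indicE mem_set ?mul1r// partP.
    by apply/andP.
  rewrite indicE memNset ?mul0r// partP => /andP[ja aj]; move/eqP: ji; apply; apply/val_inj => /=.
  have l1 : (j < i.+1)%N by rewrite -(ltr_nat R) (le_lt_trans ja ai).
  have l2 : (i < j.+1)%N by rewrite -(ltr_nat R) (le_lt_trans ia aj).
  by apply/eqP; rewrite eqn_leq -ltnS l1.
have tE : t = T * a / k.+1%:R.
  by rewrite /a; field; rewrite !gt_eqF//= addrC natr1.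
rewrite /node {1}tE -mulrBl -mulrBr normrM (gtr0_norm (_ : 0 < k.+1%:R^-1)) ?invr_gt0//.
rewrite ler_wpM2r ?invr_ge0// normrM (gtr0_norm T0) ler_piMr ?(ltW T0)//.
by move: ia ai; rewrite ler_norml -natr1; lra.
Qed.

(** By continuity in [X] at positive times, the step maps on finer and finer partitions converge in
    [norm_X] at every time of []0, T[]. *)
Lemma nice_strongly_measurable : strongly_measurable `]0, T[ (norm_X s) w.
Proof.
have [A A0 hA] := w_X.
exists step_map.
  move=> k; exists k.+1, (fun i => part k i), (fun i => w (node k i)); split => //.
  - by move=> i; exact: measurable_itv.
  - move=> i; have ni : 0 < node k i <= T.
      rewrite /node divr_gt0 ?mulr_gt0//= ler_pdivrMr// ler_pM2l// ler_nat.
      exact: ltn_ord.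
    have XA := hA _ ni; split; first by case: XA.
    by rewrite (le_lt_trans (norm_X_le n0 s1 (ltW A0) XA))// ltry.
apply: aeW => t /=; rewrite in_itv/= => tT; apply: cvge0P => e e0.
have e2 : 0 < e / 2 by rewrite divr_gt0.
have tT' : 0 < t <= T by case/andP: tT => -> /ltW.
have [d /= d0 hd] := nice_continuous s1 hK hN M0 Xv hu tT' e2.
have [k1 hk1] : exists k1 : nat, T / d < k1%:R.
  by exists (Num.bound (T / d)); apply: archi_boundP; rewrite divr_ge0 ?ltW.
exists k1 => // k /= kk; rewrite norm_X_ge0/=.
have [i ni [-> nt]] := step_mapE k tT.
have dk : T / k.+1%:R < d.
  rewrite ltr_pdivrMr// mulrC -ltr_pdivrMr// (lt_le_trans hk1)// ler_nat.
  exact: leqW.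
have XX := hd (node k i) (le_lt_trans (eq_ind_r (fun z => z <= _) nt (distrC _ _)) dk) ni.
rewrite (wu ni) (wu tT'); apply: (le_trans (norm_X_le n0 s1 (ltW e2) XX)).
by rewrite -splitr.
Qed.

Lemma nice_amild_CL : amild_CL T w.
Proof.
have [A A0 hA] := w_X; have [mju [B B0 hB] eu] := hu.
have LX : Linfty `]0, T[ (norm_X s) w.
  split; [|exact: nice_strongly_measurable|].
    apply: aeW => t /=; rewrite in_itv/= => /andP[t0 tT].
    have XA : X A (w t) by apply: hA; rewrite t0 ltW.
    by split; [case: XA|rewrite (le_lt_trans (norm_X_le n0 s1 (ltW A0) XA))// ltry].
  exists (A + A); apply: aeW => t /=; rewrite in_itv/= => /andP[t0 tT].
  by apply: norm_X_le => //; [exact: ltW|apply: hA; rewrite t0 ltW].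
split.
- split => //; first by apply: aeW => x; rewrite w0.
  move=> t tT; apply: aeW => x; have /andP[t0 tT'] := tT.
  have C0 : 0 <= L B * B by exact: (LM0 hN B0).
  have fC r : 0 < r < t -> X (L B * B) (N (u r)).
    move=> /andP[r0 rt]; apply: (N_Xle s1 hN B0); apply: hB.
    by rewrite r0 ltW// (lt_le_trans rt).
  have gB : (\int[mu1]_r (win t r * (fun=> L B * B) r)%:E <= (L B * B * t)%:E)%E.
    under eq_integral do rewrite mulrC.
    rewrite (integralZl_ge0 mu1 (measurableT_comp measurable_win (pair1_measurable (t : measurableTypeR R))) (win_ge0 t) C0).
    by rewrite integral_win ?(ltW t0)// EFinM.
  have wr r : r \in `]0%R, t[%classic -> w r = u r.
    rewrite inE/= in_itv/= => /andP[r0 rt]; apply: wu.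
    by rewrite r0 ltW// (lt_le_trans rt).
  split.
    apply: (@eq_integrable _ _ _ mu1 _ _ (EFin \o (fun r => S (t - r) (N (u r)) x))).
    + exact: measurable_itv.
    + by move=> r rt /=; rewrite wr.
    + exact: (duhamel_integrable s1 hK (jmeas_N hN mju) (measurable_cst _) (fun=> C0) gB fC).
  rewrite wu// (eu _ _ tT); congr (_ + _).
  rewrite duhamelE; apply: eq_Rintegral => r rt; by rewrite wr.
- split.
    move=> t /=; rewrite in_itv/= => /andP[t0 tT].
    have [->|tn0] := eqVneq t 0; first by rewrite w0; have [] := Xle_Lfun n0 s1 (ltW M0) Xv.
    have tT' : 0 < t <= T by rewrite lt_neqAle eq_sym tn0 t0.
    by have [] := Xle_Lfun n0 s1 (ltW A0) (hA _ tT').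
  move=> t0 /=; rewrite in_itv/= => /andP[t00 t0T]; apply: cvge0P => e e0.
  have [t0E|t0n] := eqVneq t0 0.
    have [d /= d0 hd] := nice_initial s1 hK hN M0 Xv T0 hu e0.
    exists d => // t /= td; rewrite in_itv/= => /andP[tt0 tT].
    rewrite lnorm_ge0/= t0E w0.
    have [tE|tn] := eqVneq t 0.
      rewrite tE w0; apply/(Lle_norm s1 mu _ (ltW e0)).
      have -> : v \- v = (fun=> 0) by apply/funext => x /=; rewrite subrr.
      by apply: (Lle_weak s1 (lexx 0) (ltW e0)); case: (@Xle0 _ s s1 _ _ mu).
    have tp : 0 < t by rewrite lt_neqAle eq_sym tn.
    rewrite wu ?tp//; apply/(Lle_norm s1 mu _ (ltW e0)).
    by apply: hd => //; move: td; rewrite t0E.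
  have t0p : 0 < t0 <= T by rewrite lt_neqAle eq_sym t0n t00.
  have [d /= d0 hd] := nice_continuous s1 hK hN M0 Xv hu t0p e0.
  pose d' := Num.min d t0; have d'0 : 0 < d' by rewrite lt_min d0; case/andP: t0p.
  exists d' => // t /= td; rewrite in_itv/= => /andP[tt0 tT].
  rewrite lnorm_ge0/=.
  have tp : 0 < t <= T.
    rewrite tT andbT; move: td; rewrite lt_min => /andP[_]; rewrite ltr_norml => /andP[_]; lra.
  rewrite (wu tp) (wu t0p); apply/(Lle_norm s1 mu _ (ltW e0)).
  have [] // := hd t _ tp; by move: td; rewrite lt_min => /andP[].
- apply: (Linfty_le _ _ LX) => z; first exact: lnorm_ge0.
  by rewrite /norm_X leeDr// lnorm_ge0.
Qed.

End to_mild.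

Section from_mild.
Variables (T : R) (w : R -> V -> R).
Hypotheses (T0 : 0 < T) (hw : amild T w).

(* Off a null set of times, w coincides a.e. in space with a jointly measurable map. *)
Lemma measurable_version : exists (A : R) (G : set (measurableTypeR R)) (wb : R -> V -> R),
  [/\ 0 < A, measurable G, {ae mu1, forall t, `]0, T[%classic t -> G t}, jmeas wb &
      forall t, X A (wb t) /\ (G t -> [/\ 0 < t < T, measurable_fun setT (w t) &
        {ae mu, forall x, wb t x = w t x}])].
Proof.
have [[h1 [phi sphi cphi] [B hB]] _ _] := hw.
have : {ae mu1, forall t, `]0, T[%classic t ->
    [/\ in_space (norm_X s) (w t), (norm_X s (w t) <= B%:E)%E &
        norm_X s (phi k t \- w t) @[k --> \oo] --> 0%E]}.
  have h2 : {ae mu1, forall t, `]0, T[%classic t -> (norm_X s (w t) <= B%:E)%E /\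
      norm_X s (phi k t \- w t) @[k --> \oo] --> 0%E}.
    by apply: aeS2 hB cphi => t a b D; split; [exact: a|exact: b].
  by apply: aeS2 h1 h2 => t a b D; have [b1 b2] := b D; split => //; exact: a.
move=> [Z [mZ Z0 sZ]].
(* The times of []0, T[] outside one measurable null set, at which all three almost everywhere
   properties hold. *)
pose G : set (measurableTypeR R) := `]0, T[%classic `\` Z.
have mG : measurable G by apply: measurableD => //; exact: measurable_itv.
have GP t : G t -> [/\ 0 < t < T, in_space (norm_X s) (w t), (norm_X s (w t) <= B%:E)%E &
        norm_X s (phi k t \- w t) @[k --> \oo] --> 0%E].
  move=> [tT nZ]; have h : `]0, T[%classic t ->
    [/\ in_space (norm_X s) (w t), (norm_X s (w t) <= B%:E)%E &
        norm_X s (phi k t \- w t) @[k --> \oo] --> 0%E].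
    by apply: contrapT => nP; apply: nZ; apply: sZ.
  by have [a b c] := h tT; move: tT; rewrite /= in_itv/=.
(* An upper limit is measurable whether or not the sequence converges. At times of [G] convergence
   in [norm_X] includes L^oo, so the simple maps converge for almost every [x] and the upper limit
   is [w t x]. *)
pose wb (t : R) (x : V) : R := \1_G t * fine (limn_esup (fun k => (phi k t x)%:E)).
pose A := Num.max B 1.
have A0 : 0 < A by rewrite lt_max ltr01 orbT.
have mphi k : jmeas (phi k) by exact: jmeas_simple (sphi k).
have jwb : jmeas wb.
  apply: measurable_funM; first exact: (measurableT_comp (measurable_indic mG) measurable_fst).
  apply: (measurableT_comp (fine_measurable measurableT)).
  apply: (measurable_fun_limn_esup (f := fun k (z : measurableTypeR R * V) => (phi k z.1 z.2)%:E)).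
  by move=> k; apply/measurable_EFinP; exact: mphi.
have wbw t : G t -> {ae mu, forall x, wb t x = w t x}.
  move=> Gt; have [tT [mw _] wB cphi'] := GP t Gt.
  pose dk k : V -> R := phi k t \- w t.
  (* [fine] is meaningful only for finite norms; as the norms tend to 0, this leaves out finitely
     many [k]. *)
  have : {ae mu, forall x, forall k, (norm_X s (dk k) < +oo)%E ->
      `|phi k t x - w t x| <= fine (norm_X s (dk k))}.
    apply: ae_seq => k; have [foo|nfoo] := boolP (norm_X s (dk k) < +oo)%E; last first.
      by apply: aeW => x.
    have mpw : measurable_fun setT (dk k).
      by apply: measurable_funB => //; exact: (jmeas_at t (mphi k)).
    have fE : norm_X s (dk k) = (fine (norm_X s (dk k)))%:E.
      by rewrite fineK// ge0_fin_numE// norm_X_ge0.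
    have [_ h _] := norm_X_Xle n0 s1 mpw (eq_ind _ (fun z => (norm_X s (dk k) <= z)%E) (lexx _) _ fE).
    by apply: aeS h => x h _.
  apply: aeS => x h; rewrite /wb indicE mem_set// mul1r.
  have C : phi k t x @[k --> \oo] --> w t x.
    have /fine_cvgP[fin cf] := cphi'.
    apply/cvgrPdist_le => e e0; move/cvgrPdist_le : cf => /(_ e e0) cf.
    apply: filterS2 fin cf => k fk /=; rewrite sub0r normrN => hk.
    rewrite distrC (le_trans (h k _))//; first by rewrite -ge0_fin_numE// norm_X_ge0.
    by apply: le_trans hk; exact: ler_norm.
  have C' : (phi k t x)%:E @[k --> \oo] --> (w t x)%:E by apply: cvg_EFin => //; exact: nearW.
  rewrite is_cvg_limn_esupE; last by apply/cvg_ex; exists (w t x)%:E.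
  by rewrite (cvg_lim _ C').
exists A, G, wb; split => //.
  by exists Z; split => // t h; apply: contrapT => nZ; apply: h => tT; split.
move=> t; split; last first.
  by move=> Gt; have [tT [mw _] _ _] := GP t Gt; split => //; exact: wbw.
have mwt : measurable_fun setT (wb t) by exact: (jmeas_at t jwb).
have [Gt|nGt] := pselect (G t); last first.
  have -> : wb t = fun=> 0 by apply/funext => x; rewrite /wb indicE memNset// mul0r.
  by apply: (Xle_weak s1 (lexx 0) (ltW A0)); exact: Xle0.
have [tT [mw _] wB _] := GP t Gt.
apply: (Xle_eq s1 mwt (wbw t Gt)); apply: norm_X_Xle => //.
by apply: (le_trans wB); rewrite lee_fin le_max lexx.
Qed.

(** For almost every [r], [N (w r)] and [N (wb r)] agree almost everywhere, and [S] sees classes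
    only; so [w t] agrees with the Duhamel formula [u t] written with [wb], for every [t]. The same
    substitution, now of [u] for [wb], shows that [u] satisfies its own equation at every point. *)
Lemma mild_nice : exists2 u, nice v T u & forall t, 0 < t <= T -> {ae mu, forall x, w t x = u t x}.
Proof.
have [A [G [wb [A0 mG aeG jwb hwb]]]] := measurable_version.
have [_ _ eqw] := hw.
have [mv _ _] := Xv.
pose C := L A * A; have C0 : 0 <= C by exact: (LM0 hN A0).
have mNwb := jmeas_N hN jwb.
have fC r : X C (N (wb r)) by apply: (N_Xle s1 hN A0); have [] := hwb r.
pose u t x := S t v x + duhamel (fun r => N (wb r)) t x.
have ju : jmeas u by apply: measurable_funD; [exact: (jmeas_S hK mv)|exact: (measurable_duhamel hK mNwb)].
have mNat f : measurable_fun setT f -> measurable_fun setT (N f).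
  move=> mf; have := nl_meas hN (F := fun _ : measurableTypeR R => f) (measurableT_comp mf measurable_snd).
  by move=> H; exact: (measurableT_comp H (pair1_measurable (0 : measurableTypeR R))).
have wu t : 0 < t <= T -> {ae mu, forall x, w t x = u t x}.
  move=> tT; apply: aeS (eqw t tT) => x [iw ->]; rewrite /u; congr (_ + _).
  have /andP[t0 tT'] := tT.
  rewrite duhamelE /Rintegral; congr fine; apply: ae_eq_integral.
  - exact: measurable_itv.
  - by case/integrableP: iw.
  - have gB : (\int[mu1]_r (win t r * (fun=> C) r)%:E <= (C * t)%:E)%E.
      under eq_integral do rewrite mulrC.
      rewrite (integralZl_ge0 mu1 (measurableT_comp measurable_win (pair1_measurable (t : measurableTypeR R))) (win_ge0 t) C0).
      by rewrite integral_win ?(ltW t0)// EFinM.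
    have := duhamel_integrable s1 hK mNwb (measurable_cst _) (fun=> C0) gB (fun r _ => fC r).
    by move=> /(_ x) /integrableP[].
  - apply: aeS aeG => r Gr /=; rewrite in_itv/= => /andP[r0 rt].
    have /Gr rG : `]0, T[%classic r by rewrite /= in_itv/= r0 (lt_le_trans rt).
    have [_ /(_ rG)[_ mw ww]] := hwb r; have mwb := jmeas_at r jwb.
    congr EFin; apply: (S_ae hK); [exact: mNat|exact: mNat|].
    apply: (nl_ae hN) => //; by apply: aeS ww => y ->.
exists u; last exact: wu.
split; [exact: ju| |].
  exists (M + C * T); first by rewrite ltr_wpDr// mulr_ge0// ltW.
  move=> t /andP[t0 tT].
  have [_ X1] := S_Xle s1 hK t0 (ltW M0) Xv.
  have [_ X2] := duhamel_cst s1 hK mNwb t0 C0 (fun r _ => fC r).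
  have p0 : 0 <= C * t by rewrite mulr_ge0// ltW.
  apply: (Xle_weak s1 (addr_ge0 (ltW M0) p0)); last exact: (Xle_add s1 (ltW M0) p0 X1 X2).
  by rewrite lerD2l ler_wpM2l.
move=> t x tT; rewrite /u; congr (_ + _); apply: ae_eq_Rintegral.
- exact: (measurable_duhamel_at1 hK mNwb t x).
- exact: (measurable_duhamel_at1 hK (jmeas_N hN ju) t x).
apply: aeS aeG => r Gr; have [[/andP[r0 rt] ->]|[_ ->]] := winP t r; last by rewrite !mul0r.
have /andP[_ tT'] := tT.
have /Gr rG : `]0, T[%classic r by rewrite /= in_itv/= r0 (lt_le_trans rt).
have [_ /(_ rG)[rT mw ww]] := hwb r; have mwb := jmeas_at r jwb; have mu' := jmeas_at r ju.
congr (_ * _); apply: (S_ae hK); [exact: mNat|exact: mNat|].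
apply: (nl_ae hN) => //.
have rT' : 0 < r <= T by case/andP: rT => -> /ltW.
by apply: aeS2 ww (wu r rT') => y -> ->.
Qed.

End from_mild.

Lemma nice_ge0 (T : R) (u : R -> V -> R) : nice v T u -> {ae mu, forall x, 0 <= v x} ->
  forall t x, 0 < t <= T -> 0 <= u t x.
Proof.
move=> [mju [A A0 hA] eu] v0 t x tT; have /andP[t0 _] := tT; have [mv _ _] := Xv.
rewrite (eu _ _ tT) addr_ge0 ?(S_ge0 hK)//.
apply: Rintegral_ge0 => r _; have [[/andP[r0 rt] ->]|[_ ->]] := winP t r; last by rewrite mul0r.
rewrite mul1r; apply: (S_ge0 hK); first by rewrite subr_gt0.
  exact: (jmeas_at r (jmeas_N hN mju)).
by apply: aeW => y; exact: (nl_ge0 hN).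
Qed.

End conversion.

(** * The maximal solution and the blow-up alternative *)

Section maximal.
Context {R : realType} (n : nat) (s : R) (K : Rn R n -> R -> R)
  (N : (Rn R n -> R) -> Rn R n -> R) (L : R -> R).
Hypotheses (n0 : (0 < n)%N) (s1 : 1 < s) (hK : heat_kernel K) (hN : lip_nonlinearity s N L).
Local Notation V := (Rn R n).
Local Notation mu := (leb R n).
Local Notation X := (Xle s mu).
Local Notation nice := (nice s K N).
Variables (M : R) (v : V -> R).
Hypotheses (M0 : 0 < M) (Xv : X M v).
Local Notation amild_CL := (amild_CL s K N v).

Lemma amild_CL_nice (T : R) : 0 < T ->
  (exists u, amild_CL T u) <-> (exists u, nice v T u).
Proof.
move=> T0; split=> [[u [hu _ _]]|[u hu]].
  by have [u' hu' _] := mild_nice n0 s1 hK hN M0 Xv T0 hu; exists u'.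
(* [nice] says nothing at time 0, where a mild solution has to take the initial value. *)
exists (fun t => if t <= 0 then v else u t).
apply: (nice_amild_CL n0 s1 hK hN M0 Xv T0 hu); last by rewrite lexx.
by move=> t /andP[t0 _]; rewrite leNgt t0.
Qed.

Lemma amild_local : exists T : R, 0 < T /\ exists u : R -> V -> R,
  [/\ amild_CL T u,
      (forall w : R -> V -> R, amild_CL T w ->
         forall t, 0 <= t <= T -> w t = u t %[ae mu]) &
      ({ae mu, forall x, 0 <= v x} ->
         forall t, 0 <= t <= T -> {ae mu, forall x, 0 <= u t x})].
Proof.
have [h h0 /(_ v Xv)[u hu]] := local_existence s1 hK hN M0.
exists h; split => //; exists (fun t => if t <= 0 then v else u t); split.
- apply: (nice_amild_CL n0 s1 hK hN M0 Xv h0 hu); last by rewrite lexx.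
  by move=> t /andP[t0 _]; rewrite leNgt t0.
- move=> w [hw _ _] t /andP[t0 th]; case: ifPn => [tn|]; last rewrite -ltNge => tp.
    have -> : t = 0 by apply/le_anti; rewrite t0 tn.
    by case: hw.
  have [u' hu' wu'] := mild_nice n0 s1 hK hN M0 Xv h0 hw.
  have tT : 0 < t <= h by rewrite tp.
  apply: aeS (wu' t tT) => x wx _; rewrite wx.
  exact: (nice_unique s1 hK hN hu' hu).
- move=> v0 t /andP[t0 th]; case: ifPn => [tn|]; first by [].
  rewrite -ltNge => tp; apply: aeW => x.
  by apply: (nice_ge0 hK hN Xv hu v0 x); rewrite tp.
Qed.

Let TT : set R := [set T | 0 < T /\ exists u, amild_CL T u].
Let Tm : \bar R := ereal_sup [set T%:E | T in TT].

Lemma amild_maximal : exists u : R -> V -> R,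
  [/\ forall T, 0 < T -> (T%:E < Tm)%E -> amild_CL T u,
      u 0 = v %[ae mu] &
      Tm = +oo%E \/ ((Tm < +oo)%E /\
        (lnorm +oo%E (u t) + lnorm s%:E (u t))%E @[t --> (fine Tm)^'-] --> +oo%E)].
Proof.
have [c hc] : exists c : R -> R -> V -> R, forall T, (exists u, nice v T u) -> nice v T (c T).
  have H T : exists u, (exists u, nice v T u) -> nice v T u.
    have [[u hu]|nu] := pselect (exists u, nice v T u); first by exists u.
    by exists (fun _ _ => 0).
  by have [c hc] := choice H; exists c.
(* The value at time [t] comes from a solution chosen on []0, t]]; by uniqueness it is also that of
   the solution chosen on any longer interval, so these values fit together. *)
pose w t := if t <= 0 then v else c t t.
have wc (T : R) : (exists u, nice v T u) -> forall t, 0 < t <= T -> w t = c T t.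
  move=> hT t /andP[t0 tT]; rewrite /w leNgt t0/=; apply/funext => x.
  have hct := nice_le tT (hc T hT).
  have hcc := hc t (ex_intro _ _ hct).
  by apply: (nice_unique s1 hK hN hcc hct); rewrite t0 lexx.
have TTnice T T' : TT T' -> 0 < T -> T <= T' -> exists u, nice v T u.
  move=> [T'0 /(amild_CL_nice T'0)[u hu]] T0 TT'; exists u; exact: nice_le hu.
have ltTm T : 0 < T -> (T%:E < Tm)%E -> exists u, nice v T u.
  move=> T0 /ereal_sup_gt[_ [T' hT' <-]]; rewrite lte_fin => /ltW; exact: TTnice.
exists w; split.
- move=> T T0 TTm; have hT := ltTm T T0 TTm.
  apply: (nice_amild_CL n0 s1 hK hN M0 Xv T0 (hc T hT)); last by rewrite /w lexx.
  exact: wc hT.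
- by apply: aeW => x; rewrite /w lexx.
have [->|Tfin] := eqVneq Tm +oo%E; [by left|right].
have Tlt : (Tm < +oo)%E by rewrite lt_neqAle Tfin leey.
split => //.
have [T1 [T10 hT1]] : exists T, TT T.
  by have [h [h0 [u [hu _ _]]]] := amild_local; exists h; split => //; exists u.
have T1m : (T1%:E <= Tm)%E by apply: ereal_sup_ubound; exists T1.
have Tf : Tm \is a fin_num.
  by rewrite ge0_fin_numE// (le_trans _ T1m)// lee_fin ltW.
have TmE : Tm = (fine Tm)%:E by rewrite fineK.
have Tm0 : 0 < fine Tm by rewrite -lte_fin -TmE (lt_le_trans _ T1m)// lte_fin.
apply/cvgeyPge => A.
(* The level [A] may be negative, while [local_existence] takes a positive radius. *)
pose B := Num.max A 1; have B0 : 0 < B by rewrite lt_max ltr01 orbT.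
have [h h0 hh] := local_existence s1 hK hN B0.
near=> t.
have t0 : 0 < t by near: t; exact: nbhs_left_gt.
have tTm : t < fine Tm by near: t; exact: nbhs_left_lt.
have th : fine Tm - h < t by near: t; apply: nbhs_left_gt; rewrite gtrBl.
have tTm' : (t%:E < Tm)%E by rewrite TmE lte_fin.
have hnt := ltTm t t0 tTm'; have nct := hc t hnt.
(* Since [h] depends on [B] only, a norm below [A] at one single time of []Tm - h, Tm[] extends the
   solution past [Tm]; this gives a limit and not merely an upper limit. *)
rewrite leNgt; apply/negP => small.
have wE : w t = c t t by apply: wc => //; rewrite t0 lexx.
have XB : X B (c t t).
  have [jc _ _] := nct.
  apply: (norm_X_Xle n0 s1); first exact: (jmeas_at t jc).
  rewrite /norm_X addeC -wE ltW// (lt_le_trans small)// lee_fin le_max lexx//.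
have [u2 hu2] := hh _ XB.
have hg := nice_glue s1 hK hN M0 Xv t0 nct hu2.
have th0 : 0 < t + h by rewrite addr_gt0.
have : TT (t + h) by split => //; apply/(amild_CL_nice th0); eexists; exact: hg.
move=> hTT; have : ((t + h)%:E <= Tm)%E by apply: ereal_sup_ubound; exists (t + h).
by rewrite TmE lee_fin leNgt -ltrBlDr th.
Unshelve. all: by end_near.
Qed.

End maximal.

Theorem theorem1p7 (R : realType) (n : nat) (beta alpha p q s : R)
    (u0 : Rn R n -> R)
    (hn : (1 <= n)%N)
    (hbeta : 0 < beta <= 2)
    (halpha : 0 < alpha < n%:R)
    (hp : n%:R / (n%:R - alpha) < p)
    (hq : 1 <= q)
    (hs : n%:R / (n%:R - alpha) < s < n%:R * (p - 1) / alpha)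
    (hu0s : u0 \in Lfun (leb R n) s%:E)
    (hu0oo : u0 \in Lfun (leb R n) +oo%E) :
  (exists T : R, 0 < T /\
    exists u : R -> Rn R n -> R,
      [/\ mild_solution_CL beta alpha p q s u0 T u,
          (forall w : R -> Rn R n -> R,
             mild_solution_CL beta alpha p q s u0 T w ->
             forall t, 0 <= t <= T -> w t = u t %[ae leb R n]) &
          ({ae leb R n, forall x, 0 <= u0 x} ->
             forall t, 0 <= t <= T -> {ae leb R n, forall x, 0 <= u t x})])
  /\
  (exists u : R -> Rn R n -> R,
    [/\ maximal_mild_solution beta alpha p q s u0 u,
        u 0 = u0 %[ae leb R n] &
        Tmax beta alpha p q s u0 = +oo%E \/
        ((Tmax beta alpha p q s u0 < +oo)%E /\
         (lnorm +oo%E (u t) + lnorm s%:E (u t))%E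
           @[t --> (fine (Tmax beta alpha p q s u0))^'-] --> +oo%E)]).
Proof.
have /andP[a0 an] := halpha; have /andP[s_gt s_lt] := hs.
have nR0 : 0 < n%:R :> R by rewrite ltr0n.
have one_lt : 1 < n%:R / (n%:R - alpha).
  by rewrite ltr_pdivlMr ?subr_gt0// mul1r gtrBl.
have p1 : 1 < p by exact: lt_trans hp.
have s1 : 1 < s by exact: lt_trans s_gt.
have sp : s < n%:R * p / alpha.
  by rewrite (lt_trans s_lt)// ltr_pM2r ?invr_gt0// ltr_pM2l// gtrBl.
have hK := @heat_kernel_stable R n beta hn hbeta.
have [L hN] := lip_nonlinearity_riesz hn a0 an p1 hq s1 sp.
have [M M0 XM] := Xle_ex hn s1 hu0s hu0oo.
(* [M] may be 0, and the evolution argument works with a positive radius. *)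
have M1 : 0 < M + 1 by rewrite ltr_wpDl.
have Xv : Xle s (leb R n) (M + 1) u0 by apply: (Xle_weak s1 M0 _ XM); rewrite lerDl.
split; first exact: (amild_local hn s1 hK hN M1 Xv).
exact: (amild_maximal hn s1 hK hN M1 Xv).
Qed.
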